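(* Consider a family in prenormal form $(x^2-\epsilon)y'=B(\epsilon,x)y$, with $r$ and then $\rho$ sufficiently small, and let $\hat\epsilon\in S$, $l\in\{L,R\}$, $\hat m_l=\hat C_l\hat D_l$. (a) A vector $t\in\mathbb{C}^n$ is an eigenvector of $\hat m_l$ if and only if $W_V(\hat\epsilon,x)t$ is a solution that is an eigenvector of the monodromy operator $M_{\hat x_l}$ with the same eigenvalue. Hence the number of independent solutions which are eigenvectors of $M_{\hat x_l}$ equals the number of Jordan blocks in the Jordan matrix associated to $\hat m_l$. The values of $\hat\epsilon$ for which $\hat m_l$ may not be diagonalizable are the resonance values of $\hat\epsilon$ (which correspond exactly to multiple eigenvalues of $\hat m_l$). (b) For nonresonance values of $\hat\epsilon$, let $\hat T_l$ be the unipotent triangular matrix (upper triangular for $l=R$, lower triangular for $l=L$) such that $\hat T_l^{-1}\hat m_l\hat T_l=\hat D_l$. Then the fundamental matrix of solutions $W_{\hat x_l}(x)=W_V(\hat\epsilon,x)\hat T_l$ is composed of eigenvectors of the monodromy operator around $x=\hat x_l$. A fundamental matrix having this property is unique up to its normalization: the $j$-th column of $W_{\hat x_l}$ is a nonzero multiple of the Floquet solution $$\hat w_{j,l}(x)=(x-\hat x_l)^{\hat\mu_{j,l}}\hat g_{j,l}(x),$$ with $\hat g_{j,l}(x)=e_j+O(|x-\hat x_l|)$ an analytic function of $x$ in a region containing $x=\hat x_l$ but no other singular point. (c) When $\hat\epsilon$ is a resonance value, the matrix $\hat m_l$ is no more diagonalizable, with no $j$-th eigenvector, if and only if the $j$-th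 Floquet solution $\hat w_{j,l}(x)$ does not exist and has to be replaced, in the basis of solutions around $x=\hat x_l$, by a solution containing logarithmic terms.
   Context: Systems. A family in prenormal form is a family $(x^2-\epsilon)y'=B(\epsilon,x)y$, $y\in\mathbb{C}^n$, $n\ge2$, $'=d/dx$, with $B=\Lambda(\epsilon,x)+(x^2-\epsilon)R(\epsilon,x)$, $\Lambda(\epsilon,x)=\mathrm{diag}\{\lambda_1(\epsilon,x),\dots,\lambda_n(\epsilon,x)\}=\Lambda_0(\epsilon)+\Lambda_1(\epsilon)x$, $\Lambda_0,\Lambda_1$ diagonal and analytic in $\epsilon$ near $0$, $R$ a matrix of germs of analytic functions of $(\epsilon,x)$ at the origin, and $\Re(\lambda_q(0,0)-\lambda_j(0,0))>0$ for $q<j$. Model system: $(x^2-\epsilon)z'=\Lambda(\epsilon,x)z$. Parameter sector. Let $\theta_0$ be the largest angle (supremum) in $(0,\frac\pi2)$ with $\Re(e^{\pm i\theta_0}(\lambda_q(0,0)-\lambda_j(0,0)))\ge0$ for $q<j$. Fix $\gamma>0$ with $\gamma(1+\frac{2\gamma}{\pi})<\theta_0$ and let $S=\{\hat\epsilon:0<|\hat\epsilon|<\rho,\ \arg\hat\epsilon\in(\pi-2\gamma,3\pi+2\gamma)\}$ (on the universal covering of $\mathbb{C}^*$; $\epsilon$ is the projection of $\hat\epsilon$). Put $\arg\sqrt{\hat\epsilon}=\frac12\arg\hat\epsilon$, $\hat x_L=\sqrt{\hat\epsilon}$, $\hat x_R=-\sqrt{\hat\epsilon}$. The radius $\rho>0$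 is small, in particular so that for some $C>0$, $\Re(e^{\pm i\gamma(1+2\gamma/\pi)}(\lambda_q(\epsilon,\hat x_l)-\lambda_j(\epsilon,\hat x_l)))>C$ for $q<j$, $l=L,R$, $\hat\epsilon\in S$, and $\Re(\lambda_q(\epsilon,x)-\lambda_j(\epsilon,x))>0$ for $q<j$, $|x|\le\sqrt{|\epsilon|}$. $S_\cap$ is the auto-intersection of $S$: it consists of the pairs $\bar\epsilon$, $\tilde\epsilon=\bar\epsilon e^{2\pi i}$ both in $S$. Sectorial domains. Fix $r>0$ small, $\mathbb{D}_r=\{|x|<r\}$, $\delta>0$ small, $\Omega_D=\{|x|<r,\,-(\pi+\delta)<\arg x<\delta\}$, $\Omega_U=\{|x|<r,\,-\delta<\arg x<\pi+\delta\}$, such that the closure of $\Omega_D$ (resp. $\Omega_U$) contains no ray $\Re((\lambda_q(0,0)-\lambda_j(0,0))/x)=0$, $q\ne j$, of the upper (resp. lower) half-plane. Use the time $t$ of $\dot x=x^2-\epsilon$: $x(t)=-\sqrt{\hat\epsilon}\coth(\sqrt{\hat\epsilon}\,t)$ if $\epsilon\neq0$ (period $\pi i/\sqrt{\hat\epsilon}$), $x(t)=-1/t$ if $\epsilon=0$. Fix small constants $c_0>0$, $h\in(0,1/r)$, $\kappa\in(0,\frac12)$ independent of $\hat\epsilon$. Let $N_{\hat\epsilon}$ be the connected component containing $t=0$ of $\{t:|x(t)|\ge r\}$, $P=-\pi i/\sqrt{\hat\epsilon}$, $\hat\theta=\frac{2\gamma}{\pi}(\pi-\arg\sqrt{\hat\epsilon})$,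 and $\sigma(u)=0$ if $|u|\le c_0/\sqrt{|\epsilon|}$, $\sigma(u)=(u-\mathrm{sgn}(u)c_0/\sqrt{|\epsilon|})\tan\hat\theta$ otherwise. $\Gamma_D^{\hat\epsilon}$ is the set of $t\notin N_{\hat\epsilon}$ with $\Im t<h+\sigma(\Re t)$ lying above the line $-(\frac12+\kappa)P+\mathbb{R}e^{i\hat\theta}$; $\Gamma_U^{\hat\epsilon}$ is the set of $t\notin N_{\hat\epsilon}$ with $\Im t>-h+\sigma(\Re t)$ lying below the line $(\frac12+\kappa)P+\mathbb{R}e^{i\hat\theta}$. $\Omega_s^{\hat\epsilon}=x(\Gamma_s^{\hat\epsilon})$, $s=D,U$. $\Omega_D^{\hat\epsilon}\cap\Omega_U^{\hat\epsilon}$ has three connected components $\Omega_L^{\hat\epsilon},\Omega_R^{\hat\epsilon},\Omega_C^{\hat\epsilon}$, images of the right and left components of $\Gamma_D^{\hat\epsilon}\cap\Gamma_U^{\hat\epsilon}$ and of $\Gamma_D^{\hat\epsilon}\cap(\Gamma_U^{\hat\epsilon}-P)$; their closures contain respectively $\hat x_L$, $\hat x_R$, and both; $0\in\Omega_C^{\hat\epsilon}$. Model solutions. For $l=L,R$, $\mathcal U_l=\frac1{2\hat x_l}\Lambda(\epsilon,\hat x_l)=\mathrm{diag}\{\hat\mu_{1,l},\dots,\hat\mu_{n,l}\}$, $\hat D_R=e^{-2\pi i\,\mathcal U_R}$, $\hat D_L=e^{2\pi i\,\mathcal U_L}$. $F(\epsilon,x)=(x-\hat x_R)^{\mathcal U_R}(x-\hat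 x_L)^{\mathcal U_L}$ is a fundamental matrix of the model. $F_D(\hat\epsilon,\cdot)$ is its branch on $\Omega_D^{\hat\epsilon}$ (namely $e^{t\Lambda_0}(x^2-\epsilon)^{\Lambda_1/2}$ with $x=x(t)$, $t\in\Gamma_D^{\hat\epsilon}$, converging as $\hat\epsilon\to0$ to $x^{\Lambda_1(0)}e^{-\Lambda_0(0)/x}$ with $-(\pi+\delta)<\arg x<\delta$), and $F_U(\hat\epsilon,\cdot)$ is the analytic continuation of $F_D$ to $\Omega_U^{\hat\epsilon}$ through $\Omega_R^{\hat\epsilon}$. Normalizing and unfolded Stokes matrices. $H_s(\hat\epsilon,x)$, $s=D,U$, are matrices, analytic for $\hat\epsilon\in S$, $x\in\Omega_s^{\hat\epsilon}$, such that $W_s=H_sF_s$ is a fundamental matrix of solutions of the family on $\Omega_s^{\hat\epsilon}$; $\lim_{x\to\hat x_l,x\in\Omega_s^{\hat\epsilon}}H_s(\hat\epsilon,x)$ ($l=L,R$) is an invertible diagonal matrix independent of $s$, analytic in $\hat\epsilon\in S$ with nonsingular limit at $\epsilon=0$; $|H_s(\bar\epsilon,0)-H_s(\tilde\epsilon,0)|\le c|\bar\epsilon|$ on $S_\cap$ for some $c\ge0$; and $|H_s(\hat\epsilon,0)|$, $|H_s(\hat\epsilon,0)^{-1}|$ are bounded on $S_\cap$. The unfolded Stokes matrices $\hat C_R$ (upper triangular unipotent) and $\hat C_L$ (lower triangular unipotent) are defined by $H_D^{-1}H_U=F_D\hat C_RF_D^{-1}$ on $\Omega_R^{\hat\epsilon}$,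 $H_D^{-1}H_U=F_D\hat C_LF_D^{-1}$ on $\Omega_L^{\hat\epsilon}$ (and $H_D^{-1}H_U=I$ on $\Omega_C^{\hat\epsilon}$). Monodromy. $V^{\hat\epsilon}$ is the ramified domain obtained from $\Omega_D^{\hat\epsilon}$ and $\Omega_U^{\hat\epsilon}$ by gluing along $\Omega_C^{\hat\epsilon}$ only; $W_V(\hat\epsilon,x)$ is the analytic continuation of $W_D(\hat\epsilon,x)$ from $\Omega_D^{\hat\epsilon}$ to $V^{\hat\epsilon}$ through $\Omega_C^{\hat\epsilon}$. The monodromy operator $M_{\hat x_R}$ (resp. $M_{\hat x_L}$) is analytic continuation of solutions along a loop based at a point of $\Omega_R^{\hat\epsilon}$ (resp. $\Omega_L^{\hat\epsilon}$), regarded as lying on $\Omega_D^{\hat\epsilon}$, making one turn around $\hat x_R$ in the negative (resp. around $\hat x_L$ in the positive) direction and surrounding no other singular point. The action of $M_{\hat x_l}$ on $W_V$ is represented by right multiplication by $\hat m_l=\hat C_l\hat D_l$, called the monodromy matrix. Resonance values of $\hat\epsilon$ are those for which $\hat\mu_{q,l}-\hat\mu_{j,l}\in\mathbb{N}^*=\{1,2,\dots\}$ for some $q\ne j$ and $l\in\{L,R\}$ (for the statement about $\hat m_l$, with that $l$). $e_j$ is the $j$-th standard basis vector. The ''$j$-th eigenvector'' of $\hat m_l$ is an eigenvector for the eigenvalue $(\hat D_l)_{jj}$ playing the role of the $j$-th column of the unipotent triangular matrix $\hat T_l$, i.e. in $e_j+\mathrm{span}\{e_i:i<j\}$ if $l=R$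 and in $e_j+\mathrm{span}\{e_i:i>j\}$ if $l=L$. *)

(* Defs.v *)
From HB Require Import structures.
From mathcomp Require Import all_boot all_order all_algebra perm complex.
From mathcomp Require Import all_classical all_reals all_analysis.

Set Implicit Arguments.
Unset Strict Implicit.
Unset Printing Implicit Defensive.

Import Order.TTheory GRing.Theory Num.Theory numFieldNormedType.Exports.

Local Open Scope classical_set_scope.
Local Open Scope ring_scope.

(** * Complex numbers and analytic functions *)

(* The complex field over R, presented as a numClosedFieldType so that it
   inherits the topological and normed structures of numFieldNormedType. *)
Definition Cplx (R : realType) : numClosedFieldType := R[i]%C.

Definition rc (R : realType) (t : R) : Cplx R := (t%:C)%C.
Definition cre (R : realType) (z : Cplx R) : R := complex.Re z.
Definition cim (R : realType) (z : Cplx R) : R := complex.Im z.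

Definition expi (R : realType) (a : R) : Cplx R := (cos a +i* sin a)%C.
Definition cexp (R : realType) (z : Cplx R) : Cplx R :=
  rc (expR (cre z)) * expi (cim z).

(* Analytic functions on open sets are complex differentiable functions.  For
   vectors and matrices everything is meant entrywise. *)
Definition derivable_mx (R : realType) (n m : nat)
    (Y : Cplx R -> 'M[Cplx R]_(n, m)) (x : Cplx R) : Prop :=
  forall i j, derivable (fun z => Y z i j) x 1.

Definition derive_mx (R : realType) (n m : nat)
    (Y : Cplx R -> 'M[Cplx R]_(n, m)) (x : Cplx R) : 'M[Cplx R]_(n, m) :=
  \matrix_(i, j) derive1 (fun z => Y z i j) x.

(* Germs at the origin: sums of absolutely convergent power series. *)
Definition analytic_germ (R : realType) (f : Cplx R -> Cplx R) : Prop :=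
  exists (a : nat -> Cplx R) (p M : R), [/\ 0 < p,
    (forall N, \sum_(k < N) `|a k| * rc p ^+ k <= rc M) &
    (forall z, `|z| < rc p ->
       (fun N : nat => \sum_(k < N) a k * z ^+ k) @ \oo --> f z)].

Definition analytic_germ2 (R : realType)
    (f : Cplx R -> Cplx R -> Cplx R) : Prop :=
  exists (a : nat -> nat -> Cplx R) (p M : R), [/\ 0 < p,
    (forall N, \sum_(j < N) \sum_(k < N) `|a j k| * rc p ^+ j * rc p ^+ k
       <= rc M) &
    (forall e x, `|e| < rc p -> `|x| < rc p ->
       (fun N : nat => \sum_(j < N) \sum_(k < N) a j k * e ^+ j * x ^+ k)
         @ \oo --> f e x)].

(** * Families in prenormal form *)

Record ode_family (R : realType) (n : nat) := OdeFamily {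
  Lam0 : Cplx R -> 'rV[Cplx R]_n;
  Lam1 : Cplx R -> 'rV[Cplx R]_n;
  Rem : Cplx R -> Cplx R -> 'M[Cplx R]_n }.

Definition lam (R : realType) (n : nat) (fam : ode_family R n) (j : 'I_n)
    (e x : Cplx R) : Cplx R :=
  Lam0 fam e 0 j + Lam1 fam e 0 j * x.

Definition Lammx (R : realType) (n : nat) (fam : ode_family R n)
    (e x : Cplx R) : 'M[Cplx R]_n :=
  diag_mx (\row_j lam fam j e x).

Definition Bmx (R : realType) (n : nat) (fam : ode_family R n)
    (e x : Cplx R) : 'M[Cplx R]_n :=
  Lammx fam e x + (x ^+ 2 - e) *: Rem fam e x.

Definition prenormal (R : realType) (n : nat) (fam : ode_family R n) : Prop :=
  [/\ (forall j, analytic_germ (fun e => Lam0 fam e 0 j)),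
      (forall j, analytic_germ (fun e => Lam1 fam e 0 j)),
      (forall i j, analytic_germ2 (fun e x => Rem fam e x i j)) &
      (forall q j : 'I_n, (q < j)%N -> 0 < cre (lam fam q 0 0 - lam fam j 0 0))].

(* [Y], a vector or a matrix, satisfies (x^2 - e) Y' = A(x) Y at [x]. *)
Definition solves_at (R : realType) (n m : nat) (e : Cplx R)
    (A : Cplx R -> 'M[Cplx R]_n) (Y : Cplx R -> 'M[Cplx R]_(n, m))
    (x : Cplx R) : Prop :=
  derivable_mx Y x /\ (x ^+ 2 - e) *: derive_mx Y x = A x *m Y x.

Definition fundamental_on (R : realType) (n : nat) (e : Cplx R)
    (A : Cplx R -> 'M[Cplx R]_n) (Y : Cplx R -> 'M[Cplx R]_n)
    (D : set (Cplx R)) : Prop :=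
  forall x, D x -> solves_at e A Y x /\ Y x \in unitmx.

(** * The parameter *)

(* A point of the universal covering of C^* is represented by its logarithm w:
   the parameter is epsilon = exp w, with |epsilon| = exp (Re w) and
   arg = Im w.  Analyticity on the covering is analyticity in w. *)
Definition eps (R : realType) (w : Cplx R) : Cplx R := cexp w.
Definition abs_eps (R : realType) (w : Cplx R) : R := expR (cre w).
Definition sqrt_eps (R : realType) (w : Cplx R) : Cplx R := cexp (w / rc 2).
Definition arg_sqrt_eps (R : realType) (w : Cplx R) : R := cim w / 2.

Inductive side := Lft | Rgt.
Inductive sheet := Down | Up.

Definition xsing (R : realType) (l : side) (w : Cplx R) : Cplx R :=
  match l with Lft => sqrt_eps w | Rgt => - sqrt_eps w end.

Definition other (l : side) : side :=
  match l with Lft => Rgt | Rgt => Lft end.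

Definition theta0 (R : realType) (n : nat) (fam : ode_family R n) : R :=
  sup [set th : R | 0 < th < pi / 2 /\
    forall q j : 'I_n, (q < j)%N ->
      0 <= cre (expi th * (lam fam q 0 0 - lam fam j 0 0)) /\
      0 <= cre (expi (- th) * (lam fam q 0 0 - lam fam j 0 0))].

Definition Ssec (R : realType) (gamma rho : R) : set (Cplx R) :=
  [set w | abs_eps w < rho /\ pi - 2 * gamma < cim w < 3 * pi + 2 * gamma].

(* The auto-intersection consists of the pairs (w, w + 2 i pi), and is
   represented by the first component w. *)
Definition Scap (R : realType) (gamma rho : R) : set (Cplx R) :=
  [set w | Ssec gamma rho w /\ Ssec gamma rho (w + rc (2 * pi) * 'i)].

Definition good_rho (R : realType) (n : nat) (fam : ode_family R n)
    (gamma rho : R) : Prop :=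
  let a := gamma * (1 + 2 * gamma / pi) in
  (exists C : R, 0 < C /\
     forall w l (q j : 'I_n), Ssec gamma rho w -> (q < j)%N ->
       let d := lam fam q (eps w) (xsing l w) - lam fam j (eps w) (xsing l w) in
       C < cre (expi a * d) /\ C < cre (expi (- a) * d)) /\
  (forall w x (q j : 'I_n), Ssec gamma rho w ->
     `|x| <= rc (Num.sqrt (abs_eps w)) -> (q < j)%N ->
     0 < cre (lam fam q (eps w) x - lam fam j (eps w) x)).

(* The closed arguments of Omega_D (resp. Omega_U) contain no ray
   Re ((lambda_q - lambda_j) / x) = 0 of the upper (resp. lower) half-plane. *)
Definition good_delta (R : realType) (n : nat) (fam : ode_family R n)
    (delta : R) : Prop :=
  forall (q j : 'I_n) (th : R), q != j ->
    cre ((lam fam q 0 0 - lam fam j 0 0) / expi th) = 0 ->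
    ~ (- (pi + delta) <= th <= delta /\ 0 < sin th) /\
    ~ (- delta <= th <= pi + delta /\ sin th < 0).

(** * Sectorial domains *)

Record geometry (R : realType) := Geometry {
  g_gamma : R; g_r : R; g_delta : R; g_h : R; g_kappa : R; g_c0 : R }.

Definition csinh (R : realType) (u : Cplx R) : Cplx R :=
  (cexp u - cexp (- u)) / rc 2.
Definition ccosh (R : realType) (u : Cplx R) : Cplx R :=
  (cexp u + cexp (- u)) / rc 2.

Definition xt (R : realType) (w t : Cplx R) : Cplx R :=
  - sqrt_eps w * (ccosh (sqrt_eps w * t) / csinh (sqrt_eps w * t)).

(* The poles of x(t), where division by zero would give a junk value, belong to
   the region |x(t)| >= r. *)
Definition Nhole (R : realType) (g : geometry R) (w : Cplx R) : set (Cplx R) :=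
  connected_component
    [set t : Cplx R |
       csinh (sqrt_eps w * t) = 0 \/ rc (g_r g) <= `|xt w t|] 0.

Definition period (R : realType) (w : Cplx R) : Cplx R :=
  - (rc pi * 'i) / sqrt_eps w.

Definition thetah (R : realType) (g : geometry R) (w : Cplx R) : R :=
  2 * g_gamma g / pi * (pi - arg_sqrt_eps w).

Definition sigma (R : realType) (g : geometry R) (w : Cplx R) (u : R) : R :=
  let b := g_c0 g / Num.sqrt (abs_eps w) in
  if `|u| <= b then 0 else (u - Num.sg u * b) * tan (thetah g w).

(* Above, resp. below, the line p + R e^{i th}, for |th| < pi/2. *)
Definition above (R : realType) (p : Cplx R) (th : R) : set (Cplx R) :=
  [set t | cim p + (cre t - cre p) * tan th < cim t].
Definition below (R : realType) (p : Cplx R) (th : R) : set (Cplx R) :=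
  [set t | cim t < cim p + (cre t - cre p) * tan th].

Definition Gam (R : realType) (g : geometry R) (s : sheet) (w : Cplx R) :
    set (Cplx R) :=
  let p := rc (2^-1 + g_kappa g) * period w in
  match s with
  | Down => [set t | [/\ ~ Nhole g w t, cim t < g_h g + sigma g w (cre t) &
                         above (- p) (thetah g w) t]]
  | Up => [set t | [/\ ~ Nhole g w t, - g_h g + sigma g w (cre t) < cim t &
                       below p (thetah g w) t]]
  end.

Definition Omega (R : realType) (g : geometry R) (s : sheet) (w : Cplx R) :
    set (Cplx R) :=
  xt w @` Gam g s w.

(* Gamma_D `&` Gamma_U does not meet the imaginary axis (there |Im t| < h < 1/r,
   inside the hole): its left and right components are told apart by Re t.
   Time goes to the left when x tends to x_R, to the right when x tends to x_L. *)
Definition OmegaLR (R : realType) (g : geometry R) (l : side) (w : Cplx R) :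
    set (Cplx R) :=
  xt w @` [set t | [/\ Gam g Down w t, Gam g Up w t &
                       match l with Lft => 0 < cre t | Rgt => cre t < 0 end]].

Definition OmegaC (R : realType) (g : geometry R) (w : Cplx R) :
    set (Cplx R) :=
  xt w @` [set t | Gam g Down w t /\ Gam g Up w (t + period w)].

(** * Model solutions *)

Definition mu (R : realType) (n : nat) (fam : ode_family R n) (l : side)
    (w : Cplx R) (j : 'I_n) : Cplx R :=
  lam fam j (eps w) (xsing l w) / (rc 2 * xsing l w).

(* The turn around x_R is negative, the turn around x_L positive. *)
Definition orient (R : realType) (l : side) : R :=
  match l with Lft => 1 | Rgt => - 1 end.

Definition Dhat (R : realType) (n : nat) (fam : ode_family R n) (l : side)
    (w : Cplx R) : 'M[Cplx R]_n :=
  diag_mx (\row_j cexp (rc (orient R l * (2 * pi)) * 'i * mu fam l w j)).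

(* [ell w] is the branch of log (x^2 - epsilon) on Gamma_D, as a function of
   the time, which depends continuously on the parameter and tends to 2 log x,
   with -(pi + delta) < arg x < delta, when epsilon tends to 0 (the time is then
   t = - 1 / x, and such a t lies below Im t = h). *)
Definition log_branch (R : realType) (g : geometry R) (rho : R)
    (ell : Cplx R -> Cplx R -> Cplx R) : Prop :=
  let S := Ssec (g_gamma g) rho in
  [/\ (forall w t, S w -> Gam g Down w t ->
         cexp (ell w t) = xt w t ^+ 2 - eps w),
      {within [set p : Cplx R * Cplx R | S p.1 /\ Gam g Down p.1 p.2],
         continuous (fun p : Cplx R * Cplx R => ell p.1 p.2)} &
      (forall m th : R, 0 < m < g_r g -> - (pi + g_delta g) < th < g_delta g ->
         let t := - (rc m * expi th)^-1 in cim t < g_h g ->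
         forall e : R, 0 < e -> exists2 rho1 : R, 0 < rho1 &
           forall w, S w -> abs_eps w < rho1 ->
             `|ell w t - rc 2 * (rc (ln m) + rc th * 'i)| < rc e)].

(* F_D = e^{t Lambda_0} (x^2 - epsilon)^{Lambda_1 / 2}, and F_U, its
   continuation through Omega_R, remains a solution of the model system. *)
Definition model_solutions (R : realType) (n : nat) (fam : ode_family R n)
    (g : geometry R) (rho : R) (ell : Cplx R -> Cplx R -> Cplx R)
    (F : sheet -> Cplx R -> Cplx R -> 'M[Cplx R]_n) : Prop :=
  forall w, Ssec (g_gamma g) rho w ->
  [/\ (forall t, Gam g Down w t ->
         F Down w (xt w t) =
         diag_mx (\row_j cexp (t * Lam0 fam (eps w) 0 j
                               + Lam1 fam (eps w) 0 j / rc 2 * ell w t))),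
      fundamental_on (eps w) (Lammx fam (eps w)) (F Up w) (Omega g Up w) &
      (forall x, OmegaLR g Rgt w x -> F Up w x = F Down w x)].

(** * Normalizing matrices, unfolded Stokes matrices *)

Definition normalizing (R : realType) (n : nat) (fam : ode_family R n)
    (g : geometry R) (rho : R)
    (F H : sheet -> Cplx R -> Cplx R -> 'M[Cplx R]_n) : Prop :=
  let S := Ssec (g_gamma g) rho in
  let S2 := Scap (g_gamma g) rho in
  let turn := rc (2 * pi) * 'i in
  [/\ (forall s i j w x, S w -> Omega g s w x ->
         differentiable (fun p : Cplx R * Cplx R => H s p.1 p.2 i j) (w, x)),
      (forall s w, S w ->
         fundamental_on (eps w) (Bmx fam (eps w))
           (fun x => H s w x *m F s w x) (Omega g s w)),
      (exists K : side -> Cplx R -> 'rV[Cplx R]_n,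
         [/\ (forall s l w i j, S w ->
                H s w x i j
                  @[x --> within (Omega g s w) (nbhs (xsing l w))]
                  --> diag_mx (K l w) i j),
             (forall l w j, S w ->
                K l w 0 j != 0 /\ derivable (fun v => K l v 0 j) w 1) &
             (forall l, exists K0 : 'rV[Cplx R]_n, forall j, K0 0 j != 0 /\
                forall e : R, 0 < e -> exists2 rho1 : R, 0 < rho1 &
                  forall w, S w -> abs_eps w < rho1 ->
                    `|K l w 0 j - K0 0 j| < rc e)]),
      (exists c : R, 0 <= c /\ forall s w i j, S2 w ->
         `|H s w 0 i j - H s (w + turn) 0 i j| <= rc (c * abs_eps w)) &
      (exists M : R, forall s w i j, S2 w ->
         [/\ `|H s w 0 i j| <= rc M, `|invmx (H s w 0) i j| <= rc M,
             `|H s (w + turn) 0 i j| <= rc M &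
             `|invmx (H s (w + turn) 0) i j| <= rc M])].

(* Upper triangular for the right point, lower triangular for the left one. *)
Definition unitriangular (R : realType) (n : nat) (l : side)
    (T : 'M[Cplx R]_n) : Prop :=
  (forall i, T i i = 1) /\
  (forall i j : 'I_n,
     match l with Lft => (i < j)%N | Rgt => (j < i)%N end -> T i j = 0).

Definition stokes_matrices (R : realType) (n : nat) (g : geometry R) (rho : R)
    (F H : sheet -> Cplx R -> Cplx R -> 'M[Cplx R]_n)
    (Chat : side -> Cplx R -> 'M[Cplx R]_n) : Prop :=
  forall w, Ssec (g_gamma g) rho w ->
  (forall l, unitriangular l (Chat l w) /\
     forall x, OmegaLR g l w x ->
       invmx (H Down w x) *m H Up w x =
       F Down w x *m Chat l w *m invmx (F Down w x)) /\
  (forall x, OmegaC g w x -> invmx (H Down w x) *m H Up w x = 1%:M).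

(** * Monodromy *)

(* A function on the ramified domain V is given by its values on the two
   sheets Omega_D and Omega_U, which are glued along Omega_C only.  [WV] is the
   continuation of W_D = H_D F_D to V; like any continuation of a solution, it
   satisfies the system. *)
Definition ramified_solution (R : realType) (n : nat) (fam : ode_family R n)
    (g : geometry R) (rho : R)
    (F H WV : sheet -> Cplx R -> Cplx R -> 'M[Cplx R]_n) : Prop :=
  forall w, Ssec (g_gamma g) rho w ->
  [/\ (forall x, Omega g Down w x -> WV Down w x = H Down w x *m F Down w x),
      fundamental_on (eps w) (Bmx fam (eps w)) (WV Up w) (Omega g Up w) &
      (forall x, OmegaC g w x -> WV Up w x = WV Down w x)].

(* Continuation of the germ of solution y0 at gam 0 into the germ y1 at gam 1,
   along the path gam : [0, 1] -> C, by a chain f of germs of solutions. *)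
Definition continued (R : realType) (n : nat) (fam : ode_family R n)
    (w : Cplx R) (gam : R -> Cplx R) (y0 y1 : Cplx R -> 'cV[Cplx R]_n) : Prop :=
  exists f : R -> Cplx R -> 'cV[Cplx R]_n,
  [/\ (forall s, 0 <= s <= 1 ->
         \forall x \near gam s, solves_at (eps w) (Bmx fam (eps w)) (f s) x),
      (forall s, 0 <= s <= 1 -> exists2 d : R, 0 < d &
         forall s', 0 <= s' <= 1 -> `|s' - s| < d ->
           \forall x \near gam s', f s' x = f s x),
      (\forall x \near gam 0, f 0 x = y0 x) &
      (\forall x \near gam 1, f 1 x = y1 x)].

(* One turn on the circle through x0, negative around x_R, positive around x_L.
   It is used for x0 close to x_l, so that it surrounds no other singularity. *)
Definition loop (R : realType) (l : side) (w x0 : Cplx R) (s : R) : Cplx R :=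
  xsing l w + (x0 - xsing l w) * expi (orient R l * (2 * pi) * s).

(* The germ y at x0 is a solution, not identically zero, and an eigenvector of
   the monodromy operator M_{x_l} for the eigenvalue c. *)
Definition monodromy_eigen (R : realType) (n : nat) (fam : ode_family R n)
    (l : side) (w x0 c : Cplx R) (y : Cplx R -> 'cV[Cplx R]_n) : Prop :=
  [/\ (\forall x \near x0, solves_at (eps w) (Bmx fam (eps w)) y x),
      ~ (\forall x \near x0, y x = 0) &
      continued fam w (loop l w x0) y (fun x => c *: y x)].

Definition independent_germs (R : realType) (n k : nat) (x0 : Cplx R)
    (y : 'I_k -> Cplx R -> 'cV[Cplx R]_n) : Prop :=
  forall a : 'I_k -> Cplx R,
    (\forall x \near x0, \sum_i a i *: y i x = 0) -> forall i, a i = 0.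

Definition eigen_family (R : realType) (n k : nat) (fam : ode_family R n)
    (l : side) (w x0 : Cplx R) (y : 'I_k -> Cplx R -> 'cV[Cplx R]_n) : Prop :=
  independent_germs x0 y /\ forall i, exists c, monodromy_eigen fam l w x0 c (y i).

(* k is the number of independent solutions that are eigenvectors of M_{x_l}. *)
Definition number_eigensolutions (R : realType) (n : nat) (fam : ode_family R n)
    (l : side) (w x0 : Cplx R) (k : nat) : Prop :=
  (exists y : 'I_k -> Cplx R -> 'cV[Cplx R]_n, eigen_family fam l w x0 y) /\
  (forall (k' : nat) (y : 'I_k' -> Cplx R -> 'cV[Cplx R]_n),
     eigen_family fam l w x0 y -> (k' <= k)%N).

Definition jordan_block (R : realType) (p : nat) (a : Cplx R) :
    'M[Cplx R]_p :=
  \matrix_(i, j) (if i == j then a else if (j == i.+1 :> nat) then 1 else 0).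

(* A is similar to a Jordan matrix with k blocks.  The rectangular P and Q avoid
   a cast along n = \sum_i p i. *)
Definition has_jordan_form (R : realType) (n : nat) (A : 'M[Cplx R]_n)
    (k : nat) : Prop :=
  exists (p : 'I_k -> nat) (a : 'I_k -> Cplx R)
         (P : 'M[Cplx R]_(n, \sum_i p i)) (Q : 'M[Cplx R]_(\sum_i p i, n)),
  [/\ (forall i, (0 < p i)%N), P *m Q = 1%:M, Q *m P = 1%:M &
      A = P *m (\mxdiag_i jordan_block (p i) (a i)) *m Q].

Definition resonant (R : realType) (n : nat) (fam : ode_family R n) (l : side)
    (w : Cplx R) : Prop :=
  exists (q j : 'I_n) (k : nat),
    [/\ q != j, (0 < k)%N & mu fam l w q - mu fam l w j = k%:R].

Definition has_jth_eigenvector (R : realType) (n : nat) (l : side)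
    (A D : 'M[Cplx R]_n) (j : 'I_n) : Prop :=
  exists t : 'cV[Cplx R]_n,
  [/\ A *m t = D j j *: t, t j 0 = 1 &
      forall i : 'I_n,
        match l with Lft => (i < j)%N | Rgt => (j < i)%N end -> t i 0 = 0].

(** * Floquet and logarithmic solutions *)

Definition punctured (R : realType) (g : geometry R) (l : side) (w : Cplx R)
    (d : R) : Prop :=
  0 < d /\ forall x, `|x - xsing l w| < rc d ->
    `|x| < rc (g_r g) /\ x != xsing (other l) w.

(* Multivalued functions around x_l are functions of u = log (x - x_l); for
   Y(u) = y(x), the system reads (x^2 - epsilon) dY/du = (x - x_l) B Y. *)
Definition solution_around (R : realType) (n : nat) (fam : ode_family R n)
    (l : side) (w : Cplx R) (d : R) (Y : Cplx R -> 'cV[Cplx R]_n) : Prop :=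
  forall u, expR (cre u) < d ->
    let x := xsing l w + cexp u in
    derivable_mx Y u /\
    (x ^+ 2 - eps w) *: derive_mx Y u =
      (x - xsing l w) *: (Bmx fam (eps w) x *m Y u).

(* Y(u) = (x - x_l)^{mu_j} G(x), with G analytic on |x - x_l| < d and
   G(x) = e_j + O(|x - x_l|). *)
Definition floquet (R : realType) (n : nat) (fam : ode_family R n)
    (g : geometry R) (l : side) (w : Cplx R) (j : 'I_n) (d : R)
    (Y : Cplx R -> 'cV[Cplx R]_n) : Prop :=
  punctured g l w d /\
  exists G : Cplx R -> 'cV[Cplx R]_n,
  [/\ (forall x, `|x - xsing l w| < rc d -> derivable_mx G x),
      (exists M : R, \forall x \near xsing l w, forall i,
         `|G x i 0 - (i == j)%:R| <= rc M * `|x - xsing l w|),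
      (forall u, expR (cre u) < d ->
         Y u = cexp (mu fam l w j * u) *: G (xsing l w + cexp u)) &
      solution_around fam l w d Y].

Definition floquet_exists (R : realType) (n : nat) (fam : ode_family R n)
    (g : geometry R) (l : side) (w : Cplx R) (j : 'I_n) : Prop :=
  exists d Y, floquet fam g l w j d Y.

(* Y(u) = (x - x_l)^{mu_j} \sum_p log(x - x_l)^p G_p(x), with a nonzero G_p for
   some p > 0. *)
Definition log_solution (R : realType) (n : nat) (fam : ode_family R n)
    (g : geometry R) (l : side) (w : Cplx R) (j : 'I_n) (d : R)
    (Y : Cplx R -> 'cV[Cplx R]_n) : Prop :=
  punctured g l w d /\
  exists (m : nat) (G : 'I_m -> Cplx R -> 'cV[Cplx R]_n),
  [/\ (forall p x, `|x - xsing l w| < rc d -> derivable_mx (G p) x),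
      (exists2 p : 'I_m, (0 < p)%N & ~ \forall x \near xsing l w, G p x = 0),
      (forall u, expR (cre u) < d ->
         Y u = cexp (mu fam l w j * u) *:
               \sum_(p < m) u ^+ p *: G p (xsing l w + cexp u)) &
      solution_around fam l w d Y].

(* A basis of solutions around x_l, made of the Floquet solutions that exist and
   of solutions with logarithmic terms in place of those that do not. *)
Definition local_basis (R : realType) (n : nat) (fam : ode_family R n)
    (g : geometry R) (l : side) (w : Cplx R) (d : R)
    (Y : 'I_n -> Cplx R -> 'cV[Cplx R]_n) : Prop :=
  (forall k, floquet fam g l w k d (Y k) \/
     (~ floquet_exists fam g l w k /\ log_solution fam g l w k d (Y k))) /\
  (forall a : 'I_n -> Cplx R,
     (forall u, expR (cre u) < d -> \sum_k a k *: Y k u = 0) ->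
     forall k, a k = 0).

(* A branch of log (x - x_l) on the part |x - x_l| < d of the ramified
   domain V. *)
Definition log_on_V (R : realType) (g : geometry R) (l : side) (w : Cplx R)
    (d : R) (L : sheet -> Cplx R -> Cplx R) : Prop :=
  let U := [set x : Cplx R | `|x - xsing l w| < rc d] in
  [/\ (forall s x, Omega g s w x -> U x -> cexp (L s x) = x - xsing l w),
      (forall s, {within Omega g s w `&` U, continuous (L s)}) &
      (forall x, OmegaC g w x -> U x -> L Up x = L Down x)].

(* Main.v *)
Require Import Defs.
From HB Require Import structures.
From mathcomp Require Import all_boot all_order all_algebra perm complex.
From mathcomp Require Import all_classical all_reals all_analysis.
From mathcomp Require Import ring lra zify.

Set Implicit Arguments.
Unset Strict Implicit.
Unset Printing Implicit Defensive.

Import Order.TTheory GRing.Theory Num.Theory numFieldNormedType.Exports.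
Local Open Scope classical_set_scope.
Local Open Scope ring_scope.

                        

(** Put [X] for the singular point x_l and y = x - X. Since x^2 - epsilon = y (2X + y), the family
    is Fuchsian at y = 0: it reads y Y' = A(y) Y with A(0) = diag(mu_j). Levelt's reduction
    ([levelt]) gives an analytic gauge G with G(0) = 1 that leaves only the resonant terms: the
    reduced matrix is diag(mu) + N(y), where the entry (q, k) of N(y) is a constant times y^m and
    vanishes unless mu_q - mu_k = m is a positive integer. With u = log y, the fundamental matrix is
    [levelt_sol] u = G(e^u) e^{diag(mu) u} e^{N u}, and one turn (u becomes u + c with c = 2 i pi or
    - 2 i pi) multiplies it on the right by M = e^{diag(mu) c} e^{N c}. The conditions on the sector
    order the exponents: a resonance always goes strictly up in the rank [pos l] ([mu_res_pos]), so
    N is nilpotent and M is triangular.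

    The link with the Stokes data comes from the time coordinate. With E = exp(2 X t), x = X (1 + E)
    / (1 - E), and the part of each sectorial domain near X is the image of a convex half-strip of
    times, narrower than the period P. On a convex set the quotient of two fundamental matrices is
    constant. Hence W_V is [levelt_sol] times one constant matrix Q on both sheets, the logarithm
    being advanced by c on the upper sheet, whose times differ by P along Omega_C. Comparing H_D and
    H_U on Omega_l then gives Chat D = Q^{-1} M Q ([end_solutions]). The diagonal limit of H_D at X,
    read along a ray where the exponentials are strictly ordered, forces Q to be triangular with
    nonzero diagonal ([transition_tri]).

    The rest is linear algebra over this similarity. (a) A germ of solution is [levelt_sol] times a
    coefficient vector, on which the monodromy acts as M ([monodromy_eigenP]); the coefficient of
    W_V t is Q t. Independent eigenvectors are counted by Jordan blocks ([jordan_eigen]), and the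
    eigenvalues e^{c mu_j} coincide exactly when two exponents differ by an integer ([eU_eq]). (b)
    Without resonance N = 0 and M = D, so T = Q^{-1} diag(Q) diagonalizes, and W_V T is made of the
    columns of G(e^u) e^{diag(mu) u} up to scalars. (c) Both the j-th eigenvector and the j-th
    Floquet solution amount to a vector v with N v = 0, v_j = 1, supported on j and on the indices
    resonant above it ([nullvec]). If there is none, then N e_j is nonzero and the j-th column of
    [levelt_sol] contains a logarithm ([log_sol]). *)

Section Basics.
Context {R : realType}.
Local Notation C := (Cplx R).
Implicit Types (z u v : C) (a b : R).

(** The norm of [Cplx R] takes its values in the complex field itself; this is its real value
    ([normE]), so that estimates take place in the ordered field [R]. *)
Definition cabs z : R := Num.sqrt (cre z ^+ 2 + cim z ^+ 2).

Lemma cplxP z u : cre z = cre u -> cim z = cim u -> z = u.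
Proof. by case: z u => a b [c d] /= -> ->. Qed.

Lemma rcD a b : rc (a + b) = rc a + rc b.
Proof. by apply: cplxP; rewrite /= ?addr0. Qed.
Lemma rcN a : rc (- a) = - rc a.
Proof. by apply: cplxP; rewrite /= ?oppr0. Qed.
Lemma rcB a b : rc (a - b) = rc a - rc b.
Proof. by rewrite rcD rcN. Qed.
Lemma rcM a b : rc (a * b) = rc a * rc b.
Proof. by apply: cplxP; rewrite /= ?mulr0 ?mul0r ?subr0 ?addr0. Qed.
Lemma rc0 : rc 0 = 0 :> C. Proof. by []. Qed.
Lemma rc1 : rc 1 = 1 :> C. Proof. by []. Qed.
Lemma rc_nat (n : nat) : rc n%:R = n%:R :> C.
Proof. by elim: n => // n IH; rewrite -natr1 rcD IH rc1 natr1. Qed.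
Lemma rcX a (n : nat) : rc (a ^+ n) = rc a ^+ n.
Proof. by elim: n => // n IH; rewrite !exprS rcM IH. Qed.
Lemma rc_inj : injective (@rc R).
Proof. by move=> a b [->]. Qed.
Lemma rc_eq0 a : (rc a == 0) = (a == 0).
Proof. by rewrite -rc0 (inj_eq rc_inj). Qed.
Lemma rcV a : rc a^-1 = (rc a)^-1.
Proof.
have [->|a0] := eqVneq a 0; first by rewrite invr0 rc0 invr0.
have ra0 : rc a != 0 by rewrite rc_eq0.
by apply: (mulfI ra0); rewrite -rcM divff// divff.
Qed.
Lemma rc_le a b : (rc a <= rc b) = (a <= b).
Proof. exact: lecR. Qed.
Lemma rc_lt a b : (rc a < rc b) = (a < b).
Proof. exact: ltcR. Qed.

Lemma creD z u : cre (z + u) = cre z + cre u. Proof. by case: z u => ? ? []. Qed.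
Lemma cimD z u : cim (z + u) = cim z + cim u. Proof. by case: z u => ? ? []. Qed.
Lemma creN z : cre (- z) = - cre z. Proof. by case: z. Qed.
Lemma cimN z : cim (- z) = - cim z. Proof. by case: z. Qed.
Lemma creB z u : cre (z - u) = cre z - cre u. Proof. by rewrite creD creN. Qed.
Lemma cimB z u : cim (z - u) = cim z - cim u. Proof. by rewrite cimD cimN. Qed.
Lemma creM z u : cre (z * u) = cre z * cre u - cim z * cim u.
Proof. by case: z u => ? ? []. Qed.
Lemma cimM z u : cim (z * u) = cre z * cim u + cim z * cre u.
Proof. by case: z u => ? ? []. Qed.
Lemma cre_rc a : cre (rc a) = a. Proof. by []. Qed.
Lemma cim_rc a : cim (rc a) = 0. Proof. by []. Qed.
Lemma cre_i : cre ('i : C) = 0. Proof. by []. Qed.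
Lemma cim_i : cim ('i : C) = 1. Proof. by []. Qed.
Lemma cre0 : cre (0 : C) = 0. Proof. by []. Qed.
Lemma cim0 : cim (0 : C) = 0. Proof. by []. Qed.
Lemma cre1 : cre (1 : C) = 1. Proof. by []. Qed.
Lemma cim1 : cim (1 : C) = 0. Proof. by []. Qed.
Lemma cre_rcM a z : cre (rc a * z) = a * cre z.
Proof. by rewrite creM cre_rc cim_rc mul0r subr0. Qed.
Lemma cim_rcM a z : cim (rc a * z) = a * cim z.
Proof. by rewrite cimM cre_rc cim_rc mul0r addr0. Qed.
Definition cE := (creD, cimD, creN, cimN, creM, cimM, cre_rc, cim_rc, cre_i, cim_i,
  cre0, cim0, cre1, cim1).

Lemma normE z : `|z| = rc (cabs z).
Proof. by case: z. Qed.

Lemma cabs_ge0 z : 0 <= cabs z. Proof. exact: sqrtr_ge0. Qed.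
Lemma cabsD z u : cabs (z + u) <= cabs z + cabs u.
Proof. by rewrite -rc_le rcD -!normE ler_normD. Qed.
Lemma cabsM z u : cabs (z * u) = cabs z * cabs u.
Proof. by apply: rc_inj; rewrite rcM -!normE normrM. Qed.
Lemma cabsN z : cabs (- z) = cabs z.
Proof. by apply: rc_inj; rewrite -!normE normrN. Qed.
Lemma cabsB z u : cabs (z - u) = cabs (u - z).
Proof. by rewrite -cabsN opprB. Qed.
Lemma cabs_eq0 z : (cabs z == 0) = (z == 0).
Proof. by rewrite -rc_eq0 -normE normr_eq0. Qed.
Lemma cabs_gt0 z : (0 < cabs z) = (z != 0).
Proof. by rewrite lt_def cabs_eq0 cabs_ge0 andbT. Qed.
Lemma cabs0 : cabs 0 = 0. Proof. by apply/eqP; rewrite cabs_eq0. Qed.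
Lemma cabs1 : cabs 1 = 1.
Proof. by apply: rc_inj; rewrite -normE normr1. Qed.
Lemma cabsV z : cabs z^-1 = (cabs z)^-1.
Proof. by apply: rc_inj; rewrite rcV -!normE normfV. Qed.
Lemma cabsX z (n : nat) : cabs (z ^+ n) = cabs z ^+ n.
Proof. by apply: rc_inj; rewrite rcX -!normE normrX. Qed.
Lemma cabs_rc a : cabs (rc a) = `|a|.
Proof. by rewrite /cabs cre_rc cim_rc expr0n /= addr0 sqrtr_sqr. Qed.
Lemma cabs_nat (n : nat) : cabs n%:R = n%:R.
Proof. by rewrite -rc_nat cabs_rc ger0_norm. Qed.
Lemma cabs_sum (I : Type) (r : seq I) (P : pred I) (F : I -> C) :
  cabs (\sum_(i <- r | P i) F i) <= \sum_(i <- r | P i) cabs (F i).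
Proof.
elim/big_rec2 : _ => [|i y x _ h]; first by rewrite cabs0.
by apply: (le_trans (cabsD _ _)); rewrite lerD2l.
Qed.
Lemma cre_le z : `|cre z| <= cabs z.
Proof. by rewrite -sqrtr_sqr ler_sqrt ?lerDl ?addr_ge0 ?sqr_ge0. Qed.
Lemma cim_le z : `|cim z| <= cabs z.
Proof. by rewrite -sqrtr_sqr ler_sqrt ?lerDr ?addr_ge0 ?sqr_ge0. Qed.
Lemma cabs_i : cabs 'i = 1.
Proof. by rewrite /cabs cre_i cim_i expr0n expr1n add0r sqrtr1. Qed.
Lemma zE z : z = rc (cre z) + 'i * rc (cim z).
Proof. by apply: cplxP; rewrite !cE; ring. Qed.
Lemma cabs_le z : cabs z <= `|cre z| + `|cim z|.
Proof.
by rewrite {1}(zE z); apply: (le_trans (cabsD _ _)); rewrite cabsM cabs_i mul1r !cabs_rc.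
Qed.

Lemma nbhsC z (P : set C) :
  nbhs z P <-> exists2 e : R, 0 < e & forall y, cabs (y - z) < e -> P y.
Proof.
split=> [/nbhs_ballP [e /= e0 he]|[e e0 he]].
  (* A positive complex number has zero imaginary part, so the radius comes from a real one. *)
  have eE : e = rc (cre e).
    by apply: cplxP => //; move: e0; rewrite ltcE => /andP[/eqP].
  exists (cre e) => [|y hy]; first by move: e0; rewrite ltcE => /andP[_].
  by apply: he; rewrite /ball /= /ball_ /= normE eE rc_lt cabsB.
apply/nbhs_ballP; exists (rc e) => /=; first by rewrite -rc0 rc_lt.
by move=> y; rewrite /ball /= normE rc_lt cabsB => /he.
Qed.

Lemma cvgC (T : Type) (F : set_system T) (FF : Filter F) (f : T -> C) z :
  f @ F --> z <-> forall e : R, 0 < e -> \forall x \near F, cabs (f x - z) < e.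
Proof.
split=> [h e e0|h].
  by apply: (h [set y | cabs (y - z) < e]); apply/nbhsC; exists e.
move=> P /nbhsC [e e0 he]; have := h _ e0.
by apply: filterS => x /he.
Qed.
End Basics.

                                  

(** * Complex derivatives in epsilon-delta form, and constancy along segments *)

Ltac split_norm := repeat match goal with |- context [ `|?x| ] => case: (ger0P x) => ? end; lra.
Section Calculus.
Context {R : realType}.
Local Notation C := (Cplx R).
Implicit Types (f g : C -> C) (z u v l k : C).

(** Multiplying the difference quotient by [h] removes the division, so [h = 0] needs no separate
    treatment and the chain rule becomes a plain estimate. *)
Lemma is_deriveC f z l :
  is_derive z (1 : C) f l <->
  forall e : R, 0 < e -> exists2 d : R, 0 < d &
    forall h, cabs h < d -> cabs (f (z + h) - f z - h * l) <= e * cabs h.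
Proof.
have key : (h^-1 *: ((f \o shift z) (h *: (1 : C)) - f z) @[h --> 0^'] --> l) <->
  forall e : R, 0 < e -> exists2 d : R, 0 < d &
    forall h, cabs h < d -> cabs (f (z + h) - f z - h * l) <= e * cabs h.
  split.
    move=> /cvgC H e e0; have := H _ e0.
    rewrite near_withinE => /nbhsC [d d0 hd]; exists d => // h hh.
    have [->|h0] := eqVneq h 0; first by rewrite addr0 mul0r subrr subr0 cabs0 mulr0.
    have := hd h; rewrite subr0 => /(_ hh h0) /ltW.
    rewrite /= /GRing.scale /= mulr1 [h + z]addrC => H1.
    have -> : f (z + h) - f z - h * l = (h^-1 * (f (z + h) - f z) - l) * h.
      by field.
    by rewrite cabsM ler_wpM2r ?cabs_ge0.
  move=> H; apply/cvgC => e e0; have e20 : 0 < e / 2 by rewrite divr_gt0.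
  have [d d0 hd] := H _ e20.
  rewrite near_withinE; apply/nbhsC; exists d => // h.
  rewrite subr0 => /hd hh h0; rewrite /= /GRing.scale /= mulr1 [h + z]addrC.
  have -> : h^-1 * (f (z + h) - f z) - l = (f (z + h) - f z - h * l) / h.
    by field.
  rewrite cabsM cabsV ltr_pdivrMr ?cabs_gt0//.
  apply: (le_lt_trans hh); rewrite ltr_pM2r ?cabs_gt0//.
  by rewrite ltr_pdivrMr// ltr_pMr// ltr1n.
split=> [[h1 h2]|/key h].
  by apply/key; rewrite -h2; exact: h1.
by split; [apply/cvg_ex; exists l|exact: cvg_lim].
Qed.

Lemma derive1_val f z l : is_derive z (1 : C) f l -> derive1 f z = l.
Proof. by move=> [h1 <-]; rewrite derive1E. Qed.

Lemma is_derive_derive1 f z : derivable f z (1 : C) -> is_derive z (1 : C) f (derive1 f z).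
Proof. by move=> h; rewrite derive1E; exact: derivableP. Qed.

Lemma derive_cont f z l : is_derive z (1 : C) f l ->
  forall e : R, 0 < e -> exists2 d : R, 0 < d &
    forall u, cabs (u - z) < d -> cabs (f u - f z) < e.
Proof.
move=> /is_deriveC /(_ 1 ltr01) [d d0 hd] e e0.
have l1 : 0 < 1 + cabs l by rewrite ltr_wpDr// cabs_ge0.
exists (Num.min d (e / (1 + cabs l))); first by rewrite lt_min d0 divr_gt0.
move=> u; rewrite lt_min ltr_pdivlMr// => /andP[/hd]; rewrite [z + _]addrC subrK mul1r => h1 h2.
have -> : f u - f z = (f u - f z - (u - z) * l) + (u - z) * l by ring.
apply: (le_lt_trans (cabsD _ _)); rewrite cabsM; apply: le_lt_trans h2; nra.
Qed.

Lemma is_derive_compC f g z l k : is_derive z (1 : C) g l ->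
  is_derive (g z) (1 : C) f k -> is_derive z (1 : C) (fun x => f (g x)) (k * l).
Proof.
move=> hg /is_deriveC hf; have gc := derive_cont hg; move/is_deriveC: hg => hg.
apply/is_deriveC => e e0.
set A := 1 + cabs l; set B := 1 + cabs k.
have A0 : 0 < A by rewrite ltr_wpDr// cabs_ge0.
have B0 : 0 < B by rewrite ltr_wpDr// cabs_ge0.
have e1 : 0 < e / (2 * A) by rewrite divr_gt0// mulr_gt0.
have [d1 d10 h1] := hf _ e1.
have [d2 d20 h2] := gc _ d10.
have e2 : 0 < Num.min 1 (e / (2 * B)) by rewrite lt_min ltr01 divr_gt0// mulr_gt0.
have [d3 d30 h3] := hg _ e2.
exists (Num.min d2 d3); first by rewrite lt_min d20.
move=> h; rewrite lt_min => /andP[hh2 hh3].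
have {}h2 : cabs (g (z + h) - g z) < d1 by apply: h2; rewrite addrAC subrr add0r.
have {h1} := h1 _ h2; rewrite [g z + _]addrC subrK => h1.
have {}h3 := h3 _ hh3.
have h4 : cabs (g (z + h) - g z) <= A * cabs h.
  have -> : g (z + h) - g z = (g (z + h) - g z - h * l) + h * l by ring.
  apply: (le_trans (cabsD _ _)); rewrite cabsM.
  have : cabs (g (z + h) - g z - h * l) <= cabs h.
    apply: (le_trans h3); rewrite ler_piMl ?cabs_ge0//.
    by rewrite ge_min lexx.
  rewrite /A; nra.
have -> : f (g (z + h)) - f (g z) - h * (k * l) =
  (f (g (z + h)) - f (g z) - (g (z + h) - g z) * k) +
  (g (z + h) - g z - h * l) * k by ring.
apply: (le_trans (cabsD _ _)); rewrite cabsM.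
have -> : e * cabs h = e / 2 * cabs h + e / 2 * cabs h by field.
apply: lerD.
  apply: (le_trans h1); apply: (le_trans (ler_wpM2l (ltW e1) h4)).
  by rewrite mulrA invfM mulrA mulfVK ?gt_eqF.
have h5 : cabs (g (z + h) - g z - h * l) <= e / (2 * B) * cabs h.
  apply: (le_trans h3); rewrite ler_wpM2r ?cabs_ge0//.
  by rewrite ge_min lexx orbT.
have : cabs (g (z + h) - g z - h * l) * cabs k <= e / (2 * B) * cabs h * B.
  by apply: ler_pM; rewrite ?cabs_ge0// /B lerDr.
move/le_trans; apply.
by rewrite mulrAC invfM mulrA mulfVK ?gt_eqF.
Qed.

Lemma is_derive_const (c z : C) : is_derive z (1 : C) (fun=> c) 0.
Proof. exact: is_derive_cst. Qed.

Lemma is_derive_var z : is_derive z (1 : C) (fun x => x) 1.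
Proof. exact: is_derive_id. Qed.

Lemma is_derive_add f g z l k : is_derive z (1 : C) f l -> is_derive z (1 : C) g k ->
  is_derive z (1 : C) (fun x => f x + g x) (l + k).
Proof. exact: is_deriveD. Qed.

Lemma is_derive_opp f z l : is_derive z (1 : C) f l ->
  is_derive z (1 : C) (fun x => - f x) (- l).
Proof. exact: is_deriveN. Qed.

Lemma is_derive_mul f g z l k : is_derive z (1 : C) f l -> is_derive z (1 : C) g k ->
  is_derive z (1 : C) (fun x => f x * g x) (l * g z + f z * k).
Proof.
move=> hf hg; apply: is_derive_eq (is_deriveM hf hg) _.
by rewrite /GRing.scale /= addrC; ring.
Qed.

Lemma is_derive_bigsum (I : Type) (r : seq I) (P : pred I) (F : I -> C -> C) z (D : I -> C) :
  (forall i, is_derive z (1 : C) (F i) (D i)) ->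
  is_derive z (1 : C) (fun x => \sum_(i <- r | P i) F i x) (\sum_(i <- r | P i) D i).
Proof.
move=> h; elim: r => [|i r IH].
  rewrite big_nil; under eq_fun do rewrite big_nil; exact: is_derive_const.
rewrite big_cons; under eq_fun do rewrite big_cons.
by case: (P i) => //; exact: is_derive_add.
Qed.

Lemma is_derive_inv f z l : f z != 0 -> is_derive z (1 : C) f l ->
  is_derive z (1 : C) (fun x => (f x)^-1) (- (f z)^-2 * l).
Proof.
move=> fz [h1 h2]; split; first exact: derivableV.
by rewrite deriveV// h2.
Qed.

Lemma is_derive_pow z (n : nat) : is_derive z (1 : C) (fun x => x ^+ n) (n%:R * z ^+ n.-1).
Proof.
elim: n => [|n IH]; first by rewrite mul0r; exact: is_derive_const.
under eq_fun do rewrite exprS.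
apply: is_derive_eq (is_derive_mul (is_derive_var z) IH) _.
rewrite mul1r /= -natr1 mulrDl mul1r addrC; congr (_ + _).
case: n {IH} => [|n]; first by rewrite !mul0r mulr0.
by rewrite mulrCA -exprS.
Qed.

Lemma is_derive_near f g z l : (\forall x \near z, f x = g x) ->
  is_derive z (1 : C) f l -> is_derive z (1 : C) g l.
Proof. exact: near_eq_is_derive. Qed.

(** The derivative is only known relative to [0, 1]. Composing with the retraction [k] of the line
    onto [0, 1], which is 1-Lipschitz, gives a function with zero derivative everywhere, hence
    constant; this is done for the real and the imaginary part. *)
Lemma real_cst (v : R -> C) :
  (forall s, 0 <= s <= 1 -> forall e : R, 0 < e -> exists2 d : R, 0 < d &
     forall s', 0 <= s' <= 1 -> `|s' - s| < d -> cabs (v s' - v s) <= e * `|s' - s|) ->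
  v 1 = v 0.
Proof.
move=> H.
pose k (s : R) := Num.max 0 (Num.min 1 s).
have k01 s : 0 <= k s <= 1.
  by rewrite /k le_max lexx /= ge_max ler01 /= ge_min lexx.
have kle s s' : `|k s' - k s| <= `|s' - s|.
  have h1 : `|Num.min 1 s' - Num.min 1 s| <= `|s' - s|.
    by rewrite !minEle; case: (leP 1 s) => ?; case: (leP 1 s') => ?; split_norm.
  apply: le_trans h1; rewrite /k; set a := Num.min 1 s; set b := Num.min 1 s'.
  by rewrite !maxEle; case: (leP 0 a) => ?; case: (leP 0 b) => ?; split_norm.
have main (p : C -> R) : (forall a b, `|p a - p b| <= cabs (a - b)) -> p (v 1) = p (v 0).
  move=> hp; have D (s : R) : is_derive s 1 (fun s => p (v (k s))) 0.
    have : (h^-1 *: (((fun s => p (v (k s))) \o shift s) (h *: (1 : R)) - p (v (k s)))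
       @[h --> 0^'] --> (0 : R)).
      apply/cvgrPdist_lt => e e0; have e20 : 0 < e / 2 by rewrite divr_gt0.
      have [d d0 hd] := H _ (k01 s) _ e20.
      rewrite near_withinE; apply/nbhs_ballP; exists d => //= h.
      rewrite /ball /= sub0r normrN => hh h0.
      rewrite sub0r normrN /GRing.scale /= mulr1 normrM normfV.
      rewrite mulrC ltr_pdivrMr ?normr_gt0//.
      apply: (le_lt_trans (hp _ _)).
      have h1 : `|k (h + s) - k s| <= `|h|.
        by apply: (le_trans (kle _ _)); rewrite addrK.
      apply: (le_lt_trans (hd _ (k01 _) (le_lt_trans h1 hh))).
      have h2 : 0 < `|h| by rewrite normr_gt0.
      nra.
    by move=> h; split; [apply/cvg_ex; exists 0|exact: cvg_lim].
  have := is_derive_0_is_cst (1 : R) 0 D.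
  have -> : k 1 = 1 by rewrite /k minxx; exact/max_idPr.
  have -> // : k 0 = 0.
  by rewrite /k (min_idPr _) ?ler01// maxxx.
apply: cplxP; apply: main => a b; first by rewrite -creB cre_le.
by rewrite -cimB cim_le.
Qed.

(** Connectedness of [0, 1], in the form used for branches of logarithms and for continuation along
    a path. *)
Lemma locally_cst (v : R -> C) :
  (forall s, 0 <= s <= 1 -> exists2 d : R, 0 < d &
     forall s', 0 <= s' <= 1 -> `|s' - s| < d -> v s' = v s) ->
  v 1 = v 0.
Proof.
move=> H; apply: real_cst => s s01 e e0; have [d d0 hd] := H _ s01.
exists d => // s' s'01 /(hd _ s'01) ->; rewrite subrr cabs0.
by rewrite mulr_ge0 // ltW.
Qed.

Lemma cst_segment f a b :
  (forall s : R, 0 <= s <= 1 -> is_derive (a + rc s * (b - a)) (1 : C) f 0) -> f b = f a.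
Proof.
move=> H; pose v (s : R) := f (a + rc s * (b - a)).
suff : v 1 = v 0 by rewrite /v rc1 mul1r rc0 mul0r addr0 addrC subrK.
apply: real_cst; rewrite /v.
move=> s s01 e e0; set A := 1 + cabs (b - a).
have A0 : 0 < A by rewrite ltr_wpDr// cabs_ge0.
have [d d0 hd] := (is_deriveC _ _ _).1 (H _ s01) _ (divr_gt0 e0 A0).
exists (d / A); first by rewrite divr_gt0.
move=> s' s'01 hs.
have := hd (rc (s' - s) * (b - a)).
have hA : cabs (rc (s' - s) * (b - a)) <= `|s' - s| * A.
  by rewrite cabsM cabs_rc ler_wpM2l// lerDr.
rewrite mulr0 subr0 -addrA -mulrDl -rcD [s + _]addrC subrK => {}hd.
apply: (le_trans (hd _)).
  by apply: (le_lt_trans hA); rewrite -ltr_pdivlMr.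
apply: (le_trans (ler_wpM2l _ hA)); first by rewrite divr_ge0 ?ltW.
by rewrite mulrCA mulfVK ?gt_eqF// mulrC.
Qed.
End Calculus.

                                  

(** * The complex exponential, its kernel, and the logarithm on the right half-plane *)

Section Exponential.
Context {R : realType}.
Local Notation C := (Cplx R).
Implicit Types (f g : C -> C) (z u v l k : C).

Lemma is_derive_epsR (f : R -> R) (x l : R) : is_derive x (1 : R) f l ->
  forall e : R, 0 < e -> exists2 d : R, 0 < d &
    forall h, `|h| < d -> `|f (x + h) - f x - h * l| <= e * `|h|.
Proof.
move=> [h1 h2] e e0; have : h^-1 *: ((f \o shift x) (h *: (1 : R)) - f x) @[h --> 0^'] --> l.
  by rewrite -h2; exact: h1.
move=> /cvgrPdist_lt /(_ _ e0); rewrite near_withinE => /nbhs_ballP[d /= d0 hd].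
exists d => // h hh; have [->|h0] := eqVneq h 0.
  by rewrite addr0 mul0r subrr subr0 normr0 mulr0.
have := hd h; rewrite /ball /= sub0r normrN => /(_ hh h0) /ltW.
rewrite /GRing.scale /= mulr1 [h + x]addrC => H1.
have -> : f (x + h) - f x - h * l = - (l - h^-1 * (f (x + h) - f x)) * h by field.
by rewrite normrM normrN ler_wpM2r.
Qed.

Lemma cre_cexp z : cre (cexp z) = expR (cre z) * cos (cim z).
Proof. by rewrite /cexp cre_rcM. Qed.
Lemma cim_cexp z : cim (cexp z) = expR (cre z) * sin (cim z).
Proof. by rewrite /cexp cim_rcM. Qed.
Definition cexpE := (cre_cexp, cim_cexp).
Lemma cexp0 : cexp 0 = 1 :> C.
Proof. by apply: cplxP; rewrite cexpE !cE expR0 ?cos0 ?sin0 ?mulr1 ?mulr0. Qed.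
Lemma cexpD z u : cexp (z + u) = cexp z * cexp u.
Proof.
apply: cplxP.
  by rewrite (creM (cexp z) (cexp u)) !cexpE creD cimD expRD cosD; ring.
by rewrite (cimM (cexp z) (cexp u)) !cexpE creD cimD expRD sinD; ring.
Qed.
Lemma cexp_neq0 z : cexp z != 0.
Proof.
apply/eqP => h; have := cexpD z (- z); rewrite subrr cexp0 h mul0r => /eqP.
by rewrite oner_eq0.
Qed.
Lemma cexpN z : cexp (- z) = (cexp z)^-1.
Proof. by apply: (mulfI (cexp_neq0 z)); rewrite -cexpD subrr cexp0 divff// cexp_neq0. Qed.
Lemma cexpB z u : cexp (z - u) = cexp z / cexp u.
Proof. by rewrite cexpD cexpN. Qed.
Lemma cexpMn z (n : nat) : cexp (z *+ n) = cexp z ^+ n.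
Proof. by elim: n => [|n IH]; rewrite ?mulr0n ?cexp0// mulrS exprS cexpD IH. Qed.
Lemma cabs_expi (a : R) : cabs (expi a) = 1.
Proof. by rewrite /cabs /= cos2Dsin2 sqrtr1. Qed.
Lemma cabs_cexp z : cabs (cexp z) = expR (cre z).
Proof. by rewrite /cexp cabsM cabs_rc cabs_expi mulr1 ger0_norm ?expR_ge0. Qed.
Lemma expi_cexp (a : R) : expi a = cexp (rc a * 'i).
Proof.
have -> : rc a * 'i = (0 +i* a)%C :> C by apply: cplxP; rewrite !cE /=; ring.
by apply: cplxP; rewrite cexpE /= expR0 mul1r.
Qed.

Lemma is_derive_cexp0 (e : R) : 0 < e -> exists2 d : R, 0 < d &
  forall h : C, cabs h < d -> cabs (cexp h - 1 - h) <= e * cabs h.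
Proof.
(* The four error terms [p1] to [p4] below cost 1, 2, 4 and 1 times [e1 * n], whence the factor
   8. *)
move=> e0; have [e1 [e10 e11 e1e]] : exists e1 : R, [/\ 0 < e1, e1 <= 1 & 8 * e1 <= e].
  exists (Num.min 1 (e / 8)); split; first by rewrite lt_min ltr01 divr_gt0.
    by rewrite ge_min lexx.
  by rewrite mulrC -ler_pdivlMr// ge_min lexx orbT.
have hE : is_derive (0 : R) (1 : R) expR 1.
  by apply: (is_derive_eq (is_derive_expR 0)); rewrite expR0.
have hC : is_derive (0 : R) (1 : R) cos 0.
  by apply: (is_derive_eq (is_derive_cos 0)); rewrite sin0 oppr0.
have hS : is_derive (0 : R) (1 : R) sin 1.
  by apply: (is_derive_eq (is_derive_sin 0)); rewrite cos0.
have [d1 d10 h1] := is_derive_epsR hE e10.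
have [d2 d20 h2] := is_derive_epsR hC e10.
have [d3 d30 h3] := is_derive_epsR hS e10.
exists (Num.min e1 (Num.min d1 (Num.min d2 d3))); first by rewrite !lt_min e10 d10 d20.
move=> h; rewrite !lt_min => /and4P[he hd1 hd2 hd3].
have ha := cre_le h; have hb := cim_le h.
have := h1 _ (le_lt_trans ha hd1).
have := h2 _ (le_lt_trans hb hd2).
have := h3 _ (le_lt_trans hb hd3).
rewrite !add0r !expR0 cos0 sin0 !mulr0 !mulr1 !subr0 {h1 h2 h3} => h3 h2 h1.
apply: (le_trans (cabs_le _)).
rewrite !creB !cimB cre_cexp cim_cexp cre1 cim1 subr0.
move: h1 h2 h3 ha hb he; set a := cre h; set b := cim h; set n := cabs h.
set E := expR a; set c := cos b; set s := sin b => h1 h2 h3 ha hb he.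
have n0 : 0 <= n := cabs_ge0 h.
have c1 : `|c| <= 1 := cos_max b.
have -> : E * c - 1 - a = (E - 1 - a) * c + (1 + a) * (c - 1) by ring.
have -> : E * s - b = (E - 1) * s + (s - b) by ring.
have p1 : `|(E - 1 - a) * c| <= e1 * n.
  rewrite normrM; apply: le_trans (ler_pM _ _ h1 c1) _ => //.
  by rewrite mulr1 ler_wpM2l// ltW.
have p2 : `|(1 + a) * (c - 1)| <= 2 * (e1 * n).
  rewrite normrM; apply: ler_pM => //.
    by apply: (le_trans (ler_normD _ _)); rewrite normr1; lra.
  by apply: (le_trans h2); rewrite ler_wpM2l// ltW.
have p3 : `|(E - 1) * s| <= 2 * n * (2 * e1).
  rewrite normrM; apply: ler_pM => //.
    have -> : E - 1 = (E - 1 - a) + a by ring.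
    by apply: (le_trans (ler_normD _ _)); nra.
  have -> : s = (s - b) + b by ring.
  by apply: (le_trans (ler_normD _ _)); nra.
have p4 : `|s - b| <= e1 * n.
  by apply: (le_trans h3); rewrite ler_wpM2l// ltW.
have := ler_normD ((E - 1 - a) * c) ((1 + a) * (c - 1)).
have := ler_normD ((E - 1) * s) (s - b).
have := ler_wpM2r n0 e1e; lra.
Qed.

Lemma is_derive_cexp z : is_derive z (1 : C) (@cexp R) (cexp z).
Proof.
apply/is_deriveC => e e0.
have [d d0 hd] := is_derive_cexp0 (divr_gt0 e0 (expR_gt0 (cre z))).
exists d => // h /hd hh.
have -> : cexp (z + h) - cexp z - h * cexp z = cexp z * (cexp h - 1 - h).
  by rewrite cexpD; ring.
rewrite cabsM cabs_cexp; apply: (le_trans (ler_wpM2l (expR_ge0 _) hh)).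
by rewrite mulrA mulrCA divff ?mulr1// expR_eq0.
Qed.

Lemma cexp_2pi : cexp (rc (2 * pi) * 'i) = 1 :> C.
Proof.
rewrite -expi_cexp mulr_natl; apply: cplxP => /=; first by rewrite cos2pi.
by rewrite sin2pi.
Qed.

Lemma cexp_2pi_int (k : int) : cexp (k%:~R * (rc (2 * pi) * 'i)) = 1 :> C.
Proof.
rewrite mulrzl; case: k => n /=.
  by rewrite -pmulrn cexpMn cexp_2pi expr1n.
by rewrite NegzE mulrNz cexpN -pmulrn cexpMn cexp_2pi expr1n invr1.
Qed.

Lemma cexp_eq1_near z : `|cim z| <= pi -> cexp z = 1 -> z = 0.
Proof.
move=> hz h.
have h1 : cre z = 0.
  by apply: expR_inj; rewrite -cabs_cexp h cabs1 expR0.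
have h2 : cos (cim z) = 1.
  by have := congr1 (@cre R) h; rewrite cre_cexp h1 expR0 mul1r.
apply: cplxP; rewrite // cim0; apply/eqP; rewrite -normr_eq0; apply/eqP.
apply: (@cos_inj R); rewrite ?in_itv /= ?normr_ge0 ?lexx ?pi_ge0//.
by rewrite cos_norm h2 cos0.
Qed.

Lemma cexp_eq1 z : cexp z = 1 -> exists k : int, z = k%:~R * (rc (2 * pi) * 'i).
Proof.
move=> h; have pp : 0 < 2 * pi :> R by rewrite mulr_gt0// pi_gt0.
(* [k] is the integer nearest to [cim z / (2 * pi)]; subtracting its multiple of 2 i pi brings the
   imaginary part into [-pi, pi], where [cexp_eq1_near] applies. *)
pose k := Num.floor (cim z / (2 * pi) + 2^-1); exists k.
apply/eqP; rewrite -subr_eq0; apply/eqP/cexp_eq1_near; last first.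
  by rewrite cexpB cexp_2pi_int h divr1.
have -> : cim (z - k%:~R * (rc (2 * pi) * 'i)) = cim z - k%:~R * (2 * pi).
  have -> : k%:~R = rc k%:~R :> C.
    case: (k) => n; first by rewrite -!pmulrn rc_nat.
    by rewrite NegzE !mulrNz rcN -!pmulrn rc_nat.
  by rewrite !cE; ring.
have := floor_itv (cim z / (2 * pi) + 2^-1); rewrite -/k rmorphD /=.
move=> /andP[]; rewrite -lerBlDr ler_pdivlMr// => h1.
rewrite -ltrBrDr ltr_pdivrMr// => h2.
by rewrite ler_norml; apply/andP; split; lra.
Qed.

Lemma cexp_eq1_small z : cabs z < 1 -> cexp z = 1 -> z = 0.
Proof.
move=> h; apply: cexp_eq1_near; apply: (le_trans (cim_le z)); apply: ltW.
by apply: (lt_le_trans h); apply: le_trans (@pi_ge2 R); lra.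
Qed.

(** The principal logarithm, meant for positive real part only, where the argument is the arctangent
    of the slope. All later branches are built from it by translation. *)
Definition clog z : C := (ln (cabs z) +i* atan (cim z / cre z))%C.

Lemma clogK z : 0 < cre z -> cexp (clog z) = z.
Proof.
move=> h; have z0 : 0 < cabs z.
  by rewrite cabs_gt0; apply/eqP => z0; move: h; rewrite z0 ltxx.
set x := cim z / cre z.
have h1 : cabs z = cre z * Num.sqrt (1 + x ^+ 2).
  rewrite /cabs -[in RHS](gtr0_norm h) -sqrtr_sqr -sqrtrM ?sqr_ge0//.
  by congr Num.sqrt; rewrite /x; field; rewrite gt_eqF.
have s0 : Num.sqrt (1 + x ^+ 2) != 0.
  by rewrite gt_eqF// sqrtr_gt0 ltr_pwDl// sqr_ge0.
have hc : cos (atan x) != 0 by rewrite cos_atan invr_eq0.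
have hs : sin (atan x) = x * (Num.sqrt (1 + x ^+ 2))^-1.
  by rewrite -{2}(atanK x) /tan cos_atan invrK mulfK.
apply: cplxP; rewrite cexpE /= lnK ?posrE// -/x h1.
  by rewrite cos_atan mulfK.
rewrite hs mulrACA divff// mulr1 /x mulrC divfK// gt_eqF//.
Qed.

Lemma clog1 : clog 1 = 0.
Proof. by apply: cplxP; rewrite /= ?cabs1 ?ln1// mul0r atan0. Qed.

(** Dividing by one of 1, -1, i, -i moves a nonzero number into the right half-plane. *)
Lemma cexp_surj z : z != 0 -> exists u, cexp u = z.
Proof.
move=> z0.
have key c : c != 0 -> 0 < cre (z / c) -> (exists k, cexp k = c) -> exists u, cexp u = z.
  by move=> c0 h [k hk]; exists (clog (z / c) + k); rewrite cexpD clogK// hk divfK.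
have ipi : cexp (rc pi * 'i) = - 1 :> C.
  by rewrite -expi_cexp; apply: cplxP; rewrite !cE /= ?cospi ?sinpi ?oppr0.
have ipi2 : cexp (rc (pi / 2) * 'i) = 'i :> C.
  by rewrite -expi_cexp; apply: cplxP; rewrite !cE /= ?cos_pihalf ?sin_pihalf.
have [h|h|h] := ltrgt0P (cre z).
- by apply: (key 1); rewrite ?oner_eq0 ?divr1//; exists 0; rewrite cexp0.
- apply: (key (- 1)); rewrite ?oppr_eq0 ?oner_eq0//; last by eexists; exact: ipi.
  by rewrite invrN invr1 mulrN1 creN oppr_gt0.
- have ii : 'i^-1 = - 'i :> C.
    by apply: (mulfI (neq0Ci C)); rewrite divff ?neq0Ci// mulrN -expr2 sqrCi opprK.
  have [k|k|k] := ltrgt0P (cim z).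
  + apply: (key 'i); rewrite ?neq0Ci//; last by eexists; exact: ipi2.
    by rewrite ii !cE; lra.
  + apply: (key (- 'i)); rewrite ?oppr_eq0 ?neq0Ci//.
      by rewrite invrN ii opprK !cE; lra.
    exists (rc (pi / 2) * 'i + rc pi * 'i).
    by rewrite cexpD ipi ipi2 mulrN1.
  + by case/eqP: z0; apply: cplxP; rewrite h || rewrite k.
Qed.
End Exponential.

(** * Derivatives of branches of the logarithm *)

Section Logarithm.
Context {R : realType}.
Local Notation C := (Cplx R).
Implicit Types (f g L : C -> C) (z u v l k : C).

(** Continuity makes the increment [k] of [L] small, and e^k - 1 = k + o(k) then converts the known
    increment of [f] into that of [L]. *)
Lemma is_derive_log L f z l (r : R) : 0 < r ->
  (forall e : R, 0 < e -> exists2 d : R, 0 < d &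
     forall u, cabs (u - z) < d -> cabs (L u - L z) < e) ->
  (forall u, cabs (u - z) < r -> cexp (L u) = f u) ->
  is_derive z (1 : C) f l -> is_derive z (1 : C) L (l / f z).
Proof.
move=> r0 hL hf /is_deriveC hd.
have fzE : cexp (L z) = f z by apply: hf; rewrite subrr cabs0.
have fz : f z != 0 by rewrite -fzE cexp_neq0.
have F0 : 0 < cabs (f z) by rewrite cabs_gt0.
apply/is_deriveC => e e0; set K := cabs l / cabs (f z).
have K0 : 0 <= K by rewrite divr_ge0 ?cabs_ge0.
have K10 : 0 < K + 1 by lra.
have e1 : 0 < Num.min 2^-1 (e / (4 * (K + 1))).
  by rewrite lt_min invr_gt0 ltr0n /= divr_gt0// mulr_gt0.
have [d1 d10 h1] := is_derive_cexp0 e1.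
have [d2 d20 h2] := hL _ d10.
have e2 : 0 < Num.min 1 (e / 2) * cabs (f z).
  by rewrite mulr_gt0// lt_min ltr01 divr_gt0.
have [d3 d30 h3] := hd _ e2.
exists (Num.min r (Num.min d2 d3)); first by rewrite !lt_min r0 d20.
move=> h; rewrite !lt_min => /and3P[hr hh2 hh3].
have zh : z + h - z = h by rewrite addrAC subrr add0r.
set k := L (z + h) - L z.
have kd : cabs k < d1 by apply: h2; rewrite zh.
have kE : cexp k = f (z + h) / f z by rewrite cexpB fzE hf// zh.
have {h1} := h1 _ kd; have {h3} := h3 _ hh3.
set E := f (z + h) - f z - h * l => h3 h1.
have qE : cexp k - 1 = E / f z + h * (l / f z).
  by rewrite kE /E; field.
have hE1 : cabs (E / f z) <= cabs h.
  rewrite cabsM cabsV ler_pdivrMr//; apply: (le_trans h3).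
  by rewrite mulrAC ler_wpM2r ?cabs_ge0// ler_piMl ?cabs_ge0// ge_min lexx.
have hE2 : cabs (E / f z) <= e / 2 * cabs h.
  rewrite cabsM cabsV ler_pdivrMr//; apply: (le_trans h3).
  by rewrite mulrAC ler_wpM2r ?cabs_ge0// ler_wpM2r ?cabs_ge0// ge_min lexx orbT.
have hq : cabs (cexp k - 1) <= (K + 1) * cabs h.
  rewrite qE; apply: (le_trans (cabsD _ _)); rewrite !cabsM cabsV -/K in hE1 *.
  by rewrite mulrDl mul1r addrC [cabs h * K]mulrC lerD.
(* From |e^k - 1 - k| <= |k| / 2 follows |k| <= 2 |e^k - 1|, so an error o(k) is an error o(h). *)
have hk : cabs k <= 2 * (K + 1) * cabs h.
  have -> : k = (cexp k - 1) - (cexp k - 1 - k) by ring.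
  have := le_trans h1 (ler_wpM2r (cabs_ge0 k) (_ : _ <= 2^-1)).
  rewrite ge_min lexx => /(_ isT) h1'.
  have := cabsD (cexp k - 1) (- (cexp k - 1 - k)); rewrite cabsN.
  have : cabs k <= cabs (cexp k - 1) + cabs (cexp k - 1 - k).
    have {1}-> : k = (cexp k - 1) - (cexp k - 1 - k) by ring.
    by rewrite -[X in _ <= _ + X]cabsN cabsD.
  lra.
have -> : k - h * (l / f z) = E / f z - (cexp k - 1 - k) by rewrite qE; ring.
apply: (le_trans (cabsD _ _)); rewrite cabsN.
have h4 : cabs (cexp k - 1 - k) <= e / 2 * cabs h.
  apply: (le_trans h1); apply: (le_trans (ler_wpM2l (ltW e1) hk)).
  rewrite mulrA ler_wpM2r ?cabs_ge0//.
  have : Num.min 2^-1 (e / (4 * (K + 1))) <= e / (4 * (K + 1)) by rewrite ge_min lexx orbT.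
  move=> /(ler_wpM2r (_ : 0 <= 2 * (K + 1))) hh; apply: le_trans (hh _) _; first lra.
  by rewrite le_eqVlt; apply/orP; left; apply/eqP; field; lra.
lra.
Qed.

Lemma clog_cont z : 0 < cre z ->
  forall e : R, 0 < e -> exists2 d : R, 0 < d &
     forall u, cabs (u - z) < d -> cabs (clog u - clog z) < e.
Proof.
move=> z0.
have lip (p : C -> R) : (forall a b, `|p a - p b| <= cabs (a - b)) ->
    p u @[u --> nbhs z] --> p z.
  move=> hp; apply/cvgrPdist_lt => e e0; apply/nbhsC; exists e => // y hy.
  by apply: le_lt_trans hy; rewrite distrC hp.
have c1 : cre u @[u --> nbhs z] --> cre z by apply: lip => a b; rewrite -creB cre_le.
have c2 : cim u @[u --> nbhs z] --> cim z by apply: lip => a b; rewrite -cimB cim_le.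
have c3 : cabs u @[u --> nbhs z] --> cabs z.
  apply: lip => a b; rewrite ler_norml; apply/andP; split.
    have := cabsD a (b - a); rewrite addrC subrK cabsB; lra.
  have := cabsD b (a - b); rewrite addrC subrK; lra.
have a0 : 0 < cabs z by apply: (lt_le_trans z0); apply: (le_trans (ler_norm _) (cre_le z)).
have c4 : ln (cabs u) @[u --> nbhs z] --> ln (cabs z).
  by apply: continuous_cvg c3; exact: continuous_ln.
have c5 : atan (cim u / cre u) @[u --> nbhs z] --> atan (cim z / cre z).
  apply: continuous_cvg; first exact: continuous_atan.
  by apply: cvgM => //; apply: cvgV => //; rewrite gt_eqF.
move=> e e0; have e20 : 0 < e / 2 by rewrite divr_gt0.
move/cvgrPdist_lt: c4 => /(_ _ e20) /nbhsC [d1 d10 h1].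
move/cvgrPdist_lt: c5 => /(_ _ e20) /nbhsC [d2 d20 h2].
exists (Num.min d1 d2); first by rewrite lt_min d10.
move=> u; rewrite lt_min => /andP[/h1 {}h1 /h2 {}h2].
apply: (le_lt_trans (cabs_le _)); rewrite creB cimB /= -normrN opprB.
by rewrite -[X in _ + X]normrN opprB [ltRHS](splitr e) ltrD.
Qed.

Lemma is_derive_clog z : 0 < cre z -> is_derive z (1 : C) (@clog R) z^-1.
Proof.
move=> z0; rewrite -[z^-1]mul1r.
apply: (@is_derive_log _ (fun x => x) z 1 (cre z)) => //.
- exact: clog_cont.
- move=> u hu; apply: clogK.
  have := le_lt_trans (cre_le (u - z)) hu; rewrite creB ltr_norml => /andP[]; lra.
Qed.
End Logarithm.

(** * Entrywise derivatives of matrices and quotients of solutions *)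

Section MatrixCalculus.
Context {R : realType}.
Local Notation C := (Cplx R).

(** The relational form carries derivability and the value of the derivative together; [mderP]
    converts to the form used in the statement. *)
Definition mder (n m : nat) (Y : C -> 'M[C]_(n, m)) (z : C) (Y' : 'M[C]_(n, m)) : Prop :=
  forall i j, is_derive z (1 : C) (fun x => Y x i j) (Y' i j).

Lemma mderP n m (Y : C -> 'M[C]_(n, m)) z Y' :
  mder Y z Y' <-> Defs.derivable_mx Y z /\ Defs.derive_mx Y z = Y'.
Proof.
split=> [h|[h1 <-] i j]; last by rewrite mxE; apply: is_derive_derive1; exact: h1.
split=> [i j|]; first by have [] := h i j.
by apply/matrixP => i j; rewrite mxE; exact: derive1_val.
Qed.

Lemma mder_eq n m (Y : C -> 'M[C]_(n, m)) z Y1 Y2 : mder Y z Y1 -> Y1 = Y2 -> mder Y z Y2.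
Proof. by move=> h <-. Qed.

Lemma mder_near n m (Y Z : C -> 'M[C]_(n, m)) z Y' : (\forall x \near z, Y x = Z x) ->
  mder Y z Y' -> mder Z z Y'.
Proof.
move=> h hY i j; apply: is_derive_near (hY i j).
by apply: filterS h => x ->.
Qed.

Lemma mder_const n m (A : 'M[C]_(n, m)) z : mder (fun=> A) z 0.
Proof. by move=> i j; rewrite mxE; exact: is_derive_const. Qed.

Lemma mder_mul n m p (A : C -> 'M[C]_(n, m)) (B : C -> 'M[C]_(m, p)) z A' B' :
  mder A z A' -> mder B z B' -> mder (fun x => A x *m B x) z (A' *m B z + A z *m B').
Proof.
move=> hA hB i j; under eq_fun do rewrite mxE.
rewrite !mxE -big_split /=; apply: is_derive_bigsum => k.
exact: is_derive_mul.
Qed.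

Lemma mder_mulr n m p (A : C -> 'M[C]_(n, m)) (B : 'M[C]_(m, p)) z A' :
  mder A z A' -> mder (fun x => A x *m B) z (A' *m B).
Proof.
move=> hA; apply: mder_eq (mder_mul hA (mder_const B z)) _.
by rewrite mulmx0 addr0.
Qed.

Lemma mder_comp n m (Y : C -> 'M[C]_(n, m)) (g : C -> C) z l Y' :
  is_derive z (1 : C) g l -> mder Y (g z) Y' -> mder (fun x => Y (g x)) z (l *: Y').
Proof.
move=> hg hY i j; rewrite mxE mulrC; exact: (is_derive_compC hg (hY i j)).
Qed.

Lemma derivable_det n (A : C -> 'M[C]_n) z A' : mder A z A' ->
  exists l, is_derive z (1 : C) (fun x => \det (A x)) l.
Proof.
move=> hA.
have hp (s : 'S_n) : exists l, is_derive z (1 : C) (fun x => \prod_i A x i (s i)) l.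
  elim: (index_enum _) => [|i r [l IH]].
    by exists 0; under eq_fun do rewrite big_nil; exact: is_derive_const.
  eexists; under eq_fun do rewrite big_cons.
  exact: is_derive_mul (hA i (s i)) IH.
have [D hD] := choice hp.
eexists; exact: is_derive_bigsum (fun s => is_derive_mul (is_derive_const _ _) (hD s)).
Qed.

(** The cofactor formula gives derivability of the entries of the inverse; the value then comes from
    differentiating A A^{-1} = 1. *)
Lemma mder_inv n (A : C -> 'M[C]_n) z A' : (\forall x \near z, A x \in unitmx) ->
  mder A z A' -> mder (fun x => invmx (A x)) z (- (invmx (A z) *m A' *m invmx (A z))).
Proof.
move=> hu hA; have uz : A z \in unitmx := nbhs_singleton hu.
have [d hd] := derivable_det hA.
have dz : \det (A z) != 0 by rewrite -unitfE.
have hc i j : exists l, is_derive z (1 : C) (fun x => invmx (A x) i j) l.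
  have [l hl] : exists l, is_derive z (1 : C) (fun x => \det (row' j (col' i (A x)))) l.
    apply: (@derivable_det _ _ _ (row' j (col' i A'))) => a b.
    by under eq_fun do rewrite !mxE; rewrite !mxE; exact: hA.
  eexists; apply: (@is_derive_near _
    (fun x => (\det (A x))^-1 * ((-1) ^+ (j + i) * \det (row' j (col' i (A x)))))).
    by apply: filterS hu => x hx; rewrite /invmx hx !mxE.
  exact: is_derive_mul (is_derive_inv dz hd) (is_derive_mul (is_derive_const _ _) hl).
have [B' hB] : exists B', mder (fun x => invmx (A x)) z B'.
  have hc' i : exists D, forall j, is_derive z (1 : C) (fun x => invmx (A x) i j) (D j).
    by have [D hD] := choice (hc i); exists D.
  have [D hD] := choice hc'.
  by exists (\matrix_(i, j) D i j) => i j; rewrite mxE.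
have h1 : mder (fun x => A x *m invmx (A x)) z 0.
  apply: mder_near (mder_const 1%:M z).
  by apply: filterS hu => x hx; rewrite mulmxV.
have h2 : A' *m invmx (A z) + A z *m B' = 0.
  have /mderP[_ <-] := mder_mul hA hB.
  by move/mderP: h1 => [].
apply: mder_eq hB _; move/eqP: h2; rewrite addrC addr_eq0 => /eqP /(congr1 (mulmx (invmx (A z)))).
by rewrite mulKmx// mulmxN mulmxA.
Qed.

Lemma mder_cst_segment n m (Y : C -> 'M[C]_(n, m)) a b :
  (forall s : R, 0 <= s <= 1 -> mder Y (a + rc s * (b - a)) 0) -> Y b = Y a.
Proof.
move=> h; apply/matrixP => i j; apply: (@cst_segment _ (fun x => Y x i j)) => s s01.
by have := h s s01 i j; rewrite mxE.
Qed.

                                                                                       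
(** Two solutions of one linear system differ by a constant right factor, since the derivative of
    P^{-1} Y is - P^{-1} A Y + P^{-1} A Y = 0. Every identification of solutions below rests on
    this. *)
Lemma solution_quotient n m (A : C -> 'M[C]_n) (P : C -> 'M[C]_n)
    (Y : C -> 'M[C]_(n, m)) a b :
  (forall s : R, 0 <= s <= 1 -> let z := a + rc s * (b - a) in
    [/\ mder P z (A z *m P z), mder Y z (A z *m Y z) & \forall x \near z, P x \in unitmx]) ->
  invmx (P b) *m Y b = invmx (P a) *m Y a.
Proof.
move=> h; apply: (@mder_cst_segment _ _ (fun z => invmx (P z) *m Y z)) => s s01.
have [h1 h2 h3] := h s s01; move: h1 h2 h3; set z := a + _ => h1 h2 h3.
have uz : P z \in unitmx := nbhs_singleton h3.
apply: mder_eq (mder_mul (mder_inv h3 h1) h2) _.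
by rewrite mulNmx -!mulmxA mulKVmx// addNr.
Qed.
End MatrixCalculus.

                     

(** * Convergent power series: derivative and Cauchy product *)

Section Series.
Context {R : realType}.
Local Notation C := (Cplx R).
Implicit Types (a b : nat -> C) (z h l : C) (p M q : R).

Definition ccvg (u : nat -> C) (l : C) : Prop :=
  forall e : R, 0 < e -> exists N : nat, forall n, (N <= n)%N -> cabs (u n - l) < e.

Lemma ccvgP (u : nat -> C) l : (u @ \oo --> l) <-> ccvg u l.
Proof.
split=> [/cvgC H e e0|H].
  by have [N _ hN] := H _ e0; exists N => n hn; exact: hN.
by apply/cvgC => e /H [N hN]; exists N => // n /= hn; exact: hN.
Qed.

Lemma ccvg_unique (u : nat -> C) l k : ccvg u l -> ccvg u k -> l = k.
Proof.
move=> hl hk; apply/eqP; rewrite -subr_eq0 -cabs_eq0 eq_le cabs_ge0 andbT.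
apply/ler_addgt0Pl => e e0; rewrite addr0; have e20 : 0 < e / 2 by rewrite divr_gt0.
have [N h1] := hl _ e20; have [N' h2] := hk _ e20.
have := h1 _ (leq_maxl N N'); have := h2 _ (leq_maxr N N'); set x := u _ => k1.
rewrite cabsB => k2; have := cabsD (l - x) (x - k); rewrite addrA subrK; lra.
Qed.

Lemma cvgC_eps_le (l : C) (c : R) (u : nat -> C) : ccvg u l ->
  (exists N : nat, forall n, (N <= n)%N -> cabs (u n) <= c) -> cabs l <= c.
Proof.
move=> hl [N hN]; apply/ler_addgt0Pr => e e0.
have [N' hN'] := hl _ e0.
have h1 := hN _ (leq_maxl N N'); have := hN' _ (leq_maxr N N').
set x := u _ in h1 *; rewrite cabsB => h2.
have := cabsD (l - x) x; rewrite subrK; lra.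
Qed.

Lemma ccvgD (u v : nat -> C) l k : ccvg u l -> ccvg v k -> ccvg (fun n => u n + v n) (l + k).
Proof.
move=> h1 h2 e e0; have e20 : 0 < e / 2 by rewrite divr_gt0.
have [N1 k1] := h1 _ e20; have [N2 k2] := h2 _ e20.
exists (maxn N1 N2) => n; rewrite geq_max => /andP[/k1 {}k1 /k2 {}k2].
rewrite opprD addrACA; apply: (le_lt_trans (cabsD _ _)).
by rewrite [ltRHS](splitr e) ltrD.
Qed.
Lemma ccvgM (u v : nat -> C) l k : ccvg u l -> ccvg v k -> ccvg (fun n => u n * v n) (l * k).
Proof.
move=> h1 h2 e e0; pose A := cabs l + 1; pose B := cabs k + 1.
have A0 : 0 < A by rewrite ltr_wpDl// cabs_ge0.
have B0 : 0 < B by rewrite ltr_wpDl// cabs_ge0.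
have e1 : 0 < Num.min 1 (e / (2 * B)) by rewrite lt_min ltr01 divr_gt0// mulr_gt0.
have e2 : 0 < e / (2 * A) by rewrite divr_gt0// mulr_gt0.
have [N1 k1] := h1 _ e1; have [N2 k2] := h2 _ e2.
exists (maxn N1 N2) => n; rewrite geq_max => /andP[/k1 {}k1 /k2 {}k2].
move: k1; rewrite lt_min => /andP[k1 k3].
have -> : u n * v n - l * k = u n * (v n - k) + (u n - l) * k by ring.
apply: (le_lt_trans (cabsD _ _)); rewrite !cabsM [ltRHS](splitr e).
have uA : cabs (u n) <= A.
  by have := cabsD (u n - l) l; rewrite subrK /A; lra.
apply: ltr_leD.
  apply: (le_lt_trans (ler_wpM2r (cabs_ge0 _) uA)).
  by move: k2; rewrite ltr_pdivlMr ?mulr_gt0//; lra.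
have kB : cabs k <= B by rewrite /B; lra.
apply: (le_trans (ler_wpM2l (cabs_ge0 _) kB)).
by move: k3; rewrite ltr_pdivlMr ?mulr_gt0//; lra.
Qed.
Lemma ccvg_cst l : ccvg (fun=> l) l.
Proof. by move=> e e0; exists 0%N => n _; rewrite subrr cabs0. Qed.
Lemma ccvg_sum (I : Type) (r : seq I) (P : pred I) (F : I -> nat -> C) (D : I -> C) :
  (forall i, ccvg (F i) (D i)) ->
  ccvg (fun n => \sum_(i <- r | P i) F i n) (\sum_(i <- r | P i) D i).
Proof.
move=> h; elim: r => [|i r IH].
  by rewrite big_nil; under eq_fun do rewrite big_nil; exact: ccvg_cst.
rewrite big_cons; under eq_fun do rewrite big_cons.
by case: (P i) => //; exact: ccvgD.
Qed.

Lemma cauchyC (u : nat -> C) :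
  (forall e : R, 0 < e -> exists N : nat, forall n, (N <= n)%N -> cabs (u n - u N) < e) ->
  exists l, ccvg u l.
Proof.
move=> H.
have key (f : C -> R) : (forall x y, `|f x - f y| <= cabs (x - y)) ->
    exists l : R, f (u n) @[n --> \oo] --> l.
  move=> hf; apply/cvg_ex; apply/cauchy_cvgP/cauchy_exP => e e0.
  have [N hN] := H _ e0; exists (f (u N)); exists N => // n /= hn.
  by rewrite /ball /= distrC; apply: le_lt_trans (hN _ hn).
have [|x hx] := key (@cre R); first by move=> x y; rewrite -creB cre_le.
have [|y hy] := key (@cim R); first by move=> x' y; rewrite -cimB cim_le.
exists (x +i* y)%C => e e0; have e20 : 0 < e / 2 by rewrite divr_gt0.
move/cvgrPdist_lt: hx => /(_ _ e20) [N1 _ h1].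
move/cvgrPdist_lt: hy => /(_ _ e20) [N2 _ h2].
exists (maxn N1 N2) => n; rewrite geq_max => /andP[/h1 /= k1 /h2 /= k2].
apply: (le_lt_trans (cabs_le _)); rewrite creB cimB /= distrC [X in _ + X]distrC.
by rewrite [ltRHS](splitr e) ltrD.
Qed.

Lemma expr_small q (e : R) : 0 <= q < 1 -> 0 < e ->
  exists N : nat, forall n, (N <= n)%N -> q ^+ n < e.
Proof.
move=> /andP[q0 q1] e0.
have : q ^+ n @[n --> \oo] --> (0 : R) by apply: cvg_expr; rewrite ger0_norm.
move=> /cvgrPdist_lt /(_ _ e0) [N _ hN]; exists N => n /hN /=.
by rewrite sub0r normrN ger0_norm ?exprn_ge0.
Qed.

Lemma geo_tail q (m n : nat) : 0 <= q < 1 -> \sum_(m <= k < n) q ^+ k <= q ^+ m / (1 - q).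
Proof.
move=> /andP[q0 q1]; have hq : 0 < 1 - q by lra.
have [mn|nm] := leqP m n; last first.
  by rewrite big_geq ?(ltnW nm)// divr_ge0 ?exprn_ge0// ltW.
rewrite ler_pdivlMr//.
suff -> : (\sum_(m <= k < n) q ^+ k) * (1 - q) = q ^+ m - q ^+ n.
  by rewrite lerBlDr lerDl exprn_ge0.
have /= T := @telescope_sumr _ m n (fun k => q ^+ k) mn.
rewrite mulr_suml -[RHS]opprB -T -sumrN.
by apply: eq_bigr => k _; rewrite exprS; ring.
Qed.

(** A Cauchy estimate on the coefficients. Convergence is always derived from such a bound, at the
    price of shrinking [p] by fixed factors. *)
Definition geo a p M := 0 < p /\ forall m, cabs (a m) * p ^+ m <= M.

Definition psum a z (N : nat) : C := \sum_(m < N) a m * z ^+ m.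

Lemma geo_ge0 a p M : geo a p M -> 0 <= M.
Proof.
move=> [p0 /(_ 0%N)]; apply: le_trans.
by rewrite mulr_ge0 ?cabs_ge0// exprn_ge0// ltW.
Qed.

Lemma geo_weak a p p' M : geo a p M -> 0 < p' <= p -> geo a p' M.
Proof.
move=> [p0 h] /andP[p'0 hp]; split=> // m; apply: le_trans (h m).
by rewrite ler_wpM2l ?cabs_ge0// lerXn2r ?nnegrE ?(ltW p0) ?(ltW p'0).
Qed.

Lemma geo_term a p M z m : geo a p M -> cabs (a m * z ^+ m) <= M * (cabs z / p) ^+ m.
Proof.
move=> [p0 h]; rewrite cabsM cabsX expr_div_n mulrA ler_pdivlMr ?exprn_gt0//.
by rewrite mulrAC ler_wpM2r ?exprn_ge0 ?cabs_ge0 ?h.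
Qed.

Lemma psum_diff a p M z m n : geo a p M -> cabs z < p -> (m <= n)%N ->
  cabs (psum a z n - psum a z m) <= M * (cabs z / p) ^+ m / (1 - cabs z / p).
Proof.
move=> ga zp mn; have p0 : 0 < p by case: ga.
have q01 : 0 <= cabs z / p < 1.
  by rewrite divr_ge0 ?cabs_ge0 ?(ltW p0)//= ltr_pdivrMr// mul1r.
rewrite /psum -!(big_mkord xpredT (fun m => a m * z ^+ m)).
rewrite (big_cat_nat (n := m))//= addrAC subrr add0r.
apply: (le_trans (cabs_sum _ _ _)).
apply: (@le_trans _ _ (\sum_(m <= k < n) M * (cabs z / p) ^+ k)).
  by apply: ler_sum => k _; exact: geo_term.
by rewrite -mulr_sumr -mulrA ler_wpM2l ?(geo_ge0 ga)// geo_tail.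
Qed.

Lemma geo_cvg a p M z : geo a p M -> cabs z < p -> exists l, ccvg (psum a z) l.
Proof.
move=> ga zp; have p0 : 0 < p by case: ga.
have q01 : 0 <= cabs z / p < 1.
  by rewrite divr_ge0 ?cabs_ge0 ?(ltW p0)//= ltr_pdivrMr// mul1r.
have q1 : 0 < 1 - cabs z / p by lra.
have M0 := geo_ge0 ga; have M1 : 0 < M + 1 by lra.
apply: cauchyC => e e0.
have [|N hN] := @expr_small _ (e * (1 - cabs z / p) / (M + 1)) q01.
  by rewrite divr_gt0// mulr_gt0.
exists N => n hn; apply: (le_lt_trans (psum_diff ga zp hn)).
rewrite ltr_pdivrMr//; have := hN _ (leqnn N); rewrite ltr_pdivlMr//.
have : 0 <= (cabs z / p) ^+ N by rewrite exprn_ge0//; case/andP: q01.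
nra.
Qed.

(** The sum of the series, with the default value 0 where it diverges. *)
Definition pser a z : C := xget 0 [set l | ccvg (psum a z) l].

Lemma pserP a p M z : geo a p M -> cabs z < p -> ccvg (psum a z) (pser a z).
Proof. by move=> ga zp; have [l hl] := geo_cvg ga zp; exact: (xgetI 0 hl). Qed.

Lemma pserE a z l : ccvg (psum a z) l -> pser a z = l.
Proof. by move=> h; apply: (ccvg_unique _ h); exact: (xgetI 0 h). Qed.

Lemma pser0 a : pser a 0 = a 0%N.
Proof.
apply: pserE => e e0; exists 1%N => -[//|n] _.
rewrite /psum big_ord_recl expr0 mulr1 big1 ?addr0 ?subrr ?cabs0// => i _.
by rewrite expr0n mulr0.
Qed.

Lemma pow_lip z h p (m : nat) : cabs z <= p -> cabs (z + h) <= p ->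
  p * cabs ((z + h) ^+ m - z ^+ m) <= m%:R * cabs h * p ^+ m.
Proof.
move=> hz hh; have p0 : 0 <= p := le_trans (cabs_ge0 z) hz.
elim: m => [|m IH]; first by rewrite !expr0 subrr cabs0 mulr0 mul0r mul0r.
have -> : (z + h) ^+ m.+1 - z ^+ m.+1 = (z + h) * ((z + h) ^+ m - z ^+ m) + h * z ^+ m.
  by rewrite !exprS; ring.
have h1 : cabs ((z + h) * ((z + h) ^+ m - z ^+ m)) <= p * cabs ((z + h) ^+ m - z ^+ m).
  by rewrite cabsM ler_wpM2r ?cabs_ge0.
have h2 : cabs (h * z ^+ m) <= cabs h * p ^+ m.
  by rewrite cabsM cabsX ler_wpM2l ?cabs_ge0// lerXn2r ?nnegrE ?cabs_ge0.
have := ler_wpM2l p0 (le_trans (cabsD _ _) (lerD h1 h2)).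
move=> h3; apply: (le_trans h3); rewrite -natr1 exprS.
have := ler_wpM2l p0 IH; lra.
Qed.

(** Second-order Taylor remainder of a power; the factor [p ^+ 2] on the left avoids the exponent m
    - 2. *)
Lemma pow_lip2 z h p (m : nat) : cabs z <= p -> cabs (z + h) <= p ->
  p ^+ 2 * cabs ((z + h) ^+ m - z ^+ m - h * (m%:R * z ^+ m.-1)) <=
  m%:R ^+ 2 * cabs h ^+ 2 * p ^+ m.
Proof.
move=> hz hh; have p0 : 0 <= p := le_trans (cabs_ge0 z) hz.
elim: m => [|m IH]; first by rewrite !expr0 subrr mul0r mulr0 subrr cabs0 mulr0 expr0n !mul0r.
set D := _ - h * _ in IH.
have -> : (z + h) ^+ m.+1 - z ^+ m.+1 - h * (m.+1%:R * z ^+ m.+1.-1) =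
   z * D + h * ((z + h) ^+ m - z ^+ m).
  rewrite /D !exprS /= -natr1; case: (m) => [|k] /=; rewrite ?exprS; ring.
have h1 : cabs (z * D) <= p * cabs D by rewrite cabsM ler_wpM2r ?cabs_ge0.
have h2 := pow_lip m hz hh.
have h3 := le_trans (cabsD (z * D) (h * ((z + h) ^+ m - z ^+ m))) (lerD h1 (lexx _)).
rewrite [cabs (h * _)]cabsM in h3.
have p20 : 0 <= p ^+ 2 by rewrite exprn_ge0.
apply: (le_trans (ler_wpM2l p20 h3)).
have k1 := ler_wpM2l p0 IH.
have k2 := ler_wpM2l (mulr_ge0 p0 (cabs_ge0 h)) h2.
rewrite -natr1 [p ^+ m.+1]exprS.
have k3 : 0 <= (m%:R + 1) * cabs h ^+ 2 * (p * p ^+ m).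
  by rewrite mulr_ge0 ?mulr_ge0 ?exprn_ge0 ?cabs_ge0// addr_ge0.
lra.
Qed.

Definition dcoef a (m : nat) : C := m.+1%:R * a m.+1.

Lemma geo_dcoef a p M : geo a p M -> geo (dcoef a) (p / 2) (M / p).
Proof.
move=> [p0 h]; split=> [|m]; first by rewrite divr_gt0.
rewrite /dcoef cabsM cabs_nat expr_div_n ler_pdivlMr//.
have h1 : (m.+1%:R : R) <= 2 ^+ m by rewrite -natrX ler_nat ltn_expl.
have -> : m.+1%:R * cabs (a m.+1) * (p ^+ m / 2 ^+ m) * p =
  (m.+1%:R / 2 ^+ m) * (cabs (a m.+1) * p ^+ m.+1) by rewrite exprS; ring.
apply: le_trans (h m.+1); rewrite ler_piMl//.
  by rewrite mulr_ge0 ?cabs_ge0 ?exprn_ge0// ltW.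
by rewrite ler_pdivrMr ?exprn_gt0// mul1r.
Qed.

Lemma sqr_le_expn (m : nat) : (m ^ 2 <= 4 * 2 ^ m)%N.
Proof.
elim: m => [|[|[|[|m]]] IH] //.
rewrite (expnS 2 m.+3); move: IH; rewrite -!mulnn; set X := (2 ^ _)%N; nia.
Qed.

(** The remainder is summed termwise, and m^2 <= 4 * 2^m lets a quarter of the radius absorb the
    polynomial factor. *)
Lemma pser_derive a p M z : geo a p M -> cabs z < p / 8 ->
  is_derive z (1 : C) (pser a) (pser (dcoef a) z).
Proof.
move=> ga zp; have p0 : 0 < p by case: ga.
have M0 := geo_ge0 ga.
(* With radius p/4 the m-th term is at most (16 / p^2) * 4 * 2^m * M * 4^{-m} |h|^2, that is (64 M /
   p^2) |h|^2 2^{-m}; summing over m doubles the constant. *)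
pose K := 128 * M / p ^+ 2.
have K0 : 0 <= K.
  by apply: divr_ge0; [exact: mulr_ge0 (ler0n _ _) M0|exact: exprn_ge0 _ (ltW p0)].
have main h : cabs h < p / 8 ->
    cabs (pser a (z + h) - pser a z - h * pser (dcoef a) z) <= K * cabs h ^+ 2.
  move=> hh; have zh : cabs (z + h) < p / 4 by apply: (le_lt_trans (cabsD _ _)); lra.
  have c1 : ccvg (psum a (z + h)) (pser a (z + h)) by apply: (pserP ga); lra.
  have c2 : ccvg (psum a z) (pser a z) by apply: (pserP ga); lra.
  have c3 : ccvg (psum (dcoef a) z) (pser (dcoef a) z).
    by apply: (pserP (geo_dcoef ga)); lra.
  have c4 : ccvg (fun n => psum (dcoef a) z n.-1) (pser (dcoef a) z).
    move=> e /c3 [N hN]; exists N.+1 => -[//|n] /= hn; exact: hN.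
  have := ccvgD (ccvgD c1 (ccvgM (ccvg_cst (- 1)) c2)) (ccvgM (ccvg_cst (- h)) c4).
  rewrite mulN1r mulNr => c5; apply: (cvgC_eps_le c5); exists 0%N => n _.
  have -> : psum a (z + h) n + -1 * psum a z n + - h * psum (dcoef a) z n.-1 =
    \sum_(m < n) a m * ((z + h) ^+ m - z ^+ m - h * (m%:R * z ^+ m.-1)).
    have -> : psum (dcoef a) z n.-1 = \sum_(m < n) a m * (m%:R * z ^+ m.-1).
      case: n => [|n]; first by rewrite /psum !big_ord0.
      rewrite /= [RHS]big_ord_recl /= mul0r mulr0 add0r.
      by apply: eq_bigr => i _; rewrite /dcoef /bump /= add1n; ring.
    rewrite /psum mulN1r mulNr mulr_sumr -!sumrN -!big_split /=.
    by apply: eq_bigr => i _; ring.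
  apply: (le_trans (cabs_sum _ _ _)).
  apply: (@le_trans _ _ (\sum_(m < n) K / 2 * cabs h ^+ 2 * (2^-1) ^+ m)); last first.
    rewrite -mulr_sumr -(big_mkord xpredT (fun m => (2^-1 : R) ^+ m)).
    have h12 : 0 <= (2^-1 : R) < 1 by lra.
    have := geo_tail 0 n h12; rewrite expr0 div1r.
    have -> : (1 - 2^-1 : R)^-1 = 2 by field.
    have hK : 0 <= K / 2 * cabs h ^+ 2.
      by rewrite mulr_ge0 ?exprn_ge0 ?cabs_ge0// divr_ge0.
    move=> /(ler_wpM2l hK) H; apply: (le_trans H).
    by rewrite mulrAC divfK.
  apply: ler_sum => m _; rewrite cabsM.
  have zh' : cabs z <= p / 4 by lra.
  have := pow_lip2 m zh' (ltW zh); set D := cabs (_ - _ - _) => hD.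
  have p40 : 0 < (p / 4) ^+ 2 by rewrite exprn_gt0// divr_gt0.
  have m2 : (m%:R : R) ^+ 2 <= 4 * 2 ^+ m.
    by rewrite -!natrX -natrM ler_nat; exact: sqr_le_expn.
  rewrite -(ler_pM2l p40) mulrCA.
  apply: (le_trans (ler_wpM2l (cabs_ge0 _) hD)).
  have ham : cabs (a m) * (p / 4) ^+ m <= M * (4^-1) ^+ m.
    rewrite expr_div_n mulrA -exprVn ler_wpM2r ?exprn_ge0//.
    by case: ga => _; exact.
  have hh0 : 0 <= cabs h ^+ 2 by rewrite exprn_ge0 ?cabs_ge0.
  have -> : cabs (a m) * (m%:R ^+ 2 * cabs h ^+ 2 * (p / 4) ^+ m) =
    m%:R ^+ 2 * cabs h ^+ 2 * (cabs (a m) * (p / 4) ^+ m) by ring.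
  apply: (@le_trans _ _ (4 * 2 ^+ m * cabs h ^+ 2 * (M * (4^-1) ^+ m))).
    apply: ler_pM => //; rewrite ?mulr_ge0 ?exprn_ge0 ?cabs_ge0 ?divr_ge0 ?(ltW p0)//.
    by rewrite ler_wpM2r.
  have -> : (4^-1 : R) ^+ m = (2^-1) ^+ m * (2^-1) ^+ m.
    by rewrite -exprMn; congr (_ ^+ _); field.
  have -> : 4 * 2 ^+ m * cabs h ^+ 2 * (M * (2^-1 ^+ m * 2^-1 ^+ m)) =
     (2 ^+ m * (2^-1) ^+ m) * (4 * cabs h ^+ 2 * M * (2^-1) ^+ m) by ring.
  rewrite -exprMn divff ?pnatr_eq0// expr1n mul1r /K.
  rewrite le_eqVlt; apply/orP; left; apply/eqP.
  set w := 2^-1 ^+ m; field; lra.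
apply/is_deriveC => e e0.
exists (Num.min (p / 8) (e / (K + 1))).
  by rewrite lt_min !divr_gt0//; lra.
move=> h; rewrite lt_min => /andP[/main {}main]; rewrite ltr_pdivlMr; last lra.
move=> hh; apply: (le_trans main); have := cabs_ge0 h; nra.
Qed.

Definition conv a b (m : nat) : C := \sum_(i < m.+1) a i * b (m - i)%N.

(** Stated for sequences dominated by [a] and [b] because [pser_conv] applies it to their
    truncations. The m + 1 terms of the convolution are absorbed by 2^m. *)
Lemma conv_bound a b p M M' m : geo a p M -> geo b p M' ->
  forall a' b' : nat -> C, (forall i, cabs (a' i) <= cabs (a i)) ->
  (forall i, cabs (b' i) <= cabs (b i)) ->
  cabs (conv a' b' m) * (p / 2) ^+ m <= M * M'.
Proof.
move=> ga gb a' b' ha hb; have p0 : 0 < p by case: ga.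
have M0 := geo_ge0 ga; have M'0 := geo_ge0 gb.
have h1 : cabs (conv a' b' m) * p ^+ m <= m.+1%:R * (M * M').
  apply: (le_trans (ler_wpM2r _ (cabs_sum _ _ _))); first by rewrite exprn_ge0// ltW.
  rewrite mulr_suml; apply: (@le_trans _ _ (\sum_(i < m.+1) M * M')); last first.
    by rewrite sumr_const card_ord mulr_natl.
  apply: ler_sum => i _; rewrite cabsM.
  have -> : p ^+ m = p ^+ i * p ^+ (m - i) by rewrite -exprD subnKC// -ltnS.
  rewrite mulrACA; apply: ler_pM; rewrite ?mulr_ge0 ?cabs_ge0 ?exprn_ge0 ?(ltW p0)//.
    by apply: le_trans (ga.2 i); rewrite ler_wpM2r// exprn_ge0// ltW.
  by apply: le_trans (gb.2 (m - i)%N); rewrite ler_wpM2r// exprn_ge0// ltW.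
rewrite expr_div_n mulrA ler_pdivrMr ?exprn_gt0//; apply: (le_trans h1).
rewrite mulrC ler_wpM2l ?mulr_ge0// -natrX ler_nat; exact: ltn_expl.
Qed.

Lemma geo_conv a b p M M' : geo a p M -> geo b p M' -> geo (conv a b) (p / 2) (M * M').
Proof.
move=> ga gb; have p0 : 0 < p by case: ga.
by split=> [|m]; [rewrite divr_gt0|exact: (conv_bound m ga gb)].
Qed.

(** The product of the partial sums of length n agrees with the partial sum of the convolution below
    degree n; the degrees from n to 2n form a geometric tail. *)
Lemma pser_conv a b p M M' z : geo a p M -> geo b p M' -> cabs z < p / 2 ->
  pser (conv a b) z = pser a z * pser b z.
Proof.
move=> ga gb zp; have p0 : 0 < p by case: ga.
have zp' : cabs z < p by lra.
apply: pserE => e e0.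
have e20 : 0 < e / 2 by rewrite divr_gt0.
have [N1 h1] := ccvgM (pserP ga zp') (pserP gb zp') e20.
set q := cabs z / (p / 2).
have q01 : 0 <= q < 1.
  by rewrite divr_ge0 ?cabs_ge0 ?divr_ge0 ?(ltW p0)//= ltr_pdivrMr ?mul1r// divr_gt0.
have q1 : 0 < 1 - q by lra.
have M0 : 0 <= M * M' by rewrite mulr_ge0// ?(geo_ge0 ga) ?(geo_ge0 gb).
have M1 : 0 < M * M' + 1 by lra.
have [|N2 h2] := @expr_small _ (e / 2 * (1 - q) / (M * M' + 1)) q01.
  by rewrite divr_gt0// mulr_gt0.
exists (maxn N1 N2) => n; rewrite geq_max => /andP[/h1 {}h1 /h2 {}h2].
have -> : psum (conv a b) z n - pser a z * pser b z =
  (psum a z n * psum b z n - pser a z * pser b z) -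
  (psum a z n * psum b z n - psum (conv a b) z n) by ring.
apply: (le_lt_trans (cabsD _ _)); rewrite cabsN [ltRHS](splitr e) ltr_leD//.
pose A := \poly_(i < n) a i; pose B := \poly_(i < n) b i.
have hA : psum a z n = A.[z] by rewrite horner_poly.
have hB : psum b z n = B.[z] by rewrite horner_poly.
have hAB : (size (A * B)%R <= n + n)%N.
  apply: (leq_trans (size_polyMleq _ _)); apply: (leq_trans (leq_pred _)).
  by rewrite leq_add// size_poly.
have -> : psum a z n * psum b z n - psum (conv a b) z n =
  \sum_(n <= m < n + n) (A * B)`_m * z ^+ m.
  rewrite hA hB -hornerM (horner_coef_wide _ hAB).
  rewrite -(big_mkord xpredT (fun m => (A * B)`_m * z ^+ m)).
  rewrite (big_cat_nat (n := n)) ?leq_addr//= big_mkord.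
  rewrite addrC; apply/eqP; rewrite -addrA -subr_eq0 addrAC subrr add0r subr_eq0.
  apply/eqP; apply: eq_bigr => i _; congr (_ * _).
  rewrite coefM /conv; apply: eq_bigr => j _; rewrite !coef_poly.
  have jn : (j < n)%N by apply: leq_ltn_trans (ltn_ord i); rewrite -ltnS.
  by rewrite jn (leq_ltn_trans (leq_subr _ _) (ltn_ord i)).
apply: (le_trans (cabs_sum _ _ _)).
apply: (@le_trans _ _ (\sum_(n <= m < n + n) M * M' * q ^+ m)).
  apply: ler_sum => m _; rewrite cabsM cabsX expr_div_n mulrA.
  rewrite ler_pdivlMr ?exprn_gt0 ?divr_gt0// mulrAC ler_wpM2r ?exprn_ge0 ?cabs_ge0//.
  have -> : (A * B)`_m = conv (fun i => A`_i) (fun i => B`_i) m by rewrite coefM.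
  apply: (conv_bound m ga gb) => i; rewrite coef_poly; case: ifP => // _;
    by rewrite cabs0 cabs_ge0.
rewrite -mulr_sumr; apply: (le_trans (ler_wpM2l M0 (geo_tail _ _ q01))).
rewrite mulrA ler_pdivrMr//; move: h2; rewrite ltr_pdivlMr//.
have : 0 <= q ^+ n by rewrite exprn_ge0//; case/andP: q01.
lra.
Qed.
End Series.

(** * Re-expansion of a two-variable germ at a shifted point *)

Section TaylorShift.
Context {R : realType}.
Local Notation C := (Cplx R).

Definition sqsum (T : zmodType) (f : nat -> nat -> T) (N : nat) : T :=
  \sum_(j < N) \sum_(k < N) f j k.

(** Enlarging the square by one adds a gnomon: a row and a column. *)
Lemma sqsumS (T : zmodType) (f : nat -> nat -> T) N :
  sqsum f N.+1 = sqsum f N + (\sum_(k < N.+1) f N k + \sum_(j < N) f j N).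
Proof.
rewrite /sqsum big_ord_recr /=; under eq_bigr do rewrite big_ord_recr /=.
by rewrite big_split /= -addrA; congr (_ + _); exact: addrC.
Qed.

Lemma sqsum_diff (f : nat -> nat -> C) (g : nat -> nat -> R) (c : R) N N' :
  0 <= c -> (forall j k, cabs (f j k) * c <= g j k) -> (N <= N')%N ->
  cabs (sqsum f N' - sqsum f N) * c <= sqsum g N' - sqsum g N.
Proof.
move=> c0 h; elim: N' => [|N' IH].
  by rewrite leqn0 => /eqP ->; rewrite !subrr cabs0 mul0r.
rewrite leq_eqVlt => /orP[/eqP ->|]; first by rewrite !subrr cabs0 mul0r.
rewrite ltnS => /IH {}IH; rewrite !sqsumS.
set x := \sum_(k < _) f _ _ + _; set y := \sum_(k < _) g _ _ + _.
have hs : cabs x * c <= y.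
  apply: (le_trans (ler_wpM2r c0 (cabsD _ _))); rewrite mulrDl; apply: lerD.
    apply: (le_trans (ler_wpM2r c0 (cabs_sum _ _ _))); rewrite mulr_suml.
    by apply: ler_sum => i _; exact: h.
  apply: (le_trans (ler_wpM2r c0 (cabs_sum _ _ _))); rewrite mulr_suml.
  by apply: ler_sum => i _; exact: h.
have -> : sqsum f N' + x - sqsum f N = (sqsum f N' - sqsum f N) + x by ring.
have -> : sqsum g N' + y - sqsum g N = (sqsum g N' - sqsum g N) + y by ring.
apply: (le_trans (ler_wpM2r c0 (cabsD _ _))); rewrite mulrDl; exact: lerD.
Qed.

Lemma binomial_term_le (x y : R) k m : 0 <= x -> 0 <= y ->
  'C(k, m)%:R * x ^+ (k - m) * y ^+ m <= (x + y) ^+ k.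
Proof.
move=> x0 y0; have [km|mk] := ltnP k m.
  by rewrite bin_small// !mul0r exprn_ge0// addr_ge0.
rewrite -mulrA mulr_natl exprDn (bigD1 (Ordinal (mk : (m < k.+1)%N)))//= lerDl.
by apply: sumr_ge0 => i _; rewrite mulrn_wge0// mulr_ge0 ?exprn_ge0.
Qed.

(** Expanding (x0 + y)^k by the binomial formula and collecting powers of y gives the coefficients
    [b m]. Absolute convergence of the double series, uniform after weighting by (p/2)^m, justifies
    the rearrangement. *)
Lemma germ2_taylor (f : C -> C -> C) : analytic_germ2 f ->
  exists p M : R, 0 < p /\ forall e x0, cabs e < p -> cabs x0 < p / 2 ->
    exists b : nat -> C, geo b (p / 2) M /\
      forall y, cabs y < p / 2 -> ccvg (psum b y) (f e (x0 + y)).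
Proof.
move=> [a [p [M [p0 hM hf]]]]; exists p, M; split=> // e x0 he hx0.
pose g (j k : nat) : R := cabs (a j k) * p ^+ j * p ^+ k.
have g0 j k : 0 <= g j k.
  by rewrite mulr_ge0 ?mulr_ge0 ?cabs_ge0 ?exprn_ge0// ltW.
have gM N : sqsum g N <= M.
  rewrite -rc_le; apply: le_trans (hM N).
  rewrite le_eqVlt; apply/orP; left; apply/eqP.
  rewrite /sqsum (big_morph (@rc R) (@rcD R) (rc0)); apply: eq_bigr => j _.
  rewrite (big_morph (@rc R) (@rcD R) (rc0)); apply: eq_bigr => k _.
  by rewrite /g !rcM !rcX normE.
(* The contribution of the monomial (j, k) to the coefficient of y^m; it vanishes for k < m because
   the binomial coefficient does. *)
pose F m (j k : nat) : C := a j k * e ^+ j * ('C(k, m)%:R * x0 ^+ (k - m)).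
have p20 : 0 <= p / 2 by rewrite divr_ge0// ltW.
have hF m j k : cabs (F m j k) * (p / 2) ^+ m <= g j k.
  rewrite /F /g !cabsM !cabsX cabs_nat -!mulrA ler_wpM2l ?cabs_ge0//.
  apply: ler_pM; rewrite ?exprn_ge0 ?cabs_ge0 ?mulr_ge0 ?exprn_ge0 ?cabs_ge0//.
    by rewrite lerXn2r ?nnegrE ?cabs_ge0 ?(ltW p0) ?(ltW he).
  rewrite mulrA; apply: (le_trans (binomial_term_le _ _ (cabs_ge0 _) p20)).
  have hx : cabs x0 + p / 2 <= p by lra.
  by rewrite lerXn2r ?nnegrE ?addr_ge0 ?cabs_ge0 ?(ltW p0).
(* [tau N] is the tail of the dominating series outside the square of side N. It bounds the tails
   for all m at once, which is what the exchange of limits needs. *)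
have [tau [tau0 htau tauF]] : exists tau : nat -> R, [/\ forall N, 0 <= tau N,
    forall e : R, 0 < e -> exists N0 : nat, forall N, (N0 <= N)%N -> tau N < e &
    forall N N', (N <= N')%N -> sqsum g N' - sqsum g N <= tau N].
  have mono N N' : (N <= N')%N -> sqsum g N <= sqsum g N'.
    (* Monotonicity of the sums of [g] is the domination lemma applied to the zero family. *)
    have h0 (j k : nat) : cabs (0 : C) * 0 <= g j k by rewrite mulr0.
    by move=> h; have := sqsum_diff (lexx 0) h0 h; rewrite mulr0 subr_ge0.
  have cv : sqsum g @ \oo --> sup (range (sqsum g)).
    apply: nondecreasing_cvgn => [N N' h|]; first exact: mono.
    by exists M => _ [N _ <-].
  have ub N : sqsum g N <= sup (range (sqsum g)).
    apply: ub_le_sup; last by exists N.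
    by exists M => _ [N' _ <-].
  exists (fun N => sup (range (sqsum g)) - sqsum g N); split=> [N|e' e'0|N N' _].
  - by rewrite subr_ge0.
  - move/cvgrPdist_lt: cv => /(_ _ e'0) [N0 _ h]; exists N0 => N /h /=.
    by rewrite ger0_norm// subr_ge0.
  - by rewrite lerD2r.
have hb m : exists b, ccvg (sqsum (F m)) b.
  apply: cauchyC => e' e'0.
  have pm : 0 < (p / 2) ^+ m by rewrite exprn_gt0// divr_gt0.
  have [N hN] := htau _ (mulr_gt0 e'0 pm); exists N => N' hN'.
  rewrite -(ltr_pM2r pm); apply: le_lt_trans (hN N (leqnn N)).
  by apply: le_trans (tauF _ _ hN'); apply: sqsum_diff => //; rewrite exprn_ge0.
have [b hb'] := choice hb; exists b.
have dif m N : cabs (b m - sqsum (F m) N) * (p / 2) ^+ m <= tau N.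
  have pm : 0 < (p / 2) ^+ m by rewrite exprn_gt0// divr_gt0.
  rewrite -ler_pdivlMr//.
  apply: (@cvgC_eps_le _ _ _ (fun k => sqsum (F m) k - sqsum (F m) N)).
    by apply: ccvgD (hb' m) _; exact: ccvg_cst.
  exists N => N' hN'; rewrite ler_pdivlMr//.
  by apply: le_trans (tauF _ _ hN'); apply: sqsum_diff => //; rewrite exprn_ge0.
split.
  split=> [|m]; first by rewrite divr_gt0.
  have pm : 0 < (p / 2) ^+ m by rewrite exprn_gt0// divr_gt0.
  rewrite -ler_pdivlMr//; apply: (cvgC_eps_le (hb' m)).
  exists 0%N => N _; rewrite ler_pdivlMr//; apply: le_trans (gM N).
  have := @sqsum_diff (F m) g ((p / 2) ^+ m) 0 N (ltW pm) (hF m) (leq0n _).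
  by rewrite /sqsum !big_ord0 !subr0.
move=> y hy; set q := cabs y / (p / 2).
have q01 : 0 <= q < 1.
  by rewrite divr_ge0 ?cabs_ge0//= ltr_pdivrMr ?mul1r// divr_gt0.
have q1 : 0 < 1 - q by lra.
have hxy : cabs (x0 + y) < p by apply: (le_lt_trans (cabsD _ _)); lra.
have he' : `|e| < rc p by rewrite normE rc_lt.
have hxy' : `|x0 + y| < rc p by rewrite normE rc_lt.
have /ccvgP hlim := hf _ _ he' hxy'.
move=> e' e'0; have e20 : 0 < e' / 2 by rewrite divr_gt0.
have [N1 h1] := hlim _ e20.
have [N2 h2] := htau _ (mulr_gt0 e20 q1).
exists (maxn N1 N2) => N; rewrite geq_max => /andP[/h1 {}h1 /h2 {}h2].
set S := \sum_(j < N) _ in h1.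
have -> : psum b y N - f e (x0 + y) = (psum b y N - S) + (S - f e (x0 + y)) by ring.
apply: (le_lt_trans (cabsD _ _)); rewrite [ltRHS](splitr e') ler_ltD//.
have SE : S = \sum_(m < N) sqsum (F m) N * y ^+ m.
  rewrite /S /sqsum; under [RHS]eq_bigr do rewrite mulr_suml.
  rewrite [RHS]exchange_big /=; apply: eq_bigr => j _.
  under [RHS]eq_bigr do rewrite mulr_suml.
  rewrite [RHS]exchange_big /=; apply: eq_bigr => k _.
  have -> : (x0 + y) ^+ k = \sum_(m < N) x0 ^+ (k - m) * y ^+ m *+ 'C(k, m).
    rewrite exprDn -!(big_mkord xpredT (fun m => x0 ^+ (k - m) * y ^+ m *+ 'C(k, m))).
    rewrite [RHS](big_cat_nat (n := k.+1))//= -[LHS]addr0; congr (_ + _).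
    by apply/esym; rewrite big_nat big1// => m /andP[km _]; rewrite bin_small.
  by rewrite mulr_sumr /F; apply: eq_bigr => m _; rewrite -mulr_natl; ring.
have -> : psum b y N - S = \sum_(m < N) (b m - sqsum (F m) N) * y ^+ m.
  by rewrite SE /psum -sumrB; apply: eq_bigr => m _; rewrite mulrBl.
apply: (le_trans (cabs_sum _ _ _)).
apply: (@le_trans _ _ (\sum_(m < N) tau N * q ^+ m)).
  apply: ler_sum => m _; rewrite cabsM cabsX expr_div_n mulrA.
  have pm : 0 < (p / 2) ^+ m by rewrite exprn_gt0// divr_gt0.
  by rewrite ler_pdivlMr// mulrAC ler_wpM2r// exprn_ge0// cabs_ge0.
rewrite -mulr_sumr -(big_mkord xpredT (fun m => q ^+ m)).
apply: (le_trans (ler_wpM2l (tau0 N) (geo_tail _ _ q01))).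
by rewrite expr0 mulrA mulr1 ler_pdivrMr// ltW.
Qed.

(** Provides one radius for all the entries of a matrix. *)
Lemma fin_min (I : finType) (P : I -> R -> Prop) :
  (forall i, exists2 p : R, 0 < p & forall p', 0 < p' <= p -> P i p') ->
  exists2 p : R, 0 < p & forall i p', 0 < p' <= p -> P i p'.
Proof.
move=> H; suff [p p0 hp] : exists2 p : R, 0 < p &
    forall i p', i \in enum I -> 0 < p' <= p -> P i p'.
  by exists p => // i p'; apply: hp; rewrite mem_enum.
elim: (enum I) => [|i s [p p0 IH]]; first by exists 1.
have [p1 p10 h1] := H i; exists (Num.min p p1); first by rewrite lt_min p0.
move=> j p'; rewrite in_cons le_min => /orP[/eqP ->|js] /and3P[a b c].
  by apply: h1; rewrite a c.
by apply: IH; rewrite // a b.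
Qed.

Lemma fin_max (I : finType) (P : I -> R -> Prop) :
  (forall i, exists p : R, forall p', p <= p' -> P i p') ->
  exists p : R, 0 <= p /\ forall i p', p <= p' -> P i p'.
Proof.
move=> H; suff [p [p0 hp]] : exists p : R, 0 <= p /\
    forall i p', i \in enum I -> p <= p' -> P i p'.
  by exists p; split=> // i p'; apply: hp; rewrite mem_enum.
elim: (enum I) => [|i s [p [p0 IH]]]; first by exists 0.
have [p1 h1] := H i; exists (Num.max p p1); split; first by rewrite le_max p0.
move=> j p'; rewrite in_cons ge_max => /orP[/eqP ->|js] /andP[a b].
  by apply: h1.
by apply: IH.
Qed.
End TaylorShift.

                             

(** * The Levelt recursion at a Fuchsian point *)

Section Levelt.
Context {R : realType} (n : nat).
Local Notation C := (Cplx R).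
Local Notation Mx := 'M[C]_n.
Variables (mu : 'I_n -> C) (A : nat -> Mx).

Definition mnorm (B : Mx) : R := \sum_i \sum_j cabs (B i j).

Lemma mnorm_ge0 (B : Mx) : 0 <= mnorm B.
Proof. by apply: sumr_ge0 => i _; apply: sumr_ge0 => j _; exact: cabs_ge0. Qed.

Lemma entry_le_mnorm (B : Mx) i j : cabs (B i j) <= mnorm B.
Proof.
rewrite /mnorm (bigD1 i)//= (bigD1 j)//= -addrA lerDl addr_ge0//.
  by apply: sumr_ge0 => k _; exact: cabs_ge0.
by apply: sumr_ge0 => k _; apply: sumr_ge0 => l _; exact: cabs_ge0.
Qed.

Lemma mnormD (B B' : Mx) : mnorm (B + B') <= mnorm B + mnorm B'.
Proof.
rewrite /mnorm -big_split; apply: ler_sum => i _; rewrite -big_split.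
by apply: ler_sum => j _; rewrite mxE cabsD.
Qed.

Lemma mnormN (B : Mx) : mnorm (- B) = mnorm B.
Proof. by apply: eq_bigr => i _; apply: eq_bigr => j _; rewrite mxE cabsN. Qed.

Lemma mnorm0 : mnorm 0 = 0.
Proof. by rewrite /mnorm big1// => i _; rewrite big1// => j _; rewrite mxE cabs0. Qed.

Lemma mnorm_sum (I : Type) (r : seq I) (P : pred I) (F : I -> Mx) :
  mnorm (\sum_(i <- r | P i) F i) <= \sum_(i <- r | P i) mnorm (F i).
Proof.
elim/big_rec2 : _ => [|i y x _ h]; first by rewrite mnorm0.
by apply: (le_trans (mnormD _ _)); rewrite lerD2l.
Qed.

Lemma mnormM (B B' : Mx) : mnorm (B *m B') <= mnorm B * mnorm B'.
Proof.
rewrite /mnorm mulr_suml; apply: ler_sum => i _.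
apply: (@le_trans _ _ (\sum_j \sum_k cabs (B i k) * cabs (B' k j))).
  apply: ler_sum => j _; rewrite mxE; apply: (le_trans (cabs_sum _ _ _)).
  by apply: ler_sum => k _; rewrite cabsM.
rewrite exchange_big /= mulr_suml; apply: ler_sum => k _.
rewrite -mulr_sumr ler_wpM2l ?cabs_ge0//.
rewrite [leRHS](bigD1 k)//= lerDl; apply: sumr_ge0 => l _.
by apply: sumr_ge0 => j _; exact: cabs_ge0.
Qed.

(** The part of the coefficient of y^m in A G - G (diag(mu) + N) that involves only earlier
    coefficients of G and N. *)
Definition lev_rhs (m : nat) (s : nat -> Mx * Mx) : Mx :=
  \sum_(i < m) A (m - i) *m (s i).1 - \sum_(i < m | (0 < i)%N) (s i).1 *m (s (m - i)%N).2.

                                                                            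
                                           
(** The homological equation (m + mu_k - mu_q) G_qk + N_qk = rhs is solved entrywise: by G off
    resonance and by N at a resonance. There the inverse of zero is zero, so that entry of G
    vanishes. *)
Definition lev_step (m : nat) (s : nat -> Mx * Mx) : Mx * Mx :=
  if m is 0 then (1%:M, 0) else
  (\matrix_(q, k) ((m%:R + mu k - mu q)^-1 * lev_rhs m s q k),
   \matrix_(q, k) (if m%:R + mu k - mu q == 0 then lev_rhs m s q k else 0)).

(** Course-of-values recursion: [lev_approx m] is the table of the coefficients of index below
    [m]. *)
Fixpoint lev_approx (m : nat) : nat -> Mx * Mx :=
  if m is m'.+1 then fun i => if i == m' then lev_step m' (lev_approx m') else lev_approx m' i
  else fun=> (0, 0).

Definition levG m := (lev_approx m.+1 m).1.
Definition levN m := (lev_approx m.+1 m).2.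

Lemma lev_approxE m i : (i < m)%N -> lev_approx m i = (levG i, levN i).
Proof.
elim: m => // m IH; rewrite ltnS leq_eqVlt => /orP[/eqP ->|im] /=.
  by rewrite eqxx /levG /levN /= eqxx -surjective_pairing.
by rewrite ltn_eqF// IH.
Qed.

Definition levX m : Mx :=
  \sum_(i < m) A (m - i) *m levG i - \sum_(i < m | (0 < i)%N) levG i *m levN (m - i).

Lemma lev_rhsE m : (0 < m)%N -> lev_rhs m (lev_approx m) = levX m.
Proof.
move=> m0; rewrite /lev_rhs /levX; congr (_ - _).
  by apply: eq_bigr => i _; rewrite lev_approxE.
apply: eq_bigr => i i0; rewrite !lev_approxE//.
by rewrite ltn_subrL i0.
Qed.

Lemma levG0 : levG 0 = 1%:M. Proof. by []. Qed.
Lemma levN0 : levN 0 = 0. Proof. by []. Qed.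

Lemma lev_approx_diag m : lev_approx m.+1 m = lev_step m (lev_approx m).
Proof. by rewrite /= eqxx. Qed.

Lemma levGE m q k : levG m.+1 q k = (m.+1%:R + mu k - mu q)^-1 * levX m.+1 q k.
Proof.
by rewrite /levG lev_approx_diag mxE lev_rhsE.
Qed.

Lemma levNE m q k : levN m.+1 q k =
  if m.+1%:R + mu k - mu q == 0 then levX m.+1 q k else 0.
Proof.
by rewrite /levN lev_approx_diag mxE lev_rhsE.
Qed.

Lemma levN_neq0 m q k : levN m q k != 0 -> (0 < m)%N /\ mu q - mu k = m%:R.
Proof.
case: m => [|m]; first by rewrite levN0 mxE eqxx.
rewrite levNE; case: ifP => [/eqP h _|_]; last by rewrite eqxx.
split=> //; have -> : mu q - mu k = m.+1%:R - (m.+1%:R + mu k - mu q) by ring.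
by rewrite h subr0.
Qed.

Hypothesis A0 : A 0 = diag_mx (\row_j mu j).

(** The coefficient of y^m in y G' = A G - G (diag(mu) + N(y)). This identity is what the recursion
    was designed for. *)
Lemma lev_rec m : m%:R *: levG m = \sum_(i < m.+1) A (m - i) *m levG i -
  levG m *m diag_mx (\row_j mu j) - \sum_(i < m.+1) levG i *m levN (m - i).
Proof.
case: m => [|m].
  by rewrite scale0r !big_ord1 subn0 A0 levG0 levN0 mulmx0 mulmx1 mul1mx subrr subr0.
rewrite big_ord_recr /= [X in _ - X]big_ord_recr /= subnn levN0 mulmx0 addr0 A0.
have -> : \sum_(i < m.+1) levG i *m levN (m.+1 - i) =
    levN m.+1 + \sum_(i < m.+1 | (0 < i)%N) levG i *m levN (m.+1 - i).
  rewrite (bigD1 ord0)//= levG0 mul1mx subn0; congr (_ + _).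
  by apply: eq_bigl => i; rewrite lt0n.
have e1 : levX m.+1 = m.+1%:R *: levG m.+1 + levG m.+1 *m diag_mx (\row_j mu j)
    - diag_mx (\row_j mu j) *m levG m.+1 + levN m.+1.
  apply/matrixP => q k; rewrite mul_mx_diag mul_diag_mx ![in RHS]mxE levGE levNE.
  have -> x : m.+1%:R * x + x * mu k - mu q * x = (m.+1%:R + mu k - mu q) * x by ring.
  case: ifP => [/eqP h|/negbT h]; first by rewrite h mul0r add0r.
  by rewrite mulVKf ?addr0.
have -> : \sum_(i < m.+1) A (m.+1 - i) *m levG i =
    levX m.+1 + \sum_(i < m.+1 | (0 < i)%N) levG i *m levN (m.+1 - i).
  by rewrite /levX subrK.
rewrite e1; set x := \sum_(i < _ | _) _; set y := _ *m levG _; set z := _ *: _.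
set u := _ *m _; set v := levN _.
by move: x y z u v => x y z u v; apply/matrixP => q k; rewrite !mxE; ring.
Qed.

(** A nonzero entry of N_m forces m to equal one of the finitely many differences mu_q - mu_k, so N
    is a polynomial. *)
Lemma levN_bound (p : R) : 0 < p -> exists M : R, 0 <= M /\ forall m, mnorm (levN m) * p ^+ m <= M.
Proof.
move=> p0.
have [m0 hm0] : exists m0 : nat, forall m, (m0 <= m)%N -> levN m = 0.
  have h (x : 'I_n * 'I_n) : exists r : R, forall p', r <= p' ->
      forall m : nat, p' < m%:R -> levN m x.1 x.2 = 0.
    exists (cabs (mu x.1 - mu x.2)) => p' hp m hm; apply/eqP; apply/negP => /negP.
    move=> /levN_neq0[_ h]; move: hm; rewrite -(cabs_nat m) -h; lra.
  have [r [r0 hr]] := fin_max h.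
  exists (Num.truncn r).+1 => m hm; apply/matrixP => q k; rewrite mxE.
  apply: (hr (q, k) r) => //.
  by apply: lt_le_trans (_ : (Num.truncn r).+1%:R <= _); rewrite ?ler_nat// truncnS_gt.
exists (\sum_(m < m0) mnorm (levN m) * p ^+ m); split.
  by apply: sumr_ge0 => i _; rewrite mulr_ge0 ?mnorm_ge0// exprn_ge0// ltW.
move=> m; have [h|h] := leqP m0 m.
  rewrite hm0// mnorm0 mul0r; apply: sumr_ge0 => i _.
  by rewrite mulr_ge0 ?mnorm_ge0// exprn_ge0// ltW.
rewrite (bigD1 (Ordinal h))//= lerDl; apply: sumr_ge0 => i _.
by rewrite mulr_ge0 ?mnorm_ge0// exprn_ge0// ltW.
Qed.

(** There are no small divisors: the denominator has modulus at least 1 once m exceeds |mu_q - mu_k|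
    + 1, and finitely many m remain. *)
Lemma lev_div_bound : exists D : R, 0 <= D /\
  forall (m : nat) q k, cabs ((m%:R + mu k - mu q)^-1) <= D.
Proof.
have h (x : 'I_n * 'I_n) : exists D : R, forall D', D <= D' ->
    forall m : nat, cabs ((m%:R + mu x.1 - mu x.2)^-1) <= D'.
  set c := cabs (mu x.1 - mu x.2).
  pose m0 := (Num.truncn (c + 1)).+1.
  exists (1 + \sum_(m < m0) cabs ((m%:R + mu x.1 - mu x.2)^-1)) => D' hD m.
  apply: le_trans hD; have [hm|hm] := leqP m0 m.
    apply: (@le_trans _ _ 1); last first.
      by rewrite lerDl; apply: sumr_ge0 => i _; exact: cabs_ge0.
    have y1 : 1 <= cabs (m%:R + mu x.1 - mu x.2).
      have : m%:R <= cabs (m%:R + (mu x.1 - mu x.2)) + c.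
        rewrite -[leLHS](cabs_nat m) -[X in cabs X <= _](addrK (mu x.1 - mu x.2)).
        by apply: (le_trans (cabsD _ _)); rewrite cabsN.
      have : c + 1 < m%:R.
        by apply: lt_le_trans (_ : m0%:R <= _); rewrite ?ler_nat// truncnS_gt.
      rewrite addrA; lra.
    by rewrite cabsV invf_le1// (lt_le_trans ltr01).
  rewrite (bigD1 (Ordinal hm))//= addrCA lerDl addr_ge0//.
  by apply: sumr_ge0 => i _; exact: cabs_ge0.
have [D [D0 hD]] := fin_max h.
by exists D; split=> // m q k; exact: (hD (k, q) D).
Qed.
End Levelt.

(** * Convergence of the Levelt reduction *)

Section LeveltForm.
Context {R : realType} (n : nat).
Local Notation C := (Cplx R).
Local Notation Mx := 'M[C]_n.

Lemma levX_bound (mu : 'I_n -> C) (A : nat -> Mx) (p M : R) m : 0 < p ->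
  (forall m, (mnorm (A m) + mnorm (levN mu A m)) * p ^+ m <= M) ->
  mnorm (levX mu A m) * p ^+ m <= M * \sum_(i < m) mnorm (levG mu A i) * p ^+ i.
Proof.
move=> p0 hM; have pX k : 0 <= p ^+ k by rewrite exprn_ge0// ltW.
apply: (@le_trans _ _ ((\sum_(i < m) (mnorm (A (m - i)%N) + mnorm (levN mu A (m - i)%N)) *
    mnorm (levG mu A i)) * p ^+ m)).
  rewrite ler_wpM2r//; apply: (le_trans (mnormD _ _)); rewrite mnormN.
  under [leRHS]eq_bigr do rewrite mulrDl.
  rewrite big_split /=; apply: lerD.
    by apply: (le_trans (mnorm_sum _ _ _)); apply: ler_sum => i _; exact: mnormM.
  apply: (le_trans (mnorm_sum _ _ _)); rewrite big_mkcond; apply: ler_sum => i _.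
  case: ifP => _; last by rewrite mulr_ge0 ?mnorm_ge0.
  by rewrite mulrC mnormM.
rewrite mulr_suml mulr_sumr; apply: ler_sum => i _.
have -> : p ^+ m = p ^+ (m - i)%N * p ^+ i by rewrite -exprD subnK// ltnW.
by rewrite mulrACA ler_wpM2r ?hM ?mulr_ge0 ?mnorm_ge0.
Qed.

(** The weighted norms satisfy g_{m+1} <= K (g_0 + ... + g_m); a discrete Gronwall argument gives
    g_m <= g_0 (1 + K)^m, hence convergence with radius p / (1 + K). *)
Lemma levG_geo (mu : 'I_n -> C) (A : nat -> Mx) (p M : R) : 0 < p ->
  (forall m, mnorm (A m) * p ^+ m <= M) ->
  exists p' M' : R, 0 < p' <= p /\ forall i j, geo (fun m => levG mu A m i j) p' M'.
Proof.
move=> p0 hA; have [M2 [M20 hN]] := levN_bound mu A p0.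
have [D [D0 hD]] := lev_div_bound mu.
have pX k : 0 <= p ^+ k by rewrite exprn_ge0// ltW.
have M0 : 0 <= M by apply: le_trans (hA 0%N); rewrite mulr_ge0// mnorm_ge0.
pose K := D * (M + M2).
have K0 : 0 <= K by rewrite mulr_ge0// addr_ge0.
pose g m := mnorm (levG mu A m) * p ^+ m.
have g0 m : 0 <= g m by rewrite mulr_ge0// mnorm_ge0.
have gS m : g m.+1 <= K * \sum_(i < m.+1) g i.
  have h1 : mnorm (levG mu A m.+1) <= D * mnorm (levX mu A m.+1).
    rewrite /mnorm mulr_sumr; apply: ler_sum => q _; rewrite mulr_sumr.
    by apply: ler_sum => k _; rewrite levGE cabsM ler_wpM2r ?cabs_ge0 ?hD.
  apply: (le_trans (ler_wpM2r (pX _) h1)); rewrite -!mulrA ler_wpM2l//.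
  apply: levX_bound => // k; rewrite mulrDl; exact: lerD.
have gB m : g m <= g 0%N * (1 + K) ^+ m.
  have : forall k, (k <= m)%N -> g k <= g 0%N * (1 + K) ^+ k.
    elim: m => [|m IH] k; first by rewrite leqn0 => /eqP ->; rewrite expr0 mulr1.
    rewrite leq_eqVlt => /orP[/eqP ->|]; last exact: IH.
    apply: (le_trans (gS m)).
    have -> : (1 + K) ^+ m.+1 = 1 + K * \sum_(i < m.+1) (1 + K) ^+ i.
      by have := subrX1 (1 + K) m.+1; rewrite [1 + K - 1]addrAC subrr add0r => <-; ring.
    set S := \sum_(i < _) (1 + K) ^+ i.
    have h : \sum_(i < m.+1) g i <= g 0%N * S.
      by rewrite mulr_sumr; apply: ler_sum => i _; apply: IH; rewrite -ltnS.
    have := ler_wpM2l K0 h; have := g0 0%N; lra.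
  by apply.
have K1 : 0 < 1 + K by lra.
exists (p / (1 + K)), (g 0%N); split.
  by rewrite divr_gt0//= ler_pdivrMr//; nra.
move=> i j; split=> [|m]; first by rewrite divr_gt0.
rewrite expr_div_n mulrA ler_pdivrMr ?exprn_gt0//; apply: le_trans (gB m).
by rewrite ler_wpM2r// entry_le_mnorm.
Qed.

Lemma psum_sum (I : Type) (r : seq I) (P : pred I) (a : I -> nat -> C) z N :
  psum (fun m => \sum_(i <- r | P i) a i m) z N = \sum_(i <- r | P i) psum (a i) z N.
Proof. by rewrite /psum exchange_big /=; apply: eq_bigr => k _; rewrite mulr_suml. Qed.

Lemma psum_shift (a : nat -> C) z N :
  psum (fun m => m%:R * a m) z N.+1 = z * psum (dcoef a) z N.
Proof.
rewrite /psum big_ord_recl /= !mul0r add0r mulr_sumr; apply: eq_bigr => i _.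
by rewrite /dcoef /bump add1n exprS; ring.
Qed.

Lemma ccvg_shift (u : nat -> C) l : ccvg (fun N => u N.+1) l -> ccvg u l.
Proof. by move=> h e /h [N hN]; exists N.+1 => -[//|k]; exact: hN. Qed.

Lemma ccvg_ext (u v : nat -> C) l : (forall N, u N = v N) -> ccvg u l -> ccvg v l.
Proof. by move=> h hu e /hu [N hN]; exists N => k; rewrite -h; exact: hN. Qed.

Lemma pser_single (a : nat -> C) z m0 : (forall m, a m != 0 -> m = m0) ->
  ccvg (psum a z) (a m0 * z ^+ m0).
Proof.
move=> h e e0; exists m0.+1 => N hN.
rewrite /psum (bigD1 (Ordinal hN))//= big1 ?addr0 ?subrr ?cabs0// => i.
have [-> |/h im] := eqVneq (a i) 0; first by rewrite mul0r.
by rewrite -val_eqE /= im eqxx.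
Qed.

Lemma unitmx_near1 (G : C -> Mx) (G' : Mx) : mder G 0 G' -> G 0 = 1%:M ->
  exists2 d : R, 0 < d & forall y, cabs y < d -> G y \in unitmx.
Proof.
move=> hG G1; have [l hl] := derivable_det hG.
have [d d0 hd] := derive_cont hl ltr01; exists d => // y hy.
have := hd y; rewrite subr0 G1 det1 => /(_ hy) h.
rewrite unitmxE unitfE; apply/eqP => h0; move: h.
by rewrite h0 sub0r cabsN cabs1 ltxx.
Qed.

(** The reduced term N(y): each entry is a single monomial, its exponent being the integer mu_q -
    mu_k. The constant matrix [Nh] is its value at y = 1. *)
Definition resmx (Nh : Mx) (mm : 'I_n -> 'I_n -> nat) (y : C) : Mx :=
  \matrix_(q, k) (Nh q k * y ^+ mm q k).

                                                                                  
                                                         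
(** Levelt's theorem: the formal solution of the recursion converges, and both sides of the
    differential equation are the sums of the series compared coefficientwise by [lev_rec]. *)
Lemma levelt (mu : 'I_n -> C) (A : nat -> Mx) (p M : R) (Af : C -> Mx) :
  A 0%N = diag_mx (\row_j mu j) ->
  (forall i j, geo (fun m => A m i j) p M) ->
  (0 < p) ->
  (forall y, cabs y < p -> forall i j, ccvg (psum (fun m => A m i j) y) (Af y i j)) ->
  exists (d : R) (G G' : C -> Mx) (Nh : Mx) (mm : 'I_n -> 'I_n -> nat),
  [/\ 0 < d <= p, G 0 = 1%:M,
      (forall y, cabs y < d -> mder G y (G' y) /\ G y \in unitmx),
      (forall q k, Nh q k != 0 -> (0 < mm q k)%N /\ mu q - mu k = (mm q k)%:R) &
      (forall y, cabs y < d ->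
         y *: G' y = Af y *m G y - G y *m (diag_mx (\row_j mu j) + resmx Nh mm y))].
Proof.
move=> hA0 hA p0 hAf.
have pX k : 0 <= p ^+ k by rewrite exprn_ge0// ltW.
have hAn m : mnorm (A m) * p ^+ m <= \sum_(i < n) \sum_(j < n) M.
  rewrite /mnorm mulr_suml; apply: ler_sum => i _; rewrite mulr_suml.
  by apply: ler_sum => j _; exact: (hA i j).2.
have [p' [M' [/andP[p'0 p'p] hG]]] := levG_geo mu p0 hAn.
have [M2 [M20 hN]] := levN_bound mu A p'0.
have gN i j : geo (fun m => levN mu A m i j) p' M2.
  split=> // m; apply: le_trans (hN m).
  by rewrite ler_wpM2r ?entry_le_mnorm// exprn_ge0// ltW.
have gA i j : geo (fun m => A m i j) p' M by apply: geo_weak (hA i j) _; rewrite p'0.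
pose G y : Mx := \matrix_(i, j) pser (fun m => levG mu A m i j) y.
pose G' y : Mx := \matrix_(i, j) pser (dcoef (fun m => levG mu A m i j)) y.
have G1 : G 0 = 1%:M.
  by apply/matrixP => i j; rewrite mxE pser0 levG0.
have dG y : cabs y < p' / 8 -> mder G y (G' y).
  move=> hy i j; under eq_fun do rewrite mxE.
  by rewrite mxE; exact: pser_derive (hG i j) hy.
have [|d1 d10 hd1] := unitmx_near1 (dG 0 _) G1; first by rewrite cabs0 divr_gt0.
(* An entry of N is nonzero for at most one m, since m is determined by mu_q - mu_k. *)
have [mm hmm] : exists mm : 'I_n -> 'I_n -> nat, forall q k m,
    levN mu A m q k != 0 -> m = mm q k.
  have h (x : 'I_n * 'I_n) : exists m0 : nat, forall m, levN mu A m x.1 x.2 != 0 -> m = m0.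
    have [[m0 h0]|h0] := pselect (exists m, levN mu A m x.1 x.2 != 0).
      exists m0 => m /levN_neq0[_ h1]; move: h0 => /levN_neq0[_]; rewrite h1.
      by move/eqP; rewrite eqr_nat => /eqP.
    by exists 0%N => m hm; case: h0; exists m.
  have [f hf] := choice h; exists (fun q k => f (q, k)) => q k; exact: (hf (q, k)).
exists (Num.min d1 (p' / 8)), G, G', (\matrix_(q, k) levN mu A (mm q k) q k), mm; split.
- rewrite lt_min d10 divr_gt0//= ge_min; apply/orP; right.
  by apply: le_trans p'p; lra.
- exact: G1.
- by move=> y; rewrite lt_min => /andP[h1 h2]; split; [exact: dG|exact: hd1].
- by move=> q k; rewrite mxE => /levN_neq0.
move=> y; rewrite lt_min => /andP[_ hy]; apply/matrixP => q k.
have hy2 : cabs y < p' / 2 by lra.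
have hy1 : cabs y < p' by lra.
have c1 : ccvg (psum (fun m => m%:R * levG mu A m q k) y) (y * G' y q k).
  apply: ccvg_shift; apply: (ccvg_ext (fun N => esym (psum_shift _ _ _))).
  apply: ccvgM; first exact: ccvg_cst.
  by rewrite mxE; apply: (pserP (geo_dcoef (hG q k))).
have c2 : ccvg (fun N => \sum_j psum (conv (fun m => levG mu A m j k) (fun m => A m q j)) y N)
    ((Af y *m G y) q k).
  rewrite mxE; apply: ccvg_sum => j.
  have <- : pser (fun m => A m q j) y = Af y q j.
    by apply: pserE; apply: hAf; lra.
  rewrite mxE mulrC -(pser_conv (hG j k) (gA q j) hy2).
  exact: pserP (geo_conv (hG j k) (gA q j)) hy2.
have c3 : ccvg (fun N => psum (fun m => levG mu A m q k) y N * mu k)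
    ((G y *m diag_mx (\row_j mu j)) q k).
  rewrite mul_mx_diag !mxE; apply: ccvgM (ccvg_cst _).
  exact: pserP (hG q k) hy1.
have c4 : ccvg (fun N => \sum_j psum (conv (fun m => levG mu A m q j) (fun m => levN mu A m j k)) y N)
    ((G y *m resmx (\matrix_(q, k) levN mu A (mm q k) q k) mm y) q k).
  rewrite mxE; apply: ccvg_sum => j; rewrite !mxE.
  rewrite -(pserE (pser_single y (@hmm j k))).
  rewrite -(pser_conv (hG q j) (gN j k) hy2).
  exact: pserP (geo_conv (hG q j) (gN j k)) hy2.
have sub3E (X Y Z : Mx) : (X - Y - Z) q k = X q k + -1 * Y q k + -1 * Z q k.
  by rewrite !mxE !mulN1r.
rewrite mulmxDr opprD addrA sub3E [LHS]mxE; apply: (ccvg_unique c1).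
apply: ccvg_ext (ccvgD (ccvgD c2 (ccvgM (ccvg_cst (- 1)) c3)) (ccvgM (ccvg_cst (- 1)) c4)) => N.
rewrite !mulN1r -!psum_sum /psum mulr_suml -!sumrN -!big_split /=; apply: eq_bigr => m _.
have /matrixP /(_ q k) := lev_rec hA0 m.
rewrite mul_mx_diag !mxE => ->; rewrite !summxE !mulrBl; congr (_ - _ - _).
- rewrite exchange_big /= !mulr_suml; apply: eq_bigr => i _; rewrite mxE mulr_suml /=.
  by rewrite mulr_suml; apply: eq_bigr => j _; rewrite [A _ _ _ * _]mulrC.
- by ring.
- rewrite exchange_big /= !mulr_suml; apply: eq_bigr => i _; rewrite mxE.
  by rewrite !mulr_suml.
Qed.
End LeveltForm.

(** * Exponentials of the diagonal and of the nilpotent part *)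

Section ExpMatrices.
Context {R : realType} (n : nat).
Local Notation C := (Cplx R).
Local Notation Mx := 'M[C]_n.
Variables (mu : 'I_n -> C) (Nh : Mx) (mm : 'I_n -> 'I_n -> nat) (pos : 'I_n -> nat).

Definition eU (u : C) : Mx := diag_mx (\row_j cexp (mu j * u)).

Lemma eU_0 : eU 0 = 1%:M.
Proof. by apply/matrixP => i j; rewrite !mxE mulr0 cexp0. Qed.

Lemma eUD u c : eU (u + c) = eU u *m eU c.
Proof.
rewrite /eU mulmx_diag; congr diag_mx; apply/rowP => j; rewrite !mxE.
by rewrite mulrDr cexpD.
Qed.

Lemma eU_unit u : eU u \in unitmx.
Proof.
have h : eU u *m eU (- u) = 1%:M by rewrite -eUD subrr eU_0.
exact: (mulmx1_unit h).1.
Qed.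

Lemma mder_eU u : mder eU u (diag_mx (\row_j mu j) *m eU u).
Proof.
move=> i j; rewrite mul_diag_mx !mxE.
have [<-|ij] := eqVneq i j; last first.
  rewrite mulr0n mulr0; under eq_fun do rewrite !mxE (negPf ij) mulr0n.
  exact: is_derive_const.
under eq_fun do rewrite !mxE eqxx mulr1n; rewrite mulr1n mulrC.
have h1 := is_derive_mul (is_derive_const (mu i) u) (is_derive_var u).
apply: is_derive_eq (is_derive_compC h1 (is_derive_cexp (mu i * u))) _.
by rewrite mul0r add0r mulr1.
Qed.

Definition Npow (p : nat) : Mx := iter p (mulmx Nh) 1%:M.

Lemma NpowS p : Npow p.+1 = Nh *m Npow p. Proof. by []. Qed.

Lemma NpowSr p : Npow p.+1 = Npow p *m Nh.
Proof.
elim: p => [|p IH]; first by rewrite /= mulmx1 mul1mx.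
by rewrite NpowS {1}IH NpowS mulmxA.
Qed.

(** The exponential of u N, a finite sum because the n-th power of N vanishes ([Npow_n]). *)
Definition eN (u : C) : Mx := \sum_(p < n) (u ^+ p / (p`!)%:R) *: Npow p.

Lemma eNE u : eN u = \sum_(p < n) (u ^+ p / (p`!)%:R) *: Npow p. Proof. by []. Qed.

Hypothesis pos_lt : forall i, (pos i < n)%N.
Hypothesis pos_inj : injective pos.
Hypothesis hNh : forall q k, Nh q k != 0 -> (0 < mm q k)%N /\ mu q - mu k = (mm q k)%:R.
Hypothesis res_pos : forall q k (m : nat), (0 < m)%N -> mu q - mu k = m%:R -> (pos q < pos k)%N.

(** Every factor of N raises the rank [pos] by at least one and changes the exponent by a positive
    integer. *)
Lemma Npow_neq0 p q k : Npow p q k != 0 ->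
  (pos q + p <= pos k)%N /\ exists m : nat, mu q - mu k = m%:R.
Proof.
elim: p q => [|p IH] q.
  rewrite mxE; have [-> _|_] := eqVneq q k; last by rewrite eqxx.
  by rewrite addn0; split=> //; exists 0%N; rewrite subrr.
rewrite NpowS mxE => h.
have [j hj] : exists j, Nh q j * Npow p j k != 0.
  apply/existsP; apply: contraNT h; rewrite negb_exists => /forallP h.
  by rewrite big1// => j _; apply/eqP; have := h j; rewrite negbK.
move: hj; rewrite mulf_eq0 negb_or => /andP[/hNh[m0 hm] /IH[h1 [m' hm']]].
have := res_pos m0 hm; split; first by lia.
by exists (mm q j + m')%N; rewrite natrD -hm -hm'; ring.
Qed.

Lemma Npow_n : Npow n = 0.
Proof.
apply/matrixP => q k; rewrite [RHS]mxE; apply/eqP; apply/negP => /negP /Npow_neq0[h _].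
by have := pos_lt k; lia.
Qed.

Lemma eN_0 : eN 0 = 1%:M.
Proof.
have [n0|n0] := posnP n.
  by apply/matrixP => i; have := ltn_ord i; move: (nat_of_ord i); lia.
rewrite /eN (bigD1 (Ordinal n0))//= expr0 divr1 scale1r big1 ?addr0// => i i0.
have -> : 0 ^+ i = 0 :> C by rewrite expr0n (negbTE (i0 : (i : nat) != 0%N)).
by rewrite mul0r scale0r.
Qed.

Lemma mder_eN u : mder eN u (Nh *m eN u).
Proof.
move=> i j.
have -> : (Nh *m eN u) i j =
    \sum_(p < n) (p%:R * u ^+ p.-1 / (p`!)%:R) * Npow p i j.
  rewrite /eN mulmx_sumr summxE.
  pose F p := (p%:R * u ^+ p.-1 / (p`!)%:R) * Npow p i j.
  have h : \sum_(p < n.+1) F p = \sum_(p < n) F p.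
    by rewrite big_ord_recr /= /F Npow_n mxE mulr0 addr0.
  rewrite -[RHS]h big_ord_recl /F /= !mul0r add0r.
  apply: eq_bigr => p _; rewrite -scalemxAr mxE /bump /= add1n; congr (_ * _).
  by rewrite factS natrM invfM mulrACA divff ?mul1r// pnatr_eq0.
under eq_fun do rewrite summxE.
apply: is_derive_bigsum => p; under eq_fun do rewrite mxE.
have h1 := is_derive_mul (is_derive_pow u p) (is_derive_const (p`!%:R^-1) u).
have h2 := is_derive_mul h1 (is_derive_const (Npow p i j) u).
by apply: is_derive_eq h2 _; rewrite !mulr0 !addr0.
Qed.

Lemma eN_comm u : Nh *m eN u = eN u *m Nh.
Proof.
rewrite /eN mulmx_sumr mulmx_suml; apply: eq_bigr => p _.
by rewrite -scalemxAr -scalemxAl -NpowS NpowSr.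
Qed.

(** The left side has zero derivative in u and equals [eN c] at u = 0; the group law of [eN]
    follows. *)
Lemma eN_addN c u : eN (- u) *m eN (u + c) = eN c.
Proof.
have H (z : C) : mder (fun x => eN (- x) *m eN (x + c)) z 0.
  have h1 : mder (fun x => eN (- x)) z ((- 1) *: (Nh *m eN (- z))).
    exact: (@mder_comp _ _ _ eN (fun x => - x) z _ _ (is_derive_opp (is_derive_var z)) (mder_eN (- z))).
  have h2 : mder (fun x => eN (x + c)) z ((1 + 0) *: (Nh *m eN (z + c))).
    exact: (@mder_comp _ _ _ eN (fun x => x + c) z _ _
      (is_derive_add (is_derive_var z) (is_derive_const c z)) (mder_eN (z + c))).
  apply: mder_eq (mder_mul h1 h2) _.
  by rewrite addr0 scale1r scaleN1r eN_comm mulNmx mulmxA addNr.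
have := @mder_cst_segment _ _ _ (fun x => eN (- x) *m eN (x + c)) 0 u (fun s _ => H _).
by rewrite oppr0 eN_0 mul1mx add0r.
Qed.

Lemma eN_inv u : eN (- u) *m eN u = 1%:M.
Proof. by have := eN_addN 0 u; rewrite addr0 eN_0. Qed.

Lemma eN_unit u : eN u \in unitmx.
Proof. exact: (mulmx1_unit (eN_inv u)).2. Qed.

Lemma eND u c : eN (u + c) = eN u *m eN c.
Proof.
by rewrite -(eN_addN c u) mulmxA -{2}(opprK u) eN_inv mul1mx.
Qed.

Lemma eN_tri u q k : (pos k < pos q)%N -> eN u q k = 0.
Proof.
move=> h; rewrite /eN summxE big1// => p _; rewrite mxE.
have [->|/Npow_neq0[h1 _]] := eqVneq (Npow p q k) 0; first by rewrite mulr0.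
by lia.
Qed.

Lemma eN_diag u q : eN u q q = 1.
Proof.
have : (0 < n)%N := leq_ltn_trans (leq0n _) (pos_lt q).
rewrite /eN summxE => n0; rewrite (bigD1 (Ordinal n0))//= big1 ?addr0.
  by rewrite !mxE eqxx expr0 divr1 mulr1.
move=> p p0; rewrite mxE; have [->|/Npow_neq0[h1 _]] := eqVneq (Npow p q q) 0.
  by rewrite mulr0.
by case/eqP: p0; apply: val_inj => /=; lia.
Qed.

(** Conjugation by e^{diag(mu) u} multiplies the entry (q, k) by e^{(mu_q - mu_k) u} = (e^u)^m. The
    constant N thus becomes N(y), and the reduced system is solved by e^{diag(mu) u} e^{N u}. *)
Lemma eU_Nh u : eU u *m Nh = resmx Nh mm (cexp u) *m eU u.
Proof.
apply/matrixP => q k; rewrite mul_diag_mx mul_mx_diag !mxE.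
have [->|/hNh[_ h]] := eqVneq (Nh q k) 0; first by rewrite mulr0 !mul0r.
have -> : mu q = mu k + (mm q k)%:R by rewrite -h; ring.
by rewrite mulrDl cexpD mulr_natl cexpMn; ring.
Qed.

Lemma cexp_nat_period (k : int) (m : nat) :
  cexp (m%:R * (k%:~R * (rc (2 * pi) * 'i))) = 1 :> C.
Proof. by rewrite mulr_natl cexpMn cexp_2pi_int expr1n. Qed.

(** N only links exponents that differ by integers, on which e^{mu c} takes equal values. *)
Lemma eU_comm (k : int) : let c := k%:~R * (rc (2 * pi) * 'i) in
  eU c *m Nh = Nh *m eU c.
Proof.
move=> c; apply/matrixP => q j; rewrite mul_diag_mx mul_mx_diag !mxE.
have [->|/hNh[_ h]] := eqVneq (Nh q j) 0; first by rewrite mulr0 !mul0r.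
have -> : mu q = mu j + (mm q j)%:R by rewrite -h; ring.
by rewrite mulrDl cexpD cexp_nat_period mulr1 mulrC.
Qed.

Lemma Npow_comm (A : Mx) p : A *m Nh = Nh *m A -> A *m Npow p = Npow p *m A.
Proof.
move=> h; elim: p => [|p IH]; first by rewrite mulmx1 mul1mx.
by rewrite NpowS mulmxA h -mulmxA IH mulmxA.
Qed.

Lemma eN_commute (A : Mx) u : A *m Nh = Nh *m A -> A *m eN u = eN u *m A.
Proof.
move=> h; rewrite /eN mulmx_sumr mulmx_suml; apply: eq_bigr => p _.
by rewrite -scalemxAr -scalemxAl Npow_comm.
Qed.

(** Take the least p with N^p v = 0. If p were at least 2, applying N^{p-2} to e^{cN} v = v would
    leave c N^{p-1} v = 0, against minimality. *)
Lemma Npow_fix m (c : C) (v : 'M[C]_(n, m)) : c != 0 -> eN c *m v = v -> Nh *m v = 0.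
Proof.
move=> c0 hv; apply/eqP; apply/negP => /negP hN0.
have H : exists p, Npow p *m v == 0 by exists n; rewrite Npow_n mul0mx.
pose p := ex_minn H.
have [hp hmin] : Npow p *m v = 0 /\ forall k, (k < p)%N -> Npow k *m v != 0.
  rewrite /p; case: ex_minnP => p' /eqP h1 h2; split=> // k kp.
  by apply/negP => /h2; lia.
have p2 : (1 < p)%N.
  case: (p) hp => [|[|//]] hp0; last by move: hN0; rewrite -[Nh]mulmx1 -[Nh *m _]/(Npow 1) hp0 eqxx.
  by move: hN0; rewrite -[v]mul1mx -[1%:M]/(Npow 0) hp0 mulmx0 eqxx.
have pn : (p <= n)%N.
  have /eqP h : Npow n *m v = 0 by rewrite Npow_n mul0mx.
  by rewrite /p; case: ex_minnP => p' _; exact.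
have Nadd a b : Npow a *m Npow b = Npow (a + b).
  elim: a => [|a IH]; first by rewrite mul1mx.
  by rewrite NpowS -mulmxA IH.
have Nz k : (p <= k)%N -> Npow k *m v = 0.
  by move=> h; rewrite -(subnK h) -Nadd -mulmxA hp mulmx0.
have n0 : (0 < n)%N by lia.
have n1 : (1 < n)%N by lia.
have hsum : Npow p.-2 *m (eN c *m v) = Npow p.-2 *m v + c *: (Npow p.-1 *m v).
  rewrite /eN mulmx_suml mulmx_sumr.
  under eq_bigr do rewrite -scalemxAl -scalemxAr mulmxA Nadd.
  rewrite (bigD1 (Ordinal n0))//= (bigD1 (Ordinal n1))//=.
  rewrite [X in _ + (_ + X) = _](_ : _ = 0); last first.
    apply: big1 => i /andP[i0 i1]; rewrite Nz ?scaler0//.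
    have i0' : (i != 0 :> nat) by [].
    have i1' : (i != 1 :> nat) by [].
    by lia.
  have e0 : c ^+ 0 / (0`!)%:R = 1 by rewrite expr0 divr1.
  have e1 : c ^+ 1 / (1`!)%:R = c by rewrite expr1 divr1.
  have e2 : (p.-2 + 1)%N = p.-1 by lia.
  by rewrite e0 e1 e2 scale1r addr0 addn0.
move: hsum; rewrite hv => /eqP; rewrite -subr_eq0 opprD addNKr oppr_eq0.
rewrite scalemx_eq0 (negPf c0) /=; apply/negP; apply: hmin; lia.
Qed.
End ExpMatrices.

(** * Triangular matrices with respect to a ranking of the indices *)

Section Triangular.
Variables (n : nat) (F : comUnitRingType) (pos : 'I_n -> nat).
Implicit Types A B : 'M[F]_n.
Hypothesis pos_inj : injective pos.

(** One predicate for both cases: upper triangular for the natural order of indices, lower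
    triangular for the reversed one. *)
Definition utri A := forall q k, (pos k < pos q)%N -> A q k = 0.

Lemma utri_mul A B : utri A -> utri B -> utri (A *m B).
Proof.
move=> hA hB q k h; rewrite mxE big1// => i _.
have [qi|iq] := ltnP (pos i) (pos q); first by rewrite hA ?mul0r.
by rewrite hB ?mulr0//; lia.
Qed.

Lemma utri_mul_diag A B i : utri A -> utri B -> (A *m B) i i = A i i * B i i.
Proof.
move=> hA hB; rewrite mxE (bigD1 i)//= big1 ?addr0// => j ji.
have [qi|iq] := ltnP (pos j) (pos i); first by rewrite hA ?mul0r.
rewrite hB ?mulr0// ltn_neqAle iq andbT.
by apply: contra ji => /eqP /pos_inj ->.
Qed.

Lemma utri_diag (d : 'rV[F]_n) : utri (diag_mx d).
Proof. by move=> q k h; rewrite mxE; case: eqP h => [->|]; rewrite ?ltnn// mulr0n. Qed.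

Lemma pos_ind_down (P : 'I_n -> Prop) : 
  (forall q, (forall i, (pos q < pos i)%N -> P i) -> P q) -> forall q, P q.
Proof.
move=> H; pose b := (\max_i pos i)%N.
have hb i : (pos i <= b)%N by exact: (leq_bigmax i).
suff : forall m q, (b - pos q < m)%N -> P q by move=> h q; apply: (h (b - pos q).+1).
elim=> // m IH q hq; apply: H => i hi; apply: IH; have := hb i; lia.
Qed.

(** In row q of A A^{-1} = 1, lower ranks vanish by triangularity of A and higher ones by downward
    induction, so only the invertible diagonal entry remains. *)
Lemma utri_inv A : A \in unitmx -> utri A -> (forall i, A i i \is a GRing.unit) ->
  utri (invmx A).
Proof.
move=> uA hA hd q k; elim/pos_ind_down: q => q IH h.
have : (A *m invmx A) q k = 0.
  by rewrite mulmxV// mxE; case: eqP h => // ->; rewrite ltnn.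
rewrite mxE (bigD1 q)//= big1 ?addr0.
  by move/(congr1 (fun x => (A q q)^-1 * x)); rewrite mulKr// mulr0.
move=> j jq; have [h1|h1] := ltnP (pos j) (pos q); first by rewrite hA ?mul0r.
have h2 : (pos q < pos j)%N.
  by rewrite ltn_neqAle h1 andbT; apply: contra jq => /eqP /pos_inj ->.
by rewrite IH ?mulr0// (ltn_trans h h2).
Qed.
End Triangular.

(** * Eigenvectors of the Levelt monodromy *)

Section EigenTriangular.
Context {R : realType} (n : nat).
Local Notation C := (Cplx R).
Local Notation Mx := 'M[C]_n.
Variables (mu : 'I_n -> C) (Nh : Mx) (mm : 'I_n -> 'I_n -> nat) (pos : 'I_n -> nat).
Hypothesis pos_lt : forall i, (pos i < n)%N.
Hypothesis pos_inj : injective pos.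
Hypothesis mu_inj : injective mu.
Hypothesis hNh : forall q k, Nh q k != 0 -> (0 < mm q k)%N /\ mu q - mu k = (mm q k)%:R.
Hypothesis res_pos : forall q k (m : nat), (0 < m)%N -> mu q - mu k = m%:R -> (pos q < pos k)%N.

Local Notation eN := (eN Nh).
Local Notation eU := (eU mu).

Lemma eN_mul_last u m (v : 'M[C]_(n, m)) q j :
  (forall i, (pos q < pos i)%N -> v i j = 0) -> (eN u *m v) q j = v q j.
Proof.
move=> h; rewrite mxE (bigD1 q)//= big1 ?addr0.
  by rewrite (eN_diag pos_lt hNh res_pos) mul1r.
move=> i iq; have [h1|h1] := ltnP (pos q) (pos i); first by rewrite h ?mulr0.
rewrite (eN_tri hNh res_pos) ?mul0r// ltn_neqAle h1 andbT.
by apply: contra iq => /eqP /pos_inj ->.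
Qed.

                                                                                  
(** Recovers the coefficients of a solution from its growth. By downward induction on the rank,
    (e^{N u} v)_q reduces to v_q once higher entries vanish, and multiplying by the decaying
    e^{(mu_k - mu_q) u} makes v_q tend to 0, hence be 0. *)
Lemma asymp_tri m (v : 'M[C]_(n, m)) (u : nat -> C) (a : C) j k :
  (forall q i, (pos q < pos i)%N -> ccvg (fun N => cexp ((mu q - mu i) * u N)) 0) ->
  (forall q, ccvg (fun N => cexp ((mu q - mu k) * u N) * (eN (u N) *m v) q j)
     (if q == k then a else 0)) ->
  (forall q, (pos k < pos q)%N -> v q j = 0) /\ v k j = a.
Proof.
move=> hu hv.
have h0 q : (pos k < pos q)%N -> v q j = 0.
  elim/(pos_ind_down (pos := pos)): q => q IH h.
  have c1 := hv q; have c2 := hu _ _ h.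
  have qk : q == k = false by apply/negP => /eqP qk; rewrite qk ltnn in h.
  rewrite qk in c1; have := ccvgM c1 c2; rewrite mulr0 => c3.
  apply: (ccvg_unique (ccvg_cst _)); apply: ccvg_ext c3 => N.
  rewrite eN_mul_last; last by move=> i hi; apply: IH => //; exact: ltn_trans hi.
  by rewrite mulrAC -cexpD -mulrDl (_ : _ + _ = 0) ?mul0r ?cexp0 ?mul1r//; ring.
split=> //; have := hv k; rewrite eqxx => c1.
apply: (ccvg_unique (ccvg_cst _)); apply: ccvg_ext c1 => N.
by rewrite subrr mul0r cexp0 mul1r eN_mul_last.
Qed.

                                                                                            
                                                          
(** The coefficient vectors of Floquet solutions: N v = 0 excludes logarithms, the support condition
    leaves only integral nonnegative powers of y beside y^{mu_j}, and v_j = 1 normalizes. *)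
Definition nullvec (j : 'I_n) (v : 'cV[C]_n) : Prop :=
  [/\ Nh *m v = 0, v j 0 = 1 &
      forall q, v q 0 != 0 -> q = j \/ exists m : nat, (0 < m)%N /\ mu q - mu j = m%:R].

Lemma eN_null u m (v : 'M[C]_(n, m)) : Nh *m v = 0 -> eN u *m v = v.
Proof.
move=> h; have [n0|n0] := posnP n.
  by apply/matrixP => i; have := ltn_ord i; move: (nat_of_ord i); lia.
rewrite eNE mulmx_suml (bigD1 (Ordinal n0))//= big1 ?addr0.
  by rewrite expr0 divr1 scale1r mul1mx.
move=> i i0; have i1 : (0 < i)%N by rewrite lt0n.
rewrite -scalemxAl; have -> : Npow Nh i = Npow Nh i.-1 *m Nh by rewrite -NpowSr prednK.
by rewrite -mulmxA h mulmx0 scaler0.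
Qed.

Variable kk : int.
Hypothesis kk1 : kk = 1 \/ kk = - 1.
Let c : C := kk%:~R * (rc (2 * pi) * 'i).

Lemma c_neq0 : c != 0.
Proof.
have h : rc (2 * pi) * 'i != 0 :> C.
  by rewrite mulf_neq0 ?neq0Ci// rc_eq0 mulf_neq0// gt_eqF// pi_gt0.
rewrite /c; case: kk1 => ->; first by rewrite mul1r.
by rewrite mulrNz mulN1r oppr_eq0.
Qed.

(** The kernel of the exponential turns equality of the monodromy exponentials into an integral
    difference of exponents; the sign of the integer gives the last two cases. *)
Lemma eU_eq q j : cexp (mu q * c) = cexp (mu j * c) ->
  [\/ q = j, exists m : nat, (0 < m)%N /\ mu q - mu j = m%:R |
      exists m : nat, (0 < m)%N /\ mu j - mu q = m%:R].
Proof.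
move=> h; have h1 : cexp ((mu q - mu j) * c) = 1.
  by rewrite mulrBl cexpB h divff// cexp_neq0.
have [k hk] := cexp_eq1 h1.
have h2 : mu q - mu j = (k * kk)%:~R.
  apply: (mulIf c_neq0); rewrite hk /c intrM.
  by case: kk1 => ->; rewrite ?mulrNz; ring.
move: h2; case: (k * kk) => [[|m]|m] h2.
- by constructor 1; apply: mu_inj; apply/eqP; rewrite -subr_eq0 h2.
- by constructor 2; exists m.+1.
- constructor 3; exists m.+1; split=> //.
  by rewrite -opprB h2 NegzE mulrNz opprK.
Qed.

Lemma eU_nat q j (m : nat) : mu q - mu j = m%:R -> cexp (mu q * c) = cexp (mu j * c).
Proof.
move=> h; have -> : mu q = mu j + m%:R by rewrite -h; ring.
by rewrite mulrDl cexpD /c cexp_nat_period mulr1.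
Qed.

(** Project [v] onto the indices with the same monodromy exponential as [j]. This projection
    commutes with N and turns the eigenvector equation into e^{cN} v' = v', so N v' = 0 by
    [Npow_fix]; triangularity of [v] discards resonances in the wrong direction. *)
Lemma eigen_nullvec j (v : 'cV[C]_n) :
  eU c *m eN c *m v = cexp (mu j * c) *: v -> v j 0 = 1 ->
  (forall q, (pos j < pos q)%N -> v q 0 = 0) -> exists v', nullvec j v'.
Proof.
move=> hv vj vt.
pose P : Mx := diag_mx (\row_q (cexp (mu q * c) == cexp (mu j * c))%:R).
have PN : P *m Nh = Nh *m P.
  apply/matrixP => q k; rewrite mul_diag_mx mul_mx_diag !mxE mulrC.
  have [->|/hNh[_ /eU_nat ->]] := eqVneq (Nh q k) 0; first by rewrite !mul0r.
  by [].
have PD m (x : 'M[C]_(n, m)) : P *m (eU c *m x) = cexp (mu j * c) *: (P *m x).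
  apply/matrixP => q k; rewrite mul_diag_mx mul_diag_mx [RHS]mxE mul_diag_mx !mxE.
  by case: eqP => [->|_]; rewrite ?mul1r ?mul0r ?mulr0.
have h1 : cexp (mu j * c) *: (eN c *m (P *m v)) = cexp (mu j * c) *: (P *m v).
  by rewrite mulmxA -(eN_commute c PN) -mulmxA -PD (mulmxA (eU c)) hv -scalemxAr.
have h2 : eN c *m (P *m v) = P *m v.
  have := congr1 (fun x => (cexp (mu j * c))^-1 *: x) h1.
  by rewrite !scalerA mulVf ?cexp_neq0// !scale1r.
exists (P *m v); split.
- exact: (Npow_fix pos_lt hNh res_pos c_neq0 h2).
- by rewrite mul_diag_mx !mxE eqxx mul1r.
- move=> q; rewrite mul_diag_mx !mxE.
  have [h|_] := eqVneq (cexp (mu q * c)) (cexp (mu j * c)); last by rewrite mul0r eqxx.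
  rewrite mul1r => vq; have hq : (pos q <= pos j)%N.
    by rewrite leqNgt; apply/negP => /vt h'; rewrite h' eqxx in vq.
  case: (eU_eq h) => [->|[m hm]|[m [m0 hm]]]; [by left|by right; exists m|].
  by have := res_pos m0 hm; lia.
Qed.

Lemma nullvec_tri j v : nullvec j v -> forall q, (pos j < pos q)%N -> v q 0 = 0.
Proof.
move=> [_ _ h] q hq; apply/eqP; apply/negP => /negP /h [qj|[m [m0 hm]]].
  by rewrite qj ltnn in hq.
by have := res_pos m0 hm; lia.
Qed.

Lemma nullvec_eigen j v : nullvec j v ->
  eU c *m eN c *m v = cexp (mu j * c) *: v.
Proof.
move=> [h1 h2 h3]; rewrite -mulmxA eN_null//; apply/matrixP => q k.
rewrite mul_diag_mx !mxE ord1.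
have [->|/h3 [->//|[m [m0 /eU_nat ->]]]//] := eqVneq (v q 0) 0.
by rewrite !mulr0.
Qed.

(** The relation to be established for the monodromy matrix. Triangularity of [Q] is what preserves
    the meaning of the j-th eigenvector. *)
Definition similar_to_levelt (m Q : Mx) : Prop :=
  [/\ Q \in unitmx, utri pos Q, forall i, Q i i != 0 & m = invmx Q *m (eU c *m eN c) *m Q].

Lemma jth_eigen_nullvec (m Q : Mx) j : similar_to_levelt m Q ->
  (exists t : 'cV[C]_n, [/\ m *m t = cexp (mu j * c) *: t, t j 0 = 1 &
     forall i, (pos j < pos i)%N -> t i 0 = 0]) <-> exists v, nullvec j v.
Proof.
move=> [uQ tQ dQ ->].
have Qv (A : Mx) (x : 'cV[C]_n) : utri pos A -> (forall i, (pos j < pos i)%N -> x i 0 = 0) ->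
    (forall i, (pos j < pos i)%N -> (A *m x) i 0 = 0) /\ (A *m x) j 0 = A j j * x j 0.
  move=> tA hx; split.
    move=> i hi; rewrite mxE big1// => k _; have [h|h] := ltnP (pos k) (pos i).
      by rewrite tA ?mul0r.
    by rewrite hx ?mulr0//; lia.
  rewrite mxE (bigD1 j)//= big1 ?addr0// => k kj; have [h|h] := ltnP (pos k) (pos j).
    by rewrite tA ?mul0r.
  rewrite hx ?mulr0// ltn_neqAle h andbT; apply: contra kj => /eqP /pos_inj ->.
  by [].
split=> [[t [h1 h2 h3]]|[v hv]].
  have [k1 k2] := Qv Q t tQ h3.
  apply: (@eigen_nullvec j ((Q j j)^-1 *: (Q *m t))).
  - rewrite -scalemxAr scalerA mulrC -scalerA; congr (_ *: _).
    have := congr1 (mulmx Q) h1; rewrite -!mulmxA mulKVmx// -scalemxAr => <-.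
    by rewrite !mulmxA.
  - by rewrite mxE k2 h2 mulr1 mulVf.
  - by move=> q hq; rewrite mxE k1 ?mulr0.
have dQ' i : Q i i \is a GRing.unit by rewrite unitfE.
have tI := utri_inv pos_inj uQ tQ dQ'.
have [k1 k2] := Qv (invmx Q) v tI (nullvec_tri hv).
exists (Q j j *: (invmx Q *m v)); split.
- rewrite -scalemxAr scalerA mulrC -scalerA; congr (_ *: _).
  rewrite -!mulmxA mulKVmx// scalemxAr -(nullvec_eigen hv).
  by rewrite !mulmxA.
- rewrite mxE k2; case: hv => _ -> _; rewrite mulr1 -(utri_mul_diag pos_inj _ tQ tI).
  by rewrite mulmxV// mxE eqxx.
- by move=> i hi; rewrite mxE k1 ?mulr0.
Qed.
End EigenTriangular.

                                                    

(** * The sectorial domains near a singular point, in the time coordinate *)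

Section GeometryEnd.
Context {R : realType}.
Local Notation C := (Cplx R).
Variables (g : geometry R) (l : side) (w : C).

Definition ori : R := orient R l.
Local Notation o := ori.
Local Notation s := (sqrt_eps w).
Local Notation X := (xsing l w).
Local Notation T := (thetah g w).
Local Notation P := (period w).
Local Notation r := (g_r g).
Local Notation h := (g_h g).

Lemma rc2 : rc 2 = 2 :> C. Proof. exact: rc_nat. Qed.

Lemma ori2 : o * o = 1.
Proof. by rewrite /ori; case: l => /=; ring. Qed.

Lemma xsingE : X = rc o * s.
Proof. by rewrite /ori; case: l => /=; rewrite ?rcN rc1 ?mul1r ?mulN1r. Qed.

Lemma s_neq0 : s != 0. Proof. exact: cexp_neq0. Qed.

Lemma X_neq0 : X != 0.
Proof.
rewrite xsingE mulf_neq0 ?s_neq0// rc_eq0; apply/eqP => h0.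
by have := ori2; rewrite h0 mul0r => /esym/eqP; rewrite oner_eq0.
Qed.

Lemma cabs_xsing : cabs X = cabs s.
Proof.
rewrite xsingE cabsM cabs_rc /ori.
by case: l => /=; rewrite ?normrN1 ?normr1 mul1r.
Qed.

Lemma cabs_sqrt_eps : Num.sqrt (abs_eps w) = cabs s.
Proof.
rewrite /abs_eps /sqrt_eps cabs_cexp.
have -> : cre (w / rc 2) = cre w / 2 by rewrite -rcV mulrC cre_rcM mulrC.
rewrite -{1}(divfK (_ : 2 != 0 :> R) (cre w))// mulr_natr expRD -expr2.
by rewrite sqrtr_sqr ger0_norm ?expR_ge0.
Qed.

Lemma eps_X2 : eps w = X ^+ 2.
Proof.
rewrite xsingE exprMn -rcX expr2 ori2 rc1 mul1r /sqrt_eps expr2 -cexpD /eps.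
by congr cexp; rewrite rc2; field.
Qed.

Lemma xsing_other : xsing (other l) w = - X.
Proof. by case: l => //=; rewrite opprK. Qed.

(** Equals (x - X) / (x + X) for x = x(t): a P-periodic coordinate that vanishes at [X]. *)
Definition Ee (t : C) : C := cexp (rc 2 * X * t).

Lemma Ee_period t : Ee (t + P) = Ee t.
Proof.
rewrite /Ee /period mulrDr cexpD.
have -> : rc 2 * X * (- (rc pi * 'i) / s) = - (rc (o * (2 * pi)) * 'i).
  by rewrite xsingE !rcM; field; exact: s_neq0.
rewrite cexpN (_ : cexp (rc (o * (2 * pi)) * 'i) = 1) ?invr1 ?mulr1// /ori.
case: (l) => /=; first by rewrite mul1r cexp_2pi.
by rewrite mulN1r rcN mulNr cexpN cexp_2pi invr1.
Qed.

Lemma csinhE t : (csinh (s * t) == 0) = (Ee t == 1).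
Proof.
have e0 := cexp_neq0 (s * t).
have h2 : rc 2 != 0 :> C by rewrite rc_eq0.
have h3 : (csinh (s * t) == 0) = (cexp (s * t) ^+ 2 == 1).
  rewrite /csinh mulf_eq0 invr_eq0 (negPf h2) orbF subr_eq0 cexpN.
  by rewrite -(inj_eq (mulfI e0)) divff// -expr2.
rewrite h3 /Ee xsingE /ori; case: l => /=.
  by rewrite rc1 mul1r -cexpMn rc2 -mulrA mulr_natl.
rewrite rcN rc1 mulN1r mulrN mulNr cexpN -cexpMn rc2 -mulrA mulr_natl.
by rewrite -[RHS](inj_eq (@invr_inj _)) invrK invr1.
Qed.

Lemma xtE t : Ee t != 1 -> xt w t = X * (1 + Ee t) / (1 - Ee t).
Proof.
move=> h1; have e0 := cexp_neq0 (s * t).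
have h2 : rc 2 != 0 :> C by rewrite rc_eq0.
have h3 : csinh (s * t) != 0 by rewrite csinhE.
move: h3; rewrite /xt /csinh /ccosh mulf_eq0 invr_eq0 (negPf h2) orbF.
move: h1; rewrite /Ee xsingE /ori; set e1 := cexp (s * t) in e0 *.
have ee : cexp (rc 2 * s * t) = e1 ^+ 2.
  by rewrite -cexpMn rc2 -mulrA mulr_natl.
rewrite cexpN -/e1 subr_eq0; case: l => /=.
  rewrite rc1 mul1r ee => h1 h3.
  have h4 : 1 - e1 ^+ 2 != 0 by rewrite subr_eq0 eq_sym.
  have h5 : e1 ^+ 2 - 1 != 0 by rewrite subr_eq0.
  have -> : e1 + e1^-1 = (e1 ^+ 2 + 1) / e1 by field.
  have -> : e1 - e1^-1 = (e1 ^+ 2 - 1) / e1 by field.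
  by field; rewrite h4 h5 e0.
rewrite rcN rc1 mulN1r mulrN mulNr cexpN ee => h1 h3.
have h5 : e1 ^+ 2 - 1 != 0.
  by rewrite subr_eq0; apply: contra h1 => /eqP ->; rewrite invr1.
have -> : e1 + e1^-1 = (e1 ^+ 2 + 1) / e1 by field.
have -> : e1 - e1^-1 = (e1 ^+ 2 - 1) / e1 by field.
have -> : 1 + (e1 ^+ 2)^-1 = (e1 ^+ 2 + 1) / e1 ^+ 2 by field.
have -> : 1 - (e1 ^+ 2)^-1 = (e1 ^+ 2 - 1) / e1 ^+ 2 by field.
by field; rewrite h5 e0.
Qed.


Local Notation kap := (g_kappa g).
Local Notation tT := (tan T).

                                                                                      
                                                                        
(** The vertical offset of [t] from the line through 0 of slope tan T, constant along the direction
    e^{iT} in which the domains go to infinity. *)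
Definition off (t : C) : R := cim t - cre t * tT.
(** Half the rate at which log |E| decreases along the direction [o * expi T]; its positivity says
    that this direction leads to [X]. *)
Definition pull : R := - cre (s * expi T).
Local Notation a := pull.
Definition Qoff : R := off P.
Local Notation Q := Qoff.
Local Notation q := ((2^-1 + kap) * Q).
Definition bend : R := g_c0 g / cabs s.
Local Notation b := bend.

(** [Ilo] and [Ihi] bound the offsets of the half-strip to which a domain reduces beyond the bend of
    [sigma], where [sigma] is affine of slope tan T. *)
Definition Ilo (sh : sheet) : R := match sh with Down => - q | Up => - h - o * (b * tT) end.
Definition Ihi (sh : sheet) : R := match sh with Down => h - o * (b * tT) | Up => q end.
Definition inI (sh : sheet) (x : R) : Prop := Ilo sh < x /\ x < Ihi sh.

Hypothesis cosT : 0 < cos T.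
Hypothesis a_gt0 : 0 < a.
Hypothesis h_gt0 : 0 < h.
Hypothesis kap01 : 0 < kap < 2^-1.
Hypothesis c0_gt0 : 0 < g_c0 g.
Hypothesis s_lt_r : cabs s < r.
Hypothesis star : h + b * `|tT| < (2^-1 - kap) * Q.

Lemma offD t u : off (t + u) = off t + off u.
Proof. by rewrite /off creD cimD; ring. Qed.
Lemma offN t : off (- t) = - off t.
Proof. by rewrite /off creN cimN; ring. Qed.
Lemma off_rc k t : off (rc k * t) = k * off t.
Proof. by rewrite /off cre_rcM cim_rcM; ring. Qed.
Lemma off_expi : off (expi T) = 0.
Proof. by rewrite /off /= /tan; field; rewrite gt_eqF. Qed.
Lemma off_i : off 'i = 1.
Proof. by rewrite /off !cE; ring. Qed.
Lemma off_cont t u : `|off t - off u| <= (1 + `|tT|) * cabs (t - u).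
Proof.
have -> : off t - off u = cim (t - u) - cre (t - u) * tT by rewrite /off creB cimB; ring.
apply: (le_trans (ler_normB _ _)); rewrite mulrDl mul1r lerD ?cim_le// normrM mulrC.
by rewrite ler_wpM2l// cre_le.
Qed.

Lemma tdecomp t : t = rc (cre t / cos T) * expi T + rc (off t) * 'i.
Proof.
apply: cplxP; rewrite !cE /= /off /tan; field; rewrite gt_eqF//.
Qed.

Lemma cre_2Xt t : cre (rc 2 * X * t) = - (2 * o * (cre t / cos T * a)) - 2 * o * (off t * cim s).
Proof.
have st : s * t = rc (cre t / cos T) * (s * expi T) + rc (off t) * ('i * s).
  by rewrite {1}(tdecomp t); ring.
have -> : rc 2 * X * t = rc (2 * o) * (s * t) by rewrite xsingE rcM; ring.
rewrite cre_rcM st creD !cre_rcM /pull [cre ('i * s)]creM cre_i cim_i; ring.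
Qed.

Lemma b_gt0 : 0 < b. Proof. by rewrite divr_gt0// cabs_gt0 s_neq0. Qed.

(** Obtained by eliminating P from P s = - i pi. It makes the offset of the period positive and
    measures the room available between two translates of a strip. *)
Lemma Q_eq : Q * cos T * cabs s ^+ 2 = pi * a.
Proof.
have hP : P * s = - (rc pi * 'i) by rewrite /period divfK// s_neq0.
have h1 : cre P * cre s - cim P * cim s = 0.
  by have := congr1 (@cre R) hP; rewrite creM !cE; lra.
have h2 : cre P * cim s + cim P * cre s = - pi.
  by have := congr1 (@cim R) hP; rewrite cimM !cE; lra.
have hs : cabs s ^+ 2 = cre s ^+ 2 + cim s ^+ 2.
  by rewrite sqr_sqrtr// addr_ge0 ?sqr_ge0.
have -> : Q * cos T = cim P * cos T - cre P * sin T.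
  by rewrite /Qoff /off /tan; field; rewrite gt_eqF.
have -> : a = - (cre s * cos T - cim s * sin T) by rewrite /pull creM.
rewrite hs; move: (cre P) (cim P) (cre s) (cim s) h1 h2 => p1 p2 x y h1 h2.
have -> : pi = - (p1 * y + p2 * x) by lra.
have -> : (p2 * cos T - p1 * sin T) * (x ^+ 2 + y ^+ 2) =
  - (p1 * y + p2 * x) * - (x * cos T - y * sin T) -
  (p1 * x - p2 * y) * (cos T * y + sin T * x) by ring.
by rewrite h1 mul0r subr0.
Qed.

Lemma Q_gt0 : 0 < Q.
Proof.
have := Q_eq; have : 0 < pi * a by rewrite mulr_gt0// pi_gt0.
move=> h1 h2; rewrite -h2 in h1.
have c2 : 0 < cos T * cabs s ^+ 2 by rewrite mulr_gt0// exprn_gt0// cabs_gt0 s_neq0.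
by move: h1; rewrite -mulrA pmulr_lgt0.
Qed.

Lemma obT : `|o * (b * tT)| = b * `|tT|.
Proof.
rewrite (normrM o) (normrM b) (gtr0_norm b_gt0) /ori.
by case: l => /=; rewrite ?normrN1 ?normr1 mul1r.
Qed.

Lemma obT_bounds : [/\ 0 <= b * `|tT|, - (b * `|tT|) <= o * (b * tT) & o * (b * tT) <= b * `|tT|].
Proof.
rewrite -obT; split=> //; first by rewrite lerNl -normrN ler_norm.
exact: ler_norm.
Qed.

Definition Bd : R := q + h + b * `|tT|.

Lemma inI_bound sh x : inI sh x -> `|x| <= Bd.
Proof.
have hh := h_gt0; have [k1 k2 k3] := obT_bounds.
have q0 : 0 < q by rewrite mulr_gt0 ?Q_gt0//; case/andP: kap01; lra.
rewrite /inI /Ilo /Ihi /Bd => -[h1 h2]; rewrite ler_norml; apply/andP.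
move: k1 k2 k3 h1 h2; move: (b * `|tT|) (o * (b * tT)) => y z k1 k2 k3 h1 h2.
by case: sh h1 h2 => /= h1 h2; split; lra.
Qed.

Lemma sigma_bound u : `|sigma g w u - u * tT| <= b * `|tT|.
Proof.
rewrite /sigma cabs_sqrt_eps -/b; case: ifP => hu.
  by rewrite sub0r normrN normrM ler_wpM2r.
have u0 : u != 0.
  by apply: contraFN hu => /eqP ->; rewrite normr0 ltW// b_gt0.
have -> : (u - Num.sg u * b) * tT - u * tT = - (Num.sg u * b * tT) by ring.
by rewrite normrN (normrM _ tT) (normrM _ b) normr_sg u0 mul1r (gtr0_norm b_gt0).
Qed.

Lemma sigma_side u : b < o * u -> sigma g w u = u * tT - o * (b * tT).
Proof.
have b0 := b_gt0; move=> hu; rewrite /sigma cabs_sqrt_eps -/b; move: hu; rewrite /ori.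
case: l => /=; rewrite ?mul1r ?mulN1r => hu.
  have u0 : 0 < u by apply: lt_trans hu.
  by rewrite gtr0_norm// leNgt hu /= gtr0_sg//; ring.
have u0 : u < 0 by rewrite -oppr_gt0; apply: lt_trans hu.
by rewrite ltr0_norm// leNgt hu /= ltr0_sg//; ring.
Qed.

(** The three bounds keep 1 - E away from 0, force [t] past the bend on the side of [l] when its
    offset is at most [Bd] ([side_large]), and keep |x| < r ([xt_lt_r]). *)
Definition e_end : R :=
  Num.min 2^-1 (Num.min (expR (- (2 * (Bd * cabs s) + 2 * (a / cos T * b))))
                        ((r - cabs s) / (8 * cabs s))).

Lemma e_end_gt0 : 0 < e_end.
Proof.
have s0 : 0 < cabs s by rewrite cabs_gt0 s_neq0.
by rewrite !lt_min invr_gt0 ltr0n expR_gt0 /= divr_gt0 ?subr_gt0// mulr_gt0.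
Qed.

Lemma e_end_half : e_end <= 2^-1. Proof. by rewrite ge_min lexx. Qed.

Lemma e_end_exp : e_end <= expR (- (2 * (Bd * cabs s) + 2 * (a / cos T * b))).
Proof. by rewrite !ge_min lexx orbT. Qed.

Lemma e_end_r : 8 * cabs s * e_end <= r - cabs s.
Proof.
have s0 : 0 < cabs s by rewrite cabs_gt0 s_neq0.
have : e_end <= (r - cabs s) / (8 * cabs s) by rewrite !ge_min lexx !orbT.
by rewrite ler_pdivlMr ?mulr_gt0// mulrC.
Qed.

(** log |E| is a combination of cre t and of the offset; with the offset bounded, a very negative
    logarithm must come from cre t. *)
Lemma side_large t : `|off t| <= Bd -> cabs (Ee t) < e_end -> b < o * cre t.
Proof.
move=> hB hE; have := lt_le_trans hE e_end_exp.
rewrite /Ee cabs_cexp ltr_expR cre_2Xt => h1.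
have h2 : `|o * (off t * cim s)| <= Bd * cabs s.
  rewrite normrM normrM; have -> : `|o| = 1.
    by rewrite /ori; case: l => /=; rewrite ?normrN1 ?normr1.
  by rewrite mul1r; apply: ler_pM => //; exact: cim_le.
have h3 := ler_norm (o * (off t * cim s)).
have ac : 0 < a / cos T by rewrite divr_gt0.
rewrite -(ltr_pM2l ac).
have -> : a / cos T * (o * cre t) = o * (cre t / cos T * a) by ring.
move: h1 h2 h3; rewrite -!(mulrA 2 o).
move: (o * (cre t / cos T * a)) (o * (off t * cim s)) (a / cos T * b) (Bd * cabs s).
by move=> *; lra.
Qed.

Lemma Ee_neq1 t : cabs (Ee t) < e_end -> Ee t != 1.
Proof.
move=> hE; apply/eqP => h1; move: hE; rewrite h1 cabs1.
by have := e_end_half; lra.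
Qed.

Lemma one_sub_Ee t : cabs (Ee t) < e_end -> 2^-1 <= cabs (1 - Ee t).
Proof.
move=> hE; have := cabsD (1 - Ee t) (Ee t); rewrite subrK cabs1.
by have := e_end_half; lra.
Qed.

Lemma xt_subX t : Ee t != 1 -> xt w t - X = 2 * X * Ee t / (1 - Ee t).
Proof.
move=> h1; rewrite xtE//; have h2 : 1 - Ee t != 0 by rewrite subr_eq0 eq_sym.
by field.
Qed.

Lemma xt_addX t : Ee t != 1 -> xt w t + X = 2 * X / (1 - Ee t).
Proof.
move=> h1; rewrite xtE//; have h2 : 1 - Ee t != 0 by rewrite subr_eq0 eq_sym.
by field.
Qed.

Lemma xt_dist t : cabs (Ee t) < e_end -> cabs (xt w t - X) <= 4 * cabs X * cabs (Ee t).
Proof.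
move=> hE; rewrite xt_subX ?Ee_neq1// (cabsM _ (_^-1)) (cabsM _ (Ee t)) (cabsM 2 X) cabsV cabs_nat.
have h1 := one_sub_Ee hE; rewrite ler_pdivrMr; last by apply: lt_le_trans h1.
have h2 : 0 <= cabs X * cabs (Ee t) by rewrite mulr_ge0// cabs_ge0.
have := ler_wpM2l h2 h1; lra.
Qed.

Lemma xt_lt_r t : cabs (Ee t) < e_end -> cabs (xt w t) < r.
Proof.
move=> hE; have := xt_dist hE; have := e_end_r; rewrite cabs_xsing.
have := cabsD (xt w t - X) X; rewrite subrK cabs_xsing.
have s0 : 0 < cabs s by rewrite cabs_gt0 s_neq0.
have := ler_wpM2l (ltW s0) (ltW hE); have := e_end_gt0; nra.
Qed.

Lemma notin_hole t : cabs (Ee t) < e_end -> ~ Nhole g w t.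
Proof.
move=> hE hN; have [] := connected_component_sub hN.
  by move/eqP; rewrite csinhE (negPf (Ee_neq1 hE)).
by rewrite normE rc_le leNgt xt_lt_r.
Qed.

Lemma GamE sh t : Gam g sh w t <-> [/\ ~ Nhole g w t,
  match sh with Down => cim t < h + sigma g w (cre t) | Up => - h + sigma g w (cre t) < cim t end &
  match sh with Down => - q < off t | Up => off t < q end].
Proof.
have qE : off (rc (2^-1 + kap) * P) = q by rewrite off_rc.
have e1 : (cim (- (rc (2^-1 + kap) * P)) + (cre t - cre (- (rc (2^-1 + kap) * P))) * tT < cim t)
   = (- q < off t).
  by rewrite -qE /off creN cimN; apply/idP/idP; lra.
have e2 : (cim t < cim (rc (2^-1 + kap) * P) + (cre t - cre (rc (2^-1 + kap) * P)) * tT)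
   = (off t < q).
  by rewrite -qE /off; apply/idP/idP; lra.
by case: sh => /=; rewrite /above /below /= ?e1 ?e2.
Qed.

Lemma end_Gam sh t : cabs (Ee t) < e_end -> inI sh (off t) -> Gam g sh w t /\ 0 < o * cre t.
Proof.
move=> hE hI; have hb := side_large (inI_bound hI) hE; split; last exact: lt_trans b_gt0 hb.
apply/GamE; move: hI; rewrite (sigma_side hb) /inI /Ilo /Ihi.
by case: sh => /= -[h1 h2]; split=> //; try exact: notin_hole; move: h1 h2; rewrite /off; lra.
Qed.

Lemma Ee_lt t e : e <= 2^-1 -> cabs (xt w t - X) < cabs X * e -> cabs (Ee t) < e.
Proof.
move=> e12 hx; have X0 : 0 < cabs X by rewrite cabs_gt0 X_neq0.
have e0 : 0 < e by rewrite -(pmulr_rgt0 _ X0); exact: le_lt_trans (cabs_ge0 _) hx.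
(* At a pole of x(t) the division by zero gives x = 0, at distance |X| from [X], which the bound on
   the distance excludes. *)
have E1 : Ee t != 1.
  rewrite -csinhE; apply/eqP => h0; move: hx; rewrite /xt h0 invr0 mulr0 mulr0 sub0r cabsN.
  by nra.
have E0 : 0 < cabs (1 - Ee t) by rewrite cabs_gt0 subr_eq0 eq_sym.
have h1 : cabs (xt w t - X) = cabs (Ee t) * cabs (xt w t + X).
  by rewrite xt_subX// xt_addX// -cabsM; congr cabs; ring.
have h2 : cabs X < cabs (xt w t + X).
  have := cabsD (xt w t + X) (- (xt w t - X)); rewrite cabsN.
  have -> : xt w t + X - (xt w t - X) = 2 * X by ring.
  rewrite cabsM cabs_nat; nra.
have h3 := cabs_ge0 (Ee t); rewrite h1 in hx.
rewrite ltNge; apply/negP => h4.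
have : cabs X * e <= cabs (Ee t) * cabs (xt w t + X); last by lra.
by rewrite mulrC; apply: ler_pM => //; exact: ltW.
Qed.

(** Converse of [end_Gam]: near [X] the domain is nothing but the half-strip. *)
Lemma Gam_end sh t e : e <= e_end -> Gam g sh w t -> cabs (xt w t - X) < cabs X * e ->
  cabs (Ee t) < e /\ inI sh (off t).
Proof.
move=> he hG hx.
have hE := Ee_lt (le_trans he e_end_half) hx; split=> //.
have k0 := sigma_bound (cre t); move: k0; rewrite ler_norml => /andP[k1 k2].
have q0 : 0 < q by rewrite mulr_gt0 ?Q_gt0//; case/andP: kap01; lra.
have bT : 0 <= b * `|tT| by rewrite mulr_ge0// ltW// b_gt0.
have hB : `|off t| <= Bd.
  have hh := h_gt0; move/GamE: hG => [_ h1 h2]; rewrite ler_norml /Bd.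
  by case: sh h1 h2; rewrite /off /= => h1 h2; apply/andP; split; lra.
have hb := side_large hB (lt_le_trans hE he); have hh := h_gt0.
move/GamE: hG => [_]; rewrite (sigma_side hb) /inI /Ilo /Ihi /off.
by case: sh => /= h1 h2; split; lra.
Qed.

Lemma inI_width sh x y : inI sh x -> inI sh y -> x - y < Q.
Proof.
have hh := h_gt0; have [k1 k2 k3] := obT_bounds; have := Q_gt0; have := star.
rewrite /inI /Ilo /Ihi => k4 k5 [h1 h2] [h3 h4].
move: k1 k2 k3 k4 h1 h2 h3 h4; move: (b * `|tT|) (o * (b * tT)) => bt obt k1 k2 k3 k4 h1 h2 h3 h4.
by case: sh h1 h2 h3 h4 => /= h1 h2 h3 h4; lra.
Qed.

(** Equal values of E differ by a multiple of the period, whose offset is a multiple of Q, while the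
    strip is narrower than Q. *)
Lemma Ee_inj sh t u : inI sh (off t) -> inI sh (off u) -> Ee t = Ee u -> t = u.
Proof.
move=> ht hu hE.
have h1 : cexp (rc 2 * X * (t - u)) = 1.
  by rewrite mulrBr cexpB -/(Ee t) hE divff// cexp_neq0.
have [k hk] := cexp_eq1 h1.
have rk : k%:~R = rc k%:~R :> C.
  case: (k) => m; first by rewrite -!pmulrn rc_nat.
  by rewrite NegzE !mulrNz rcN -!pmulrn rc_nat.
have h2 : t - u = rc (- (o * k%:~R)) * P.
  have x0 : rc 2 * X != 0 by rewrite mulf_neq0 ?X_neq0// rc_eq0.
  apply: (mulfI x0); rewrite hk rk /period xsingE rcN !rcM.
  have -> : rc 2 * (rc o * s) * (- (rc o * rc k%:~R) * (- (rc pi * 'i) / s)) =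
    (rc o * rc o) * (rc k%:~R * (rc 2 * rc pi * 'i)) by field; exact: s_neq0.
  by rewrite -(rcM o o) ori2 rc1 mul1r.
have h3 : off t - off u = - (o * k%:~R) * Q by rewrite -off_rc -h2 offD offN.
have w1 := inI_width ht hu; have w2 := inI_width hu ht; have Q0 := Q_gt0.
have [k0|k1|k2] := ltgtP k 0.
- have hk1 : k%:~R <= (- 1)%:~R :> R by rewrite ler_int; move: k0; clear; lia.
  exfalso; have := ler_wpM2r (ltW Q0) hk1; rewrite mulrN1z.
  move: h3 w1 w2; rewrite /ori; clear.
  by move: (off t) (off u) Q (k%:~R : R) => x y z K; case: l => /= *; lra.
- have hk1 : 1%:~R <= k%:~R :> R by rewrite ler_int; move: k1; clear; lia.
  exfalso; have := ler_wpM2r (ltW Q0) hk1; rewrite mulr1z.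
  move: h3 w1 w2; rewrite /ori; clear.
  by move: (off t) (off u) Q (k%:~R : R) => x y z K; case: l => /= *; lra.
- by apply/eqP; rewrite -subr_eq0 h2 k2 mulr0 oppr0 rc0 mul0r.
Qed.

Lemma seg_lt (x m n c : R) : 0 <= x -> x <= 1 -> m < c -> n < c -> m + x * (n - m) < c.
Proof.
move=> x0 x1 hm hn; have [->|x1'] := eqVneq x 1; first by lra.
have h1 : 0 < (1 - x) * (c - m) by rewrite mulr_gt0 ?subr_gt0// lt_neqAle x1'.
have h2 : 0 <= x * (c - n) by rewrite mulr_ge0// subr_ge0 ltW.
by lra.
Qed.

Lemma seg_gt (x m n c : R) : 0 <= x -> x <= 1 -> c < m -> c < n -> c < m + x * (n - m).
Proof.
move=> x0 x1 hm hn; have := @seg_lt x (- m) (- n) (- c) x0 x1; rewrite !ltrN2.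
by move=> /(_ hm hn); lra.
Qed.

(** log |E| and the offset are real affine functions of t. *)
Lemma end_convex e sh t u (x : R) : 0 < e -> 0 <= x <= 1 ->
  cabs (Ee t) < e -> inI sh (off t) -> cabs (Ee u) < e -> inI sh (off u) ->
  cabs (Ee (t + rc x * (u - t))) < e /\ inI sh (off (t + rc x * (u - t))).
Proof.
move=> e0 /andP[x0 x1]; rewrite /Ee !cabs_cexp -[e]lnK ?posrE// !ltr_expR.
rewrite mulrDr [rc 2 * X * (rc x * _)]mulrCA creD cre_rcM mulrBr creB.
rewrite /inI offD off_rc [off (u - t)]offD offN => h1 [h2 h3] h4 [h5 h6].
by split; [exact: seg_lt|split; [exact: seg_gt|exact: seg_lt]].
Qed.

                                                                                               
(** Points of offset [v] marching towards the singular point; limits at [X] are taken along them. *)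
Definition tray (v : R) (N : nat) : C := rc (o * N%:R) * expi T + rc v * 'i.

Lemma off_tray v N : off (tray v N) = v.
Proof. by rewrite /tray offD !off_rc off_expi off_i mulr0 add0r mulr1. Qed.

Lemma tray_E v (e : R) : 0 < e -> exists N0 : nat, forall N, (N0 <= N)%N -> cabs (Ee (tray v N)) < e.
Proof.
move=> e0; pose M := - ln e - 2 * o * (v * cim s).
exists (Num.truncn (`|M| / (2 * a))).+1 => N hN.
rewrite /Ee cabs_cexp -[e]lnK ?posrE// ltr_expR cre_2Xt off_tray.
have -> : cre (tray v N) / cos T = o * N%:R.
  by rewrite /tray creD !cre_rcM cre_i mulr0 addr0 /=; field; rewrite gt_eqF.
have h1 : `|M| / (2 * a) < N%:R.
  by apply: lt_le_trans (truncnS_gt _) _; rewrite ler_nat.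
move: h1; rewrite ltr_pdivrMr ?mulr_gt0// => h1.
have := ler_norm M; rewrite /M => h2.
have -> : 2 * o * (o * N%:R * a) = (o * o) * (N%:R * (2 * a)) by ring.
rewrite ori2 mul1r.
lra.
Qed.

(** An offset common to both strips, whose ray therefore stays in the overlap Omega_l. *)
Definition vmid : R := - (o * (b * tT)).

Lemma vmid_in sh : inI sh vmid.
Proof.
have hh := h_gt0; have [k1 k2 k3] := obT_bounds; have := Q_gt0; have := star; case/andP: kap01.
by rewrite /inI /Ilo /Ihi /vmid; case: sh => /= ? ? ? ?; split; nra.
Qed.

(** A time of offset - Q/2 and its translate by the period lie in the strips of the two sheets: the
    overlap Omega_C also reaches the singular point. *)
Lemma vC_in : inI Down (- (Q / 2)) /\ inI Up (- (Q / 2) + Q).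
Proof.
have hh := h_gt0; have [k1 k2 k3] := obT_bounds; have := Q_gt0; have := star; case/andP: kap01.
by rewrite /inI /Ilo /Ihi => /= ? ? ? ?; split; split; nra.
Qed.

Lemma Ee_derive t : is_derive t (1 : C) Ee (rc 2 * X * Ee t).
Proof.
have h1 := is_derive_mul (is_derive_const (rc 2 * X) t) (is_derive_var t).
apply: is_derive_eq (is_derive_compC h1 (is_derive_cexp _)) _.
by rewrite mul0r add0r mulr1 mulrC.
Qed.

Lemma end_open e sh t : cabs (Ee t) < e -> inI sh (off t) ->
  exists2 d : R, 0 < d & forall u, cabs (u - t) < d -> cabs (Ee u) < e /\ inI sh (off u).
Proof.
move=> hE [h1 h2].
have hE' : 0 < e - cabs (Ee t) by rewrite subr_gt0.
have [d1 d10 hd1] := derive_cont (Ee_derive t) hE'.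
pose m := Num.min (off t - Ilo sh) (Ihi sh - off t).
have m0 : 0 < m by rewrite lt_min !subr_gt0 h1 h2.
have K0 : 0 < 1 + `|tT| by rewrite ltr_pwDl.
exists (Num.min d1 (m / (1 + `|tT|))); first by rewrite lt_min d10 divr_gt0.
move=> u; rewrite lt_min ltr_pdivlMr// mulrC => /andP[/hd1 hu1 hu2]; split.
  by have := cabsD (Ee u - Ee t) (Ee t); rewrite subrK; lra.
have := le_lt_trans (off_cont u t) hu2; rewrite lt_min => /andP[k1 k2].
have := ler_norm (off u - off t); have := ler_norm (off t - off u); rewrite distrC.
by split; lra.
Qed.
End GeometryEnd.

(** * Angles in the parameter sector *)

Section SectorAngles.
Context {R : realType}.
Local Notation C := (Cplx R).

                                                                                        
                                                                                        
(** Ranking the indices backwards on the left makes lower triangular there the same as upper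
    triangular on the right. *)
Definition pos (l : side) {n : nat} (i : 'I_n) : nat :=
  match l with Rgt => i | Lft => rev_ord i end.

Lemma pos_lt l n (i : 'I_n) : (pos l i < n)%N.
Proof. by case: l => /=; [exact: (ltn_ord (rev_ord i))|exact: ltn_ord]. Qed.

Lemma pos_inj l n : injective (@pos l n).
Proof.
case: l => i j h; last exact: ord_inj.
by apply: rev_ord_inj; apply: ord_inj.
Qed.

Lemma unitriangularP l n (A : 'M[C]_n) :
  unitriangular l A <-> (forall i, A i i = 1) /\ utri (pos l) A.
Proof.
split=> -[h1 h2]; split=> // i j; case: l h2 => h2 /= h; apply: h2 => //=.
  by move: h; have := ltn_ord i; have := ltn_ord j; lia.
by have := ltn_ord i; have := ltn_ord j; lia.
Qed.

Lemma cos_le (x y : R) : 0 <= x -> x <= y -> y <= pi -> cos y <= cos x.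
Proof.
move=> x0 xy yp; rewrite leNgt; apply/negP; rewrite ltr_cos ?in_itv /= ?x0 ?yp ?(le_trans x0 xy) ?(le_trans xy yp)//.
by rewrite ltNge xy.
Qed.

Lemma sin_le (x y : R) : - (pi / 2) <= x -> x <= y -> y <= pi / 2 -> sin x <= sin y.
Proof.
move=> x0 xy yp; rewrite leNgt; apply/negP; rewrite ltr_sin ?in_itv /= ?x0 ?yp ?(le_trans x0 xy) ?(le_trans xy yp)//.
by rewrite ltNge xy.
Qed.

Variables (gamma : R).
Hypothesis gamma0 : 0 < gamma.
Local Notation A := (gamma * (1 + 2 * gamma / pi)).
Hypothesis hA : A < pi / 2.

Lemma A_bounds : [/\ gamma < A, 0 < A, gamma < pi / 2, 0 < 2 * gamma ^+ 2 / pi &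
  2 * gamma ^+ 2 / pi < pi / 2].
Proof.
have p0 := @pi_gt0 R.
have p1 : pi != 0 :> R by rewrite gt_eqF.
have e1 : A = gamma + 2 * gamma ^+ 2 / pi.
  by move: p1; generalize (pi : R) => p p1; field.
have g2 : 0 < 2 * gamma ^+ 2 / pi by rewrite divr_gt0// mulr_gt0// exprn_gt0.
move: hA gamma0; rewrite e1 => h1 h2.
by split; lra.
Qed.

(** A lower bound, uniform over the whole sector, for - cos (arg sqrt(epsilon) + T). *)
Definition sig0 : R := sin (2 * gamma ^+ 2 / pi).

Lemma sig0_gt0 : 0 < sig0.
Proof. by have [_ _ _ h1 h2] := A_bounds; apply: sin_gt0_pihalf; rewrite h1 h2. Qed.

Variables (g : geometry R) (rho : R) (w : C).
Hypothesis ggamma : g_gamma g = gamma.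
Hypothesis hw : Ssec gamma rho w.
Local Notation T := (thetah g w).

Lemma T_le : `|T| <= A.
Proof.
have p0 := @pi_gt0 R; have p1 : pi != 0 :> R by rewrite gt_eqF.
have g0 := gamma0.
case: hw => _ /andP[h1 h2]; rewrite /thetah ggamma /arg_sqrt_eps normrM.
have h3 : 0 < 2 * gamma / pi by rewrite divr_gt0// mulr_gt0.
rewrite gtr0_norm//.
have -> : A = 2 * gamma / pi * (pi / 2 + gamma).
  by move: p1; generalize (pi : R) => p p1; field.
by rewrite ler_pM2l// ler_norml; apply/andP; split; lra.
Qed.

Lemma cosT_gt0 : 0 < cos T.
Proof.
have := T_le; rewrite ler_norml => /andP[h1 h2]; have h3 := hA.
by apply: cos_gt0_pihalf; apply/andP; split; lra.
Qed.

(** With a = arg sqrt(epsilon), a + T - pi = (a - pi)(1 - 2 gamma / pi), and |a - pi| <= pi/2 +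
    gamma bounds it by pi/2 - 2 gamma^2 / pi. The tilt of the domains is chosen for this margin. *)
Lemma cos_alphaT : cos (arg_sqrt_eps w + T) <= - sig0.
Proof.
have p0 := @pi_gt0 R; have p1 : pi != 0 :> R by rewrite gt_eqF.
have g0 := gamma0; have [_ _ g1 k1 k2] := A_bounds.
case: hw => _ /andP[h1 h2].
have -> : arg_sqrt_eps w + T = (arg_sqrt_eps w - pi) * (1 - 2 * gamma / pi) + pi.
  rewrite /thetah ggamma; by move: p1; generalize (pi : R) => p p1; field.
rewrite cosDpi lerN2 -cos_norm normrM.
have h3 : 0 < 1 - 2 * gamma / pi.
  by rewrite subr_gt0 ltr_pdivrMr// mul1r; lra.
have h4 : `|arg_sqrt_eps w - pi| <= pi / 2 + gamma.
  by rewrite /arg_sqrt_eps ler_norml; apply/andP; split; lra.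
have h5 : `|arg_sqrt_eps w - pi| * `|1 - 2 * gamma / pi| <= pi / 2 - 2 * gamma ^+ 2 / pi.
  have -> : pi / 2 - 2 * gamma ^+ 2 / pi = (pi / 2 + gamma) * (1 - 2 * gamma / pi).
    by move: p1; generalize (pi : R) => p p1; field.
  by rewrite (gtr0_norm h3) ler_wpM2r// ltW.
rewrite /sig0 -[X in sin X](_ : (pi / 2 - (pi / 2 - 2 * gamma ^+ 2 / pi)) = _); last by ring.
rewrite sinB cos_pihalf sin_pihalf mul0r subr0 mul1r.
by apply: cos_le; rewrite ?mulr_ge0//; lra.
Qed.

Lemma pullE : pull g w = cabs (sqrt_eps w) * - cos (arg_sqrt_eps w + T).
Proof.
rewrite /pull /sqrt_eps cabs_cexp creM cre_cexp cim_cexp /= cosD.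
have -> : cim (w / rc 2) = arg_sqrt_eps w.
  by rewrite -rcV mulrC cim_rcM mulrC.
ring.
Qed.

Lemma pull_gt0 : 0 < pull g w.
Proof.
rewrite pullE mulr_gt0// ?cabs_gt0 ?s_neq0//.
have := cos_alphaT; have := sig0_gt0; lra.
Qed.

Hypothesis h0 : 0 < g_h g.
Hypothesis kap01 : 0 < g_kappa g < 2^-1.
Hypothesis c00 : 0 < g_c0 g.
Hypothesis hc : g_h g * cabs (sqrt_eps w) + g_c0 g < (2^-1 - g_kappa g) * (pi * sig0).

(** Multiplying by |s| cos T turns Q into pi times - cos (arg + T), at least pi [sig0], and the left
    side into at most h |s| + c0. This is where c0 and rho have to be small. *)
Lemma star_ineq : g_h g + bend g w * `|tan T| < (2^-1 - g_kappa g) * Qoff g w.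
Proof.
have s0 : 0 < cabs (sqrt_eps w) by rewrite cabs_gt0 s_neq0.
have c0 := cosT_gt0; have k0 : 0 < 2^-1 - g_kappa g by case/andP: kap01; lra.
have D0 : 0 < cabs (sqrt_eps w) * cos T by rewrite mulr_gt0.
rewrite -(ltr_pM2r D0).
have QE := Q_eq c0; have aE := pullE; have ca := cos_alphaT.
have p0 := @pi_gt0 R.
have e1 : (2^-1 - g_kappa g) * Qoff g w * (cabs (sqrt_eps w) * cos T) =
    (2^-1 - g_kappa g) * (pi * - cos (arg_sqrt_eps w + T)).
  rewrite -!mulrA; congr (_ * _); apply: (mulIf (lt0r_neq0 s0)).
  by rewrite -[RHS]mulrA [_ * cabs _ in RHS]mulrC -aE -QE; ring.
rewrite e1.
have e2 : (2^-1 - g_kappa g) * (pi * sig0) <= (2^-1 - g_kappa g) * (pi * - cos (arg_sqrt_eps w + T)).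
  by rewrite ler_pM2l// ler_pM2l//; lra.
apply: lt_le_trans e2; apply: le_lt_trans hc; rewrite mulrDl; apply: lerD.
  rewrite ler_pM2l//; rewrite -[leRHS]mulr1 ler_pM2l//; exact: cos_le1.
rewrite /bend /tan normrM normfV (gtr0_norm c0).
have -> : g_c0 g / cabs (sqrt_eps w) * (`|sin T| / cos T) * (cabs (sqrt_eps w) * cos T) =
   g_c0 g * `|sin T| by field; rewrite !gt_eqF.
by rewrite -[leRHS]mulr1 ler_pM2l// sin_max.
Qed.

(** Positivity of Re (e^{i theta} d) at theta = A and - A passes to the intermediate angle T, by
    monotonicity of sine and cosine. *)
Lemma expi_sector (C0 : R) (d : C) : 0 < C0 ->
  C0 < cre (expi A * d) -> C0 < cre (expi (- A) * d) -> 0 < cre (expi T * d).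
Proof.
move=> C00; rewrite !creM /= cosN sinN; move: (cre d) (cim d) => x y h1 h2.
have [_ A0 _ _ _] := A_bounds; have hA' := hA; have TA := T_le.
have hT := TA; rewrite ler_norml in hT; case/andP: hT => hT1 hT2.
have cA : 0 < cos A by apply: cos_gt0_pihalf; apply/andP; split; lra.
have sA : 0 < sin A by apply: sin_gt0_pihalf; apply/andP; split; lra.
have c1 : cos A <= cos T.
  by rewrite -[leRHS]cos_norm; apply: cos_le; rewrite ?normr_ge0//; lra.
have s1 : sin T <= sin A by apply: sin_le; lra.
have s2 : - sin A <= sin T by rewrite -sinN; apply: sin_le; lra.
have x0 : 0 < x.
  rewrite ltNge; apply/negP => x0; have : cos A * x <= 0 by rewrite mulr_ge0_le0// ltW.
  lra.
have c2 : cos A * x <= cos T * x by rewrite ler_wpM2r// ltW.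
have [y0|y0] := leP 0 y.
  have : sin T * y <= sin A * y by rewrite ler_wpM2r.
  lra.
have : sin T * y <= - sin A * y by rewrite ler_wnM2r// ltW.
lra.
Qed.
End SectorAngles.

(** * Order of the exponents at a singular point *)

Section Order.
Context {R : realType} (n : nat) (fam : ode_family R n) (gamma rho : R) (g : geometry R).
Local Notation C := (Cplx R).
Variables (l : side) (w : C).
Hypothesis gamma0 : 0 < gamma.
Hypothesis hA : gamma * (1 + 2 * gamma / pi) < pi / 2.
Hypothesis ggamma : g_gamma g = gamma.
Hypothesis hw : Ssec gamma rho w.
Hypothesis hrho : good_rho fam gamma rho.
Local Notation X := (xsing l w).
Local Notation lamX q := (lam fam q (eps w) X).

Lemma order_T (q j : 'I_n) : (q < j)%N -> 0 < cre (expi (thetah g w) * (lamX q - lamX j)).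
Proof.
move=> qj; have [[C0 [C00 h]] _] := hrho.
by have [h1 h2] := h w l q j hw qj; exact: (expi_sector gamma0 hA ggamma hw C00 h1 h2).
Qed.

(** Along the ray towards [X], solutions of lower rank are dominated by those of higher rank; [ori]
    and [pos] give both ends the same form. *)
Lemma order_pos (q j : 'I_n) : (pos l q < pos l j)%N ->
  ori l * cre (expi (thetah g w) * (lamX q - lamX j)) < 0.
Proof.
rewrite /ori /pos => h.
have : match l with Lft => (j < q)%N | Rgt => (q < j)%N end.
  by case: l h => //= h; have := ltn_ord q; have := ltn_ord j; lia.
have := @order_T q j; have := @order_T j q.
have -> : lamX j - lamX q = - (lamX q - lamX j) by rewrite opprB.
rewrite mulrN creN; move: (cre _) => x h1 h2.
by case: l => /= hl; [have := h1 hl|have := h2 hl]; lra.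
Qed.

Lemma lamX_mu (q k : 'I_n) : lamX q - lamX k = rc 2 * X * (mu fam l w q - mu fam l w k).
Proof.
by rewrite /mu rc2; field; exact: X_neq0.
Qed.

(** A resonance makes the difference of the lambda equal to 2 X m, whose projection on the ray has
    the sign of [- pull]; by [order_pos] only one direction of the rank is possible. *)
Lemma mu_res_pos (q k : 'I_n) (m : nat) : (0 < m)%N ->
  mu fam l w q - mu fam l w k = m%:R -> (pos l q < pos l k)%N.
Proof.
move=> m0 hm.
rewrite ltnNge leq_eqVlt; apply/negP => /orP[/eqP /pos_inj qk|/order_pos].
  by move: hm; rewrite qk subrr => /esym/eqP; rewrite pnatr_eq0; case: m m0 => //.
rewrite -opprB lamX_mu hm -rc_nat.
have -> : expi (thetah g w) * - (rc 2 * X * rc m%:R) =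
   rc (- (2 * m%:R * ori l)) * (sqrt_eps w * expi (thetah g w)).
  by rewrite xsingE rcN !rcM; ring.
rewrite cre_rcM mulrA.
have -> : ori l * - (2 * m%:R * ori l) = - (2 * m%:R) * (ori l * ori l) :> R by ring.
have := pull_gt0 gamma0 hA ggamma hw; rewrite /pull (@ori2 R l) => h1 h2.
have m1 : 0 < m%:R :> R by rewrite ltr0n.
clear hm; nra.
Qed.

Lemma mu_inj : injective (mu fam l w).
Proof.
move=> q k h; apply: (@pos_inj l); have d0 : lamX q - lamX k = 0.
  by rewrite lamX_mu h subrr mulr0.
apply/eqP; rewrite eqn_leq; apply/andP; split; rewrite leqNgt; apply/negP => /order_pos.
  by rewrite -opprB d0 oppr0 mulr0 cre0 mulr0 ltxx.
by rewrite d0 mulr0 cre0 mulr0 ltxx.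
Qed.
End Order.

                                       

(** * The family as a Fuchsian system at the singular point *)

Section FamilyLevelt.
Context {R : realType} (n : nat) (fam : ode_family R n).
Local Notation C := (Cplx R).
Local Notation Mx := 'M[C]_n.
Variables (l : side) (w : C).
Local Notation X := (xsing l w).
Local Notation mu := (mu fam l w).

(** Since x^2 - epsilon = y (2 X + y) at x = X + y, the family becomes y Y' = [Af] y Y. *)
Definition Af (y : C) : Mx := (2 * X + y)^-1 *: Bmx fam (eps w) (X + y).

(** Taylor coefficients of y / (2 X + y) = 1 - 1 / (1 + y / (2 X)). *)
Definition gcoef (m : nat) : C := (m == 0)%:R - (- (2 * X)^-1) ^+ m.

Lemma psumD (a b : nat -> C) z N : psum (fun m => a m + b m) z N = psum a z N + psum b z N.
Proof. by rewrite /psum -big_split /=; apply: eq_bigr => i _; rewrite mulrDl. Qed.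

Lemma psumZ (k : C) (a : nat -> C) z N : psum (fun m => k * a m) z N = k * psum a z N.
Proof. by rewrite /psum mulr_sumr; apply: eq_bigr => i _; rewrite mulrA. Qed.

Lemma ccvg_geometric (q : C) : cabs q < 1 -> ccvg (fun N => \sum_(m < N) q ^+ m) (1 - q)^-1.
Proof.
move=> hq; have q1 : 1 - q != 0.
  by rewrite subr_eq0; apply: contraTneq hq => <-; rewrite cabs1 ltxx.
have c0 : 0 < cabs (1 - q) by rewrite cabs_gt0.
move=> e e0; have [|N hN] := @expr_small _ (cabs q) (e * cabs (1 - q)) _ (mulr_gt0 e0 c0).
  by rewrite cabs_ge0.
exists N => k /hN hk.
have -> : \sum_(m < k) q ^+ m - (1 - q)^-1 = - (q ^+ k / (1 - q)).
  apply: (mulIf q1); rewrite mulrBl mulNr !mulVf ?divfK//.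
  set S := \sum_(m < k) _; have -> : S * (1 - q) = - ((q - 1) * S) by ring.
  by rewrite -subrX1; ring.
by rewrite cabsN cabsM cabsV cabsX ltr_pdivrMr.
Qed.

Lemma gcoef_cvg y : cabs y < cabs X -> ccvg (psum gcoef y) (y / (2 * X + y)).
Proof.
move=> hy; have X0 := X_neq0 l w; have X1 : 0 < cabs X by rewrite cabs_gt0.
have h2 : 2 * X + y != 0.
  rewrite -cabs_gt0; have := cabsD (2 * X + y) (- y); rewrite addrK cabsN cabsM cabs_nat; lra.
have hq : cabs (- (2 * X)^-1 * y) < 1.
  rewrite cabsM cabsN cabsV cabsM cabs_nat mulrC ltr_pdivrMr ?mulr_gt0//; lra.
have c1 := ccvgM (ccvg_cst (- 1)) (ccvg_geometric hq).
have c2 : ccvg (psum (fun m => (m == 0)%:R : C) y) 1.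
  move=> e e0; exists 1%N => -[//|N] _.
  by rewrite /psum big_ord_recl /= expr0 mulr1 big1 ?addr0 ?subrr ?cabs0// => i _; rewrite mul0r.
have -> : y / (2 * X + y) = 1 + -1 * (1 - - (2 * X)^-1 * y)^-1.
  have h3 : 1 - - (2 * X)^-1 * y = (2 * X + y) / (2 * X) by field.
  by rewrite h3 invf_div; field; rewrite h2.
apply: ccvg_ext (ccvgD c2 c1) => N.
rewrite /gcoef psumD; congr (_ + _); rewrite mulN1r /psum -sumrN.
by apply: eq_bigr => i _; rewrite exprMn mulNr.
Qed.

Lemma gcoef_geo : geo gcoef (cabs X) 2.
Proof.
have X0 := X_neq0 l w; have X1 : 0 < cabs X by rewrite cabs_gt0.
split=> // m; rewrite /gcoef; case: m => [|m].
  by rewrite !expr0 eqxx subrr cabs0 mul0r.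
rewrite sub0r cabsN cabsX -exprMn cabsN cabsV cabsM cabs_nat.
have -> : (2 * cabs X)^-1 * cabs X = 2^-1 by field; rewrite gt_eqF.
by rewrite (@le_trans _ _ 1)// ?ler1n// exprn_ile1 ?invr_ge0// invf_le1// ler1n.
Qed.

(** The coefficients after multiplication by y. *)
Definition sblock (a : nat -> C) (m : nat) : C := if m is m'.+1 then a m' else 0.

Lemma sblock_cvg a y v : ccvg (psum a y) v -> ccvg (psum (sblock a) y) (y * v).
Proof.
move=> h; apply: ccvg_shift; apply: ccvg_ext (ccvgM (ccvg_cst y) h) => N.
rewrite /psum big_ord_recl /= mul0r add0r mulr_sumr; apply: eq_bigr => i _.
by rewrite /bump /= add1n exprS; ring.
Qed.

Lemma sblock_geo a p M : geo a p M -> geo (sblock a) p (M * p).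
Proof.
move=> ga; have [p0 h] := ga; split=> // -[|m] /=.
  by rewrite cabs0 mul0r mulr_ge0 ?(geo_ge0 ga)// ltW.
by rewrite exprSr mulrA ler_wpM2r// ltW.
Qed.

Lemma geo_add (a b : nat -> C) p M M' : geo a p M -> geo b p M' -> geo (fun m => a m + b m) p (M + M').
Proof.
move=> [p0 h] [_ h']; split=> // m.
apply: le_trans (lerD (h m) (h' m)); rewrite -mulrDl ler_wpM2r ?cabsD//.
by rewrite exprn_ge0// ltW.
Qed.

Lemma geo_scale k (a : nat -> C) p M : geo a p M -> geo (fun m => k * a m) p (cabs k * M).
Proof.
move=> [p0 h]; split=> // m; rewrite cabsM -mulrA ler_wpM2l ?cabs_ge0//.
Qed.

Lemma geo_weakM (a : nat -> C) p M M' : geo a p M -> M <= M' -> geo a p M'.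
Proof. by move=> [p0 h] hM; split=> // m; apply: le_trans hM. Qed.

(** The conclusion of [levelt] for this family; the bound d <= |X| keeps the other singular point -
    X outside the disc. *)
Definition lev_data (d : R) (G G' : C -> Mx) (Nh : Mx) (mm : 'I_n -> 'I_n -> nat) : Prop :=
  [/\ 0 < d <= cabs X, G 0 = 1%:M,
      (forall y, cabs y < d -> mder G y (G' y) /\ G y \in unitmx),
      (forall q k, Nh q k != 0 -> (0 < mm q k)%N /\ mu q - mu k = (mm q k)%:R) &
      (forall y, cabs y < d ->
         y *: G' y = Af y *m G y - G y *m (diag_mx (\row_j mu j) + resmx Nh mm y))].

Lemma Af_entry y i j : 2 * X + y != 0 -> Af y i j =
  (i == j)%:R * mu i + (i == j)%:R * (Lam1 fam (eps w) 0 i - mu i) * (y / (2 * X + y)) +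
  y * Rem fam (eps w) (X + y) i j.
Proof.
move=> h2; have X0 := X_neq0 l w.
have m2 : 2 * X * mu i = lam fam i (eps w) X by rewrite /Defs.mu rc2; field.
have l2 : lam fam i (eps w) (X + y) = 2 * X * mu i + Lam1 fam (eps w) 0 i * y.
  by rewrite m2 /lam; ring.
have e2 : (X + y) ^+ 2 - eps w = y * (2 * X + y) by rewrite (eps_X2 l); ring.
rewrite /Af /Bmx /Lammx !mxE e2 l2; case: (eqVneq i j) => [_|_].
  by have -> : true%:R = 1 :> C by []; rewrite mulr1n; field.
by have -> : false%:R = 0 :> C by []; rewrite mulr0n; field.
Qed.

Lemma lev_data_exists (p : R) : 0 < p ->
  (forall i j, exists M : R, exists b : nat -> C, geo b p M /\
     forall y, cabs y < p -> ccvg (psum b y) (Rem fam (eps w) (X + y) i j)) ->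
  exists d G G' Nh mm, lev_data d G G' Nh mm.
Proof.
move=> p0 hR; have X0 := X_neq0 l w; have X1 : 0 < cabs X by rewrite cabs_gt0.
have hR' (x : 'I_n * 'I_n) : exists b : nat -> C, (exists M, geo b p M) /\
   forall y, cabs y < p -> ccvg (psum b y) (Rem fam (eps w) (X + y) x.1 x.2).
  by have [M [b [h1 h2]]] := hR x.1 x.2; exists b; split=> //; exists M.
have [b hb] := choice hR'.
pose p1 := Num.min p (cabs X).
have p10 : 0 < p1 by rewrite lt_min p0.
pose A (m : nat) : Mx := \matrix_(i, j) ((i == j)%:R * mu i * (m == 0)%:R +
   (i == j)%:R * (Lam1 fam (eps w) 0 i - mu i) * gcoef m + sblock (b (i, j)) m).
have A0 : A 0%N = diag_mx (\row_j mu j).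
  apply/matrixP => i j; rewrite !mxE /gcoef expr0 eqxx subrr mulr0 !addr0 mulr1.
  by case: eqP => [->|_]; rewrite ?mul1r ?mulr1n ?mul0r ?mulr0n.
have gd : geo (fun m => (m == 0)%:R : C) p1 1.
  split=> // -[|m]; first by rewrite expr0 mulr1 cabs1.
  by rewrite cabs0 mul0r.
have gA (x : 'I_n * 'I_n) : exists M : R, forall M', M <= M' -> geo (fun m => A m x.1 x.2) p1 M'.
  have [[M hM] _] := hb x.
  have g1 : geo gcoef p1 2 by apply: geo_weak gcoef_geo _; rewrite p10 ge_min lexx orbT.
  have g2 : geo (sblock (b x)) p1 (M * p).
    by apply: geo_weak (sblock_geo hM) _; rewrite p10 ge_min lexx.
  exists (cabs ((x.1 == x.2)%:R * mu x.1) * 1 +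
    cabs ((x.1 == x.2)%:R * (Lam1 fam (eps w) 0 x.1 - mu x.1)) * 2 + M * p) => M' hM'.
  apply: (geo_weakM _ hM'); rewrite /A.
  under eq_fun do rewrite mxE -surjective_pairing.
  exact: geo_add (geo_add (geo_scale _ gd) (geo_scale _ g1)) g2.
have [M [_ hM]] := fin_max gA.
have [|d [G [G' [Nh [mm [/andP[d0 dp] G1 hG hN hode]]]]]] :=
  @levelt _ _ mu A p1 M Af A0 (fun i j => hM (i, j) M (lexx _)) p10.
  move=> y; rewrite lt_min => /andP[yp yX] i j.
  have h2 : 2 * X + y != 0.
    rewrite -cabs_gt0; have := cabsD (2 * X + y) (- y); rewrite addrK cabsN cabsM cabs_nat; lra.
  rewrite Af_entry//.
  have c2 : ccvg (psum (fun m => (m == 0)%:R : C) y) 1.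
    move=> e e0; exists 1%N => -[//|N] _.
    by rewrite /psum big_ord_recl /= expr0 mulr1 big1 ?addr0 ?subrr ?cabs0// => k _; rewrite mul0r.
  have := ccvgD (ccvgD (ccvgM (ccvg_cst ((i == j)%:R * mu i)) c2)
    (ccvgM (ccvg_cst ((i == j)%:R * (Lam1 fam (eps w) 0 i - mu i))) (gcoef_cvg yX)))
    (sblock_cvg ((hb (i, j)).2 y yp)).
  rewrite mulr1; apply: ccvg_ext => N; rewrite -!psumZ -!psumD.
  by apply: eq_bigr => k _; rewrite /A mxE.
exists d, G, G', Nh, mm; split=> //.
by rewrite d0 (le_trans dp)// ge_min lexx orbT.
Qed.
End FamilyLevelt.

(** * The Levelt fundamental matrix *)

Section LeveltSolution.
Context {R : realType} (n : nat) (fam : ode_family R n).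
Local Notation C := (Cplx R).
Local Notation Mx := 'M[C]_n.
Variables (l : side) (w : C) (d : R) (G G' : C -> Mx) (Nh : Mx) (mm : 'I_n -> 'I_n -> nat).
Local Notation X := (xsing l w).
Local Notation mu := (mu fam l w).
Hypothesis HD : lev_data fam l w d G G' Nh mm.
Hypothesis res_pos : forall q k (m : nat), (0 < m)%N -> mu q - mu k = m%:R ->
  (pos l q < pos l k)%N.

Local Notation eU := (eU mu).
Local Notation eN := (eN Nh).

Lemma lev_hNh q k : Nh q k != 0 -> (0 < mm q k)%N /\ mu q - mu k = (mm q k)%:R.
Proof. by case: HD => _ _ _ h _; exact: h. Qed.

(** Written in the logarithm u of x - X, so that it is single-valued and one turn is a translation
    of u. *)
Definition levelt_sol (u : C) : Mx := G (cexp u) *m (eU u *m eN u).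

Lemma levY_unit u : expR (cre u) < d -> levelt_sol u \in unitmx.
Proof.
move=> hu; case: HD => _ _ h _ _.
have [|_ h1] := h (cexp u); first by rewrite cabs_cexp.
rewrite /levelt_sol !unitmx_mul h1 eU_unit.
exact: (eN_unit (@pos_lt l n) lev_hNh res_pos).
Qed.

Lemma levY_der u : expR (cre u) < d -> mder levelt_sol u (Af fam l w (cexp u) *m levelt_sol u).
Proof.
move=> hu; case: HD => _ _ h _ hode.
have hu' : cabs (cexp u) < d by rewrite cabs_cexp.
have [h1 _] := h _ hu'.
have d1 := mder_comp (is_derive_cexp u) h1.
have d2 := mder_mul (mder_eU mu u) (mder_eN (@pos_lt l n) lev_hNh res_pos u).
apply: mder_eq (mder_mul d1 d2) _; rewrite hode// /levelt_sol.
have -> : diag_mx (\row_j mu j) *m eU u *m eN u + eU u *m (Nh *m eN u) =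
    (diag_mx (\row_j mu j) + resmx Nh mm (cexp u)) *m (eU u *m eN u).
  by rewrite (mulmxA (eU u)) (eU_Nh lev_hNh) mulmxDl -!mulmxA.
by rewrite mulmxBl -!mulmxA subrK.
Qed.

Lemma levY_period (k : int) u : let c := k%:~R * (rc (2 * pi) * 'i) in
  levelt_sol (u + c) = levelt_sol u *m (eU c *m eN c).
Proof.
move=> c; rewrite /levelt_sol cexpD cexp_2pi_int mulr1 eUD (eND (@pos_lt l n) lev_hNh res_pos).
rewrite -!mulmxA; congr (_ *m (_ *m _)).
by rewrite !mulmxA (eN_commute u (eU_comm lev_hNh k)).
Qed.
End LeveltSolution.

(** * The logarithm of x - X as a function of time *)

Section EndCoordinate.
Context {R : realType}.
Local Notation C := (Cplx R).
Variables (l : side) (w : C).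
Local Notation X := (xsing l w).
Local Notation E := (Ee l w).

Lemma one_sub_re t : cabs (E t) <= 2^-1 -> 0 < cre (1 - E t).
Proof.
move=> h; have := cre_le (E t); rewrite ler_norml => /andP[_ h1].
by rewrite creB cre1; lra.
Qed.

Lemma half_neq1 t : cabs (E t) <= 2^-1 -> E t != 1.
Proof. by move=> h; apply: contraTneq h => ->; rewrite cabs1 -ltNge; lra. Qed.

Lemma one_sub_neq0 t : cabs (E t) <= 2^-1 -> 1 - E t != 0.
Proof. by move=> h; rewrite subr_eq0 eq_sym half_neq1. Qed.

Definition l0 : C := xget 0 [set u | cexp u = 2 * X].

Lemma cexp_l0 : cexp l0 = 2 * X.
Proof.
have h : 2 * X != 0 by rewrite mulf_neq0 ?X_neq0// pnatr_eq0.
have [u hu] := cexp_surj h.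
exact: (xgetI 0 (hu : [set u | cexp u = 2 * X] u)).
Qed.

                                                             
(** From x - X = 2 X E / (1 - E): a branch of log (x - X) on the whole half-plane |E| <= 1/2, since
    1 - E has positive real part there. *)
Definition ucoord (t : C) : C := l0 + rc 2 * X * t - clog (1 - E t).

Lemma cexp_ucoord t : cabs (E t) <= 2^-1 -> cexp (ucoord t) = xt w t - X.
Proof.
move=> h; rewrite xt_subX ?half_neq1// /ucoord cexpB cexpD cexp_l0 clogK//.
exact: one_sub_re.
Qed.

Lemma ucoord_period t : ucoord (t + period w) = ucoord t + rc 2 * X * period w.
Proof. by rewrite /ucoord Ee_period; ring. Qed.

Definition oriz : int := match l with Lft => 1 | Rgt => - 1 end.
(** The increment of log (x - X) along one turn in the chosen orientation. Going back by one period
    in time adds exactly this ([ucoord_back]). *)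
Definition ctp : C := oriz%:~R * (rc (2 * pi) * 'i).

Lemma oriz1 : oriz = 1 \/ oriz = - 1.
Proof. by rewrite /oriz; case: l; [left|right]. Qed.

Lemma ctpE : ctp = rc (orient R l * (2 * pi)) * 'i.
Proof.
rewrite /ctp /oriz; case: l => /=; first by rewrite !mul1r.
by rewrite mulrNz !mulN1r rcN mulNr.
Qed.

Lemma twoX_period : rc 2 * X * period w = - ctp.
Proof.
rewrite ctpE xsingE /period -/(ori l) !rcM; field; exact: s_neq0.
Qed.

Lemma ucoord_back t : ucoord (t - period w) = ucoord t + ctp.
Proof.
have := ucoord_period (t - period w); rewrite subrK twoX_period => ->.
by rewrite subrK.
Qed.

Lemma Ee_back t : E (t - period w) = E t.
Proof. by have := Ee_period l w (t - period w); rewrite subrK => ->. Qed.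

Lemma ucoord_der t : cabs (E t) < 2^-1 ->
  is_derive t (1 : C) ucoord (xt w t + X).
Proof.
move=> h; have hle := ltW h; have h1 := one_sub_neq0 hle.
have d1 : is_derive t (1 : C) (fun t => 1 - E t) (0 + - (rc 2 * X * E t)).
  exact: is_derive_add (is_derive_const 1 t) (is_derive_opp (Ee_derive l w t)).
have d2 := is_derive_opp (is_derive_compC d1 (is_derive_clog (one_sub_re hle))).
have d3 := is_derive_mul (is_derive_const (rc 2 * X) t) (is_derive_var t).
have d4 := is_derive_add (is_derive_add (is_derive_const l0 t) d3) d2.
apply: is_derive_eq d4 _; rewrite xt_addX ?half_neq1// rc2; field.
exact: h1.
Qed.

Lemma Ee_open (e : R) t : cabs (E t) < e -> \forall u \near t, cabs (E u) < e.
Proof.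
move=> h; have h' : 0 < e - cabs (E t) by rewrite subr_gt0.
have [d d0 hd] := derive_cont (Ee_derive l w t) h'.
apply/nbhsC; exists d => // u /hd hu.
by have := cabsD (E u - E t) (E t); rewrite subrK; lra.
Qed.

Lemma xt_der t : cabs (E t) < 2^-1 -> is_derive t (1 : C) (xt w) (xt w t ^+ 2 - eps w).
Proof.
move=> h; have d1 := is_derive_compC (ucoord_der h) (is_derive_cexp (ucoord t)).
have d2 := is_derive_add (is_derive_const X t) d1.
have dn : \forall u \near t, X + cexp (ucoord u) = xt w u.
  by apply: filterS (Ee_open h) => u hu; rewrite (cexp_ucoord (ltW hu)); ring.
apply: is_derive_eq (is_derive_near dn d2) _.
by rewrite (cexp_ucoord (ltW h)) (eps_X2 l); ring.
Qed.

Lemma xt_back t : cabs (E t) <= 2^-1 -> xt w (t - period w) = xt w t.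
Proof. by move=> h; rewrite !(xtE (l := l)) ?Ee_back ?half_neq1. Qed.

Lemma xt_fwd t : cabs (E t) <= 2^-1 -> xt w (t + period w) = xt w t.
Proof. by move=> h; rewrite !(xtE (l := l)) ?Ee_period ?half_neq1. Qed.
End EndCoordinate.

(** * The system and its model in the time coordinate *)

Section EndSolutions.
Context {R : realType} (n : nat) (fam : ode_family R n).
Local Notation C := (Cplx R).
Local Notation Mx := 'M[C]_n.
Variables (l : side) (w : C).
Local Notation X := (xsing l w).
Local Notation E := (Ee l w).
Local Notation mu := (mu fam l w).
Variables (d : R) (G G' : C -> Mx) (Nh : Mx) (mm : 'I_n -> 'I_n -> nat).
Hypothesis HD : lev_data fam l w d G G' Nh mm.
Hypothesis res_pos : forall q k (m : nat), (0 < m)%N -> mu q - mu k = m%:R ->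
  (pos l q < pos l k)%N.

Definition Ysol (t : C) : Mx := levelt_sol fam l w G Nh (ucoord l w t).

Definition e_lev : R := Num.min 2^-1 (d / (4 * cabs X)).

Lemma e_lev_gt0 : 0 < e_lev.
Proof.
have X0 : 0 < cabs X by rewrite cabs_gt0 X_neq0.
by case: HD => /andP[d0 _] _ _ _ _; rewrite lt_min invr_gt0 ltr0n divr_gt0// mulr_gt0.
Qed.

Lemma e_lev_half t : cabs (E t) < e_lev -> cabs (E t) < 2^-1.
Proof. by rewrite lt_min => /andP[]. Qed.

Lemma xt_dist_d t : cabs (E t) < e_lev -> cabs (xt w t - X) < d.
Proof.
move=> h; have h2 := ltW (e_lev_half h); have X0 : 0 < cabs X by rewrite cabs_gt0 X_neq0.
rewrite xt_subX ?half_neq1// (cabsM _ (_^-1)) (cabsM _ (E t)) (cabsM 2 X) cabsV cabs_nat.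
have h1 : 2^-1 <= cabs (1 - E t).
  by have := cabsD (1 - E t) (E t); rewrite subrK cabs1; lra.
rewrite ltr_pdivrMr; last by apply: lt_le_trans h1.
have h3 : cabs (E t) < d / (4 * cabs X) by move: h; rewrite lt_min => /andP[].
move: h3; rewrite ltr_pdivlMr ?mulr_gt0// => h3.
have d0 : 0 < d by case: HD => /andP[].
have := ler_wpM2l (ltW d0) h1; lra.
Qed.

Lemma ucoord_dom t : cabs (E t) < e_lev -> expR (cre (ucoord l w t)) < d.
Proof.
move=> h; rewrite -cabs_cexp (cexp_ucoord (ltW (e_lev_half h))); exact: xt_dist_d.
Qed.

Lemma Ysol_unit t : cabs (E t) < e_lev -> Ysol t \in unitmx.
Proof. by move=> h; apply: (levY_unit HD res_pos); exact: ucoord_dom. Qed.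

Lemma Ysol_der t : cabs (E t) < e_lev -> mder Ysol t (Bmx fam (eps w) (xt w t) *m Ysol t).
Proof.
move=> h; have h2 := e_lev_half h.
have d1 := mder_comp (ucoord_der h2) (levY_der HD res_pos (ucoord_dom h)).
apply: mder_eq d1 _; rewrite cexp_ucoord ?ltW// /Af.
have -> : 2 * X + (xt w t - X) = xt w t + X by ring.
have -> : X + (xt w t - X) = xt w t by ring.
have h3 : xt w t + X != 0.
  rewrite xt_addX ?half_neq1 ?ltW// !mulf_neq0 ?X_neq0 ?pnatr_eq0// invr_eq0.
  by rewrite one_sub_neq0// ltW.
by rewrite -scalemxAl scalerA divff// scale1r.
Qed.

Lemma Ysol_back t : Ysol (t - period w) = Ysol t *m (eU mu (ctp l) *m eN Nh (ctp l)).
Proof. by rewrite /Ysol ucoord_back (levY_period HD res_pos). Qed.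

Variable cst : 'I_n -> C.
Hypothesis cst0 : forall j, cst j != 0.

(** The model solution e^{t Lambda_0} (x^2 - epsilon)^{Lambda_1/2} rewritten through log (x^2 -
    epsilon) = const + 2 X t - 2 log (1 - E); the constants go into [cst]. It makes sense for all t
    near the end, and a shift by - P multiplies it by Dhat. *)
Definition Phi (t : C) : Mx :=
  diag_mx (\row_j (cst j * cexp (t * lam fam j (eps w) X -
    Lam1 fam (eps w) 0 j * clog (1 - E t)))).

Lemma diag_unit (v : 'rV[C]_n) : (forall j, v 0 j != 0) -> diag_mx v \in unitmx.
Proof.
move=> h; rewrite unitmxE det_diag unitfE; apply/prodf_neq0 => j _; exact: h.
Qed.

Lemma Phi_unit t : Phi t \in unitmx.
Proof. by apply: diag_unit => j; rewrite mxE mulf_neq0 ?cexp_neq0. Qed.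

Lemma Phi_der t : cabs (E t) < 2^-1 -> mder Phi t (Lammx fam (eps w) (xt w t) *m Phi t).
Proof.
move=> h i j; rewrite /Lammx mul_diag_mx !mxE.
have [<-|ij] := eqVneq i j; last first.
  rewrite mulr0n mulr0; under eq_fun do rewrite !mxE (negPf ij) mulr0n.
  exact: is_derive_const.
rewrite mulr1n; under eq_fun do rewrite !mxE eqxx mulr1n.
have hle := ltW h; have h1 := one_sub_neq0 hle.
have d1 : is_derive t (1 : C) (fun t => 1 - E t) (0 + - (rc 2 * X * E t)).
  exact: is_derive_add (is_derive_const 1 t) (is_derive_opp (Ee_derive l w t)).
have d2 := is_derive_compC d1 (is_derive_clog (one_sub_re hle)).
have d3 := is_derive_mul (is_derive_const (Lam1 fam (eps w) 0 i) t) d2.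
have d4 := is_derive_mul (is_derive_var t) (is_derive_const (lam fam i (eps w) X) t).
have d5 := is_derive_add d4 (is_derive_opp d3).
have d6 := is_derive_compC d5 (is_derive_cexp _).
apply: is_derive_eq (is_derive_mul (is_derive_const (cst i) t) d6) _.
have -> : xt w t = X + 2 * X * E t / (1 - E t) by rewrite -xt_subX ?half_neq1//; ring.
rewrite rc2 /lam; set ex := cexp _; field; exact: h1.
Qed.

Lemma Phi_back t : Phi (t - period w) = Phi t *m Dhat fam l w.
Proof.
rewrite /Phi /Dhat mulmx_diag; congr diag_mx; apply/rowP => j; rewrite !mxE Ee_back.
rewrite -mulrA -cexpD; congr (_ * cexp _).
have h := twoX_period l w.
have -> : rc (orient R l * (2 * pi)) * 'i * mu j = - (period w * lam fam j (eps w) X).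
  rewrite -ctpE -[ctp l]opprK -h /Defs.mu rc2; field; exact: X_neq0.
by ring.
Qed.

Lemma Dhat_eU : Dhat fam l w = eU mu (ctp l).
Proof.
by rewrite /Dhat /eU; congr diag_mx; apply/rowP => j; rewrite !mxE -ctpE mulrC.
Qed.
End EndSolutions.

                                                       

(** * Matrix identities behind the similarity *)

Section StokesAlgebra.
Context {K : fieldType} {n : nat}.
Implicit Types Y Q P M D : 'M[K]_n.

Lemma invmx_mul (A B : 'M[K]_n) : A \in unitmx -> B \in unitmx ->
  invmx (A *m B) = invmx B *m invmx A.
Proof.
move=> uA uB; have uAB : A *m B \in unitmx by rewrite unitmx_mul uA.
by rewrite -[RHS](mulmxK uAB) -!mulmxA (mulKmx uA) (mulmxA _ B) mulVmx// mul1mx.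
Qed.

Lemma mulmx_eq_divr (H' P Y Q D : 'M[K]_n) : P \in unitmx -> D \in unitmx ->
  H' *m (P *m D) = Y *m Q -> H' = Y *m (Q *m invmx D) *m invmx P.
Proof.
move=> uP uD h.
by rewrite (mulmxA Y) -h (mulmxA H') (mulmxK uD) (mulmxK uP).
Qed.

Lemma mulmx_cancel2 (Y P Q1 Q2 : 'M[K]_n) : Y \in unitmx -> P \in unitmx ->
  Y *m Q1 *m invmx P = Y *m Q2 *m invmx P -> Q1 = Q2.
Proof.
move=> uY uP h.
by rewrite -(mulKmx uY Q1) -(mulKmx uY Q2) -(mulmxKV uP (Y *m Q1)) h (mulmxKV uP).
Qed.

(** With H_D = Y Q P^{-1} and H_U = Y M Q (P D)^{-1}, the factors Y and P cancel in the Stokes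
    relation. *)
Lemma stokes_similar (Y Q P M D Ch : 'M[K]_n) :
  Y \in unitmx -> Q \in unitmx -> P \in unitmx -> D \in unitmx ->
  invmx (Y *m Q *m invmx P) *m (Y *m M *m Q *m invmx (P *m D)) = P *m Ch *m invmx P ->
  Ch *m D = invmx Q *m M *m Q.
Proof.
move=> uY uQ uP uD.
rewrite !invmx_mul ?unitmx_mul ?uY ?uQ ?unitmx_inv// invmxK.
have -> : P *m (invmx Q *m invmx Y) *m (Y *m M *m Q *m (invmx D *m invmx P)) =
    P *m (invmx Q *m M *m Q *m invmx D) *m invmx P.
  by rewrite -!mulmxA (mulKmx uY).
move=> h; have {}h : P *m (invmx Q *m M *m Q *m invmx D) = P *m Ch.
  by rewrite -(mulmxKV uP (P *m (_ *m invmx D))) -(mulmxKV uP (P *m Ch)) -h !mulmxA mulmxKV.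
by rewrite -(mulKmx uP Ch) -h (mulKmx uP) mulmxKV.
Qed.
End StokesAlgebra.

(** * The unfolded Stokes matrix in terms of the Levelt monodromy *)

Section EndAnalysis.
Context {R : realType} (n : nat) (fam : ode_family R n).
Local Notation C := (Cplx R).
Local Notation Mx := 'M[C]_n.
Variables (g : geometry R) (l : side) (w : C).
Local Notation X := (xsing l w).
Local Notation E := (Ee l w).
Local Notation mu := (mu fam l w).
Local Notation T := (thetah g w).
Local Notation P := (period w).
Local Notation off := (off g w).
Hypothesis cosT : 0 < cos T.
Hypothesis a_gt0 : 0 < pull g w.
Hypothesis h_gt0 : 0 < g_h g.
Hypothesis kap01 : 0 < g_kappa g < 2^-1.
Hypothesis c0_gt0 : 0 < g_c0 g.
Hypothesis s_lt_r : cabs (sqrt_eps w) < g_r g.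
Hypothesis star : g_h g + bend g w * `|tan T| < (2^-1 - g_kappa g) * Qoff g w.

Variables (d : R) (G G' : C -> Mx) (Nh : Mx) (mm : 'I_n -> 'I_n -> nat).
Hypothesis HD : lev_data fam l w d G G' Nh mm.
Hypothesis res_pos : forall q k (m : nat), (0 < m)%N -> mu q - mu k = m%:R ->
  (pos l q < pos l k)%N.

Local Notation Ys := (Ysol fam l w G Nh).

Definition e1 : R := Num.min (e_end g w) (e_lev l w d).

Lemma e1_gt0 : 0 < e1.
Proof. by rewrite lt_min e_end_gt0// (e_lev_gt0 HD). Qed.

Lemma e1_end : e1 <= e_end g w. Proof. by rewrite ge_min lexx. Qed.

Lemma e1_lev t : cabs (E t) < e1 -> cabs (E t) < e_lev l w d.
Proof. by rewrite lt_min => /andP[]. Qed.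

Lemma e1_half t : cabs (E t) < e1 -> cabs (E t) < 2^-1.
Proof. by move/e1_lev/e_lev_half. Qed.

(** The half-strip of times of sheet [sh] near the end: convex, open, and mapped onto the part of
    the domain close to [X]. *)
Definition Tend (sh : sheet) : set C := [set t | cabs (E t) < e1 /\ inI g l w sh (off t)].

Lemma Tend_Gam sh t : Tend sh t -> Gam g sh w t /\ 0 < ori l * cre t.
Proof. by move=> [h1 h2]; apply: end_Gam => //; exact: lt_le_trans h1 e1_end. Qed.

Lemma Tend_Omega sh t : Tend sh t -> Omega g sh w (xt w t).
Proof. by move=> /Tend_Gam[h _]; exists t. Qed.

Lemma Tend_OmegaLR t : Tend Down t -> Tend Up t -> OmegaLR g l w (xt w t).
Proof.
move=> /Tend_Gam[h1 h3] /Tend_Gam[h2 _]; exists t => //; split=> //.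
by move: h3; rewrite /ori; case: l => /=; rewrite ?mul1r ?mulN1r ?oppr_gt0.
Qed.

Lemma Tend_OmegaC t : Tend Down t -> Tend Up (t + P) -> OmegaC g w (xt w t).
Proof. by move=> /Tend_Gam[h1 _] /Tend_Gam[h2 _]; exists t. Qed.

Lemma Gam_Tend sh t : Gam g sh w t -> cabs (xt w t - X) < cabs X * e1 -> Tend sh t.
Proof. by move=> h1 h2; apply: Gam_end => //; exact: e1_end. Qed.

Lemma Tend_convex sh t u (x : R) : 0 <= x <= 1 -> Tend sh t -> Tend sh u ->
  Tend sh (t + rc x * (u - t)).
Proof. by move=> hx [h1 h2] [h3 h4]; apply: end_convex => //; exact: e1_gt0. Qed.

Lemma Tend_open sh t : Tend sh t -> \forall u \near t, Tend sh u.
Proof.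
move=> [h1 h2]; have [d' d'0 hd] := end_open h1 h2.
by apply/nbhsC; exists d'.
Qed.

Lemma tray_Tend : exists N0 : nat, forall N, (N0 <= N)%N -> forall sh,
  Tend sh (tray g l w (vmid g l w) N).
Proof.
have [N0 h] := tray_E l cosT a_gt0 (vmid g l w) e1_gt0; exists N0 => N /h hN sh; split=> //.
by rewrite off_tray//; exact: vmid_in.
Qed.

Lemma tC_ex : exists t, Tend Down t /\ Tend Up (t + P).
Proof.
have [v1 v2] : inI g l w Down (- (Qoff g w / 2)) /\ inI g l w Up (- (Qoff g w / 2) + Qoff g w).
  exact: vC_in.
have [N0 h] := tray_E l cosT a_gt0 (- (Qoff g w / 2)) e1_gt0.
exists (tray g l w (- (Qoff g w / 2)) N0); have hN := h _ (leqnn N0).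
have offT := off_tray l cosT (- (Qoff g w / 2)) N0.
split; split; rewrite ?(Ee_period, offD, offT)//.
Qed.

Lemma const_quot m (A : C -> Mx) (P1 : C -> Mx) (P2 : C -> 'M[C]_(n, m)) sh t u :
  (forall t, Tend sh t -> [/\ mder P1 t (A t *m P1 t), mder P2 t (A t *m P2 t) & P1 t \in unitmx]) ->
  Tend sh t -> Tend sh u -> invmx (P1 u) *m P2 u = invmx (P1 t) *m P2 t.
Proof.
move=> h ht hu; apply: (solution_quotient (A := A)) => s s01 z.
have hz : Tend sh z by exact: Tend_convex.
have [h1 h2 h3] := h _ hz; split=> //.
by apply: filterS (Tend_open hz) => y /h [].
Qed.

Lemma fund_comp (A Z : C -> Mx) sh t : fundamental_on (eps w) A Z (Omega g sh w) ->
  Tend sh t -> mder (fun t => Z (xt w t)) t (A (xt w t) *m Z (xt w t)) /\ Z (xt w t) \in unitmx.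
Proof.
move=> hf ht; have [[h1 h2] h3] := hf _ (Tend_Omega ht); split=> //.
have hd : mder Z (xt w t) (Defs.derive_mx Z (xt w t)) by apply/mderP.
have := mder_comp (xt_der (e1_half ht.1)) hd.
by rewrite h2.
Qed.

Lemma Ys_back_der t : cabs (E t) < e1 ->
  mder (fun t => Ys (t - P)) t (Bmx fam (eps w) (xt w t) *m Ys (t - P)).
Proof.
move=> h; have h' : cabs (E (t - P)) < e_lev l w d by rewrite Ee_back; exact: e1_lev.
have d0 : is_derive t (1 : C) (fun t => t - P) (1 + 0).
  exact: is_derive_add (is_derive_var t) (is_derive_const (- P) t).
have := mder_comp d0 (Ysol_der HD res_pos h').
by rewrite addr0 scale1r (xt_back (l := l))// ltW// e1_half.
Qed.

Variables (ell : C -> C) (F H W : sheet -> C -> Mx) (Ch : Mx) (K : 'rV[C]_n).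
Hypothesis ell_exp : forall t, Gam g Down w t -> cexp (ell t) = xt w t ^+ 2 - eps w.
Hypothesis ell_cont : forall t, Gam g Down w t -> forall e : R, 0 < e ->
  exists2 d : R, 0 < d & forall u, Gam g Down w u -> cabs (u - t) < d -> cabs (ell u - ell t) < e.
Hypothesis hFD : forall t, Gam g Down w t -> F Down (xt w t) =
  diag_mx (\row_j cexp (t * Lam0 fam (eps w) 0 j + Lam1 fam (eps w) 0 j / rc 2 * ell t)).
Hypothesis hFU : fundamental_on (eps w) (Lammx fam (eps w)) (F Up) (Omega g Up w).
Hypothesis hHF : forall sh, fundamental_on (eps w) (Bmx fam (eps w))
  (fun x => H sh x *m F sh x) (Omega g sh w).
Hypothesis hK0 : forall j, K 0 j != 0.
Hypothesis hK : forall i j (e : R), 0 < e -> exists2 d : R, 0 < d &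
  forall x, Omega g Down w x -> cabs (x - X) < d -> cabs (H Down x i j - diag_mx K i j) < e.
Hypothesis hCh : forall x, OmegaLR g l w x ->
  invmx (H Down x) *m H Up x = F Down x *m Ch *m invmx (F Down x).
Hypothesis hCC : forall x, OmegaC g w x -> invmx (H Down x) *m H Up x = 1%:M.
Hypothesis hWD : forall x, Omega g Down w x -> W Down x = H Down x *m F Down x.
Hypothesis hWU : fundamental_on (eps w) (Bmx fam (eps w)) (W Up) (Omega g Up w).
Hypothesis hWC : forall x, OmegaC g w x -> W Up x = W Down x.

(** Two continuous logarithms of the same function differ by a locally constant multiple of 2 i pi,
    hence by a constant on the convex half-strip. *)
Lemma ell_const : exists k : C, forall t, Tend Down t ->
  ell t = k + (2 * l0 l w + rc 2 * X * t - 2 * clog (1 - E t)).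
Proof.
pose psi t := 2 * l0 l w + rc 2 * X * t - 2 * clog (1 - E t).
have hpsi t : Tend Down t -> cexp (psi t) = xt w t ^+ 2 - eps w.
  move=> ht; have h := ltW (e1_half ht.1).
  have -> : psi t = ucoord l w t + (l0 l w - clog (1 - E t)) by rewrite /psi /ucoord; ring.
  rewrite cexpD cexp_ucoord// cexpB cexp_l0 clogK ?one_sub_re//.
  by rewrite -(xt_addX (half_neq1 h)) (eps_X2 l); ring.
have dpsi t : Tend Down t -> exists k, is_derive t (1 : C) psi k.
  move=> ht; have h := e1_half ht.1.
  have d1 := ucoord_der h.
  have d2 := is_derive_mul (is_derive_const (rc 2 * X) t) (is_derive_var t).
  have d3 := is_derive_mul (is_derive_const 2 t) d1.
  have d4 := is_derive_add d3 (is_derive_opp d2).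
  exists (0 * ucoord l w t + 2 * (xt w t + X) + - (0 * t + rc 2 * X * 1)).
  have -> : psi = fun x => 2 * ucoord l w x + - (rc 2 * X * x).
    by apply/funext => x; rewrite /psi /ucoord; ring.
  exact: d4.
have [N0 hN0] := tray_Tend; have ht0 := hN0 _ (leqnn N0) Down.
set t0 := tray _ _ _ _ _ in ht0.
exists (ell t0 - psi t0) => t ht; rewrite -/(psi t); clearbody psi.
pose v (x : R) := ell (t0 + rc x * (t - t0)) - psi (t0 + rc x * (t - t0)).
suff : v 1 = v 0.
  rewrite /v rc1 mul1r rc0 mul0r addr0 (_ : t0 + (t - t0) = t); last by ring.
  move=> h.
  by rewrite -h; ring.
apply: locally_cst => s s01; rewrite /v.
set z := t0 + rc s * (t - t0); have hz : Tend Down z by exact: Tend_convex.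
have e20 : 0 < (2^-1 : R) by lra.
have [d1 d10 h1] := ell_cont (Tend_Gam hz).1 e20.
have [k hk] := dpsi _ hz.
have [d2 d20 h2] := derive_cont hk e20.
have A0 : 0 < 1 + cabs (t - t0) by rewrite ltr_wpDr// cabs_ge0.
exists (Num.min d1 d2 / (1 + cabs (t - t0))); first by rewrite divr_gt0// lt_min d10.
move=> s' s'01; rewrite (ltr_pdivlMr _ _ A0) => hs.
set z' := t0 + rc s' * (t - t0); have hz' : Tend Down z' by exact: Tend_convex.
have hzz : cabs (z' - z) < Num.min d1 d2.
  apply: le_lt_trans hs; have -> : z' - z = rc (s' - s) * (t - t0) by rewrite rcB /z /z'; ring.
  by rewrite cabsM cabs_rc ler_wpM2l// lerDr.
move: hzz; rewrite lt_min => /andP[hz1 hz2].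
have {}h1 := h1 _ (Tend_Gam hz').1 hz1; have {}h2 := h2 _ hz2.
apply/eqP; rewrite -subr_eq0; apply/eqP/cexp_eq1_small.
  have -> : ell z' - psi z' - (ell z - psi z) = (ell z' - ell z) - (psi z' - psi z) by ring.
  by apply: (le_lt_trans (cabsD _ _)); rewrite cabsN; lra.
have [g1 _] := Tend_Gam hz; have [g2 _] := Tend_Gam hz'.
rewrite cexpB !cexpB !hpsi// !ell_exp//.
have nz y : Tend Down y -> xt w y ^+ 2 - eps w != 0 by move=> hy; rewrite -hpsi// cexp_neq0.
by rewrite !divff ?divr1 ?nz ?oner_eq0.
Qed.

Lemma FD_Phi : exists cst : 'I_n -> C, (forall j, cst j != 0) /\
  forall t, Tend Down t -> F Down (xt w t) = Phi fam l w cst t.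
Proof.
have [k hk] := ell_const.
exists (fun j => cexp (Lam1 fam (eps w) 0 j / rc 2 * (k + 2 * l0 l w))).
split=> [j|t ht]; first exact: cexp_neq0.
have [g1 _] := Tend_Gam ht; rewrite hFD// /Phi; congr diag_mx; apply/rowP => j; rewrite !mxE hk//.
rewrite -cexpD; congr cexp; rewrite /lam rc2; by field.
Qed.

(** All solutions are compared with the Levelt solution on the half-strips, that of the upper sheet
    being evaluated at t - P. Gluing along Omega_C shows that the same [Q] serves on both sheets;
    the Stokes relation on Omega_l then relates times t and t - P, that is, one full turn. *)
Lemma end_solutions : exists (Q : Mx) (cst : 'I_n -> C),
  [/\ forall j, cst j != 0, Q \in unitmx,
      forall t, Tend Down t -> W Down (xt w t) = Ys t *m Q,
      forall t, Tend Up t -> W Up (xt w t) = Ys (t - P) *m Q &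
      (forall t, Tend Down t -> H Down (xt w t) *m Phi fam l w cst t = Ys t *m Q) /\
      Ch *m Dhat fam l w = invmx Q *m (eU mu (ctp l) *m eN Nh (ctp l)) *m Q].
Proof.
have [cst [cst0 hPhi]] := FD_Phi.
have [tC [tC1 tC2]] := tC_ex.
have YsU t : cabs (E t) < e1 -> Ys t \in unitmx.
  by move=> h; apply: (Ysol_unit HD res_pos); exact: e1_lev.
have YsbU t : cabs (E t) < e1 -> Ys (t - P) \in unitmx.
  by move=> h; apply: YsU; rewrite Ee_back.
have YsD t : cabs (E t) < e1 -> mder Ys t (Bmx fam (eps w) (xt w t) *m Ys t).
  by move=> h; apply: (Ysol_der HD res_pos); exact: e1_lev.
(* The connection matrix, computed at a time [tC] whose image lies in Omega_C. *)
pose Q := invmx (Ys tC) *m (H Down (xt w tC) *m F Down (xt w tC)).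
have HFu sh t : Tend sh t -> H sh (xt w t) *m F sh (xt w t) \in unitmx.
  by move=> ht; have [_] := fund_comp (@hHF sh) ht.
have uQ : Q \in unitmx by rewrite unitmx_mul unitmx_inv (YsU _ tC1.1) (HFu Down).
have hD t : Tend Down t -> H Down (xt w t) *m F Down (xt w t) = Ys t *m Q.
  move=> ht; have h : invmx (Ys t) *m (H Down (xt w t) *m F Down (xt w t)) = Q.
    apply: (@const_quot _ (fun t => Bmx fam (eps w) (xt w t)) Ys
      (fun t => H Down (xt w t) *m F Down (xt w t)) Down tC t _ tC1 ht) => y hy.
    by split; [exact: YsD hy.1|have [] := fund_comp (@hHF Down) hy|exact: YsU hy.1].
  by rewrite -h mulKVmx ?(YsU _ ht.1).
have hU (Z : C -> Mx) : fundamental_on (eps w) (Bmx fam (eps w)) Z (Omega g Up w) ->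
    exists2 QZ, forall t, Tend Up t -> Z (xt w t) = Ys (t - P) *m QZ & QZ \in unitmx.
  move=> hZ; exists (invmx (Ys (tC + P - P)) *m Z (xt w (tC + P))).
    move=> t ht.
    have <- : invmx (Ys (t - P)) *m Z (xt w t) = invmx (Ys (tC + P - P)) *m Z (xt w (tC + P)).
      apply: (@const_quot _ (fun t => Bmx fam (eps w) (xt w t)) (fun t => Ys (t - P))
        (fun t => Z (xt w t)) Up (tC + P) t _ tC2 ht) => y hy.
      by split; [exact: Ys_back_der hy.1|have [] := fund_comp hZ hy|exact: YsbU hy.1].
    by rewrite mulKVmx ?(YsbU _ ht.1).
  by rewrite unitmx_mul unitmx_inv (YsbU _ tC2.1); have [] := fund_comp hZ tC2.
have xC : xt w (tC + P) = xt w tC by rewrite (xt_fwd (l := l))// ltW// (e1_half tC1.1).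
have OC := Tend_OmegaC tC1 tC2.
have [QW hQW _] := hU _ hWU.
(* At [tC + P] on the upper sheet the shifted Levelt solution is [Ys tC], so the gluing of W_V
   identifies the two constants. *)
have QWE : QW = Q.
  have := hQW _ tC2; rewrite xC addrK hWC//.
  rewrite (hWD (Tend_Omega tC1)) (hD _ tC1) => h.
  by have := congr1 (mulmx (invmx (Ys tC))) h; rewrite !mulKmx ?(YsU _ tC1.1).
have [QH hQH uQH] := hU _ (@hHF Up).
have PhU := Phi_unit fam l w cst0.
have PhB y : Tend Up y -> mder (fun t => Phi fam l w cst (t - P)) y
    (Lammx fam (eps w) (xt w y) *m Phi fam l w cst (y - P)).
  move=> hy; have d0 : is_derive y (1 : C) (fun t => t - P) (1 + 0).
    exact: is_derive_add (is_derive_var y) (is_derive_const (- P) y).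
  have hy' : cabs (E (y - P)) < 2^-1 by rewrite Ee_back; exact: e1_half hy.1.
  have := mder_comp d0 (Phi_der fam cst hy').
  by rewrite addr0 scale1r (xt_back (l := l))// ltW// (e1_half hy.1).
have [K' hK' uK'] : exists2 K', forall t, Tend Up t -> F Up (xt w t) = Phi fam l w cst (t - P) *m K' &
    K' \in unitmx.
  exists (invmx (Phi fam l w cst (tC + P - P)) *m F Up (xt w (tC + P))).
    move=> t ht.
    have <- : invmx (Phi fam l w cst (t - P)) *m F Up (xt w t) =
        invmx (Phi fam l w cst (tC + P - P)) *m F Up (xt w (tC + P)).
      apply: (@const_quot _ (fun t => Lammx fam (eps w) (xt w t))
        (fun t => Phi fam l w cst (t - P)) (fun t => F Up (xt w t)) Up (tC + P) t _ tC2 ht).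
      move=> y hy; have [hF' _] := fund_comp hFU hy; split=> //; exact: PhB hy.
    by rewrite mulKVmx.
  by rewrite unitmx_mul unitmx_inv PhU; have [] := fund_comp hFU tC2.
have HDu sh t : Tend sh t -> H sh (xt w t) \in unitmx.
  by move=> /HFu; rewrite unitmx_mul => /andP[].
have HUE t : Tend Up t -> H Up (xt w t) = Ys (t - P) *m (QH *m invmx K') *m invmx (Phi fam l w cst (t - P)).
  by move=> ht; apply: mulmx_eq_divr => //; rewrite -hK'// hQH.
have HDE t : Tend Down t -> H Down (xt w t) = Ys t *m Q *m invmx (Phi fam l w cst t).
  move=> ht; rewrite -(hD _ ht) (hPhi _ ht); exact/esym/mulmxK.
(* The constant of H_U is fixed by H_D = H_U on Omega_C, at the same point. *)
have QE : QH *m invmx K' = Q.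
  have h1 : H Up (xt w tC) = H Down (xt w tC).
    have := congr1 (mulmx (H Down (xt w tC))) (hCC OC).
    by rewrite mulKVmx ?mulmx1// (HDu Down).
  have := HUE _ tC2; rewrite xC h1 addrK (HDE _ tC1).
  by move=> e; apply: (mulmx_cancel2 (YsU _ tC1.1) (PhU tC)); exact: esym e.
exists Q, cst; split=> //.
- by move=> t ht; rewrite hWD ?hD//; exact: Tend_Omega.
- by move=> t ht; rewrite hQW// QWE.
split; first by move=> t ht; rewrite (HDE _ ht); exact: mulmxKV.
(* On Omega_l one time belongs to both half-strips: there [Ys] (t - P) is [Ys] t times the Levelt
   monodromy, and [Phi] (t - P) is [Phi] t times Dhat. *)
have [N0 hN0] := tray_Tend; have hT := hN0 _ (leqnn N0).
set t := tray _ _ _ _ _ in hT.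
have := hCh (Tend_OmegaLR (hT Down) (hT Up)).
rewrite (HUE _ (hT Up)) QE (hPhi _ (hT Down)) (HDE _ (hT Down)) Phi_back (Ysol_back HD res_pos).
have uD : Dhat fam l w \in unitmx by rewrite Dhat_eU eU_unit.
exact: (stokes_similar (YsU _ (hT Down).1) uQ (PhU t) uD).
Qed.
End EndAnalysis.

(** * Triangularity of the connection matrix *)

Section EndTriangular.
Context {R : realType} (n : nat) (fam : ode_family R n).
Local Notation C := (Cplx R).
Local Notation Mx := 'M[C]_n.
Variables (g : geometry R) (l : side) (w : C).
Local Notation X := (xsing l w).
Local Notation E := (Ee l w).
Local Notation mu := (mu fam l w).
Local Notation T := (thetah g w).
Local Notation P := (period w).
Local Notation off := (off g w).
Local Notation lamX q := (lam fam q (eps w) X).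
Hypothesis cosT : 0 < cos T.
Hypothesis a_gt0 : 0 < pull g w.
Hypothesis h_gt0 : 0 < g_h g.
Hypothesis kap01 : 0 < g_kappa g < 2^-1.
Hypothesis c0_gt0 : 0 < g_c0 g.
Hypothesis s_lt_r : cabs (sqrt_eps w) < g_r g.
Hypothesis star : g_h g + bend g w * `|tan T| < (2^-1 - g_kappa g) * Qoff g w.

Variables (d : R) (G G' : C -> Mx) (Nh : Mx) (mm : 'I_n -> 'I_n -> nat).
Hypothesis HD : lev_data fam l w d G G' Nh mm.
Hypothesis res_pos : forall q k (m : nat), (0 < m)%N -> mu q - mu k = m%:R ->
  (pos l q < pos l k)%N.
Hypothesis order : forall q j : 'I_n, (pos l q < pos l j)%N ->
  ori l * cre (expi T * (lamX q - lamX j)) < 0.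

Local Notation e1 := (e1 g l w d).
Local Notation Tend := (Tend g l w d).

Lemma mul_mx_diag_entry m (A : 'M[C]_(m, n)) (v : 'rV[C]_n) i j :
  (A *m diag_mx v) i j = A i j * v 0 j.
Proof. by rewrite mul_mx_diag mxE. Qed.

Lemma mul_diag_mx_entry m (A : 'M[C]_(n, m)) (v : 'rV[C]_n) i j :
  (diag_mx v *m A) i j = v 0 i * A i j.
Proof. by rewrite mul_diag_mx mxE. Qed.

Lemma ccvg_der (f : C -> C) z k (u : nat -> C) : is_derive z (1 : C) f k -> ccvg u z ->
  ccvg (fun N => f (u N)) (f z).
Proof.
move=> hf hu e e0; have [r r0 hr] := derive_cont hf e0.
by have [N hN] := hu _ r0; exists N => m /hN; exact: hr.
Qed.

Lemma ccvg_pow (z : C) : cabs z < 1 -> ccvg (fun N => z ^+ N) 0.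
Proof.
move=> hz e e0; have h : 0 <= cabs z < 1 by rewrite cabs_ge0.
have [N hN] := expr_small h e0; exists N => m /hN; by rewrite subr0 cabsX.
Qed.

Lemma ccvg_drop (u : nat -> C) z N0 : ccvg u z -> ccvg (fun N => u (N0 + N)%N) z.
Proof.
by move=> h e /h[N hN]; exists N => m hm; apply: hN; rewrite (leq_trans hm)// leq_addl.
Qed.

Let tN (N : nat) : C := tray g l w (vmid g l w) N.

Lemma tray_E0 : ccvg (fun N => E (tN N)) 0.
Proof.
move=> e e0; have [N0 h] := tray_E l cosT a_gt0 (vmid g l w) e0.
by exists N0 => m /h; rewrite subr0.
Qed.

Lemma ccvg_E_x : ccvg (fun N => xt w (tN N)) X.
Proof.
move=> e e0; have X0 : 0 < cabs X by rewrite cabs_gt0 X_neq0.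
have e' : 0 < Num.min (e_end g w) (e / (4 * cabs X)).
  by rewrite lt_min e_end_gt0// divr_gt0// mulr_gt0.
have [N0 h] := tray_E l cosT a_gt0 (vmid g l w) e'; exists N0 => m /h.
rewrite lt_min => /andP[/xt_dist h1 h2]; apply: le_lt_trans h1 _.
by move: h2; rewrite ltr_pdivlMr ?mulr_gt0// mulrC.
Qed.

Lemma ccvg_clog : ccvg (fun N => clog (1 - E (tN N))) 0.
Proof.
have h : ccvg (fun N => 1 - E (tN N)) 1.
  have := ccvgD (ccvg_cst 1) (ccvgM (ccvg_cst (- 1)) tray_E0); rewrite mulr0 addr0.
  by apply: ccvg_ext => N; rewrite mulN1r.
have h1 : 0 < cre (1 : C) by rewrite cre1.
by have := ccvg_der (is_derive_clog h1) h; rewrite clog1.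
Qed.

Lemma ccvg_cexp_clog (k : C) : ccvg (fun N => cexp (k * clog (1 - E (tN N)))) 1.
Proof.
have := ccvg_der (is_derive_cexp (k * 0)) (ccvgM (ccvg_cst k) ccvg_clog).
by rewrite mulr0 cexp0.
Qed.

(** Along the ray this exponential is a constant times z^N times a factor tending to 1, with |z| < 1
    by [order]. *)
Lemma dominated_along (q i : 'I_n) : (pos l q < pos l i)%N ->
  ccvg (fun N => cexp ((mu q - mu i) * ucoord l w (tN N))) 0.
Proof.
move=> /order h.
pose dl := lamX q - lamX i; pose k := mu q - mu i.
have hdl : k * (rc 2 * X) = dl by rewrite /dl lamX_mu mulrC.
pose z := cexp (dl * (rc (ori l) * expi T)).
have hz : cabs z < 1.
  rewrite /z cabs_cexp -expR0 ltr_expR (_ : dl * _ = rc (ori l) * (expi T * dl)); last by ring.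
  by rewrite cre_rcM.
have := ccvgM (ccvgM (ccvg_cst (cexp (k * l0 l w + dl * (rc (vmid g l w) * 'i)))) (ccvg_pow hz))
  (ccvg_cexp_clog (- k)).
rewrite mulr0 mul0r; apply: ccvg_ext => N.
rewrite /z -cexpMn -!cexpD; congr cexp; rewrite /ucoord -/k -hdl /tN /tray.
by rewrite rcM (rc_nat N) -(mulr_natr _ N); ring.
Qed.

Lemma ccvg_invG (y : nat -> C) i j : ccvg y 0 ->
  ccvg (fun N => invmx (G (y N)) i j) (i == j)%:R.
Proof.
move=> hy; have [/andP[d0 _] G0 hG _ _] := HD.
have c0 : cabs (0 : C) < d by rewrite cabs0.
have uG : \forall x \near (0 : C), G x \in unitmx.
  apply/nbhsC; exists d => // x; rewrite subr0 => /hG[] //.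
have := ccvg_der (mder_inv uG (hG _ c0).1 i j) hy.
by rewrite G0 invmx1 mxE.
Qed.

Variables (H : C -> Mx) (cst : 'I_n -> C) (Q : Mx) (K : 'rV[C]_n).
Hypothesis cst0 : forall j, cst j != 0.
Hypothesis hK0 : forall j, K 0 j != 0.
Hypothesis hK : forall i j (e : R), 0 < e -> exists2 d : R, 0 < d &
  forall x, Omega g Down w x -> cabs (x - X) < d -> cabs (H x i j - diag_mx K i j) < e.
Hypothesis hHQ : forall t, Tend Down t -> H (xt w t) *m Phi fam l w cst t = Ysol fam l w G Nh t *m Q.

(** The linear growth in t cancels between the model solution and e^{- mu_k u}, because lambda_k(X)
    = 2 X mu_k; what remains has a limit. *)
Lemma Phi_scaled t k : cabs (E t) < 2^-1 ->
  cst k * cexp (t * lamX k - Lam1 fam (eps w) 0 k * clog (1 - E t)) * cexp (- (mu k * ucoord l w t)) =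
  cst k * cexp (- (mu k * l0 l w)) * cexp ((mu k - Lam1 fam (eps w) 0 k) * clog (1 - E t)).
Proof.
move=> _; rewrite -mulrA -[RHS]mulrA -(cexpD (t * _ - _)) -(cexpD (- _)); congr (_ * cexp _).
have -> : lamX k = mu k * (rc 2 * X).
  by rewrite divfK// mulf_neq0 ?X_neq0// rc_eq0 pnatr_eq0.
by rewrite /ucoord; ring.
Qed.

(** Rewrite H Phi = Y Q as (G^{-1} H) Phi = e^{diag(mu) u} e^{N u} Q. Since G^{-1} H tends to
    diag(K), the k-th column of Q times e^{- mu_k u} has the limits required by [asymp_tri], with a
    nonzero diagonal one. *)
Lemma transition_tri : utri (pos l) Q /\ forall i, Q i i != 0.
Proof.
have [/andP[d0 _] G0 hG _ _] := HD.
have [N0 hN0] := tray_Tend cosT a_gt0 h_gt0 kap01 c0_gt0 s_lt_r star HD.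
pose t N := tN (N0 + N).
have hT N sh : Tend sh (t N) by apply: hN0; exact: leq_addr.
pose y N := xt w (t N) - X.
have hE N : cabs (E (t N)) < e_lev l w d by apply: (e1_lev (g := g)); exact: (hT N Down).1.
have hx : ccvg (fun N => xt w (t N)) X := ccvg_drop N0 ccvg_E_x.
have hy : ccvg y 0.
  by have := ccvgD hx (ccvg_cst (- X)); rewrite subrr.
have hyd N : cabs (y N) < d := xt_dist_d HD (hE N).
have cGi i j := ccvg_invG i j hy.
have cH i j : ccvg (fun N => H (xt w (t N)) i j) (diag_mx K i j).
  move=> e /(hK i j)[r r0 hr]; have [N hN] := hx _ r0; exists N => m hm.
  apply: hr; last exact: hN.
  exact: (Tend_Omega cosT a_gt0 h_gt0 kap01 c0_gt0 s_lt_r (hT m Down)).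
have key k : (forall q, (pos l k < pos l q)%N -> Q q k = 0) /\
    Q k k = K 0 k * (cst k * cexp (- (mu k * l0 l w))).
  apply: (@asymp_tri _ _ mu Nh mm (pos l) (@pos_lt l n) (@pos_inj l n) (lev_hNh HD) res_pos _ Q
    (fun N => ucoord l w (t N))) => [q i qi|q].
    exact: (ccvg_drop N0 (dominated_along qi)).
  have c1 := ccvg_drop N0 (ccvg_cexp_clog (mu k - Lam1 fam (eps w) 0 k)).
  have c2 := ccvgM (ccvg_cst (cst k * cexp (- (mu k * l0 l w)))) c1.
  have c3 : ccvg (fun N => (invmx (G (y N)) *m H (xt w (t N))) q k) (diag_mx K q k).
    rewrite -[diag_mx K]mul1mx mxE.
    have : ccvg (fun N => \sum_j invmx (G (y N)) q j * H (xt w (t N)) j k)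
        (\sum_j (1%:M : Mx) q j * diag_mx K j k).
      by apply: ccvg_sum => j; apply: ccvgM => //; rewrite mxE.
    by apply: ccvg_ext => N; rewrite mxE.
  have := ccvgM c3 c2; rewrite mulr1 mxE.
  have -> : (K 0 q *+ (q == k)) * (cst k * cexp (- (mu k * l0 l w))) =
      (if q == k then K 0 k * (cst k * cexp (- (mu k * l0 l w))) else 0).
    by case: eqP => [->|_]; rewrite ?mulr1n ?mulr0n ?mul0r.
  apply: ccvg_ext => N.
  have e2 := e_lev_half (hE N); rewrite -(Phi_scaled k e2).
  have uG := (hG _ (hyd N)).2.
  have h1 : invmx (G (y N)) *m (H (xt w (t N)) *m Phi fam l w cst (t N)) =
      eU mu (ucoord l w (t N)) *m (eN Nh (ucoord l w (t N)) *m Q).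
    rewrite (hHQ (hT N Down)) /Ysol /levelt_sol (cexp_ucoord (ltW e2)) -/(y N) -!mulmxA.
    by rewrite (mulKmx uG).
  have := congr1 (fun M : Mx => M q k) h1.
  rewrite /Phi /eU (mulmxA (invmx _)) mul_mx_diag_entry mul_diag_mx_entry ![(\row_ _ _) _ _]mxE => h2.
  rewrite mulrA h2 mulrAC -cexpD; congr (cexp _ * _); ring.
split; first by move=> q k h; exact: (key k).1.
move=> i; rewrite (key i).2; apply: mulf_neq0; first exact: hK0.
by apply: mulf_neq0; rewrite ?cst0 ?cexp_neq0.
Qed.

Lemma closure_end : closure (OmegaLR g l w) X.
Proof.
have [N0 hN0] := tray_Tend cosT a_gt0 h_gt0 kap01 c0_gt0 s_lt_r star HD.
move=> B /nbhsC[r r0 hr]; have [N1 hN1] := ccvg_E_x r0.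
exists (xt w (tN (maxn N0 N1))); split.
  by apply: (Tend_OmegaLR cosT a_gt0 h_gt0 kap01 c0_gt0 s_lt_r (d := d)); apply: hN0; exact: leq_maxl.
by apply: hr; apply: hN1; exact: leq_maxr.
Qed.
End EndTriangular.

(** * A branch of log (x - X) on the ramified domain *)

Section Branches.
Context {R : realType} (n : nat) (fam : ode_family R n).
Local Notation C := (Cplx R).
Local Notation Mx := 'M[C]_n.
Variables (g : geometry R) (l : side) (w : C).
Local Notation X := (xsing l w).
Local Notation E := (Ee l w).
Local Notation mu := (mu fam l w).
Local Notation T := (thetah g w).
Local Notation P := (period w).
Local Notation off := (off g w).
Hypothesis cosT : 0 < cos T.
Hypothesis a_gt0 : 0 < pull g w.
Hypothesis h_gt0 : 0 < g_h g.
Hypothesis kap01 : 0 < g_kappa g < 2^-1.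
Hypothesis c0_gt0 : 0 < g_c0 g.
Hypothesis s_lt_r : cabs (sqrt_eps w) < g_r g.
Hypothesis star : g_h g + bend g w * `|tan T| < (2^-1 - g_kappa g) * Qoff g w.

Variables (d : R) (G G' : C -> Mx) (Nh : Mx) (mm : 'I_n -> 'I_n -> nat).
Hypothesis HD : lev_data fam l w d G G' Nh mm.

Local Notation e1 := (e1 g l w d).
Local Notation Tend := (Tend g l w d).
Local Notation Tend_half := (e1_half (g := g) (d := d)).

Lemma Ee_xt t : cabs (E t) <= 2^-1 -> E t = (xt w t - X) / (xt w t + X).
Proof.
move=> h; rewrite xt_subX ?xt_addX ?half_neq1//; have h1 := one_sub_neq0 h.
field; rewrite h1 X_neq0 !andbT; first by rewrite ?mulf_neq0 ?X_neq0 ?pnatr_eq0.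
Qed.

(** A local inverse of x(t), obtained by taking the logarithm of E = (x - X) / (x + X); along it
    [ucoord] is the expected continuation of the logarithm. *)
Lemma end_time_local sh t0 : Tend sh t0 ->
  \forall x \near xt w t0, exists t, [/\ Tend sh t, xt w t = x &
    ucoord l w t = ucoord l w t0 + clog ((x - X) / (xt w t0 - X))].
Proof.
move=> ht0; set x0 := xt w t0; have h0 := Tend_half ht0.1; have h0' := ltW h0.
have x0E : cexp (ucoord l w t0) = x0 - X by exact: cexp_ucoord.
have nzX : x0 - X != 0 by rewrite -x0E cexp_neq0.
have nzE : E t0 != 0 by exact: cexp_neq0.
have n2 : rc 2 * X != 0 by rewrite mulf_neq0 ?X_neq0// rc_eq0 pnatr_eq0.
have nzP : x0 + X != 0.
  rewrite xt_addX ?half_neq1// mulf_neq0 ?invr_eq0 ?one_sub_neq0//.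
  by rewrite mulf_neq0 ?X_neq0// pnatr_eq0.
have E0 : E t0 = (x0 - X) / (x0 + X) := Ee_xt h0'.
have dB (c : C) : is_derive x0 (1 : C) (fun x => x - c) (1 + 0).
  exact: is_derive_add (is_derive_var x0) (is_derive_const (- c) x0).
have dP : is_derive x0 (1 : C) (fun x => x + X) (1 + 0).
  exact: is_derive_add (is_derive_var x0) (is_derive_const X x0).
(* The quotient of the value of E at [x] by its value at [t0], equal to 1 at [x0], so [clog] applies
   nearby. *)
pose q x := (x - X) * (x + X)^-1 * (E t0)^-1.
pose q2 x := (x - X) * (x0 - X)^-1.
have dq := is_derive_mul (is_derive_mul (dB X) (@is_derive_inv _ (fun x => x + X) x0 _ nzP dP)) (is_derive_const (E t0)^-1 x0).
have dq2 := is_derive_mul (dB X) (is_derive_const (x0 - X)^-1 x0).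
have q1 : q x0 = 1 by rewrite /q -E0 divff.
have q21 : q2 x0 = 1 by rewrite /q2 divff.
have c1 : 0 < cre (1 : C) by rewrite cre1.
have dclog (f : C -> C) k : f x0 = 1 -> is_derive x0 (1 : C) f k ->
    exists k', is_derive x0 (1 : C) (fun x => clog (f x)) k'.
  move=> f1 hf; have := is_derive_clog (z := f x0); rewrite f1 => /(_ c1) h.
  eexists; apply: (is_derive_compC hf); rewrite f1; exact: h.
have [k1 dc1] := dclog _ _ q1 dq; have [k2 dc2] := dclog _ _ q21 dq2.
pose tt x := t0 + clog (q x) * (rc 2 * X)^-1.
have dtt := is_derive_add (is_derive_const t0 x0) (is_derive_mul dc1 (is_derive_const (rc 2 * X)^-1 x0)).
have tt0 : tt x0 = t0 by rewrite /tt q1 clog1 mul0r addr0.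
pose psi x := ucoord l w (tt x) - clog (q2 x).
have [k3 dpsi] : exists k, is_derive x0 (1 : C) psi k.
  have hu : is_derive (tt x0) (1 : C) (ucoord l w) (x0 + X) by rewrite tt0; exact: ucoord_der.
  eexists; exact: is_derive_add (is_derive_compC dtt hu) (is_derive_opp dc2).
have psi0 : psi x0 = ucoord l w t0 by rewrite /psi tt0 q21 clog1 subr0.
have /nbhsC[r0 r00 hr0] := Tend_open ht0.
have [r1 r10 hr1] := derive_cont dtt r00.
have [r2 r20 hr2] := derive_cont dpsi (ltr01 : 0 < (1 : R)).
have h12 : 0 < (2^-1 : R) by rewrite invr_gt0 ltr0n.
have [r3 r30 hr3] := derive_cont dq h12.
have [r4 r40 hr4] := derive_cont dq2 h12.
have cre_near (z : C) : cabs (z - 1) < 2^-1 -> 0 < cre z.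
  by move=> h; have := le_lt_trans (cre_le _) h; rewrite creB cre1 ltr_norml => /andP[]; lra.
apply/nbhsC; exists (Num.min (cabs (x0 + X)) (Num.min (Num.min r1 r2) (Num.min r3 r4))).
  by rewrite !lt_min cabs_gt0 nzP r10 r20 r30.
move=> x; rewrite !lt_min => /and3P[hx /andP[hx1 hx2] /andP[hx3 hx4]].
have nzx : x + X != 0.
  apply: contraTneq hx => hx; rewrite -leNgt cabsB (_ : x0 - x = x0 + X - (x + X)); last by ring.
  by rewrite hx subr0.
have {hx1}ht : Tend sh (tt x).
  by apply: hr0; have := hr1 _ hx1; rewrite -/(tt x) -/(tt x0) tt0.
have hq : 0 < cre (q x) by apply: cre_near; have := hr3 _ hx3; rewrite -/(q x) -/(q x0) q1.
have hq2 : 0 < cre (q2 x) by apply: cre_near; have := hr4 _ hx4; rewrite -/(q2 x) -/(q2 x0) q21.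
have EE : E (tt x) = (x - X) / (x + X).
  rewrite /Ee /tt mulrDr cexpD -/(E t0).
  rewrite (_ : rc 2 * X * (clog (q x) * (rc 2 * X)^-1) = clog (q x)); last by rewrite mulrC divfK.
  rewrite clogK//.
  by rewrite /q mulrC divfK.
have hE := ltW (Tend_half ht.1).
have xtx : xt w (tt x) = x.
  rewrite (xtE (l := l)) ?half_neq1// EE; field; rewrite nzx.
  rewrite (_ : x + X - (x - X) = rc 2 * X); last by rewrite rc2; ring.
  by rewrite n2.
exists (tt x); split=> //.
(* Both are logarithms of the same number and they are close, hence equal. *)
have hp : psi x - psi x0 = 0.
  apply: cexp_eq1_small; first exact: hr2.
  rewrite psi0 cexpB /psi cexpB (cexp_ucoord hE) xtx x0E clogK// /q2.
  have : cexp (ucoord l w (tt x)) != 0 by exact: cexp_neq0.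
  by rewrite (cexp_ucoord hE) xtx => nzx2; field; rewrite nzX nzx2.
by rewrite -psi0 -[psi x0](subKr (psi x)) hp subr0 /psi subrK.
Qed.

(** The time of [x] in the half-strip, unique by [Ee_inj]. *)
Definition tsel sh x : C := xget 0 [set t | Tend sh t /\ xt w t = x].

Lemma tselE sh t : Tend sh t -> tsel sh (xt w t) = t.
Proof.
move=> ht; rewrite /tsel; case: xgetP => [u _ [hu hx]|/(_ t)]; last by case.
apply: (Ee_inj cosT a_gt0 h_gt0 c0_gt0 star hu.2 ht.2).
by rewrite (Ee_xt (ltW (Tend_half hu.1))) (Ee_xt (ltW (Tend_half ht.1))) hx.
Qed.

(** A point of Omega_C has time t on the lower sheet and t + P on the upper one; subtracting P makes
    the logarithms agree along the gluing. *)
Definition shft sh : C := match sh with Down => 0 | Up => P end.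
                                                                                      
Definition logV sh x : C := ucoord l w (tsel sh x - shft sh).
(** Small enough for points of the domains to come from the half-strips, for the disc to stay in |x|
    < r, and for the Levelt gauge to converge. *)
Definition dV : R := Num.min (Num.min (cabs X * e1) (g_r g - cabs X)) d.

Lemma dV_gt0 : 0 < dV.
Proof.
have X0 : 0 < cabs X by rewrite cabs_gt0 X_neq0.
have [/andP[d0 _] _ _ _ _] := HD.
by rewrite !lt_min d0 mulr_gt0 ?(e1_gt0 s_lt_r HD)// subr_gt0 cabs_xsing s_lt_r.
Qed.

Lemma dV_le x : x < dV -> [/\ x < cabs X * e1, x < g_r g - cabs X & x < d].
Proof. by rewrite !lt_min => /andP[/andP[]]. Qed.

Lemma Omega_Tend sh x : Omega g sh w x -> cabs (x - X) < dV ->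
  exists2 t, Tend sh t & xt w t = x.
Proof.
move=> [t ht <-] /dV_le[h _ _]; exists t => //.
exact: (Gam_Tend cosT a_gt0 h_gt0 kap01 c0_gt0 ht).
Qed.

Lemma logV_end sh t : Tend sh t -> logV sh (xt w t) = ucoord l w t + (if sh is Up then ctp l else 0).
Proof.
move=> ht; rewrite /logV tselE//; case: (sh) => /=; first by rewrite subr0 addr0.
by rewrite ucoord_back.
Qed.

Lemma logV_local sh x0 : Omega g sh w x0 -> cabs (x0 - X) < dV ->
  cexp (logV sh x0) = x0 - X /\
  \forall x \near x0, logV sh x = logV sh x0 + clog ((x - X) / (x0 - X)).
Proof.
move=> h1 h2; have [t0 ht0 E0] := Omega_Tend h1 h2; split.
  rewrite -E0 logV_end// cexpD (cexp_ucoord (ltW (Tend_half ht0.1))).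
  case: (sh); first by rewrite cexp0 mulr1.
  by rewrite /ctp cexp_2pi_int mulr1.
have := end_time_local ht0; rewrite E0; apply: filterS => x [t [ht <- hu]].
by rewrite -E0 !logV_end// hu E0; ring.
Qed.

Lemma logV_log : log_on_V g l w dV logV.
Proof.
split=> [sh x h1|sh|x hC].
- by rewrite /= normE rc_lt => h2; exact: (logV_local h1 h2).1.
- apply/subspace_continuousP => x0 [h1]; rewrite /= normE rc_lt => h2.
  have [hx0 hl] := logV_local h1 h2; apply/cvgC => e e0.
  have nz : x0 - X != 0 by rewrite -hx0 cexp_neq0.
  pose q x := (x - X) * (x0 - X)^-1.
  have dB : is_derive x0 (1 : C) (fun x => x - X) (1 + 0).
    exact: is_derive_add (is_derive_var x0) (is_derive_const (- X) x0).
  have dq := is_derive_mul dB (is_derive_const (x0 - X)^-1 x0).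
  have c1 : 0 < cre (q x0) by rewrite /q divff// cre1.
  have [r r0 hr] := derive_cont (is_derive_compC dq (is_derive_clog c1)) e0.
  suff H : \forall x \near x0, cabs (logV sh x - logV sh x0) < e by exact: cvg_within H.
  have : \forall x \near x0, cabs (x - x0) < r by apply/nbhsC; exists r.
  apply: filterS2 hl => x -> hx; rewrite addrAC subrr add0r.
  by have := hr x hx; rewrite divff// clog1 subr0.
rewrite /= normE rc_lt => h2; case: hC => t [ht1 ht2] hx; rewrite -hx in h2 *.
have [h3 _ _] := dV_le h2.
have k1 := Gam_Tend cosT a_gt0 h_gt0 kap01 c0_gt0 ht1 h3.
have xE := xt_fwd (ltW (Tend_half k1.1)).
rewrite -{2}xE in h3 *; have k2 : Tend Up (t + P).
  by apply: (Gam_Tend cosT a_gt0 h_gt0 kap01 c0_gt0 ht2); rewrite xE.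
by rewrite xE -{1}xE /logV !tselE// addrK subr0.
Qed.

Lemma dV_punctured : punctured g l w dV.
Proof.
split; first exact: dV_gt0.
move=> x; rewrite !normE !rc_lt => /dV_le[h1 h2 _]; have X0 : 0 < cabs X by rewrite cabs_gt0 X_neq0.
have := cabsD (x - X) X; rewrite subrK => h3; split; first by lra.
rewrite xsing_other; apply: contraTneq h1 => ->; rewrite -leNgt.
rewrite (_ : - X - X = - (2 * X)); last by ring.
have h4 : e1 <= 1 by apply: (le_trans (e1_end g l w d)); apply: (le_trans (e_end_half _ _)); lra.
rewrite cabsN cabsM cabs_nat; nra.
Qed.

Variables (W : sheet -> C -> Mx) (Q : Mx).
Hypothesis hWD : forall t, Tend Down t -> W Down (xt w t) = Ysol fam l w G Nh t *m Q.
Hypothesis hWU : forall t, Tend Up t -> W Up (xt w t) = Ysol fam l w G Nh (t - P) *m Q.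

Lemma W_logV sh x : Omega g sh w x -> cabs (x - X) < dV ->
  W sh x = levelt_sol fam l w G Nh (logV sh x) *m Q.
Proof.
move=> h1 h2; have [t ht <-] := Omega_Tend h1 h2.
rewrite /logV (tselE ht); case: sh ht {h1} => ht; last exact: hWU.
by rewrite /shft subr0; exact: hWD.
Qed.

Lemma W_local x0 : Omega g Down w x0 -> cabs (x0 - X) < dV ->
  \forall x \near x0, W Down x =
    levelt_sol fam l w G Nh (logV Down x0 + clog ((x - X) / (x0 - X))) *m Q.
Proof.
move=> h1 h2; have [_ hl] := logV_local h1 h2; have [t0 ht0 E0] := Omega_Tend h1 h2.
have := end_time_local ht0; rewrite E0; apply: filterS2 hl => x hl [t [ht hx _]].
rewrite -hl -hx (hWD ht) /logV (tselE ht) /shft subr0; reflexivity.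
Qed.
End Branches.

                  

(** * The monodromy operator on germs of solutions *)

Section Monodromy.
Context {R : realType} (n : nat) (fam : ode_family R n).
Local Notation C := (Cplx R).
Local Notation Mx := 'M[C]_n.
Variables (l : side) (w : C).
Local Notation X := (xsing l w).
Local Notation mu := (mu fam l w).
Variables (d : R) (G G' : C -> Mx) (Nh : Mx) (mm : 'I_n -> 'I_n -> nat).
Hypothesis HD : lev_data fam l w d G G' Nh mm.
Hypothesis res_pos : forall q k (m : nat), (0 < m)%N -> mu q - mu k = m%:R ->
  (pos l q < pos l k)%N.
Local Notation levY := (levelt_sol fam l w G Nh).
Local Notation B := (Bmx fam (eps w)).
Local Notation A x := ((x ^+ 2 - eps w)^-1 *: B x).

Lemma clog_cexp_near : exists2 r : R, 0 < r & forall u : C, cabs u < r -> 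
  0 < cre (cexp u) /\ clog (cexp u) = u.
Proof.
have h1 : 0 < cre (cexp (0 : C)) by rewrite cexp0 cre1.
have d1 := is_derive_compC (is_derive_cexp 0) (is_derive_clog h1).
have d2 := is_derive_add d1 (is_derive_opp (is_derive_var 0)).
have h12 : 0 < (2^-1 : R) by rewrite invr_gt0 ltr0n.
have [r1 r10 hr1] := derive_cont d2 h12.
have [r2 r20 hr2] := derive_cont (is_derive_cexp (0 : C)) h12.
exists (Num.min r1 r2); first by rewrite lt_min r10.
move=> u; rewrite lt_min => /andP[hu1 hu2].
have hc : 0 < cre (cexp u).
  have := hr2 u; rewrite subr0 cexp0 => /(_ hu2) h; have := le_lt_trans (cre_le _) h.
  by rewrite creB cre1 ltr_norml => /andP[]; lra.
split=> //; apply/eqP; rewrite -subr_eq0; apply/eqP/cexp_eq1_small; last first.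
  by rewrite cexpB clogK// divff// cexp_neq0.
have := hr1 u; rewrite subr0 cexp0 clog1 subr0 subr0 => /(_ hu1) h.
by apply: (lt_trans h); lra.
Qed.

(** The logarithm of x - X near [z0] that takes the value [v] at [z0]. *)
Definition branch (v z0 x : C) : C := v + clog ((x - X) / (z0 - X)).

Lemma branch0 v z0 : z0 - X != 0 -> branch v z0 z0 = v.
Proof. by move=> h; rewrite /branch divff// clog1 addr0. Qed.

Lemma branch_near v z0 : cexp v = z0 - X -> exists2 r : R, 0 < r &
  forall x, cabs (x - z0) < r -> cexp (branch v z0 x) = x - X /\
    is_derive x (1 : C) (branch v z0) (x - X)^-1.
Proof.
move=> hv; have nz : z0 - X != 0 by rewrite -hv cexp_neq0.
have c0 : 0 < cabs (z0 - X) by rewrite cabs_gt0.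
exists (cabs (z0 - X)) => // x hx.
have hq : 0 < cre ((x - X) / (z0 - X)).
  have -> : (x - X) / (z0 - X) = 1 + (x - z0) / (z0 - X) by field.
  have h : cabs ((x - z0) / (z0 - X)) < 1 by rewrite cabsM cabsV ltr_pdivrMr// mul1r.
  have := le_lt_trans (cre_le _) h; rewrite ltr_norml => /andP[h1 _].
  by rewrite creD cre1; lra.
split; first by rewrite /branch cexpD clogK// hv mulrC divfK.
have dB : is_derive x (1 : C) (fun x => x - X) (1 + 0).
  exact: is_derive_add (is_derive_var x) (is_derive_const (- X) x).
have dq := is_derive_mul dB (is_derive_const (z0 - X)^-1 x).
have nx : x - X != 0.
  by apply: contraTneq hq => ->; rewrite mul0r cre0 ltxx.
apply: is_derive_eq (is_derive_add (is_derive_const v x) (is_derive_compC dq (is_derive_clog hq))) _.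
by field; rewrite ?nz ?nx.
Qed.

Lemma x2_eps x : x ^+ 2 - eps w = (x - X) * (x + X).
Proof. by rewrite (eps_X2 l); ring. Qed.

Lemma near_sing x : cabs (x - X) < d -> x + X != 0.
Proof.
have [/andP[_ dX] _ _ _ _] := HD.
move=> h; apply: contraTneq (lt_le_trans h dX) => h0.
rewrite -leNgt (_ : x - X = x + X - 2 * X); last by ring.
by rewrite h0 sub0r cabsN cabsM cabs_nat; have := cabs_ge0 X; lra.
Qed.

Lemma solves_at_mder m (Y : C -> 'M[C]_(n, m)) x : x ^+ 2 - eps w != 0 ->
  solves_at (eps w) B Y x <-> mder Y x (A x *m Y x).
Proof.
move=> nz; split=> [[h1 h2]|/mderP[h1 h2]].
  by apply/mderP; split=> //; rewrite -scalemxAl -h2 scalerA mulVf// scale1r.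
by split=> //; rewrite h2 -scalemxAl scalerA mulfV// scale1r.
Qed.

Lemma solves_mulr m p (Y : C -> 'M[C]_(n, m)) (K : 'M[C]_(m, p)) x :
  solves_at (eps w) B Y x -> solves_at (eps w) B (fun z => Y z *m K) x.
Proof.
move=> [h1 h2]; have h : mder Y x (Defs.derive_mx Y x) by apply/mderP.
have /mderP[k1 k2] := mder_mulr K h; split=> //.
by rewrite k2 scalemxAl h2 mulmxA.
Qed.

Section Local.
Variables (v z0 : C).
Hypothesis hv : cexp v = z0 - X.
Hypothesis hd : cabs (z0 - X) < d.
Local Notation br := (branch v z0).

Lemma local_fund : exists2 r : R, 0 < r & forall x, cabs (x - z0) < r ->
  [/\ x ^+ 2 - eps w != 0, cexp (br x) = x - X,
    mder (fun x => levY (br x)) x (A x *m levY (br x)) & levY (br x) \in unitmx].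
Proof.
have [r r0 hr] := branch_near hv; have h1 : 0 < d - cabs (z0 - X) by rewrite subr_gt0.
exists (Num.min r (d - cabs (z0 - X))); first by rewrite lt_min r0.
move=> x; rewrite lt_min => /andP[hx1 hx2]; have [hb db] := hr _ hx1.
have hxd : cabs (x - X) < d.
  by rewrite (_ : x - X = (x - z0) + (z0 - X)); [apply: (le_lt_trans (cabsD _ _)); lra|ring].
have hre : expR (cre (br x)) < d by rewrite -cabs_cexp hb.
have nX : x - X != 0 by rewrite -hb cexp_neq0.
have nP := near_sing hxd.
split=> //; first by rewrite x2_eps mulf_neq0.
  apply: mder_eq (mder_comp db (levY_der HD res_pos hre)) _.
  rewrite hb /Af (_ : 2 * X + (x - X) = x + X); last by ring.
  rewrite (_ : X + (x - X) = x); last by ring.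
  by rewrite -!scalemxAl scalerA x2_eps invfM.
exact: (levY_unit HD res_pos hre).
Qed.

Lemma local_sol (k : 'cV[C]_n) : 
  \forall x \near z0, solves_at (eps w) B (fun x => levY (br x) *m k) x.
Proof.
have [r r0 hr] := local_fund; apply/nbhsC; exists r => // x /hr[nz _ h _].
by apply/solves_at_mder => //; rewrite mulmxA; exact: mder_mulr.
Qed.

(** Every germ of solution is the Levelt solution times a constant vector, read off at the
    centre. *)
Lemma local_coef m (y : C -> 'M[C]_(n, m)) : (\forall x \near z0, solves_at (eps w) B y x) ->
  \forall x \near z0, y x = levY (br x) *m (invmx (levY v) *m y z0).
Proof.
move=> /nbhsC[r1 r10 hy]; have [r r0 hr] := local_fund.
have nz : z0 - X != 0 by rewrite -hv cexp_neq0.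
apply/nbhsC; exists (Num.min r r1); first by rewrite lt_min r0.
move=> x hx.
have : invmx (levY (br x)) *m y x = invmx (levY (br z0)) *m y z0.
  apply: (@solution_quotient _ _ _ (fun x => A x) (fun x => levY (br x))) => s /andP[s0 s1] z.
  have : cabs (z - z0) < Num.min r r1.
    apply: le_lt_trans hx; rewrite /z addrAC subrr add0r cabsM cabs_rc ger0_norm//.
    by rewrite ler_piMl// cabs_ge0.
  rewrite lt_min => /andP[hz1 hz2]; have [k1 _ k2 k3] := hr _ hz1.
  split=> //; first by apply/solves_at_mder => //; exact: hy.
  apply/nbhsC; exists (r - cabs (z - z0)); first by rewrite subr_gt0.
  move=> u hu; have hu' : cabs (u - z0) < r.
    by rewrite (_ : u - z0 = (u - z) + (z - z0)); [apply: (le_lt_trans (cabsD _ _)); lra|ring].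
  by have [] := hr _ hu'.
rewrite branch0// => <-.
by move: hx; rewrite lt_min => /andP[/hr[_ _ _ ux] _]; rewrite mulKVmx.
Qed.
End Local.

Variables (u0 x0 : C).
Hypothesis hu0 : cexp u0 = x0 - X.
Hypothesis hd0 : cabs (x0 - X) < d.
(** The logarithm of x - X followed continuously along the loop; it increases by [ctp l] in
    total. *)
Let ls (s : R) : C := u0 + rc s * ctp l.
Local Notation lp := (loop l w x0).

Lemma loopE s : cexp (ls s) = lp s - X.
Proof.
rewrite /loop addrAC subrr add0r /ls cexpD hu0 expi_cexp; congr (_ * cexp _).
by rewrite ctpE (rcM (orient R l * (2 * pi)) s) mulrA [rc s * _]mulrC.
Qed.

Lemma loop_dist s : cabs (lp s - X) < d.
Proof. by rewrite /loop addrAC subrr add0r cabsM cabs_expi mulr1. Qed.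

Lemma loop0 : lp 0 = x0.
Proof. by have := loopE 0; rewrite /ls rc0 mul0r addr0 hu0 => /addIr. Qed.

Lemma loop1 : lp 1 = x0.
Proof.
have := loopE 1; rewrite /ls rc1 mul1r /ctp cexpD cexp_2pi_int mulr1 hu0.
by move=> /addIr.
Qed.

Lemma branch_shift : exists2 r : R, 0 < r & forall s s' : R, `|s' - s| < r ->
  branch (ls s) (lp s) (lp s') = ls s'.
Proof.
have [r r0 hr] := clog_cexp_near; have c1 : 0 < 1 + cabs (ctp l : C) by rewrite ltr_wpDr// cabs_ge0.
exists (r / (1 + cabs (ctp l : C))); first by rewrite divr_gt0.
move=> s s'; rewrite (ltr_pdivlMr _ _ c1) => h; rewrite /branch -!loopE -cexpB.
have -> : ls s' - ls s = rc (s' - s) * ctp l by rewrite rcB /ls; ring.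
have [|_ ->] := hr (rc (s' - s) * ctp l).
  rewrite cabsM cabs_rc; by apply: le_lt_trans h; rewrite ler_wpM2l// lerDr.
by rewrite rcB /ls; ring.
Qed.

Lemma loop_cont s (e : R) : 0 < e -> exists2 r : R, 0 < r & forall s', `|s' - s| < r ->
  cabs (lp s' - lp s) < e.
Proof.
move=> e0; have [r r0 hr] := derive_cont (is_derive_cexp (ls s)) e0.
have c1 : 0 < 1 + cabs (ctp l : C) by rewrite ltr_wpDr// cabs_ge0.
exists (r / (1 + cabs (ctp l : C))); first by rewrite divr_gt0.
move=> s'; rewrite (ltr_pdivlMr _ _ c1) => h.
have -> : lp s' - lp s = cexp (ls s') - cexp (ls s) by rewrite !loopE; ring.
apply: hr; have -> : ls s' - ls s = rc (s' - s) * ctp l by rewrite rcB /ls; ring.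
by rewrite cabsM cabs_rc; apply: le_lt_trans h; rewrite ler_wpM2l// lerDr.
Qed.

(** The coefficient vector, computed with the logarithm carried along the loop, is locally constant
    in the parameter, so it is the same at both ends. *)
Lemma continued_coef (y0 y1 : C -> 'cV[C]_n) : continued fam w lp y0 y1 ->
  invmx (levY (u0 + ctp l)) *m y1 x0 = invmx (levY u0) *m y0 x0.
Proof.
move=> [f [hf1 hf2 hf3 hf4]].
pose v s : 'cV[C]_n := invmx (levY (ls s)) *m f s (lp s).
suff : v 1 = v 0.
  rewrite /v /ls rc1 mul1r rc0 mul0r addr0 loop0 loop1.
  by have := nbhs_singleton hf3; have := nbhs_singleton hf4; rewrite loop0 loop1 => -> ->.
have H s : 0 <= s <= 1 -> exists2 r : R, 0 < r &
    forall s', 0 <= s' <= 1 -> `|s' - s| < r -> v s' = v s.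
  move=> hs; have [r2 r20 hr2] := hf2 _ hs; have [r3 r30 hr3] := branch_shift.
  have := local_coef (loopE s) (loop_dist s) (hf1 _ hs) => /nbhsC[e1 e10 he1].
  have [r1 r10 hr1] := loop_cont s e10.
  exists (Num.min r1 (Num.min r2 r3)); first by rewrite !lt_min r10 r20.
  move=> s' hs'; rewrite !lt_min => /and3P[/hr1/he1 h1 /(hr2 _ hs') h2 /hr3 h3].
  have uY : levY (ls s') \in unitmx.
    apply: (levY_unit HD res_pos); rewrite -cabs_cexp loopE; exact: loop_dist.
  rewrite /v (nbhs_singleton h2) h1 h3; exact: mulKmx.
clearbody v; apply/matrixP => i j.
apply: (@locally_cst _ (fun s => v s i j)) => s /H[r r0 hr].
by exists r => // s' hs' h; rewrite (hr _ hs' h).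
Qed.

(** Conversely, one vector [k] against the moving branch gives an explicit chain of germs;
    neighbouring branches agree, as they are close and have the same exponential. *)
Lemma coef_continued (y0 y1 : C -> 'cV[C]_n) k :
  (\forall x \near x0, solves_at (eps w) B y0 x) ->
  (\forall x \near x0, solves_at (eps w) B y1 x) ->
  invmx (levY u0) *m y0 x0 = k -> invmx (levY (u0 + ctp l)) *m y1 x0 = k ->
  continued fam w lp y0 y1.
Proof.
move=> h0 h1 hk0 hk.
exists (fun s x => levY (branch (ls s) (lp s) x) *m k); split.
- by move=> s _; exact: (local_sol (loopE s) (loop_dist s)).
- move=> s _; have [r3 r30 hr3] := branch_shift.
  have [r r0 hr] := branch_near (loopE s).
  have [r1 r10 hr1] := loop_cont s r0.
  exists (Num.min r1 r3); first by rewrite lt_min r10.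
  move=> s' _; rewrite lt_min => /andP[/hr1 k1 /hr3 k3].
  have [r' r'0 hr'] := branch_near (loopE s').
  have [_ dd1] := hr _ k1.
  have k4 : cabs (lp s' - lp s') < r' by rewrite subrr cabs0.
  have [_ dd2] := hr' _ k4.
  have dd := is_derive_add dd1 (is_derive_opp dd2).
  have [r4 r40 hr4] := derive_cont dd (ltr01 : 0 < (1 : R)).
  have r5 : 0 < r - cabs (lp s' - lp s) by rewrite subr_gt0.
  apply/nbhsC; exists (Num.min (r - cabs (lp s' - lp s)) (Num.min r' r4)).
    by rewrite !lt_min r5 r'0.
  move=> x; rewrite !lt_min => /and3P[hx1 /hr'[hx2 _] /hr4 hx3].
  have hx4 : cabs (x - lp s) < r.
    by rewrite (_ : x - lp s = (x - lp s') + (lp s' - lp s)); [apply: (le_lt_trans (cabsD _ _)); lra|ring].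
  have [hx5 _] := hr _ hx4.
  have nz : lp s' - X != 0 by rewrite -loopE cexp_neq0.
  rewrite k3 (branch0 _ nz) subrr subr0 in hx3.
  have nx : x - X != 0 by rewrite -hx5 cexp_neq0.
  have : branch (ls s) (lp s) x - branch (ls s') (lp s') x = 0.
    by apply: cexp_eq1_small hx3 _; rewrite cexpB hx5 hx2 divff.
  by move/eqP; rewrite subr_eq0 => /eqP ->.
- have := local_coef hu0 hd0 h0; rewrite hk0 loop0 /ls rc0 mul0r addr0.
  by apply: filterS => x ->.
have e1 : cexp (u0 + ctp l) = x0 - X by rewrite cexpD /ctp cexp_2pi_int mulr1.
have := local_coef e1 hd0 h1; rewrite loop1 /ls rc1 mul1r hk.
by apply: filterS => x ->.
Qed.

Definition germ_coef (y : C -> 'cV[C]_n) : 'cV[C]_n := invmx (levY u0) *m y x0.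

Local Notation Mh := (eU mu (ctp l) *m eN Nh (ctp l)).

Lemma levY_u0 : levY u0 \in unitmx.
Proof. by apply: (levY_unit HD res_pos); rewrite -cabs_cexp hu0. Qed.

Lemma coefE (y : C -> 'cV[C]_n) : (\forall x \near x0, solves_at (eps w) B y x) ->
  \forall x \near x0, y x = levY (branch u0 x0 x) *m germ_coef y.
Proof. exact: local_coef. Qed.

Lemma Mh_unit : Mh \in unitmx.
Proof.
rewrite unitmx_mul eU_unit.
exact: (eN_unit (@pos_lt l n) (lev_hNh HD) res_pos).
Qed.

(** After one turn the Levelt solution gains the factor [Mh], so continuing y to c y means [Mh] k =
    c k for its coefficient k. *)
Lemma monodromy_eigenP (c : C) (y : C -> 'cV[C]_n) :
  monodromy_eigen fam l w x0 c y <->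
  [/\ \forall x \near x0, solves_at (eps w) B y x, germ_coef y != 0 & Mh *m germ_coef y = c *: germ_coef y].
Proof.
have hp : levY (u0 + ctp l) = levY u0 *m Mh by exact: (levY_period HD res_pos (oriz l) u0).
have uY := levY_u0; have uM := Mh_unit.
have E1 : invmx (levY (u0 + ctp l)) *m (c *: y x0) = invmx Mh *m (c *: germ_coef y).
  by rewrite hp (invmx_mul uY uM) -mulmxA -(scalemxAr c (invmx (levY u0))).
split=> -[h1 h2 h3]; split; try exact: h1.
- apply/eqP => h0; apply: h2; apply: filterS (coefE h1) => x ->; rewrite h0.
  exact: mulmx0.
- have h5 : invmx Mh *m (c *: germ_coef y) = germ_coef y := etrans (esym E1) (continued_coef h3).
  have h6 := congr1 (mulmx Mh) h5; rewrite (mulKVmx uM) in h6; exact: esym h6.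
- move=> h0; move/eqP: h2; apply; rewrite /germ_coef (nbhs_singleton h0); exact: mulmx0.
apply: (@coef_continued _ _ (germ_coef y)); [exact: h1| |exact: erefl|].
  apply: filterS h1 => x k1.
  by have := solves_mulr c%:M k1; under eq_fun do rewrite mul_mx_scalar.
by rewrite E1 -h3; exact: (mulKmx uM).
Qed.
End Monodromy.

                     

(** * Eigenvectors and Jordan blocks, triangular spectra *)

Section JordanForms.
Context {R : realType}.
Local Notation C := (Cplx R).

Lemma jordan_block_eigen p (a c : C) (v : 'cV[C]_p) : jordan_block p a *m v = c *: v ->
  forall r : 'I_p, (0 < r)%N -> v r 0 = 0.
Proof.
move=> h.
(* Row r of the eigenvector equation; the entry after the last one is read as 0. *)
have rec (r : 'I_p) : a * v r 0 + (if insub r.+1 is Some r' then v r' 0 else 0) = c * v r 0.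
  have := congr1 (fun M : 'cV[C]_p => M r 0) h; rewrite mxE [in RHS]mxE => <-.
  rewrite (bigD1 r)//= mxE eqxx; congr (_ + _).
  case: insubP => [r' _ hr'|hr].
    have rr : (r' == r) = false by rewrite -val_eqE /= hr' gtn_eqF.
    rewrite (bigD1 r')/= ?rr// mxE eq_sym rr hr' eqxx mul1r big1 ?addr0// => j /andP[j1 j2].
    rewrite mxE eq_sym (negPf j1); case: eqP => [jr|_]; last by rewrite mul0r.
    by case/eqP: j2; apply: ord_inj; rewrite jr -hr'.
  rewrite big1// => j j1; rewrite mxE eq_sym (negPf j1); case: eqP => [jr|_]; last by rewrite mul0r.
  by move: hr; rewrite -jr ltn_ord.
have [ac|ac] := eqVneq a c.
  move=> r r0; have hr : (r.-1 < p)%N by have := ltn_ord r; lia.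
  have := rec (Ordinal hr) => /=; rewrite prednK// ac -[RHS]addr0 => /addrI.
  by case: insubP => [r' _ hr'|]; [move=> <-; congr (v _ _); apply: ord_inj|rewrite ltn_ord].
have all0 m : forall r : 'I_p, (p <= r + m)%N -> v r 0 = 0.
  elim: m => [|m IH] r hm; first by have := ltn_ord r; lia.
  have := rec r; rewrite (_ : (if _ is Some _ then _ else _) = 0); last first.
    by case: insubP => // r' _ hr'; apply: IH; move: hr' => /= ->; lia.
  move/eqP; rewrite addr0 -subr_eq0 -mulrBl mulf_eq0 subr_eq0 (negPf ac) /= => /eqP //.
by move=> r _; apply: (all0 p); lia.
Qed.

Lemma tall_kernel (k k' : nat) (Z : 'M[C]_(k, k')) : (k < k')%N ->
  exists2 z : 'cV[C]_k', z != 0 & Z *m z = 0.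
Proof.
move=> h; have : kermx Z^T != 0.
  rewrite -mxrank_eq0 mxrank_ker subn_eq0 -ltnNge mxrank_tr.
  exact: leq_ltn_trans (rank_leq_row Z) h.
move=> /rowV0Pn[v /sub_kermxP hv v0]; exists v^T; first by rewrite -trmx0 (inj_eq trmx_inj).
by apply: trmx_inj; rewrite trmx_mul trmxK trmx0.
Qed.

(** The first vectors of the blocks give k independent eigenvectors. Conversely any eigenvector,
    whatever its eigenvalue, lives in their span by [jordan_block_eigen], so more than k of them are
    dependent by [tall_kernel]. *)
Lemma jordan_eigen n (A : 'M[C]_n) k : has_jordan_form A k ->
  (exists (V : 'M[C]_(n, k)) (a : 'I_k -> C), A *m V = V *m diag_mx (\row_i a i) /\
     forall z : 'cV[C]_k, V *m z = 0 -> z = 0) /\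
  (forall k' (U : 'M[C]_(n, k')) (c : 'I_k' -> C), A *m U = U *m diag_mx (\row_i c i) ->
     (forall z : 'cV[C]_k', U *m z = 0 -> z = 0) -> (k' <= k)%N).
Proof.
move=> [p [a [P [Q [p0 PQ QP ->]]]]].
set J := (\mxdiag_i _); pose fst i : 'I_(p i) := Ordinal (p0 i).
pose S := \mxcol_i (\matrix_(r < p i, j < k) ((i == j) && (r == fst i))%:R : 'M[C]_(p i, k)).
split.
  exists (P *m S), a; split.
    rewrite -!mulmxA (mulmxA Q) QP mul1mx; congr (_ *m _).
    rewrite /J /S mul_mxdiag_mxcol; apply/mxcolP => i; rewrite mxcolK -submxcol_mul mxcolK.
    apply/matrixP => r j; rewrite mul_mx_diag !mxE (bigD1 (fst i))//= big1 ?addr0.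
      rewrite !mxE eqxx andbT; have [<-|ij] := eqVneq i j; last by rewrite mulr0 mul0r.
      rewrite mulr1 /=; have [_|rf] := eqVneq r (fst i); first by rewrite mul1r.
      by rewrite mul0r.
    by move=> s sf; rewrite !mxE (negPf sf) andbF mulr0.
  move=> z hz; have : S *m z = 0.
    by have := congr1 (mulmx Q) hz; rewrite mulmx0 -mulmxA mulmxA QP mul1mx.
  move/mxcolP => hS; apply/matrixP => i j; rewrite ord1 [RHS]mxE.
  have := hS i; rewrite submxcol0 -submxcol_mul mxcolK => /matrixP/(_ (fst i) 0).
  rewrite !mxE (bigD1 i)//= !mxE !eqxx mul1r big1 ?addr0// => s si.
  by rewrite mxE eq_sym (negPf si) mul0r.
move=> k' U c hU inj; rewrite leqNgt; apply/negP => kk.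
(* Keeps only the first coordinate in each block; by the lemma on one block, [S *m Z] restores all
   of [Q *m U]. *)
pose Z : 'M[C]_(k, k') := \matrix_(i, j) submxcol (Q *m U) i (fst i) j.
have [z z0 hz] := tall_kernel Z kk; move/eqP: z0; apply; apply: inj.
suff -> : U = P *m (S *m Z) by rewrite -!mulmxA hz !mulmx0.
suff <- : Q *m U = S *m Z by rewrite mulmxA PQ mul1mx.
have hJ : J *m (Q *m U) = (Q *m U) *m diag_mx (\row_i c i).
  rewrite -[RHS]mulmxA -hU !mulmxA QP mul1mx -!mulmxA //.
apply/mxcolP => i; apply/matrixP => r j.
rewrite -[submxcol (S *m Z) i]submxcol_mul mxcolK [RHS]mxE.
have hj : jordan_block (p i) (a i) *m col j (submxcol (Q *m U) i) = c j *: col j (submxcol (Q *m U) i).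
  move/mxcolP/(_ i): hJ; rewrite -{1}(submxcolK (Q *m U)) /J mul_mxdiag_mxcol mxcolK.
  move=> h2; rewrite [X in _ *m X]colE mulmxA h2 -colE; apply/matrixP => s t.
  by rewrite mul_mx_diag !mxE [RHS]mulrC.
rewrite [RHS](bigD1 i)//= [X in _ = _ + X]big1 ?addr0 => [|s si]; last first.
  by rewrite mxE eq_sym (negPf si) mul0r.
rewrite [X in _ = X * _]mxE eqxx /= [Z i j]mxE; have [->|rf] := eqVneq r (fst i); first by rewrite mul1r.
have r0 : (0 < r)%N by rewrite lt0n; apply: contraNneq rf => r0; apply/eqP/ord_inj.
by have := jordan_block_eigen hj r0; rewrite mul0r mxE.
Qed.

Lemma diagonalizableE n (A : 'M[C]_n) : diagonalizable A <->
  exists2 P : 'M[C]_n, P \in unitmx & exists D, A = invmx P *m diag_mx D *m P.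
Proof.
split=> [[P uP hP]|[P uP [D ->]]].
  have [D ->] := diagonalizable_forLR uP hP.
  by exists P; [exact: uP|exists D; exact: conjVmx].
exists P; first exact: uP.
by apply/(diagonalizable_forLR uP); exists D; exact: esym (conjVmx _ uP).
Qed.

Lemma char_poly_similar n (A B Q : 'M[C]_n) : Q \in unitmx -> Q *m A = B *m Q ->
  char_poly A = char_poly B.
Proof.
move=> uQ h; have : map_mx polyC Q *m char_poly_mx A = char_poly_mx B *m map_mx polyC Q.
  by rewrite /char_poly_mx mulmxBr mulmxBl -!map_mxM h scalar_mxC.
move/(congr1 determinant); rewrite !det_mulmx det_map_mx mulrC => /mulIf; apply.
by rewrite polyC_eq0 -unitfE -unitmxE.
Qed.

Lemma char_poly_tr n (A : 'M[C]_n) : char_poly A^T = char_poly A.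
Proof.
rewrite /char_poly -[RHS]det_tr; congr (\det _); apply/matrixP => i j.
by rewrite !mxE eq_sym.
Qed.

Lemma mup_utri l n (A : 'M[C]_n) c : utri (pos l) A ->
  (1 < mup c (char_poly A))%N <-> exists i j, [/\ i != j, A i i = c & A j j = c].
Proof.
move=> tA; have -> : char_poly A = \prod_(i < n) ('X - (A i i)%:P).
  case: l tA => tA; first by rewrite char_poly_trig//; apply/is_trig_mxP => i j ij; apply: tA => /=; have := ltn_ord j; lia.
  rewrite -char_poly_tr char_poly_trig; first by apply: eq_bigr => i _; rewrite mxE.
  by apply/is_trig_mxP => i j ij; rewrite mxE tA.
rewrite -(big_map (fun i => A i i) xpredT (fun y => 'X - y%:P)) mu_prod_XsubC.
rewrite count_map -size_filter; set s := seq.filter _ _.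
have us : uniq s by rewrite filter_uniq// index_enum_uniq.
have ms i : (i \in s) = (A i i == c) by rewrite mem_filter /= mem_index_enum andbT.
split=> [|[i [j [ij hi hj]]]].
  move: us ms; case: s => [|i [|j s]]//= /andP[ij _] ms _; exists i, j.
  rewrite inE negb_or in ij; case/andP: ij => -> _; split=> //; apply/eqP; rewrite -ms !inE eqxx ?orbT//.
have : (size [:: i; j] <= size s)%N.
  apply: uniq_leq_size => [|x]; first by rewrite /= inE ij.
  by rewrite !inE => /orP[] /eqP ->; rewrite ms ?hi ?hj.
by [].
Qed.
Lemma utri_unit l n (A : 'M[C]_n) : utri (pos l) A -> (forall i, A i i != 0) -> A \in unitmx.
Proof.
move=> tA dA; rewrite unitmxE unitfE.
have -> : \det A = \prod_i A i i.
  case: l tA => tA.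
    by rewrite det_trig//; apply/is_trig_mxP => i j ij; apply: tA => /=; have := ltn_ord j; lia.
  rewrite -det_tr det_trig; first by apply: eq_bigr => i _; rewrite mxE.
  by apply/is_trig_mxP => i j ij; rewrite mxE tA.
by apply/prodf_neq0 => i _.
Qed.
End JordanForms.

(** * Consequences of the similarity: resonances, diagonalization, eigensolutions *)

Section LocalMonodromy.
Context {R : realType} (n : nat) (fam : ode_family R n).
Local Notation C := (Cplx R).
Local Notation Mx := 'M[C]_n.
Variables (l : side) (w : C).
Local Notation X := (xsing l w).
Local Notation mu := (mu fam l w).
Variables (d : R) (G G' : C -> Mx) (Nh : Mx) (mm : 'I_n -> 'I_n -> nat).
Hypothesis HD : lev_data fam l w d G G' Nh mm.
Hypothesis res_pos : forall q k (m : nat), (0 < m)%N -> mu q - mu k = m%:R ->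
  (pos l q < pos l k)%N.
Hypothesis mu_inj : injective mu.
Variables m Q : Mx.
Hypothesis hsim : similar_to_levelt mu Nh (pos l) (oriz l) m Q.
Local Notation levY := (levelt_sol fam l w G Nh).
Local Notation B := (Bmx fam (eps w)).
Local Notation c := (ctp l).
Local Notation Mh := (eU mu c *m eN Nh c).
Local Notation D := (Dhat fam l w).

Let uQ : Q \in unitmx. Proof. by case: hsim. Qed.

Lemma m_eq : m = invmx Q *m Mh *m Q. Proof. by have [] := hsim. Qed.

Lemma conj_eigen (t : 'cV[C]_n) a : m *m t = a *: t <-> Mh *m (Q *m t) = a *: (Q *m t).
Proof.
rewrite m_eq -!mulmxA (mulmxA (eU _ _)); split=> h.
  by have := congr1 (mulmx Q) h; rewrite (mulKVmx uQ) -(scalemxAr a).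
by rewrite h -(scalemxAr a) (mulKmx uQ).
Qed.

Lemma Mh_tri : utri (pos l) Mh.
Proof.
apply: (utri_mul (@utri_diag _ _ _ _)).
by move=> q k; exact: (eN_tri (lev_hNh HD) res_pos).
Qed.

Lemma Mh_diag i : Mh i i = cexp (mu i * c).
Proof.
have tN : utri (pos l) (eN Nh c) by move=> q k; exact: (eN_tri (lev_hNh HD) res_pos).
rewrite (utri_mul_diag (@pos_inj l n) i (@utri_diag _ _ _ _) tN).
by rewrite (eN_diag (@pos_lt l n) (lev_hNh HD) res_pos) !mxE eqxx mulr1 mulr1n.
Qed.

Lemma Dhat_entry i j : D i j = (i == j)%:R * cexp (mu i * c).
Proof. by rewrite Dhat_eU !mxE; case: eqP => [->|_]; rewrite ?mul1r ?mul0r. Qed.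

Lemma resonant_eigen : resonant fam l w <->
  exists i j, i != j /\ cexp (mu i * c) = cexp (mu j * c).
Proof.
split=> [[q [j [k [qj k0 h]]]]|[i [j [ij h]]]].
  by exists q, j; split=> //; exact: (eU_nat (oriz l) h).
have [/eqP|[k [k0 hk]]|[k [k0 hk]]] := eU_eq mu_inj (oriz1 l) h.
- by rewrite (negPf ij).
- by exists i, j, k.
by exists j, i, k; rewrite eq_sym.
Qed.

Lemma resonant_mup : resonant fam l w <-> exists a : C, (1 < mup a (char_poly m))%N.
Proof.
have -> : char_poly m = char_poly Mh.
  by apply: (char_poly_similar uQ); rewrite m_eq -mulmxA (mulKVmx uQ).
rewrite resonant_eigen; split=> [[i [j [ij h]]]|[a /(mup_utri _ Mh_tri)[i [j [ij hi hj]]]]].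
  by exists (cexp (mu i * c)); apply/(mup_utri _ Mh_tri); exists i, j; rewrite !Mh_diag.
by exists i, j; split=> //; rewrite -!Mh_diag hi hj.
Qed.

(** A nonzero entry of N is itself a resonance between two indices, distinct because their ranks
    differ. *)
Lemma nonresonant_Nh : ~ resonant fam l w -> Nh = 0.
Proof.
move=> nres; apply/matrixP => q k; rewrite [RHS]mxE; apply/eqP; apply/negP => /negP.
move=> /(lev_hNh HD)[m0 hm]; apply: nres; exists q, k, (mm q k); split=> //.
by have := res_pos m0 hm; apply: contraTneq => ->; rewrite ltnn.
Qed.

Lemma nonresonant_Mh : ~ resonant fam l w -> Mh = D.
Proof.
move=> /nonresonant_Nh h; rewrite Dhat_eU -[RHS]mulmx1; congr (_ *m _).
have := @eN_null _ _ Nh c _ (1%:M : Mx); rewrite !mulmx1; exact.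
Qed.

Lemma not_diag_resonant : ~ diagonalizable m -> resonant fam l w.
Proof.
move=> hd; have [//|/nonresonant_Mh h] := EM (resonant fam l w); exfalso; apply: hd.
apply/diagonalizableE; exists Q => //.
exists (\row_j cexp (rc (orient R l * (2 * pi)) * 'i * mu j)).
by rewrite m_eq h.
Qed.

Definition Ed : Mx := diag_mx (\row_i Q i i).
(** With N = 0, Q^{-1} diagonalizes the matrix; rescaling its columns by the diagonal of Q makes it
    unipotent and keeps the diagonalization. *)
Definition Tn : Mx := invmx Q *m Ed.

Lemma Ed_unit : Ed \in unitmx.
Proof. by apply: diag_unit => j; rewrite mxE; case: hsim. Qed.

Lemma Tn_unit : Tn \in unitmx.
Proof. by rewrite unitmx_mul unitmx_inv uQ Ed_unit. Qed.

Lemma Q_Tn : Q *m Tn = Ed. Proof. exact: mulKVmx. Qed.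

Lemma Tn_unitriangular : unitriangular l Tn.
Proof.
have [_ tQ dQ _] := hsim.
have tV : utri (pos l) (invmx Q).
  by apply: (utri_inv (@pos_inj l n)) => // i; rewrite unitfE.
apply/unitriangularP; split; last by apply: utri_mul => //; exact: utri_diag.
move=> i; rewrite (utri_mul_diag (@pos_inj l n) i tV (@utri_diag _ _ _ _)).
by rewrite [Ed i i]mxE eqxx mulr1n mxE -(utri_mul_diag (@pos_inj l n) i tV tQ) mulVmx// mxE eqxx.
Qed.

Section Nonresonant.
Hypothesis nres : ~ resonant fam l w.

Lemma D_inj i j : D i i = D j j -> i = j.
Proof.
rewrite !Dhat_entry !eqxx !mul1r => h; apply/eqP; apply/negP => /negP ij.
by apply: nres; apply/resonant_eigen; exists i, j.
Qed.

Lemma m_Tn : m *m Tn = Tn *m D.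
Proof.
rewrite m_eq (nonresonant_Mh nres) -(mulmxA _ Q) Q_Tn -(mulmxA (invmx Q)) -(mulmxA (invmx Q)).
by congr (_ *m _); rewrite /Ed /Dhat !mulmx_diag; congr diag_mx; apply/rowP => j; rewrite !mxE mulrC.
Qed.

Lemma Tn_diag : invmx Tn *m m *m Tn = D.
Proof. by rewrite -mulmxA m_Tn (mulKmx Tn_unit). Qed.

(** The quotient of two such matrices commutes with D, whose entries are distinct, so it is
    diagonal; unit diagonals make it the identity. *)
Lemma Tn_unique T' : unitriangular l T' -> invmx T' *m m *m T' = D -> T' = Tn.
Proof.
move=> /unitriangularP[d1 t1] h.
have uT : T' \in unitmx by apply: (utri_unit t1) => i; rewrite d1 oner_eq0.
have h2 : m *m T' = T' *m D by rewrite -h -!mulmxA mulKVmx.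
pose K := invmx Tn *m T'.
have hK : D *m K = K *m D.
  transitivity (invmx Tn *m m *m T'); last first.
    by rewrite /K -(mulmxA _ T') -h2 mulmxA.
  by rewrite -{1}Tn_diag /K -(mulmxA (invmx Tn *m m)) (mulKVmx Tn_unit).
have K0 i j : i != j -> K i j = 0.
  move=> ij; have := congr1 (fun M : Mx => M i j) hK; rewrite /= {1}/Dhat mul_diag_mx_entry.
  rewrite {1}/Dhat mul_mx_diag_entry [K i j * _]mulrC => /eqP; rewrite -subr_eq0 -mulrBl mulf_eq0.
  case/orP => [|/eqP //]; rewrite subr_eq0 => /eqP h3.
  by case/eqP: ij; apply: D_inj; rewrite /Dhat [in LHS]mxE [in RHS]mxE !eqxx.
have [d2 t2] := (unitriangularP _ _).1 Tn_unitriangular.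
have E : T' = Tn *m K by rewrite /K mulKVmx// Tn_unit.
have tK : utri (pos l) K.
  by move=> q k h3; apply: K0; apply: contraTneq h3 => ->; rewrite ltnn.
suff -> : T' = Tn *m 1%:M by rewrite mulmx1.
rewrite {1}E; congr (_ *m _); apply/matrixP => i j; rewrite [RHS]mxE.
have [<-|ij] := eqVneq i j; last exact: K0.
by have := d1 i; rewrite E (utri_mul_diag (@pos_inj l n) i t2 tK) d2 mul1r.
Qed.
End Nonresonant.

Variables (u0 x0 : C).
Hypothesis hu0 : cexp u0 = x0 - X.
Hypothesis hd0 : cabs (x0 - X) < d.
Variable Wd : C -> Mx.
Hypothesis hW : \forall x \near x0, Wd x = levY (branch l w u0 x0 x) *m Q.
Local Notation coef := (germ_coef fam l w G Nh u0 x0).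
Let uY : levY u0 \in unitmx := levY_u0 HD res_pos hu0 hd0.

Lemma near_solves p (Y Z : C -> 'M[C]_(n, p)) : (\forall x \near x0, Y x = Z x) ->
  (\forall x \near x0, solves_at (eps w) B Z x) -> \forall x \near x0, solves_at (eps w) B Y x.
Proof.
move=> /nbhsC[r r0 hr] h2.
have : \forall x \near x0, cabs (x - x0) < r by apply/nbhsC; exists r.
apply: filterS2 h2 => x [h3 h4] hx.
have hn : \forall y \near x, Z y = Y y.
  apply/nbhsC; exists (r - cabs (x - x0)); first by rewrite subr_gt0.
  move=> y hy; rewrite hr// (_ : y - x0 = (y - x) + (x - x0)); last by ring.
  by apply: (le_lt_trans (cabsD _ _)); lra.
have h5 : mder Z x (Defs.derive_mx Z x) by apply/mderP.
have /mderP[h6 h7] := mder_near hn h5; split; first exact: h6.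
by rewrite h7 h4 -(nbhs_singleton hn).
Qed.

Lemma Wd0 : Wd x0 = levY u0 *m Q.
Proof.
have nz : x0 - X != 0 by rewrite -hu0 cexp_neq0.
by rewrite (nbhs_singleton hW) (branch0 _ nz).
Qed.

Lemma levYQ_solves : \forall x \near x0, solves_at (eps w) B (fun x => levY (branch l w u0 x0 x) *m Q) x.
Proof.
have [r r0 hr] := local_fund HD res_pos hu0 hd0; apply/nbhsC; exists r => // x /hr[nz _ h _].
by apply/(solves_at_mder _ _ nz); rewrite mulmxA; exact: mder_mulr.
Qed.

Lemma Wd_solves : \forall x \near x0, solves_at (eps w) B Wd x.
Proof. exact: near_solves hW levYQ_solves. Qed.

Lemma Wd_unit : \forall x \near x0, Wd x \in unitmx.
Proof.
have [r r0 hr] := local_fund HD res_pos hu0 hd0.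
have : \forall x \near x0, cabs (x - x0) < r by apply/nbhsC; exists r.
by apply: filterS2 hW => x -> /hr[_ _ _ h]; rewrite unitmx_mul h uQ.
Qed.

Lemma Wd_mulr_solves p (K : 'M[C]_(n, p)) :
  \forall x \near x0, solves_at (eps w) B (fun x => Wd x *m K) x.
Proof. by apply: filterS Wd_solves => x; exact: solves_mulr. Qed.

Lemma coefW (t : 'cV[C]_n) : coef (fun x => Wd x *m t) = Q *m t.
Proof. by rewrite /germ_coef Wd0 -mulmxA; exact: mulKmx. Qed.

Lemma mulQ_eq0 (t : 'cV[C]_n) : (Q *m t == 0) = (t == 0).
Proof.
apply/eqP/eqP => [h|->]; last exact: mulmx0.
by rewrite -(mulKmx uQ t) h mulmx0.
Qed.

Lemma W_eigenP (t : 'cV[C]_n) a :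
  (t != 0 /\ m *m t = a *: t) <-> monodromy_eigen fam l w x0 a (fun x => Wd x *m t).
Proof.
split=> [[t0 /conj_eigen ht]|/(monodromy_eigenP HD res_pos hu0 hd0)[_]].
  apply/(monodromy_eigenP HD res_pos hu0 hd0); rewrite coefW mulQ_eq0; split=> //.
  exact: Wd_mulr_solves.
by rewrite coefW mulQ_eq0 => -> h; split=> //; apply/conj_eigen.
Qed.

Lemma col_mulmx p r (A : 'M[C]_(n, p)) (K : 'M[C]_(p, r)) j : col j (A *m K) = A *m col j K.
Proof. by rewrite !colE mulmxA. Qed.

(** Coefficient vectors transport independent eigensolutions to independent eigenvectors of the
    monodromy matrix and back. *)
Lemma number_eigen k : has_jordan_form m k -> number_eigensolutions fam l w x0 k.
Proof.
move=> /jordan_eigen[[V [a [hV inj]]] hmax]; split.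
  exists (fun i x => Wd x *m col i V); split.
    move=> b /nbhs_singleton hb.
    have h0 : Wd x0 *m (V *m \col_i b i) = 0.
      rewrite -hb mulmxA; apply/matrixP => i j; rewrite [LHS]mxE summxE; apply: eq_bigr => s _.
      by rewrite -col_mulmx !mxE mulrC.
    have : V *m (\col_i b i) = 0.
      by rewrite -(mulKmx (nbhs_singleton Wd_unit) (V *m _)) h0 mulmx0.
    by move/inj => h i; have := congr1 (fun M : 'cV[C]_k => M i 0) h; rewrite !mxE.
  move=> i; exists (a i); apply/W_eigenP; split.
    apply/eqP => h; have := inj (delta_mx i 0); rewrite -colE => /(_ h).
    by move/matrixP/(_ i 0); rewrite !mxE !eqxx => /eqP; rewrite oner_eq0.
  rewrite -col_mulmx hV; apply/matrixP => r s.
  by rewrite mul_mx_diag !mxE mulrC.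
move=> k' y [ind eig].
have [b hb] := choice eig.
pose U : 'M[C]_(n, k') := \matrix_(r, i) (invmx Q *m coef (y i)) r 0.
have cU i : col i U = invmx Q *m coef (y i) by apply/matrixP => r s; rewrite !mxE ord1.
have hy i := (monodromy_eigenP HD res_pos hu0 hd0 _ _).1 (hb i).
apply: (hmax k' U b).
  apply/matrixP => r i; rewrite mul_mx_diag [RHS]mxE.
  have [_ _ h3] := hy i.
  have : m *m col i U = b i *: col i U by apply/conj_eigen; rewrite cU mulKVmx.
  rewrite -col_mulmx => /matrixP/(_ r 0); rewrite [LHS]mxE => ->.
  by rewrite !mxE mulrC.
move=> z hz; apply/matrixP => i j; rewrite ord1 [RHS]mxE.
apply: (ind (fun i => z i 0)).
have hall : \forall x \near x0, forall i, y i x = levY (branch l w u0 x0 x) *m coef (y i).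
  apply: (@filter_forall _ _ (fun s x => y s x = levY (branch l w u0 x0 x) *m coef (y s)) _
    (nbhs_filter x0)) => s; have [h1 _ _] := hy s.
  exact: (coefE HD res_pos hu0 hd0 h1).
apply: filterS hall => x hx.
have E : \sum_s z s 0 *: coef (y s) = Q *m (U *m z).
  rewrite mulmxA; apply/matrixP => r t; rewrite summxE ord1 mxE; apply: eq_bigr => s _.
  rewrite mulrC -[in LHS](mulKVmx uQ (coef (y s))) -cU -col_mulmx !mxE; congr (_ * _).
transitivity (levY (branch l w u0 x0 x) *m \sum_s z s 0 *: coef (y s)); last by rewrite E hz !mulmx0.
by rewrite mulmx_sumr; apply: eq_bigr => s _; rewrite hx scalemxAr.
Qed.
End LocalMonodromy.

(** * Uniqueness of the basis of eigensolutions without resonance *)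

Section LocalBasis.
Context {R : realType} (n : nat) (fam : ode_family R n).
Local Notation C := (Cplx R).
Local Notation Mx := 'M[C]_n.
Variables (l : side) (w : C).
Local Notation X := (xsing l w).
Local Notation mu := (mu fam l w).
Variables (d : R) (G G' : C -> Mx) (Nh : Mx) (mm : 'I_n -> 'I_n -> nat).
Hypothesis HD : lev_data fam l w d G G' Nh mm.
Hypothesis res_pos : forall q k (m : nat), (0 < m)%N -> mu q - mu k = m%:R ->
  (pos l q < pos l k)%N.
Hypothesis mu_inj : injective mu.
Variables m Q : Mx.
Hypothesis hsim : similar_to_levelt mu Nh (pos l) (oriz l) m Q.
Local Notation levY := (levelt_sol fam l w G Nh).
Local Notation B := (Bmx fam (eps w)).
Local Notation c := (ctp l).
Local Notation Mh := (eU mu c *m eN Nh c).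
Local Notation D := (Dhat fam l w).


Hypothesis nres : ~ resonant fam l w.
Variables (u0 x0 : C).
Hypothesis hu0 : cexp u0 = x0 - X.
Hypothesis hd0 : cabs (x0 - X) < d.
Variable Wd : C -> Mx.
Hypothesis hW : \forall x \near x0, Wd x = levY (branch l w u0 x0 x) *m Q.
Local Notation T := (Tn Q).
Local Notation coef := (germ_coef fam l w G Nh u0 x0).

Lemma diag_eigen (v : 'cV[C]_n) a : v != 0 -> D *m v = a *: v ->
  exists q, [/\ a = D q q, v q 0 != 0 & v = v q 0 *: delta_mx q 0].
Proof.
move=> /matrix0Pn[q [z]]; rewrite ord1 => vq h.
have ent r : v r 0 != 0 -> a = D r r.
  move=> vr; have := congr1 (fun M : 'cV[C]_n => M r 0) h.
  rewrite /= {1}/Dhat mul_diag_mx_entry [in RHS]mxE => /(mulIf vr) <-.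
  by rewrite !mxE eqxx.
exists q; split=> //; first exact: ent.
apply/matrixP => r z'; rewrite ord1 !mxE eqxx andbT.
have [->|rq] := eqVneq r q; first by rewrite mulr1.
rewrite mulr0; apply/eqP; apply/negP => /negP /ent h1; case/eqP: rq.
by apply: (D_inj mu_inj nres); rewrite -h1; exact: ent.
Qed.

Lemma floquet_basis_local :
  [/\ (\forall x \near x0, solves_at (eps w) B (fun z => Wd z *m T) x /\ Wd x *m T \in unitmx),
      (forall j, monodromy_eigen fam l w x0 (D j j) (fun x => col j (Wd x *m T))) &
      (forall Y : C -> Mx,
         (\forall x \near x0, solves_at (eps w) B Y x /\ Y x \in unitmx) ->
         (forall j, exists a : C, monodromy_eigen fam l w x0 a (fun x => col j (Y x))) ->
         exists p : 'S_n, forall j,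
           monodromy_eigen fam l w x0 (D (p j) (p j)) (fun x => col j (Y x)) /\
           exists2 a : C, a != 0 &
             \forall x \near x0, col j (Y x) = a *: col (p j) (Wd x *m T))].
Proof.
have [uQ _ dQ _] := hsim.
have uT := Tn_unit hsim.
have [d1 _] := Tn_unitriangular hsim.
split.
- have h1 := Wd_mulr_solves HD res_pos hu0 hd0 hW T.
  have h2 := Wd_unit HD res_pos hsim hu0 hd0 hW.
  by apply: filterS2 h1 h2 => x k1 k2; split; [exact: k1|rewrite unitmx_mul k2 uT].
- move=> j; under eq_fun do rewrite col_mulmx.
  apply/(W_eigenP HD res_pos hsim hu0 hd0 hW); split.
    apply/eqP => /matrixP/(_ j 0); rewrite [LHS]mxE [RHS]mxE => h.
    by have := d1 j; rewrite h => /esym/eqP; rewrite oner_eq0.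
  rewrite -col_mulmx (m_Tn HD res_pos hsim nres); apply/matrixP => r z.
  by rewrite mxE {1}/Dhat mul_mx_diag_entry !mxE eqxx mulr1n mulrC.
move=> Y hY eig; have [a ha] := choice eig.
have hy i := (monodromy_eigenP HD res_pos hu0 hd0 _ _).1 (ha i).
have hMh := nonresonant_Mh HD res_pos nres.
have hq i : exists q, a i = D q q /\ exists2 b, b != 0 & coef (fun x => col i (Y x)) = b *: delta_mx q 0.
  have [_ h2 h3] := hy i; rewrite hMh in h3; have [q [k1 k2 k3]] := diag_eigen h2 h3.
  by exists q; split=> //; exists (coef (fun x => col i (Y x)) q 0).
have [p hp] := choice hq.
have near_y i : \forall x \near x0, col i (Y x) = levY (branch l w u0 x0 x) *m coef (fun x => col i (Y x)).
  by have [h1 _ _] := hy i; exact: (coefE HD res_pos hu0 hd0 h1).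
(* Two columns with the same index would be proportional, contradicting the invertibility of
   [Y x0]. *)
have pinj : injective p.
  move=> i j pij; apply/eqP; apply/negP => /negP ij.
  have [_ [bi bi0 hbi]] := hp i; have [_ [bj bj0 hbj]] := hp j.
  have Ei := nbhs_singleton (near_y i); have Ej := nbhs_singleton (near_y j).
  rewrite hbi in Ei; rewrite hbj -pij in Ej.
  have uY0 : Y x0 \in unitmx by have [] := nbhs_singleton hY.
  pose z : 'cV[C]_n := bj *: delta_mx i 0 - bi *: delta_mx j 0.
  have hz : Y x0 *m z = 0.
    rewrite mulmxBr -!scalemxAr -!colE Ei Ej -!scalemxAr !scalerA [bj * bi]mulrC.
    exact: subrr.
  have z0 : z = 0 by rewrite -(mulKmx uY0 z) hz mulmx0.
  have := congr1 (fun M : 'cV[C]_n => M i 0) z0; rewrite !mxE !eqxx (negPf ij) /= mulr1 mulr0 subr0.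
  by move/eqP; rewrite (negPf bj0).
exists (perm pinj) => j; rewrite permE.
have [h1 [b b0 h2]] := hp j; split; first by rewrite -h1; exact: ha.
exists (b / Q (p j) (p j)); first by rewrite mulf_neq0 ?invr_eq0 ?dQ.
apply: filterS2 hW (near_y j) => x -> ->; rewrite h2 -mulmxA (Q_Tn hsim) col_mulmx.
have -> : col (p j) (Ed Q) = Q (p j) (p j) *: delta_mx (p j) 0.
  apply/matrixP => r z; rewrite !mxE ord1 eqxx andbT; case: eqP => [->|_]; rewrite ?mulr1n ?mulr1 ?mulr0n ?mulr0//.
by rewrite -!scalemxAr scalerA divfK.
Qed.
End LocalBasis.

                                          

(** * Floquet solutions from null vectors of N *)

Section Floquet.
Context {R : realType} (n : nat) (fam : ode_family R n).
Local Notation C := (Cplx R).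
Local Notation Mx := 'M[C]_n.
Variables (g : geometry R) (l : side) (w : C).
Local Notation X := (xsing l w).
Local Notation mu := (mu fam l w).
Variables (d : R) (G G' : C -> Mx) (Nh : Mx) (mm : 'I_n -> 'I_n -> nat).
Hypothesis HD : lev_data fam l w d G G' Nh mm.
Hypothesis res_pos : forall q k (m : nat), (0 < m)%N -> mu q - mu k = m%:R ->
  (pos l q < pos l k)%N.
Local Notation levY := (levelt_sol fam l w G Nh).
Local Notation B := (Bmx fam (eps w)).
Variable dv : R.
Hypothesis hp : punctured g l w dv.
Hypothesis dv_d : dv <= d.

Lemma near_lip (f : C -> C) z k : is_derive z (1 : C) f k ->
  exists M : R, \forall u \near z, cabs (f u - f z) <= M * cabs (u - z).
Proof.
move=> /is_deriveC /(_ 1 ltr01)[r r0 hr]; exists (1 + cabs k).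
apply/nbhsC; exists r => // u hu; have := hr _ hu; rewrite mul1r (_ : z + (u - z) = u); last by ring.
move=> h.
rewrite (_ : f u - f z = (f u - f z - (u - z) * k) + (u - z) * k); last by ring.
by apply: (le_trans (cabsD _ _)); rewrite cabsM; lra.
Qed.

Lemma G_mder x : cabs (x - X) < d -> mder (fun x => G (x - X)) x (G' (x - X)) /\ G (x - X) \in unitmx.
Proof.
have [_ _ hG _ _] := HD => /hG[h1 h2]; split=> //.
have dB : is_derive x (1 : C) (fun x => x - X) (1 + 0).
  exact: is_derive_add (is_derive_var x) (is_derive_const (- X) x).
by have := mder_comp dB h1; rewrite addr0 scale1r.
Qed.

Lemma sol_mder (v : 'cV[C]_n) u : expR (cre u) < d ->
  mder (fun u => levY u *m v) u (Af fam l w (cexp u) *m (levY u *m v)) /\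
  forall p (Y : C -> 'M[C]_(n, p)),
    (Defs.derivable_mx Y u /\ ((X + cexp u) ^+ 2 - eps w) *: Defs.derive_mx Y u =
      (X + cexp u - X) *: (B (X + cexp u) *m Y u)) <-> mder Y u (Af fam l w (cexp u) *m Y u).
Proof.
move=> hu; split; first by rewrite mulmxA; exact: mder_mulr (levY_der HD res_pos hu).
move=> p Y; have hc : cabs (X + cexp u - X) < d by rewrite addrAC subrr add0r cabs_cexp.
have nz := near_sing HD hc; have nc := cexp_neq0 u.
have e1 : (X + cexp u) ^+ 2 - eps w = cexp u * (X + cexp u + X) by rewrite (x2_eps l); ring.
have e2 : X + cexp u - X = cexp u by ring.
have e3 : 2 * X + cexp u = X + cexp u + X by ring.
have nzz : cexp u * (X + cexp u + X) != 0 by rewrite mulf_neq0.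
rewrite e1 e2 /Af e3; split=> [[h1 h2]|/mderP[h1 h2]].
  apply/mderP; split=> //; rewrite -scalemxAl.
  have := congr1 (fun M => (cexp u * (X + cexp u + X))^-1 *: M) h2.
  rewrite scalerA (mulVf nzz) scale1r => ->; rewrite scalerA; congr (_ *: _).
  by rewrite invfM mulrAC mulVf// mul1r.
by split=> //; rewrite h2 -scalemxAl scalerA mulfK.
Qed.

Lemma sol_around (v : 'cV[C]_n) : solution_around fam l w dv (fun u => levY u *m v).
Proof.
move=> u hu x; have hu' := lt_le_trans hu dv_d; have [h1 h2] := sol_mder v hu'.
exact: ((h2 _ _).2 h1).
Qed.

(** The analytic vector left after y^{mu_j} is factored out of G e^{diag(mu) u} b, when the
    exponents on the support of b exceed mu_j by the natural numbers [e]. *)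
Definition mono (b : 'cV[C]_n) (e : 'I_n -> nat) (x : C) : 'cV[C]_n :=
  G (x - X) *m (\col_q (b q 0 * (x - X) ^+ e q)).

Lemma mono_mder b e x : cabs (x - X) < d -> exists M, mder (mono b e) x M.
Proof.
move=> /G_mder[h1 _].
have h2 : mder (fun x => \col_q (b q 0 * (x - X) ^+ e q) : 'cV[C]_n) x
    (\col_q (b q 0 * ((e q)%:R * (x - X) ^+ (e q).-1))).
  move=> q z; rewrite mxE; under eq_fun do rewrite mxE.
  have dB : is_derive x (1 : C) (fun x => x - X) (1 + 0).
    exact: is_derive_add (is_derive_var x) (is_derive_const (- X) x).
  have h := is_derive_mul (is_derive_const (b q 0) x) (is_derive_compC dB (is_derive_pow (x - X) (e q))).
  by apply: is_derive_eq h _; ring.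
by eexists; exact: mder_mul h1 h2.
Qed.

Lemma mono_derivable b e x : cabs (x - X) < d -> Defs.derivable_mx (mono b e) x.
Proof. by move=> /(mono_mder b e)[M /mderP[]]. Qed.

Lemma eU_mono (b : 'cV[C]_n) (e : 'I_n -> nat) j u :
  (forall q, b q 0 != 0 -> mu q - mu j = (e q)%:R) ->
  G (cexp u) *m (eU mu u *m b) = cexp (mu j * u) *: mono b e (X + cexp u).
Proof.
move=> h; rewrite /mono (_ : X + cexp u - X = cexp u); last by ring.
rewrite scalemxAr; congr (_ *m _); apply/matrixP => q z.
rewrite mul_diag_mx_entry ord1 !mxE.
have [->|bq] := eqVneq (b q 0) 0; first by rewrite mul0r !mulr0.
have -> : mu q = mu j + (e q)%:R by rewrite -(h _ bq); ring.
by rewrite mulrDl cexpD mulr_natl cexpMn; ring.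
Qed.

(** N v = 0 removes e^{N u}, and the support of v makes every other power of y positive, so the
    analytic factor starts with e_j. *)
Lemma floquet_nullvec j v : nullvec mu Nh j v -> floquet fam g l w j dv (fun u => levY u *m v).
Proof.
move=> [hN hj hv]; split=> //.
have H q : exists k : nat, v q 0 != 0 -> mu q - mu j = k%:R /\ (q != j -> (0 < k)%N).
  have [vq|/hv[->|[k [k0 hk]]]] := eqVneq (v q 0) 0; first by exists 0%N.
    by exists 0%N; rewrite subrr eqxx.
  by exists k.
have [e he] := choice H.
have ej : e j = 0%N.
  have [|h _] := he j; first by rewrite hj oner_eq0.
  by apply/eqP; move/eqP: h; rewrite subrr eq_sym pnatr_eq0.
exists (mono v e); split.
- by move=> x; rewrite normE rc_lt => hx; apply: mono_derivable; exact: lt_le_trans hx dv_d.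
- have [/andP[d0 _] G0 _ _ _] := HD.
  have X0 : cabs (X - X) < d by rewrite subrr cabs0.
  have [M hM] := mono_mder v e X0.
  have hMi i : exists K : R, \forall x \near X, cabs (mono v e x i 0 - mono v e X i 0) <= K * cabs (x - X).
    exact: near_lip (hM i 0).
  have [K hK] := choice hMi; exists (\sum_i `|K i|).
  apply: filterS (@filter_forall _ _ _ _ (nbhs_filter X) hK) => x hx i.
  have -> : (i == j)%:R = mono v e X i 0.
    rewrite /mono subrr G0 mul1mx mxE; have [->|ij] := eqVneq i j.
      by rewrite ej expr0 mulr1 hj.
    have [->|vi] := eqVneq (v i 0) 0; first by rewrite mul0r.
    by have [_ /(_ ij) e0] := he _ vi; rewrite expr0n gtn_eqF// mulr0.
  rewrite !normE -rcM rc_le; apply: (le_trans (hx i)); rewrite ler_wpM2r ?cabs_ge0//.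
  rewrite (bigD1 i)//=; apply: (le_trans (ler_norm _)); rewrite lerDl sumr_ge0//.
- move=> u hu; rewrite -(eU_mono (j := j)) => [|q /he[]//].
  by rewrite /levelt_sol -mulmxA -mulmxA eN_null.
exact: sol_around.
Qed.

(** A half-plane of logarithms is convex, so a solution around [X] has one coefficient vector on all
    of it. *)
Lemma sol_coef (d0 : R) (Y : C -> 'cV[C]_n) : d0 <= d -> solution_around fam l w d0 Y ->
  forall u u', expR (cre u) < d0 -> expR (cre u') < d0 ->
  invmx (levY u') *m Y u' = invmx (levY u) *m Y u.
Proof.
move=> hd hY u u' hu hu'.
have dom (s : R) : 0 <= s <= 1 -> expR (cre (u + rc s * (u' - u))) < d0.
  have d00 : 0 < d0 := lt_trans (expR_gt0 _) hu.
  move: hu hu'; rewrite -[d0]lnK ?posrE// !ltr_expR creD cre_rcM creB => h1 h2 /andP[s0 s1].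
  exact: seg_lt.
apply: (@solution_quotient _ _ _ (fun u => Af fam l w (cexp u)) levY) => s s01 z.
have hz := dom _ s01; have hzd := lt_le_trans hz hd.
have [_ h2] := sol_mder (0 : 'cV[C]_n) hzd.
split; first exact: (levY_der HD res_pos hzd).
  by apply/h2; exact: hY.
have dz : 0 < d - cabs (cexp z) by rewrite subr_gt0 cabs_cexp.
have [r r0 hr] := derive_cont (is_derive_cexp z) dz.
apply/nbhsC; exists r; first by [].
move=> y /hr hy; apply: (levY_unit HD res_pos); rewrite -cabs_cexp.
have := cabsD (cexp y - cexp z) (cexp z); rewrite subrK; lra.
Qed.
End Floquet.

Lemma conj_transfer (K : fieldType) n (P Q M D : 'M[K]_n) : P \in unitmx -> Q \in unitmx ->
  invmx P *m D *m P = invmx Q *m M *m Q -> P *m invmx Q *m M = D *m (P *m invmx Q).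
Proof.
move=> uP uQ h.
have E1 : P *m (invmx Q *m M *m Q) = D *m P by rewrite -h -(mulmxA (invmx P)) (mulKVmx uP).
by rewrite (mulmxA D) -E1 -!mulmxA (mulmxV uQ) mulmx1.
Qed.

(** * Existence of Floquet solutions and logarithmic terms *)

Section Resonance.
Context {R : realType} (n : nat) (fam : ode_family R n).
Local Notation C := (Cplx R).
Local Notation Mx := 'M[C]_n.
Variables (g : geometry R) (l : side) (w : C).
Local Notation X := (xsing l w).
Local Notation E := (Ee l w).
Local Notation mu := (mu fam l w).
Local Notation T := (thetah g w).
Local Notation lamX q := (lam fam q (eps w) X).
Hypothesis cosT : 0 < cos T.
Hypothesis a_gt0 : 0 < pull g w.
Hypothesis h_gt0 : 0 < g_h g.
Hypothesis kap01 : 0 < g_kappa g < 2^-1.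
Hypothesis c0_gt0 : 0 < g_c0 g.
Hypothesis s_lt_r : cabs (sqrt_eps w) < g_r g.
Hypothesis star : g_h g + bend g w * `|tan T| < (2^-1 - g_kappa g) * Qoff g w.
Variables (d : R) (G G' : C -> Mx) (Nh : Mx) (mm : 'I_n -> 'I_n -> nat).
Hypothesis HD : lev_data fam l w d G G' Nh mm.
Hypothesis res_pos : forall q k (m : nat), (0 < m)%N -> mu q - mu k = m%:R ->
  (pos l q < pos l k)%N.
Hypothesis order : forall q j : 'I_n, (pos l q < pos l j)%N ->
  ori l * cre (expi T * (lamX q - lamX j)) < 0.
Hypothesis mu_inj : injective mu.
Hypothesis n_gt1 : (1 < n)%N.
Local Notation levY := (levelt_sol fam l w G Nh).
Local Notation c := (ctp l).
Local Notation Mh := (eU mu c *m eN Nh c).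

Lemma floquet_monodromy (d0 : R) (Y : C -> 'cV[C]_n) j u : floquet fam g l w j d0 Y ->
  expR (cre u) < d0 -> Y (u + c) = cexp (mu j * c) *: Y u.
Proof.
move=> [_ [G0 [_ _ hY _]]] hu.
have e1 : cexp (u + c) = cexp u by rewrite cexpD /ctp cexp_2pi_int mulr1.
rewrite hY; last by rewrite -cabs_cexp e1 cabs_cexp.
by rewrite (hY u hu) e1 mulrDr cexpD scalerA mulrC.
Qed.

(** The coefficient vector of a Floquet solution is an eigenvector of the Levelt monodromy by
    periodicity of its analytic factor. The limit e_j of that factor makes it triangular with j-th
    entry 1, through [asymp_tri]; [eigen_nullvec] then applies. *)
Lemma floquet_exists_nullvec j : floquet_exists fam g l w j -> exists v, nullvec mu Nh j v.
Proof.
move=> [d0 [Y hfl]]; have [[d00 _] [G0 [_ [M hM] hY hsol]]] := hfl.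
have [/andP[dp _] _ hG _ _] := HD.
pose d' := Num.min d d0; have d'0 : 0 < d' by rewrite lt_min dp.
have d'd : d' <= d by rewrite ge_min lexx.
have d'd0 : d' <= d0 by rewrite ge_min lexx orbT.
have hsol' : solution_around fam l w d' Y.
  by move=> u hu; apply: hsol; exact: lt_le_trans hu d'd0.
have h12 : 0 < (2^-1 : R) by rewrite invr_gt0 ltr0n.
have hE0 := tray_E0 l cosT a_gt0; have hx0 := ccvg_E_x l cosT a_gt0 s_lt_r.
have [N1 hN1] := hE0 _ h12; have [N2 hN2] := hx0 _ d'0.
pose N0 := maxn N1 N2; pose t N := tray g l w (vmid g l w) (N0 + N).
have tE N : cabs (E (t N)) <= 2^-1.
  have := hN1 (N0 + N)%N; rewrite subr0 => h; apply/ltW/h.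
  by apply: leq_trans (leq_maxl _ _) (leq_addr _ _).
pose u N := ucoord l w (t N).
have cu N : cexp (u N) = xt w (t N) - X := cexp_ucoord (tE N).
have hu N : expR (cre (u N)) < d'.
  rewrite -cabs_cexp cu; apply: hN2.
  by apply: leq_trans (leq_maxr _ _) (leq_addr _ _).
have hx : ccvg (fun N => xt w (t N)) X := ccvg_drop N0 hx0.
have hy : ccvg (fun N => xt w (t N) - X) 0.
  by have := ccvgD hx (ccvg_cst (- X)); rewrite subrr.
pose v := invmx (levY (u 0%N)) *m Y (u 0%N).
have uY z : expR (cre z) < d' -> levY z \in unitmx.
  by move=> hz; apply: (levY_unit HD res_pos); exact: lt_le_trans hz d'd.
have Yv z : expR (cre z) < d' -> Y z = levY z *m v.
  by move=> hz; rewrite /v -(sol_coef HD res_pos d'd hsol' (hu 0%N) hz) (mulKVmx (uY _ hz)).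
have hMv : Mh *m v = cexp (mu j * c) *: v.
  have h0 := hu 0%N.
  have h1 : expR (cre (u 0%N + c)) < d'.
    by rewrite -cabs_cexp cexpD /ctp cexp_2pi_int mulr1 cabs_cexp.
  have := floquet_monodromy hfl (lt_le_trans h0 d'd0); rewrite (Yv _ h1) (Yv _ h0).
  have -> : levY (u 0%N + c) = levY (u 0%N) *m Mh := levY_period HD res_pos (oriz l) (u 0%N).
  move=> h2; have h3 : levY (u 0%N) *m (Mh *m v) = levY (u 0%N) *m (cexp (mu j * c) *: v).
    exact: etrans (mulmxA _ _ _) (etrans h2 (scalemxAr _ _ _)).
  by rewrite -(mulKmx (uY _ h0) (Mh *m v)) h3 (mulKmx (uY _ h0)).
have hG0 i : ccvg (fun N => G0 (xt w (t N)) i 0) (i == j)%:R.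
  move/nbhsC: hM => [r r0 hr] e e0.
  have M0 : 0 < `|M| + 1 by rewrite ltr_wpDl.
  have er : 0 < Num.min r (e / (`|M| + 1)) by rewrite lt_min r0 divr_gt0.
  have [N hN] := hx _ er; exists N => k /hN; rewrite lt_min => /andP[/hr/(_ i) h1 h2].
  move: h1; rewrite !normE -rcM rc_le => h1; apply: le_lt_trans h1 _.
  move: h2; rewrite ltr_pdivlMr// => h2; apply: le_lt_trans h2; rewrite mulrC ler_wpM2l ?cabs_ge0//.
  by apply: (le_trans (ler_norm _)); rewrite lerDl.
have [v0 vj] : (forall q, (pos l j < pos l q)%N -> v q 0 = 0) /\ v j 0 = 1.
  apply: (@asymp_tri _ _ mu Nh mm (pos l) (@pos_lt l n) (@pos_inj l n) (lev_hNh HD) res_pos _ v u)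
    => [q i qi|q].
    exact: (ccvg_drop N0 (dominated_along cosT a_gt0 order qi)).
  have c1 : ccvg (fun N => \sum_i invmx (G (xt w (t N) - X)) q i * G0 (xt w (t N)) i 0)
      (\sum_i (q == i)%:R * (i == j)%:R).
    by apply: ccvg_sum => i; apply: ccvgM => //; exact: (ccvg_invG HD).
  have e1 : \sum_i (q == i)%:R * (i == j)%:R = (if q == j then 1 else 0) :> C.
    rewrite (bigD1 q)//= eqxx mul1r big1 ?addr0; last by move=> i; rewrite eq_sym => /negPf ->; rewrite mul0r.
    by case: eqP.
  rewrite e1 in c1; apply: ccvg_ext c1 => N.
  have uG : G (cexp (u N)) \in unitmx.
    by apply: (hG _ _).2; rewrite cabs_cexp; exact: lt_le_trans (hu N) d'd.
  have xu : X + cexp (u N) = xt w (t N) by rewrite cu addrC subrK.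
  have h1 : cexp (mu j * u N) *: (invmx (G (cexp (u N))) *m G0 (xt w (t N))) =
      eU mu (u N) *m (eN Nh (u N) *m v).
    have := hY _ (lt_le_trans (hu N) d'd0); rewrite (Yv _ (hu N)) xu /levelt_sol -!mulmxA => h2.
    have := congr1 (mulmx (invmx (G (cexp (u N))))) h2; rewrite (mulKmx uG) => ->.
    by rewrite -scalemxAr.
  have := congr1 (fun M : 'cV[C]_n => M q 0) h1.
  rewrite /= mul_diag_mx_entry [LHS]mxE [(\row__ _) _ _]mxE cu [(_ *m G0 _) q 0]mxE => h2.
  rewrite mulrBl cexpB mulrAC -h2 mulrAC mulfV ?cexp_neq0// mul1r //.
exact: (eigen_nullvec (@pos_lt l n) mu_inj (lev_hNh HD) res_pos (oriz1 l) hMv vj v0).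
Qed.

Variable dv : R.
Hypothesis hp : punctured g l w dv.
Hypothesis dv_d : dv <= d.

(** The coefficient of u in e^{N u} e_k is N e_k, nonzero by hypothesis; G invertible keeps the
    corresponding analytic vector nonzero. *)
Lemma log_sol k : ~ (Nh *m (delta_mx k 0 : 'cV[C]_n) = 0) ->
  log_solution fam g l w k dv (fun u => levY u *m delta_mx k 0).
Proof.
move=> hk; split=> //.
have H (pq : nat * 'I_n) : exists e : nat, Npow Nh pq.1 pq.2 k != 0 -> mu pq.2 - mu k = e%:R.
  have [_|h] := eqVneq (Npow Nh pq.1 pq.2 k) 0; first by exists 0%N.
  by have [_ [e he]] := Npow_neq0 (lev_hNh HD) res_pos h; exists e.
have [e he] := choice H.
pose b p : 'cV[C]_n := (p`!)%:R^-1 *: col k (Npow Nh p).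
have hb p q : b p q 0 != 0 -> mu q - mu k = (e (p, q))%:R.
  move=> h; apply: (he (p, q)); apply: contraNneq h => /= h; by rewrite !mxE h mulr0.
exists n, (fun p => mono l w G (b p) (fun q => e (p : nat, q))); split.
- move=> p x; rewrite normE rc_lt => hx; apply: (mono_derivable HD); exact: lt_le_trans hx dv_d.
- exists (Ordinal n_gt1) => // /nbhsC[r r0 hr]; apply: hk.
  have b1 : b 1%N = col k Nh by rewrite /b /Npow /= mulmx1 invr1 scale1r.
  have [/andP[dp _] _ hG _ _] := HD.
  pose s := Num.min r d / 2; have s0 : 0 < s by rewrite divr_gt0// lt_min r0.
  have ss : s < Num.min r d by rewrite /s ltr_pdivrMr// ltr_pMr ?lt_min ?r0//; lra.
  have := hr (X + rc s); rewrite addrAC subrr add0r cabs_rc ger0_norm ?ltW//.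
  move: ss; rewrite lt_min => /andP[sr sd] /(_ sr); rewrite /mono.
  rewrite (_ : X + rc s - X = rc s); last by ring.
  have uG : G (rc s) \in unitmx by apply: (hG _ _).2; rewrite cabs_rc ger0_norm ?ltW.
  move=> h; have := mulKmx uG (\col_q (b (Ordinal n_gt1) q 0 * rc s ^+ e ((Ordinal n_gt1 : nat), q)) : 'cV[C]_n).
  rewrite h mulmx0 => /matrixP h2; apply/matrixP => q z; rewrite ord1.
  have := h2 q 0; rewrite [LHS]mxE [RHS]mxE => /esym/eqP; rewrite mulf_eq0 expf_eq0 rc_eq0.
  rewrite (gt_eqF s0) andbF orbF => /eqP; rewrite b1 -colE => ->.
  by rewrite mxE.
- move=> u hu.
  have -> : levY u *m delta_mx k 0 = G (cexp u) *m (eU mu u *m (\sum_(p < n) u ^+ p *: b p)).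
    rewrite /levelt_sol -!mulmxA; congr (_ *m (_ *m _)).
    rewrite /eN mulmx_suml; apply: eq_bigr => p _.
    by rewrite -scalemxAl -colE /b scalerA.
  rewrite mulmx_sumr mulmx_sumr scaler_sumr; apply: eq_bigr => p _.
  rewrite -!(scalemxAr (u ^+ p)) scalerA.
  rewrite [_ * u ^+ p]mulrC -scalerA; congr (_ *: _).
  by apply: eU_mono => q; exact: hb.
exact: (sol_around HD res_pos dv_d).
Qed.

Variables (m Q : Mx).
Hypothesis hsim : similar_to_levelt mu Nh (pos l) (oriz l) m Q.

Lemma eU_eN_comm : eU mu c *m eN Nh c = eN Nh c *m eU mu c.
Proof. by apply: eN_commute; exact: (eU_comm (lev_hNh HD) (oriz l)). Qed.

(** The vector e_j generates a Jordan chain of the Levelt monodromy, on which diagonalizability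
    forces length one; so e^{cN} fixes e_j and N e_j = 0. *)
Lemma diag_nullvec j : diagonalizable m -> nullvec mu Nh j (delta_mx j 0).
Proof.
move=> /diagonalizableE[P uP [Dl hDl]].
have uQ : Q \in unitmx by case: hsim.
pose S := P *m invmx Q; have uS : S \in unitmx by rewrite unitmx_mul uP unitmx_inv.
have hS : S *m Mh = diag_mx Dl *m S.
  exact: (conj_transfer uP uQ (etrans (esym hDl) (m_eq hsim))).
pose a := cexp (mu j * c); have a0 : a != 0 := cexp_neq0 _.
(* [x k] is (e^{cN} - 1)^k applied to e_j; the monodromy minus [a] sends it to [a *: x k.+1]. *)
pose x k : 'cV[C]_n := iter k (fun y => eN Nh c *m y - y) (delta_mx j 0).
have xS k : eN Nh c *m x k = x k.+1 + x k by rewrite /= subrK.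
have eUx k : eU mu c *m x k = a *: x k.
  elim: k => [|k IH].
    apply/matrixP => q z; rewrite mul_diag_mx_entry !mxE; case: eqP => [->|_] /=; first by [].
    by rewrite !mulr0.
  rewrite [x k.+1]/= mulmxBr mulmxA eU_eN_comm -mulmxA IH scalerBr; congr (_ - _).
  by rewrite -scalemxAr.
have xpos k q : x k q 0 != 0 -> (pos l q + k <= pos l j)%N.
  elim: k q => [|k IH] q.
    by rewrite mxE; have [->|_] := eqVneq q j; rewrite ?addn0 ?eqxx.
  apply: contraR; rewrite -ltnNge => hq.
  rewrite [x k.+1]/= !mxE (bigD1 q)//= (eN_diag (@pos_lt l n) (lev_hNh HD) res_pos) mul1r addrAC subrr add0r.
  apply/eqP/big1 => i iq; have [->|/IH h] := eqVneq (x k i 0) 0; first by rewrite mulr0.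
  have [h1|h1] := ltnP (pos l i) (pos l q).
    by rewrite (eN_tri (lev_hNh HD) res_pos _ h1) mul0r.
  have h2 : (pos l q < pos l i)%N.
    by rewrite ltn_neqAle h1 andbT; apply: contra iq => /eqP /pos_inj ->.
  exfalso; move: hq h h2; move: (pos l q) (pos l i) (pos l j); clear; lia.
have xn : x n = 0.
  apply/matrixP => q z; rewrite ord1 [RHS]mxE; apply/eqP; apply/negP => /negP /xpos.
  move=> h; have := leq_trans (leq_addl _ _) h; by rewrite leqNgt pos_lt.
have Mx' k : Mh *m x k = a *: x k.+1 + a *: x k.
  by rewrite eU_eN_comm -mulmxA eUx -scalemxAr xS scalerDr.
(* In diagonal coordinates, (Dl - a) y = 0 and (Dl - a) z = a y are incompatible at any index where
   y is nonzero. *)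
have step k : x k.+2 = 0 -> x k.+1 = 0.
  move=> h; pose y := S *m x k.+1; pose z := S *m x k.
  have hy : diag_mx Dl *m y = a *: y.
    by rewrite /y mulmxA -hS -mulmxA Mx' h scaler0 add0r -scalemxAr.
  have hz : diag_mx Dl *m z = a *: y + a *: z.
    by rewrite /z mulmxA -hS -mulmxA Mx' mulmxDr -!scalemxAr.
  suff y0 : y = 0 by rewrite -(mulKmx uS (x k.+1)) -/y y0 mulmx0.
  apply/matrixP => i s; rewrite ord1 [RHS]mxE; apply/eqP; apply/negP => /negP yi.
  have := congr1 (fun M : 'cV[C]_n => M i 0) hy; rewrite mul_diag_mx_entry [in RHS]mxE => /(mulIf yi) hD.
  have := congr1 (fun M : 'cV[C]_n => M i 0) hz; rewrite mul_diag_mx_entry [RHS]mxE [(a *: y) _ _]mxE [(a *: z) _ _]mxE hD.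
  move/eqP; rewrite -subr_eq0 opprD addrCA subrr addr0 oppr_eq0 mulf_eq0 (negPf a0) /= => /eqP y0.
  by rewrite y0 eqxx in yi.
have x1 : x 1%N = 0.
  have H k : x k.+1 = 0 -> x 1%N = 0 by elim: k => // k IH /step.
  by apply: (H n.-1); rewrite prednK ?xn//; exact: ltnW.
have fix1 : eN Nh c *m x 0%N = x 0%N by rewrite xS x1 add0r.
split.
- exact: (Npow_fix (@pos_lt l n) (lev_hNh HD) res_pos (c_neq0 (oriz1 l)) fix1).
- by rewrite mxE !eqxx.
- by move=> q; rewrite mxE andbT; have [->|_] := eqVneq q _; [left|rewrite eqxx].
Qed.

(** Take a null vector for each index that has one and the basis vector e_k otherwise. These
    coefficients form a triangular matrix with unit diagonal, whence independence. *)
Lemma nullvec_basis : exists Y : 'I_n -> C -> 'cV[C]_n, local_basis fam g l w dv Y /\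
  forall k, ~ (exists v, nullvec mu Nh k v) -> log_solution fam g l w k dv (Y k).
Proof.
have H k : exists v : 'cV[C]_n, nullvec mu Nh k v \/
    (~ (exists v, nullvec mu Nh k v)) /\ v = delta_mx k 0.
  have [[v hv]|h] := EM (exists v, nullvec mu Nh k v); first by exists v; left.
  by exists (delta_mx k 0); right.
have [v hv] := choice H.
have vlog k : ~ (exists v, nullvec mu Nh k v) ->
    v k = delta_mx k 0 /\ ~ (Nh *m (delta_mx k 0 : 'cV[C]_n) = 0).
  move=> h; have [h1|[_ ->]] := hv k; first by case: h; exists (v k).
  split=> // h0; apply: h; exists (delta_mx k 0); split=> //; first by rewrite mxE !eqxx.
  by move=> q; rewrite mxE andbT; have [->|_] := eqVneq q _; [left|rewrite eqxx].
have hlog k : ~ (exists v, nullvec mu Nh k v) ->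
    log_solution fam g l w k dv (fun u => levY u *m v k).
  by move=> /vlog[-> h]; exact: log_sol.
exists (fun k u => levY u *m v k); split=> //; split.
  move=> k; have [h|h] := EM (exists v, nullvec mu Nh k v).
    left; have [h1|[h1 _]] := hv k; last by case: h1.
    exact: (floquet_nullvec HD res_pos hp dv_d h1).
  by right; split; [move=> /floquet_exists_nullvec|exact: hlog].
move=> a ha.
pose V : Mx := \matrix_(q, k) v k q 0.
have uV : V \in unitmx.
  apply: (utri_unit (l := l)).
    move=> q k h; rewrite mxE; have [h1|[_ ->]] := hv k.
      exact: (nullvec_tri (pos := pos l) res_pos (oriz1 l) h1 h).
    by rewrite mxE andbT; have [qk|_] := eqVneq q k; first by rewrite qk ltnn in h.
  move=> i; rewrite mxE; have [[_ -> _]|[_ ->]] := hv i; first exact: oner_neq0.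
  by rewrite mxE !eqxx oner_eq0.
have [dv0 _] := hp.
have hu : expR (cre (rc (ln (dv / 2)))) < dv.
  by rewrite cre_rc lnK ?posrE ?divr_gt0//; lra.
have := ha _ hu; set u := rc _.
have uY : levY u \in unitmx.
  by apply: (levY_unit HD res_pos); exact: lt_le_trans hu dv_d.
have -> : \sum_k a k *: (levY u *m v k) = levY u *m (V *m \col_k a k).
  under eq_bigr do rewrite scalemxAr; rewrite -mulmx_sumr; congr (_ *m _).
  apply/matrixP => q z; rewrite summxE ord1 mxE; apply: eq_bigr => k _.
  by rewrite !mxE mulrC.
move=> h k; have h2 := congr1 (mulmx (invmx (levY u))) h; rewrite (mulKmx uY) mulmx0 in h2.
have h3 := congr1 (mulmx (invmx V)) h2; rewrite (mulKmx uV) mulmx0 in h3.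
by have := congr1 (fun M : 'cV[C]_n => M k 0) h3; rewrite !mxE.
Qed.

Lemma jth_nullvec j : has_jth_eigenvector l m (Dhat fam l w) j <-> exists v, nullvec mu Nh j v.
Proof.
rewrite -(jth_eigen_nullvec (@pos_lt l n) (@pos_inj l n) mu_inj (lev_hNh HD) res_pos (oriz1 l) j hsim).
have hD : Dhat fam l w j j = cexp (mu j * c) by rewrite Dhat_entry eqxx mul1r.
rewrite /has_jth_eigenvector hD.
split=> -[t [h1 h2 h3]]; exists t; split=> // i; case: (l) h3 => h3 /= h; apply: h3 => //=;
  move: h; have := ltn_ord i; have := ltn_ord j; rewrite /pos /=; lia.
Qed.

Lemma part_c j : (~ diagonalizable m /\ ~ has_jth_eigenvector l m (Dhat fam l w) j) <->
  (~ floquet_exists fam g l w j /\ exists (d : R) (Y : 'I_n -> C -> 'cV[C]_n),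
     local_basis fam g l w d Y /\ log_solution fam g l w j d (Y j)).
Proof.
split=> [[_ h]|[h _]].
  have h1 : ~ (exists v, nullvec mu Nh j v) by move=> /jth_nullvec.
  split; first by move=> /floquet_exists_nullvec.
  by have [Y [hY hlog]] := nullvec_basis; exists dv, Y; split=> //; exact: hlog.
have h1 : ~ (exists v, nullvec mu Nh j v).
  move=> [v hv]; apply: h; exists dv, (fun u => levY u *m v).
  exact: (floquet_nullvec HD res_pos hp dv_d hv).
by split=> [/(diag_nullvec j) h2|/jth_nullvec//]; apply: h1; exists (delta_mx j 0).
Qed.
End Resonance.

(** * Choice of the radii and assembly *)

Section Radii.
Context {R : realType} (n : nat) (fam : ode_family R n).
Local Notation C := (Cplx R).

Lemma theta0_le : theta0 fam <= pi / 2.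
Proof.
rewrite /theta0; set A := [set th : R | _].
have [->|/set0P A0] := eqVneq A set0; first by rewrite sup0 divr_ge0// pi_ge0.
by apply: ge_sup => // th [/andP[_ /ltW]].
Qed.

Lemma Rem_taylor : prenormal fam -> exists2 p : R, 0 < p &
  forall (e x0 : C) i j, cabs e < p -> cabs x0 < p -> exists (M : R) (b : nat -> C), geo b p M /\
    forall y, cabs y < p -> ccvg (psum b y) (Rem fam e (x0 + y) i j).
Proof.
move=> [_ _ hR _].
pose Pr (ij : 'I_n * 'I_n) (p : R) := forall e x0 : C,
    cabs e < p -> cabs x0 < p -> exists (M : R) (b : nat -> C), geo b p M /\
    forall y, cabs y < p -> ccvg (psum b y) (Rem fam e (x0 + y) ij.1 ij.2).
have H ij : exists2 p : R, 0 < p & forall p', 0 < p' <= p -> Pr ij p'.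
  case: ij => [i j]; rewrite /Pr /=; have [p [M [p0 hp]]] := germ2_taylor (hR i j).
  exists (p / 2) => [|p' /andP[p'0 hp'] e x0 he hx]; first by rewrite divr_gt0.
  have he' : cabs e < p by lra.
  have [b [gb hb]] := hp e x0 he' (lt_le_trans hx hp').
  exists M, b; split; first by apply: geo_weak gb _; rewrite p'0.
  by move=> y hy; apply: hb; exact: lt_le_trans hy hp'.
have [p p0 hp] := fin_min H.
by exists p => // e x0 i j; apply: (hp (i, j)); rewrite p0 lexx.
Qed.

Lemma sqrt_lt (x K : R) : 0 < K -> x < K ^+ 2 -> Num.sqrt x < K.
Proof.
move=> K0 h; have -> : K = Num.sqrt (K ^+ 2) by rewrite sqrtr_sqr gtr0_norm.
by rewrite ltr_sqrt// exprn_gt0.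
Qed.

Lemma within_nbhsC (A : set C) z (P : set C) : (\forall x \near within A (nbhs z), P x) <->
  exists2 d : R, 0 < d & forall x, A x -> cabs (x - z) < d -> P x.
Proof.
split=> [/nbhsC[d d0 h]|[d d0 h]]; first by exists d => // x Ax hx; exact: h.
by apply/nbhsC; exists d => // x hx Ax; exact: h.
Qed.
End Radii.

Theorem theorem4p34 (R : realType) (n : nat) (fam : ode_family R n) (gamma : R) :
  (2 <= n)%N -> prenormal fam ->
  0 < gamma -> gamma * (1 + 2 * gamma / pi) < theta0 fam ->
  exists2 r0 : R, 0 < r0 & forall r : R, 0 < r < r0 ->
  forall delta h kappa : R, 0 < delta -> good_delta fam delta ->
    0 < h < r^-1 -> 0 < kappa < 2^-1 ->
  exists2 c1 : R, 0 < c1 & forall c0 : R, 0 < c0 < c1 ->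
  exists2 rho0 : R, 0 < rho0 & forall rho : R, 0 < rho < rho0 ->
    good_rho fam gamma rho ->
  let g := Geometry gamma r delta h kappa c0 in
  forall (ell : Cplx R -> Cplx R -> Cplx R)
         (F H WV : sheet -> Cplx R -> Cplx R -> 'M[Cplx R]_n)
         (Chat : side -> Cplx R -> 'M[Cplx R]_n),
    log_branch g rho ell ->
    model_solutions fam g rho ell F ->
    normalizing fam g rho F H ->
    stokes_matrices g rho F H Chat ->
    ramified_solution fam g rho F H WV ->
  forall (w : Cplx R) (l : side), Ssec gamma rho w ->
  let xl := xsing l w in
  let D := Dhat fam l w in
  let m := Chat l w *m D in
  let base := within (OmegaLR g l w) (nbhs xl) in
  closure (OmegaLR g l w) xl /\
           
  [/\ (\forall x0 \near base,
         (forall (t : 'cV[Cplx R]_n) (c : Cplx R),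
            (t != 0 /\ m *m t = c *: t) <->
            monodromy_eigen fam l w x0 c (fun x => WV Down w x *m t)) /\
         (forall k : nat, has_jordan_form m k ->
            number_eigensolutions fam l w x0 k)),
      (~ diagonalizable m -> resonant fam l w) &
      (resonant fam l w <->
       exists c : Cplx R, (1 < mup c (char_poly m))%N)] /\
           
  (~ resonant fam l w ->
   exists T : 'M[Cplx R]_n,
   [/\ unitriangular l T /\ invmx T *m m *m T = D,
       (forall T' : 'M[Cplx R]_n,
          unitriangular l T' -> invmx T' *m m *m T' = D -> T' = T),
       (\forall x0 \near base,
          [/\ (\forall x \near x0,
                 solves_at (eps w) (Bmx fam (eps w))
                   (fun z => WV Down w z *m T) x /\
                 WV Down w x *m T \in unitmx),
              (forall j : 'I_n, monodromy_eigen fam l w x0 (D j j)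
                 (fun x => col j (WV Down w x *m T))) &
              (forall Y : Cplx R -> 'M[Cplx R]_n,
                 (\forall x \near x0,
                    solves_at (eps w) (Bmx fam (eps w)) Y x /\
                    Y x \in unitmx) ->
                 (forall j, exists c : Cplx R,
                    monodromy_eigen fam l w x0 c (fun x => col j (Y x))) ->
                 exists p : 'S_n, forall j,
                   monodromy_eigen fam l w x0 (D (p j) (p j))
                     (fun x => col j (Y x)) /\
                   exists2 a : Cplx R, a != 0 &
                     \forall x \near x0,
                       col j (Y x) = a *: col (p j) (WV Down w x *m T))]) &
       (forall j : 'I_n,
          exists (d : R) (Yj : Cplx R -> 'cV[Cplx R]_n)
                 (L : sheet -> Cplx R -> Cplx R) (a : Cplx R),
          [/\ floquet fam g l w j d Yj, log_on_V g l w d L, a != 0 &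
              forall s x, Omega g s w x -> `|x - xl| < rc d ->
                col j (WV s w x *m T) = a *: Yj (L s x)])]) /\
           
  (resonant fam l w ->
   forall j : 'I_n,
     (~ diagonalizable m /\ ~ has_jth_eigenvector l m D j) <->
     (~ floquet_exists fam g l w j /\
      exists (d : R) (Y : 'I_n -> Cplx R -> 'cV[Cplx R]_n),
        local_basis fam g l w d Y /\ log_solution fam g l w j d (Y j))).
Proof.
move=> n2 hfam gamma0 hgam; have hA := lt_le_trans hgam (theta0_le fam).
exists 1 => // r /andP[r0 _] delta h kappa _ _ /andP[h0 _] kap.
have c10 : 0 < (2^-1 - kappa) * (pi * sig0 gamma) / 2.
  rewrite divr_gt0// mulr_gt0//; first by case/andP: kap; rewrite subr_gt0.
  by rewrite mulr_gt0// ?pi_gt0// sig0_gt0.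
(* Half of the margin of [star_ineq] goes to c0; the other half is kept for h times
   |sqrt(epsilon)|. *)
exists ((2^-1 - kappa) * (pi * sig0 gamma) / 2) => // c0 /andP[c00 c0c1].
have [p p0 hp] := Rem_taylor hfam.
set c1 := (2^-1 - kappa) * (pi * sig0 gamma) / 2 in c10 c0c1.
(* In turn: |epsilon| < p, and |sqrt(epsilon)| less than p, r and c1 / h. The first two serve the
   Taylor expansion of the remainder at the singular point. *)
exists (Num.min (Num.min p (p ^+ 2)) (Num.min (r ^+ 2) ((c1 / h) ^+ 2))).
  by rewrite !lt_min p0 !exprn_gt0// divr_gt0.
move=> rho /andP[_]; rewrite !lt_min => /andP[/andP[rp rp2] /andP[rr rc1']] hrho g.
move=> ell F H WV Chat hell hF hH hC hWV w l hw xl D m base.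
have [eps_rho _] := hw.
have sX : cabs (sqrt_eps w) = Num.sqrt (abs_eps w) by rewrite cabs_sqrt_eps.
have s_lt_r : cabs (sqrt_eps w) < g_r g by rewrite sX; apply: sqrt_lt => //; exact: lt_trans eps_rho rr.
have hc : g_h g * cabs (sqrt_eps w) + g_c0 g < (2^-1 - g_kappa g) * (pi * sig0 gamma).
  have : cabs (sqrt_eps w) < c1 / h.
    by rewrite sX; apply: sqrt_lt; [rewrite divr_gt0|exact: lt_trans eps_rho rc1'].
  by rewrite ltr_pdivlMr// mulrC => h1 /=; rewrite /c1 in h1 c0c1; lra.
have ggam : g_gamma g = gamma by [].
have cosT := cosT_gt0 gamma0 hA ggam hw.
have a_gt0 := pull_gt0 gamma0 hA ggam hw.
have star := star_ineq gamma0 hA ggam hw (h0 : 0 < g_h g) (kap : 0 < g_kappa g < 2^-1) (c00 : 0 < g_c0 g) hc.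
have h_gt0 : 0 < g_h g := h0.
have kap01 : 0 < g_kappa g < 2^-1 := kap.
have c0_gt0 : 0 < g_c0 g := c00.
have minj := @mu_inj _ _ fam _ _ g l w gamma0 hA ggam hw hrho.
have order q j := @order_pos _ _ fam _ _ g l w gamma0 hA ggam hw hrho q j.
have res_pos q k (e : nat) := @mu_res_pos _ _ fam _ _ g l w gamma0 hA ggam hw hrho q k e.
have [d [G [G' [Nh [mm HD]]]]] : exists d G G' Nh mm, lev_data fam l w d G G' Nh mm.
  apply: (lev_data_exists p0) => i j; apply: hp.
    by rewrite /eps cabs_cexp; exact: lt_trans eps_rho rp.
  by rewrite cabs_xsing sX; apply: sqrt_lt => //; exact: lt_trans eps_rho rp2.
have [hell1 hell2 _] := hell; have [hF1 hF2 _] := hF w hw.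
have [_ hH1 [K [hK1 hK2 _]] _ _] := hH; have [hC1 hC2] := hC w hw.
have [hW1 hW2 hW3] := hWV w hw.
have [_ hCl] := hC1 l.
(* Joint continuity in the parameter and the time, restricted to the fixed parameter [w]. *)
have ell_cont t : Gam g Down w t -> forall e : R, 0 < e -> exists2 b : R, 0 < b &
    forall u, Gam g Down w u -> cabs (u - t) < b -> cabs (ell w u - ell w t) < e.
  move=> ht e e0; have /subspace_continuousP/(_ (w, t)) := hell2.
  move=> /(_ (conj hw ht))/cvgC/(_ e e0) [[P1 P2] [/= hP1 hP2] hP].
  move/nbhsC: hP2 => [b b0 hb]; exists b => // u hu ub.
  move/nbhsC: hP1 => [b1 b10 hb1].
  have P1w : P1 w by apply: hb1; rewrite subrr cabs0.
  exact: (hP (w, u) (conj P1w (hb _ ub)) (conj hw hu)).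
have [Q [cst [cst0 uQ hWD hWU [hHQ hm]]]] := end_solutions (ell := ell w) (F := fun sh => F sh w)
  (H := fun sh => H sh w) (W := fun sh => WV sh w) cosT a_gt0 h_gt0 kap01 c0_gt0 s_lt_r star
  HD res_pos (fun t => hell1 w t hw) ell_cont hF1 hF2 (fun sh => hH1 sh w hw) hCl hC2 hW1 hW2 hW3.
have hK i j (e : R) : 0 < e -> exists2 b : R, 0 < b &
    forall x, Omega g Down w x -> cabs (x - xl) < b -> cabs (H Down w x i j - diag_mx (K l w) i j) < e.
  by move=> e0; have /cvgC/(_ e e0)/within_nbhsC := hK1 Down l w i j hw.
have [tQ dQ] := transition_tri (H := H Down w) cosT a_gt0 h_gt0 kap01 c0_gt0 s_lt_r star HD res_pos order cst0
  (fun j => (hK2 l w j hw).1) hK hHQ.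
have hsim : similar_to_levelt (mu fam l w) Nh (pos l) (oriz l) m Q by split.
have dv0 := dV_gt0 s_lt_r HD; have dvp := dV_punctured s_lt_r HD.
have dvd : dV g l w d <= d by rewrite ge_min lexx orbT.
(* Any base point of Omega_l within [dV] of the singular point has a logarithm in which W_D is the
   Levelt solution times [Q]; the local statements only need this. *)
have at_base (P : Cplx R -> Prop) :
    (forall x0 u0, cexp u0 = x0 - xl -> cabs (x0 - xl) < d ->
      (\forall x \near x0, WV Down w x = levelt_sol fam l w G Nh (branch l w u0 x0 x) *m Q) -> P x0) ->
    \forall x0 \near base, P x0.
  move=> hPx; apply/within_nbhsC; exists (dV g l w d) => // x0 [t [t1 _ _] tx] hx.
  have O : Omega g Down w x0 by exists t.
  apply: (hPx x0 (logV g l w d Down x0)).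
  - by have [] := logV_local cosT a_gt0 h_gt0 kap01 c0_gt0 star O hx.
  - exact: lt_le_trans hx dvd.
  exact: (W_local (W := fun sh => WV sh w) cosT a_gt0 h_gt0 kap01 c0_gt0 star hWD O hx).
split; first exact: (closure_end cosT a_gt0 h_gt0 kap01 c0_gt0 s_lt_r star HD).
split.
  split.
  - apply: at_base => x0 u0 hu0 hd0 hW0; split.
      exact: (W_eigenP HD res_pos hsim hu0 hd0 hW0).
    by move=> k; exact: (number_eigen HD res_pos hsim hu0 hd0 hW0).
  - exact: (not_diag_resonant HD res_pos hsim).
  - exact: (resonant_mup HD res_pos minj hsim).
split; last first.
  by move=> _ j; exact: (part_c cosT a_gt0 h_gt0 kap01 c0_gt0 s_lt_r star HD res_pos order minj n2 dvp dvd hsim).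
move=> nres; exists (Tn Q); split.
- split; first exact: (Tn_unitriangular hsim).
  exact: (Tn_diag HD res_pos hsim nres).
- exact: (Tn_unique HD res_pos minj hsim nres).
- apply: at_base => x0 u0 hu0 hd0 hW0.
  exact: (floquet_basis_local HD res_pos minj hsim nres hu0 hd0 hW0).
(* Since N = 0, e_j is a null vector and the j-th column of the Levelt solution is the Floquet
   solution; as Q T = diag(Q), the scalar is the j-th diagonal entry of [Q]. *)
move=> j; exists (dV g l w d), (fun u => levelt_sol fam l w G Nh u *m delta_mx j 0), (logV g l w d), (Q j j).
have hN := nonresonant_Nh HD res_pos nres.
split.
- apply: (floquet_nullvec HD res_pos dvp dvd); split; first by rewrite hN mul0mx.
    by rewrite mxE !eqxx.
  by move=> q; rewrite mxE andbT; have [->|_] := eqVneq q _; [left|rewrite eqxx].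
- exact: (logV_log l cosT a_gt0 h_gt0 kap01 c0_gt0 star d).
- exact: dQ.
move=> s x hO; rewrite normE rc_lt => hx.
have hW0 := W_logV (W := fun sh => WV sh w) cosT a_gt0 h_gt0 kap01 c0_gt0 star hWD hWU hO hx.
rewrite hW0 -mulmxA (Q_Tn hsim) col_mulmx (scalemxAr (Q j j)); congr (_ *m _).
apply/matrixP => q z; rewrite ord1 !mxE eqxx andbT.
by have [->|_] := eqVneq q j; rewrite ?mulr1n ?mulr1 ?mulr0n ?mulr0.
Qed.
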